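(* Let $A,B\in\Xi_{n,d}$ with $B$ tridiagonal (i.e. $b_{ij}=0$ unless $|i-j|\le1$) and $\mathrm{row}_{\mathfrak c}(A)=\mathrm{col}_{\mathfrak c}(B)$, and put $\alpha_i=b_{i,i+1}$ for $i\in\mathbb Z$ (equivalently, $\alpha=(\alpha_i)$ is $n$-periodic and $B-\sum_{1\le i\le n}\alpha_iE^{i,i+1}_\theta$ is diagonal). Then the following two expressions (the right-hand sides of two multiplication formulas for $e_Be_A$ in the equal-parameter affine type C Schur algebra) are identical: $$\sum_{T\in\Theta_{B,A},\ S\in\Gamma_T}(v^2-1)^{n(S)}\,v^{2(\ell(A,B,S,T)-n(S)-h(T,S))}\,\llbracket A;S;T\rrbracket\,e_{A^{(T-S)}}\;=\;\sum_{X,Y}v^{2\xi_{A,X,Y}}\,n(X,Y)\left[{A_{X,Y}\atop X}\right]e_{A_{X,Y}},$$ where the second sum runs over all $X,Y\in\Theta_n$ with $x_{ij}+x_{-i-1,-j}=y_{ij}+y_{-i-1,-j}$ for all $i,j$, with row sums $\sum_jx_{ij}=\alpha_i$ and $\sum_jy_{ij}=\alpha_{-i-1}$ for all $i$, with $A-Y+\check Y\in\Theta_n$ and $A_{X,Y}\in\Xi_{n,d}$.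
   Context: Both expressions are elements of the free $\mathbb Q(v)$-module with basis $\{e_C:C\in\Xi_{n,d}\}$ (all but finitely many terms vanish). **Common notation.** Fix integers $r\ge0$, $d\ge2$; $n=2r+2$, $D=2d+2$, $\mathbb N=\{0,1,\dots\}$. $\Theta_n$: $\mathbb Z\times\mathbb Z$ matrices over $\mathbb N$ with $a_{i+n,j+n}=a_{ij}$. $\Xi_{n,d}$: $A\in\Theta_n$ with $a_{-i,-j}=a_{ij}$, $a_{00},a_{r+1,r+1}$ odd, $\sum_{i=1}^n\sum_ja_{ij}=D$; $\Xi_n=\bigcup_{d\in\mathbb N}\Xi_{n,d}$. $a'_{ii}=\frac12(a_{ii}-1)$ if $i\equiv0,r+1\pmod n$, $a'_{ij}=a_{ij}$ otherwise. $\mathrm{row}_{\mathfrak c}(A)$ has entries $a'_{00}+\sum_{j\ge1}a_{0j}$, $\sum_ja_{kj}$ ($1\le k\le r$), $a'_{r+1,r+1}+\sum_{j\le r}a_{r+1,j}$; $\mathrm{col}_{\mathfrak c}(A)=\mathrm{row}_{\mathfrak c}(A^{\mathrm{transpose}})$. $E^{ij}_\theta=\sum_k(E_{i+kn,j+kn}+E_{-i+kn,-j+kn})$. $[m]=\frac{v^{2m}-1}{v^2-1}$ ($m\in\mathbb Z$), $[k]^!=[1]\cdots[k]$, $\left[{m\atop k}\right]=\frac{[m]\cdots[m-k+1]}{[k]^!}$. **Weyl group.** $W$: permutations $g$ of $\mathbb Z$ with $g(i+D)=g(i)+D$, $g(-i)=-g(i)$, Coxeter generators $s_0=(1,-1)_{\mathfrak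 c}$, $s_i=(i,i+1)_{\mathfrak c}$ ($1\le i\le d-1$), $s_d=(d,d+2)_{\mathfrak c}$, where $(i,j)_{\mathfrak c}$ swaps $kD+i\leftrightarrow kD+j$, $kD-i\leftrightarrow kD-j$ for all $k$; length $\ell$. $\Lambda_{r',d}$: $\lambda=(\lambda_0,\dots,\lambda_{r'+1})\in\mathbb N^{r'+2}$ with sum $d$; $\lambda_{0,i}=\lambda_0+\cdots+\lambda_i$; $W_\lambda=\langle\{s_0,\dots,s_d\}\setminus\{s_{\lambda_{0,0}},\dots,s_{\lambda_{0,r'}}\}\rangle$; $\mathscr D_\lambda=\{g:\ell(wg)=\ell(w)+\ell(g)\ \forall w\in W_\lambda\}$; $\mathscr D_{\lambda\mu}=\mathscr D_\lambda\cap\mathscr D_\mu^{-1}$. $R^\lambda_0=[-\lambda_0..\lambda_0]$, $R^\lambda_i=[\lambda_{0,i-1}+1..\lambda_{0,i}]$ ($1\le i\le r'$), $R^\lambda_{r'+1}=[d+1-\lambda_{r'+1}..d+1+\lambda_{r'+1}]$, $R^\lambda_{-i}=-R^\lambda_i$, $R^\lambda_{i+2r'+2}=R^\lambda_i+D$. Every $C\in\Xi_{n,d}$ is $C=\kappa(\lambda,g,\mu)=(|R^\lambda_i\cap gR^\mu_j|)$ for unique $\lambda,\mu\in\Lambda_{r,d}$, $g\in\mathscr D_{\lambda\mu}$; $\ell(C):=\ell(g)$. **First expression.** $T_\theta=(t_{ij}+t_{-i,-j})$; $\mathrm{row}_{\mathfrak a}(T)_i=\sum_jt_{ij}$; $\widehat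 S=(s_{i+1,j})$; $S^\dagger=(s_{1-i,-j})$; $\le_e$ entrywise order. $\Theta_{B,A}=\{T\in\Theta_n:T_\theta\le_eA,\mathrm{row}_{\mathfrak a}(T)_i=b_{i-1,i}\,\forall i\}$; $\Gamma_T=\{S\in\Theta_n:S\le_eT,\mathrm{row}_{\mathfrak a}(S)=\mathrm{row}_{\mathfrak a}(S^\dagger)\}$; $A^{(T-S)}=A-(T-S)_\theta+(\widehat{T-S})_\theta$; $n(S)=\sum_{i=1}^{r+1}\mathrm{row}_{\mathfrak a}(S)_i$; $$h(T,S)=\sum_{i=1}^{r+1}\sum_js_{ij}\Big(\sum_{k\le j}t_{ik}-\tfrac{s_{ij}+1}2\Big)+\sum_{i=1}^{r+1}\sum_j(t_{1-i,-j}-s_{1-i,-j})\Big(\sum_{k\le j-1}t_{ik}+\sum_{k\ge j}s_{ik}-\sum_{k\ge j+1}s_{1-i,-k}\Big);$$ $\llbracket S\rrbracket=\prod_{i=1}^{r+1}\prod_j\left[{\sum_{k\le j}(S-S^\dagger)_{ik}\atop s^\dagger_{i,j+1}}\right][s^\dagger_{i,j+1}]^!$; $[T]^!=\prod_{i=1}^n\prod_j[t_{ij}]^!$; for $A\in\Xi_n$, $[A]^!_{\mathfrak c}=\prod_{k=1}^{a'_{00}}[2k]\prod_{k=1}^{a'_{r+1,r+1}}[2k]\prod_{(i,j)\in I^+_{\mathfrak a}}[a_{ij}]^!$ with $I^+_{\mathfrak a}=(\{0\}\times\mathbb Z_{\ge1})\sqcup([1..r]\times\mathbb Z)\sqcup(\{r+1\}\times\mathbb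 Z_{\le r})$; $\llbracket A;S;T\rrbracket=\frac{[A^{(T-S)}]^!_{\mathfrak c}\,\llbracket S\rrbracket}{[A-T_\theta]^!_{\mathfrak c}[S]^![T-S]^!}$. With $B=\kappa(\lambda,g_1,\mu)$, $A=\kappa(\mu,g_2,\nu)$, $\delta=(b'_{00},b_{10};b_{01},b_{11},b_{21};\dots;b_{r-1,r},b_{rr},b_{r+1,r};b_{r,r+1},b'_{r+1,r+1})\in\Lambda_{3r+2,d}$, the map $\phi:\mathscr D_\delta\cap W_\mu\to\Theta_{B,A}$ is $\phi(w)_{ij}=|R^\delta_{3i-1}\cap wg_2R^\nu_j|$, and $w_{A,T}$ is the minimal length element of $\phi^{-1}(T)$. $\ell(A,B,S,T)=\ell(A)+\ell(B)-\ell(A^{(T-S)})+\ell(w_{A,T})$. **Second expression.** $\check X=(x_{i-1,j})$; $A_{X,Y}=A+X-Y-(\check X-\check Y)=(a^*_{ij})$. $$\left[{A_{X,Y}\atop X}\right]=\prod_{(i,j)\in\mathscr I}\left[{a^*_{ij}\atop x_{ij}}\right]\left[{a^*_{ij}-x_{ij}\atop x_{-i,-j}}\right]\prod_{i\in\{0,-r-1\}}\prod_{k=0}^{x_{ii}-1}\frac{[a^*_{ii}-2k-1]}{[k+1]},$$ $\mathscr I=(\{-r-1\}\times\mathbb Z_{>-r-1})\cup([-r..-1]\times\mathbb Z)\cup(\{0\}\times\mathbb Z_{<0})$. For finitely supported $a,\gamma,\beta\in\mathbb N^{\mathbb Z}$, $$n(a,\gamma,\beta)=\sum_\sigma v^{2\left(\sum_{k,l,p;\,l>p}\sigma_{kl}a_p+\sum_k\sigma_{kk}a_k+\sum_{k>p,\,l<q}\sigma_{kl}\sigma_{pq}\right)}\frac{\prod_k[\beta_k]^!}{\prod_{k,l}[\sigma_{kl}]^!}\prod_{l\in\mathbb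 Z}\ \prod_{m=0}^{\gamma_l-\sigma_{ll}-1}(v^{2a_l}-v^{2m}),$$ sum over upper triangular $\sigma\in\mathrm{Mat}_{\mathbb Z\times\mathbb Z}(\mathbb N)$ with row sums $\sum_l\sigma_{kl}=\beta_k$ and column sums $\sum_k\sigma_{kl}=\gamma_l$. $a^J=(a_{-i})_i$; $n(X,Y)=\prod_{0\le i\le r}n(X_i,Y_i,(X_{-i-1})^J)$ with $X_i,Y_i$ the $i$-th rows. $$\xi_{A,X,Y}=\sum_{-r-1\le i\le r,\ j>l}(a^*_{ij}-x_{ij})x_{il}-\Big(\sum_{-r\le i\le-1,\ j>l}+\sum_{i\in\{-r-1,0\},\ 2i-l>j>l}\Big)x_{-i,-j}x_{il}-\sum_{i\in\{-r-1,0\},\ j<i}\frac{x_{ij}(x_{ij}+1)}2.$$ *)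

(* Defs.v *)
From HB Require Import structures.
From mathcomp Require Export all_boot all_order all_algebra.
From mathcomp Require Export finmap.
From mathcomp Require Export boolp classical_sets functions cardinality fsbigop.
From mathcomp Require Export monalg.

Set Implicit Arguments.
Unset Strict Implicit.
Unset Printing Implicit Defensive.

Import Order.TTheory GRing.Theory Num.Theory.
Local Open Scope classical_set_scope.
Local Open Scope ring_scope.

(* Sums and products over infinite index sets are the finitely supported big
   operators of fsbigop, which return the neutral element when the support is
   infinite. The statement only uses them where the support is finite; where
   the value of such a sum is itself what forces the support to be finite,
   finiteness is required explicitly (see [has_sum] and [Xi]). *)
Reserved Notation "\prod_ ( i '\in' A ) F"
  (F at level 36, A at level 60,
    format "'[' \prod_ ( i  '\in'  A ) '/  '  F ']'").
Notation "\prod_ ( i '\in' A ) F" := (\big[*%R/1%R]_(i \in A) F) : ring_scope.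

Definition Qv : fieldType := {fraction {poly rat}}.
Definition v : Qv := tofrac 'X.

(* Z x Z matrices are integer valued, so that differences of matrices are
   genuine differences; being a matrix over N is the predicate [Nmat]. *)
Notation mat := (int -> int -> int).

Definition has_sum (f : int -> int) (m : int) : Prop :=
  finite_set [set j | f j <> 0] /\ \sum_(j \in [set: int]) f j = m.

Definition Nmat (M : mat) : Prop := forall i j, 0 <= M i j.
Definition le_e (M N : mat) : Prop := forall i j, M i j <= N i j.
Definition trmat (M : mat) : mat := fun i j => M j i.

Definition period (r : nat) : nat := (2 * r + 2)%N.
Definition Dper (d : nat) : nat := (2 * d + 2)%N.

Definition Theta (r : nat) : set mat :=
  [set M | Nmat M /\
    forall i j, M (i + (period r)%:Z) (j + (period r)%:Z) = M i j].

Definition Xi (r d : nat) : set mat :=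
  [set M | Theta r M
    /\ (forall i j, M (- i) (- j) = M i j)
    /\ (M 0 0 = 1 %[mod 2])%Z
    /\ (M r.+1%:Z r.+1%:Z = 1 %[mod 2])%Z
    /\ (forall i, finite_set [set j | M i j <> 0])
    /\ \sum_(1 <= i < (period r).+1) \sum_(j \in [set: int]) M i%:Z j
       = (Dper d)%:Z].

(* a'_{ij} *)
Definition prim (r : nat) (M : mat) : mat := fun i j =>
  if (i == j) && ((i == 0 %[mod period r])%Z
                  || (i == r.+1%:Z %[mod period r])%Z)
  then ((M i j - 1) %/ 2)%Z else M i j.

Definition row_a (M : mat) (i : int) : int := \sum_(j \in [set: int]) M i j.

Definition row_c (r : nat) (M : mat) : (r.+2).-tuple int :=
  [tuple
    if val k == 0%N then
      prim r M 0 0 + \sum_(j \in [set j : int | 1 <= j]) M 0 j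
    else if val k == r.+1 then
      prim r M r.+1%:Z r.+1%:Z
        + \sum_(j \in [set j : int | j <= r%:Z]) M r.+1%:Z j
    else row_a M (val k)%:Z
  | k < r.+2].

Definition col_c (r : nat) (M : mat) : (r.+2).-tuple int := row_c r (trmat M).

Definition tridiagonal (M : mat) : Prop :=
  forall i j : int, ~~ (`|i - j| <= 1) -> M i j = 0.

(* In [qfact k] and [qbinom m k], k is only ever a nonnegative integer. *)
Definition qint (m : int) : Qv := (v ^ (2 * m) - 1) / (v ^+ 2 - 1).
Definition qfact (k : int) : Qv := \prod_(1 <= i < `|k|%N.+1) qint i%:Z.
Definition qbinom (m k : int) : Qv :=
  (\prod_(0 <= i < `|k|%N) qint (m - i%:Z)) / qfact k.

Section WeylGroup.
Variable d : nat.
Let D : int := (Dper d)%:Z.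

Definition Wgrp : set (int -> int) :=
  [set g | bijective g
    /\ (forall i, g (i + D) = g i + D) /\ (forall i, g (- i) = - g i)].

(* (i, j)_c : swaps kD + i <-> kD + j and kD - i <-> kD - j *)
Definition cswap (i j : int) : int -> int := fun x =>
  if (x == i %[mod D])%Z || (x == - j %[mod D])%Z then x + (j - i)
  else if (x == j %[mod D])%Z || (x == - i %[mod D])%Z then x - (j - i)
  else x.

Definition cox (k : nat) : int -> int :=
  if k == 0%N then cswap 1 (-1)
  else if k == d then cswap d%:Z (d%:Z + 2)
  else cswap k%:Z (k%:Z + 1).

Definition word_eval (w : seq nat) : int -> int :=
  foldr (fun k g => cox k \o g) id w.

Definition word (w : seq nat) : bool := all (fun k => (k <= d)%N) w.

Definition ell (g : int -> int) : nat :=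
  xget 0%N [set m | (exists w, word w /\ word_eval w = g /\ size w = m)
                 /\ (forall w, word w -> word_eval w = g -> (m <= size w)%N)].

Section Parabolic.
Variable r' : nat.

Definition Lambda : set ((r'.+2).-tuple nat) := [set l | sumn l = d].

Definition psum (l : seq nat) (i : nat) : nat := sumn (take i.+1 l).

(* The generators are involutions, so W_l consists of the products of words in
   the allowed generators. *)
Definition Wpar (l : (r'.+2).-tuple nat) : set (int -> int) :=
  [set g | exists w, word w
    /\ all (fun k => k \notin [seq psum l i | i <- iota 0 r'.+1]) w
    /\ word_eval w = g].

Definition Dmin (l : (r'.+2).-tuple nat) : set (int -> int) :=
  [set g | Wgrp g
    /\ forall w, Wpar l w -> ell (w \o g) = (ell w + ell g)%N].

Definition Dmin_inv (l : (r'.+2).-tuple nat) : set (int -> int) :=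
  [set g | exists h, Dmin l h /\ cancel g h /\ cancel h g].

Definition Ddouble (l m : (r'.+2).-tuple nat) : set (int -> int) :=
  Dmin l `&` Dmin_inv m.

Definition Rbase (l : (r'.+2).-tuple nat) (m : nat) : set int :=
  if m == 0%N then
    [set x | - (nth 0%N l 0)%:Z <= x <= (nth 0%N l 0)%:Z]
  else if m == r'.+1 then
    [set x | d%:Z + 1 - (nth 0%N l r'.+1)%:Z <= x
             <= d%:Z + 1 + (nth 0%N l r'.+1)%:Z]
  else [set x | (psum l m.-1)%:Z + 1 <= x <= (psum l m)%:Z].

(* R^l_i for all i in Z, from the blocks 0 <= m <= r' + 1 and the rules
   R_{-i} = - R_i, R_{i + N} = R_i + D with N = 2 r' + 2: write i = q N + m
   with 0 <= m < N; if m > r' + 1 then i = (q + 1) N - (N - m). *)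
Definition Rblock (l : (r'.+2).-tuple nat) (i : int) : set int :=
  let N := period r' in
  let q := (i %/ N)%Z in
  let m := `|(i %% N)%Z|%N in
  if (m <= r'.+1)%N then [set x | Rbase l m (x - q * D)]
  else [set x | Rbase l (N - m)%N ((q + 1) * D - x)].

End Parabolic.

Definition card_int (E : set int) : int := (#|` fset_set E|%fset)%:Z.

Definition kappa (r : nat) (l : (r.+2).-tuple nat) (g : int -> int)
    (m : (r.+2).-tuple nat) : mat :=
  fun i j => card_int (Rblock l i `&` g @` Rblock m j).

Local Notation datum r :=
  ((r.+2).-tuple nat * (int -> int) * (r.+2).-tuple nat)%type.

(* The unique (l, g, m) with C = kappa(l, g, m), for C in Xi r d. *)
Definition kappa_datum (r : nat) (C : mat) : datum r :=
  xget ([tuple 0%N | _ < r.+2], (id : int -> int), [tuple 0%N | _ < r.+2])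
    [set p : datum r | [/\ Lambda p.1.1, Lambda p.2,
                       Ddouble p.1.1 p.2 p.1.2
                     & C = kappa p.1.1 p.1.2 p.2]].

Definition ell_mat (r : nat) (C : mat) : nat := ell (kappa_datum r C).1.2.

(* delta lists, column by column, the nonzero diagonals of B: writing
   k + 1 = 3 i + m with m in {0, 1, 2}, delta_k = b'_{i + m - 1, i}. *)
Definition delta (r : nat) (B : mat) : ((3 * r + 2).+2).-tuple nat :=
  [tuple `|prim r B (((val k).+1 %/ 3)%N%:Z + ((val k).+1 %% 3)%N%:Z - 1)
                    ((val k).+1 %/ 3)%N%:Z|%N
  | k < (3 * r + 2).+2].

Definition phi (r : nat) (dl : ((3 * r + 2).+2).-tuple nat) (g2 : int -> int)
    (nu : (r.+2).-tuple nat) (w : int -> int) : mat :=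
  fun i j => card_int (Rblock dl (3 * i - 1) `&` (w \o g2) @` Rblock nu j).

(* phi^{-1}(T), where A = kappa(mu, g2, nu) *)
Definition phi_fiber (r : nat) (A B T : mat) : set (int -> int) :=
  let: (mu, g2, nu) := kappa_datum r A in
  [set w | Dmin (delta r B) w /\ Wpar mu w /\ phi (delta r B) g2 nu w = T].

Definition w_AT (r : nat) (A B T : mat) : int -> int :=
  xget (id : int -> int) [set w | phi_fiber r A B T w
                /\ forall w', phi_fiber r A B T w' -> (ell w <= ell w')%N].

End WeylGroup.

Section FirstExpression.
Variable r : nat.

Definition theta (T : mat) : mat := fun i j => T i j + T (- i) (- j).
Definition hat (S : mat) : mat := fun i j => S (i + 1) j.
Definition dag (S : mat) : mat := fun i j => S (1 - i) (- j).

Definition Theta_BA (B A : mat) : set mat :=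
  [set T | [/\ Theta r T, le_e (theta T) A
             & forall i, row_a T i = B (i - 1) i]].

Definition Gamma (T : mat) : set mat :=
  [set S | [/\ Theta r S, le_e S T & forall i, row_a S i = row_a (dag S) i]].

(* A^{(T - S)} *)
Definition A_TS (A T S : mat) : mat := A - theta (T - S) + theta (hat (T - S)).

Definition n_S (S : mat) : int := \sum_(1 <= i < r.+2) row_a S i%:Z.

(* s (x - (s + 1) / 2) is written s x - s (s + 1) / 2 to stay in Z *)
Definition h_TS (T S : mat) : int :=
  \sum_(1 <= i < r.+2) \sum_(j \in [set: int])
    (S i%:Z j * (\sum_(k \in [set k : int | k <= j]) T i%:Z k)
     - (S i%:Z j * (S i%:Z j + 1) %/ 2)%Z)
  + \sum_(1 <= i < r.+2) \sum_(j \in [set: int])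
    (T (1 - i%:Z) (- j) - S (1 - i%:Z) (- j))
    * (\sum_(k \in [set k : int | k <= j - 1]) T i%:Z k
       + \sum_(k \in [set k : int | j <= k]) S i%:Z k
       - \sum_(k \in [set k : int | j + 1 <= k]) S (1 - i%:Z) (- k)).

(* [[S]] *)
Definition dbr_S (S : mat) : Qv :=
  \prod_(1 <= i < r.+2) \prod_(j \in [set: int])
    (qbinom (\sum_(k \in [set k : int | k <= j]) (S - dag S) i%:Z k)
            (dag S i%:Z (j + 1))
     * qfact (dag S i%:Z (j + 1))).

(* [T]^! *)
Definition mfact (T : mat) : Qv :=
  \prod_(1 <= i < (period r).+1) \prod_(j \in [set: int]) qfact (T i%:Z j).

Definition Iplus : set (int * int) :=
  [set p | (p.1 = 0 /\ 1 <= p.2) \/ (1 <= p.1 <= r%:Z)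
           \/ (p.1 = r.+1%:Z /\ p.2 <= r%:Z)].

(* [A]^!_c *)
Definition mfact_c (A : mat) : Qv :=
  (\prod_(1 <= k < `|prim r A 0 0|%N.+1) qint (2 * k%:Z))
  * (\prod_(1 <= k < `|prim r A r.+1%:Z r.+1%:Z|%N.+1) qint (2 * k%:Z))
  * \prod_(p \in Iplus) qfact (A p.1 p.2).

(* [[A; S; T]] *)
Definition dbr_AST (A S T : mat) : Qv :=
  mfact_c (A_TS A T S) * dbr_S S
  / (mfact_c (A - theta T) * mfact S * mfact (T - S)).

Definition ell_ABST (d : nat) (A B S T : mat) : int :=
  (ell_mat d r A)%:Z + (ell_mat d r B)%:Z - (ell_mat d r (A_TS A T S))%:Z
  + (ell d (w_AT d r A B T))%:Z.

End FirstExpression.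

Section SecondExpression.
Variable r : nat.

Definition check (X : mat) : mat := fun i j => X (i - 1) j.

Definition A_XY (A X Y : mat) : mat := A + X - Y - (check X - check Y).

Definition Iset : set (int * int) :=
  [set p | (p.1 = - r%:Z - 1 /\ - r%:Z - 1 < p.2) \/ (- r%:Z <= p.1 <= -1)
           \/ (p.1 = 0 /\ p.2 < 0)].

(* the bracket [A_{X,Y} over X], with M = A_{X,Y} *)
Definition br_MX (M X : mat) : Qv :=
  (\prod_(p \in Iset)
     (qbinom (M p.1 p.2) (X p.1 p.2)
      * qbinom (M p.1 p.2 - X p.1 p.2) (X (- p.1) (- p.2))))
  * \prod_(i <- [:: 0 : int; - r%:Z - 1])
      \prod_(0 <= k < `|X i i|%N)
        (qint (M i i - 2 * k%:Z - 1) / qint (k%:Z + 1)).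

Definition upper_triangular (gamma beta : int -> int) : set mat :=
  [set s | [/\ Nmat s, (forall k l : int, l < k -> s k l = 0),
               (forall k, has_sum (s k) (beta k))
             & (forall l, has_sum (s^~ l) (gamma l))]].

Definition n_exp (a : int -> int) (s : mat) : int :=
  \sum_(k \in [set: int]) \sum_(l \in [set: int])
     \sum_(p \in [set p : int | p < l]) s k l * a p
  + \sum_(k \in [set: int]) s k k * a k
  + \sum_(k \in [set: int]) \sum_(l \in [set: int])
     \sum_(p \in [set p : int | p < k]) \sum_(q \in [set q : int | l < q])
       s k l * s p q.

(* n(a, gamma, beta) *)
Definition n_vec (a gamma beta : int -> int) : Qv :=
  \sum_(s \in upper_triangular gamma beta)
    v ^ (2 * n_exp a s)
    * ((\prod_(k \in [set: int]) qfact (beta k))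
       / \prod_(k \in [set: int]) \prod_(l \in [set: int]) qfact (s k l))
    * \prod_(l \in [set: int])
        \prod_(0 <= m < `|gamma l - s l l|%N)
          (v ^ (2 * a l) - v ^ (2 * m%:Z)).

(* n(X, Y) *)
Definition n_XY (X Y : mat) : Qv :=
  \prod_(0 <= i < r.+1)
    n_vec (X i%:Z) (Y i%:Z) (fun j => X (- i%:Z - 1) (- j)).

(* xi_{A,X,Y}, with M = A_{X,Y} *)
Definition xi_MX (M X : mat) : int :=
  \sum_(i \in [set i : int | - r%:Z - 1 <= i <= r%:Z])
    \sum_(l \in [set: int]) \sum_(j \in [set j : int | l < j])
      (M i j - X i j) * X i l
  - (\sum_(i \in [set i : int | - r%:Z <= i <= -1])
       \sum_(l \in [set: int]) \sum_(j \in [set j : int | l < j])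
         X (- i) (- j) * X i l
     + \sum_(i <- [:: - r%:Z - 1; 0 : int])
       \sum_(l \in [set: int])
         \sum_(j \in [set j : int | l < j /\ j < 2 * i - l])
           X (- i) (- j) * X i l)
  - \sum_(i <- [:: - r%:Z - 1; 0 : int])
      \sum_(j \in [set j : int | j < i]) (X i j * (X i j + 1) %/ 2)%Z.

Definition XY_index (d : nat) (A : mat) (alpha : int -> int)
    : set (mat * mat) :=
  [set p | let: (X, Y) := p in
    [/\ Theta r X /\ Theta r Y,
        (forall i j, X i j + X (- i - 1) (- j) = Y i j + Y (- i - 1) (- j)),
        (forall i, has_sum (X i) (alpha i))
        /\ (forall i, has_sum (Y i) (alpha (- i - 1))),
        Theta r (A - Y + check Y)
      & Xi r d (A_XY A X Y)]].

End SecondExpression.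

(* The free Q(v)-module with basis e_C, C ranging over all of Z^(Z x Z): it
   contains the free module on Xi r d as the span of part of its basis, and
   makes e_C available before C is known to lie in Xi r d. *)
Notation freeQv := {malg Qv[mat]}.
Definition e_ (C : mat) : freeQv := mkmalgU C 1.

(* Main.v *)
Require Import Defs.
From mathcomp Require Import zify lra.

Set Implicit Arguments.
Unset Strict Implicit.
Unset Printing Implicit Defensive.
Import Order.TTheory GRing.Theory Num.Theory.
Local Open Scope classical_set_scope.
Local Open Scope ring_scope.

(** Why the two expressions agree.  A pair (T, S) of the first sum is sent to
    (X, Y), where x_ij = t_(i+1,j) - s_(i+1,j) + s_(-i,-j) and y_ij = t_(-i,-j).
    Then A^(T-S) = A_(X,Y), and Y determines T.  The terms (X, Y) of the second
    sum for which A - T_theta has a negative entry are zero, because the bracket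
    vanishes ([br_zero]).  For the other ones the bracket is
    [A_(X,Y)]^! / ([A - T_theta]^! [X]^!) ([br_fact]), and the coefficient of
    e_(A_(X,Y)) has to be compared with the sum of the coefficients over the
    fibre, that is over all S with the given T and X.

    The rows of S occur in pairs (i, 1 - i), and within a pair S is determined
    by its row 1 - i, read backwards; call it u.  The fibre is thus a product of
    r + 1 independent sets of rows u ([fibre_bij], [prod_fsum]).  On the other
    side n(X, Y) is a product of r + 1 sums n(a, gamma, beta) over upper
    triangular matrices sigma; writing the diagonal of sigma as gamma - u and
    summing over the strictly upper triangular part turns n(a, gamma, beta) into
    a sum over the same rows u ([n_vecE]).  The inner sum is evaluated column
    after column by the q-Vandermonde identity ([vandermonde], [strict_sum]), and
    produces the Gaussian binomials of the factor [[S]].  All factorials then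
    match, and only the exponents of v remain.

    For these the length of an element of W is computed as a weighted number of
    inversions modulo the period ([ell_inv8]), in which a multiple of d + 1, being
    fixed by all of W, has weight 1 and every other integer weight 2.  Labelling
    the integers by the blocks containing them and their preimages turns this
    number into a quadratic form in the entries of the matrix of a double coset
    ([ell_matE]), and likewise for w_(A,T) ([ell_wAT]), which is constructed as
    the element that is as increasing as the prescribed sizes of intersections of
    blocks permit.  In terms of the bilinear pairing <p, q> = sum_(j < l) p_j q_l
    of rows, l(A) - l(A^(T-S)) telescopes ([Qb_diff]); after summation over the
    rows modulo n and reflection i -> -i, all terms that involve A or two
    different rows cancel against xi ([global_exponent]).  What is left is an
    identity between pairings of the four rows y_i, t_(i+1), s_(i+1) and u, which
    is a formal consequence of <p, q> + <q, p> + p.q = |p| |q| ([local_identity],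
    [exponent_identity]). *)

(** * Finitely supported sums and inversions modulo the period *)

(** A finitely supported big operator over an infinite set can be computed on any
    duplicate-free list outside of which its terms are neutral. *)
Lemma fsbigE_cond (R : Type) (idx : R) (op : Monoid.com_law idx)
    (T : choiceType) (A : set T) (r : seq T) (f : T -> R) :
  uniq r -> (forall i, A i -> i \notin r -> f i = idx) ->
  \big[op/idx]_(i \in A) f i = \big[op/idx]_(i <- r | i \in A) f i.
Proof.
move=> ur h; rewrite fsbig_mkcond (fsbigE r) //=; last first.
  by move=> i _ nir; rewrite /patch; case: ifP => // /[!inE] Ai; exact: h.
rewrite [LHS]big_mkcond [RHS]big_mkcond /=.
by apply: eq_bigr => i _; rewrite in_setT /patch; case: ifP.
Qed.

Lemma fsum_add (T : choiceType) (V : zmodType) (P : set T) (f g : T -> V) :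
  finite_set (P `&` [set x | f x <> 0]) ->
  finite_set (P `&` [set x | g x <> 0]) ->
  \sum_(x \in P) (f x + g x) = \sum_(x \in P) f x + \sum_(x \in P) g x.
Proof.
move=> ff fg.
set Q := (P `&` [set x | f x <> 0]) `|` (P `&` [set x | g x <> 0]).
have fQ : finite_set Q by rewrite finite_setU.
have QP : Q `<=` P by move=> x [[]|[]].
have out x : (P `\` Q) x -> f x = 0 /\ g x = 0.
  move=> [Px nQ]; split; apply: contrapT => h; apply: nQ; by [left|right].
rewrite -!(fsbig_widen Q P) ?fsbig_split // => x /out[f0 g0] /=;
by rewrite /preimage/= ?f0 ?g0 ?addr0.
Qed.

(** Sums over two fundamental domains of an action tau of the integers agree; h1
    and h2 are height functions which tau shifts by N1 and N2. *)
Lemma fsum_fdom (T : choiceType) (V : zmodType) (tau : int -> T -> T)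
    (h1 h2 : T -> int) (N1 N2 : int) (F : T -> V) :
  (forall a b x, tau (a + b) x = tau a (tau b x)) -> (forall x, tau 0 x = x) ->
  0 < N1 -> 0 < N2 ->
  (forall k x, h1 (tau k x) = h1 x + k * N1) ->
  (forall k x, h2 (tau k x) = h2 x + k * N2) ->
  (forall k x, F (tau k x) = F x) ->
  \sum_(x \in [set x | 0 <= h1 x < N1]) F x
  = \sum_(x \in [set x | 0 <= h2 x < N2]) F x.
Proof.
move=> tD t0 N1p N2p H1 H2 FF.
pose f x := tau (- (h2 x %/ N2)%Z) x.
rewrite (reindex_fsbig f [set x | 0 <= h1 x < N1] [set x | 0 <= h2 x < N2]).
  by apply: eq_fsbigr => x _; rewrite /f FF.
have modb h N x : 0 < N -> 0 <= h x + - (h x %/ N)%Z * N < N :> bool.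
  move=> Np; rewrite {1 3}(divz_eq (h x) N) addrAC mulNr subrr add0r.
  by rewrite modz_ge0 ?gt_eqF //= ltz_pmod.
split.
- by move=> x /= _; rewrite /f H2 modb.
- move=> x y /[!inE] /= hx hy e.
  have {}e : y = tau ((h2 y %/ N2)%Z - (h2 x %/ N2)%Z) x.
    by rewrite tD; move: e; rewrite /f => ->; rewrite -tD subrr t0.
  move: e; set c := (_ - _) => e.
  have : h1 y = h1 x + c * N1 by rewrite e H1.
  move=> hh; suff c0 : c = 0 by rewrite e c0 t0.
  by nia.
- move=> y /= hy; exists (tau (- (h1 y %/ N1)%Z) y); first by rewrite /= H1 modb.
  rewrite /f -tD H2; set c := (h1 y %/ N1)%Z.
  have -> : ((h2 y + - c * N2) %/ N2)%Z = - c.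
    rewrite addrC divzMDl ?gt_eqF // divz_small ?addr0 //.
    by move: hy; lia.
  by rewrite opprK subrr t0.
Qed.

Lemma eqmodP (D x i : int) :
  reflect (exists q, x = i + q * D) (x == i %[mod D])%Z.
Proof.
rewrite eqz_mod_dvd; apply: (iffP dvdzP) => -[q e]; exists q.
  by rewrite -e addrC subrK.
by rewrite e addrC addKr.
Qed.

Lemma finite_zrange (a b : int) : finite_set [set x : int | a <= x <= b].
Proof.
pose s := [seq a + k%:Z | k <- iota 0 `|b - a|.+1].
apply: (@sub_finite_set int _ [set` s]); last exact: finite_seq.
move=> x /= h; rewrite /s; apply/mapP; exists `|x - a|%N; last by lia.
by rewrite mem_iota; lia.
Qed.

Section Length.
Variable d : nat.
Let D : int := (Dper d)%:Z.
Let DE : D = 2 * d%:Z + 2. Proof. by rewrite /D /Dper; lia. Qed.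
Let Dgt0 : 0 < D. Proof. by rewrite DE; lia. Qed.

(** The weight of an integer: the multiples of d + 1 are fixed by all of W and
    count for one, all other integers count for two. *)
Definition om (x : int) : int := if (d.+1%:Z %| x)%Z then 1 else 2.

Lemma dvd_half x : (d.+1%:Z %| x)%Z = (0 == x %[mod D])%Z || (d%:Z + 1 == x %[mod D])%Z.
Proof.
apply/idP/orP.
- move=> /dvdzP[q ->]; have := divz_eq q 2.
  have : (0 <= (q %% 2)%Z < 2) by rewrite modz_ge0 //= ltz_pmod.
  set e := (q %% 2)%Z => he qe.
  have [e0|e1] : e = 0 \/ e = 1 by lia.
  + by left; apply/eqmodP; exists (- (q %/ 2)%Z); rewrite {1}qe DE e0; lia.
  + by right; apply/eqmodP; exists (- (q %/ 2)%Z); rewrite {1}qe DE e1; lia.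
- by move=> [] /eqmodP[q e]; apply/dvdzP; [exists (- (2 * q))|exists (1 - 2 * q)];
    move: e; rewrite DE; lia.
Qed.

Lemma omD k x : om (x + k * D) = om x.
Proof.
rewrite /om; congr (if _ then _ else _).
have -> : D = d.+1%:Z * 2 by rewrite DE; lia.
by rewrite mulrCA addrC rpredDl ?dvdz_mulr.
Qed.

Lemma omN x : om (- x) = om x.
Proof. by rewrite /om rpredN. Qed.

Lemma om_gt0 x : 0 < om x. Proof. by rewrite /om; case: ifP. Qed.

Lemma om2 x : 0 < x <= d%:Z -> om x = 2.
Proof.
move=> h; rewrite /om; case: dvdzP => // -[q e]; exfalso.
have [q0|q0] : q <= 0 \/ 1 <= q by lia.
  by nia.
by nia.
Qed.

Lemma om1 x : x = 0 \/ x = d%:Z + 1 -> om x = 1.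
Proof.
move=> [->|->]; rewrite /om ?dvdz0 // (_ : d%:Z + 1 = d.+1%:Z) ?dvdzz //; lia.
Qed.

Section Elements.
Variable g : int -> int.
Hypothesis gW : Wgrp d g.

Lemma W_shift k x : g (x + k * D) = g x + k * D.
Proof.
have gs y : g (y + D) = g y + D by case: gW => _ [+ _]; apply.
have shn (n : nat) y : g (y + n%:Z * D) = g y + n%:Z * D.
  elim: n y => [|n IH] y; first by rewrite mul0r !addr0.
  by rewrite -addn1 PoszD mulrDl mul1r !addrA gs IH.
case: k => n; first exact: shn.
have := shn n.+1 (x + Negz n * D); rewrite NegzE.
have -> : x + - n.+1%:Z * D + n.+1%:Z * D = x by lia.
by move=> ->; lia.
Qed.

Lemma W_opp x : g (- x) = - g x. Proof. by case: gW => _ [_]; apply. Qed.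

Lemma W0 : g 0 = 0. Proof. by have := W_opp 0; rewrite oppr0; move: (g 0) => z; lia. Qed.

Lemma W_mid : g (d%:Z + 1) = d%:Z + 1.
Proof.
have := W_shift 1 (- (d%:Z + 1)); rewrite W_opp.
by rewrite (_ : _ + 1 * D = d%:Z + 1) DE; lia.
Qed.

(** The multiples of d + 1 are exactly the centres of symmetry x = - x + k D. *)
Lemma W_fix x : (d.+1%:Z %| x)%Z -> g x = x.
Proof.
rewrite dvd_half => /orP[] /eqmodP[q e].
  have -> : x = 0 + (- q) * D by rewrite e; lia.
  by rewrite W_shift W0.
have -> : x = d%:Z + 1 + (- q) * D by rewrite e; lia.
by rewrite W_shift W_mid.
Qed.

Lemma W_inj : injective g. Proof. by case: gW => /bij_inj. Qed.

Lemma W_om x : om (g x) = om x.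
Proof.
rewrite /om; suff -> : (d.+1%:Z %| g x)%Z = (d.+1%:Z %| x)%Z by [].
apply/idP/idP => h; last by rewrite W_fix.
by have e : g (g x) = g x by [apply: W_fix]; rewrite -(W_inj e).
Qed.

Lemma W_bound : exists K : int, forall x, `|g x - x| <= K.
Proof.
exists (\sum_(m < Dper d) `|g m%:Z - m%:Z|) => x.
pose m := `|(x %% D)%Z|%N.
have me : (x %% D)%Z = m%:Z by rewrite /m gez0_abs // modz_ge0 // gt_eqF.
have mD : (m < Dper d)%N by rewrite -ltz_nat -me ltz_pmod.
have e : x = (x %% D)%Z + (x %/ D)%Z * D by rewrite addrC -divz_eq.
rewrite {1 2}e W_shift me opprD addrACA subrr addr0.
rewrite (bigD1 (Ordinal mD)) //= lerDl sumr_ge0 //.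
Qed.
End Elements.

Lemma W_comp g1 g2 : Wgrp d g1 -> Wgrp d g2 -> Wgrp d (g1 \o g2).
Proof.
move=> [b1 [s1 o1]] [b2 [s2 o2]]; split; first exact: bij_comp.
by split=> i /=; [rewrite s2 s1|rewrite o2 o1].
Qed.

Lemma W_id : Wgrp d id. Proof. by split; [exists id|]. Qed.

Lemma W_inv g : Wgrp d g -> exists h, [/\ Wgrp d h, cancel g h & cancel h g].
Proof.
move=> gW; case: (gW) => -[h gh hg] _; exists h; split=> //; split; first by exists g.
split=> i; apply: (W_inj gW); rewrite hg.
  by rewrite -/D -[in RHS](mul1r D) (W_shift gW) hg mul1r.
by rewrite (W_opp gW) hg.
Qed.

Lemma W_canW g h : Wgrp d g -> cancel g h -> cancel h g -> Wgrp d h.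
Proof.
move=> gW gh hg; have [h' [h'W gh' hg']] := W_inv gW.
suff -> : h = h' by [].
by apply/funext => x; rewrite -{2}(hg x) gh'.
Qed.

(** The sum of a translation invariant function of two integers, over the pairs
    modulo simultaneous translation by D. *)
Definition psum2 (F : int -> int -> int) : int :=
  \sum_(p \in [set p : int * int | 0 <= p.1 < D]) F p.1 p.2.

(** Simultaneous translation of a pair by k D. *)
Definition sh2 (k : int) (p : int * int) := (p.1 + k * D, p.2 + k * D).

Lemma sh2D a b p : sh2 (a + b) p = sh2 a (sh2 b p).
Proof. by rewrite /sh2 /=; congr pair; lia. Qed.
Lemma sh20 p : sh2 0 p = p.
Proof. by case: p => a b; rewrite /sh2 /= mul0r !addr0. Qed.

(** Invariance under simultaneous translation by multiples of D. *)
Definition shinv (F : int -> int -> int) :=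
  forall k x y, F (x + k * D) (y + k * D) = F x y.

Lemma psum2_fdom F (h : int * int -> int) (N : int) : shinv F -> 0 < N ->
  (forall k p, h (sh2 k p) = h p + k * N) ->
  psum2 F = \sum_(p \in [set p : int * int | 0 <= h p < N]) F p.1 p.2.
Proof.
move=> Fs N0 hN.
apply: (@fsum_fdom _ _ sh2 fst h D N) => //; first exact: sh2D.
by apply: sh20.
by move=> k x; rewrite /sh2 /= Fs.
Qed.

Lemma psum2_window a F : shinv F ->
  psum2 F = \sum_(p \in [set p : int * int | a <= p.1 < a + D]) F p.1 p.2.
Proof.
move=> Fs; rewrite (@psum2_fdom F (fun p => p.1 - a) D) //.
  by apply: eq_fsbigl; apply/funext => p /=; apply/propext; lia.
by move=> k p /=; lia.
Qed.

Lemma psum2_conj g F : Wgrp d g -> shinv F ->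
  psum2 F = psum2 (fun x y => F (g x) (g y)).
Proof.
move=> gW Fs; have [h [hW gh hg]] := W_inv gW.
rewrite (@psum2_fdom F (fun p => h p.1) D) //; last first.
  by move=> k p /=; rewrite (W_shift hW).
rewrite (reindex_fsbig (fun p : int * int => (g p.1, g p.2))
  [set p | 0 <= p.1 < D]) //.
split=> //.
- by move=> p /= ?; rewrite gh.
- by move=> [a b] [a' b'] _ _ /= [] /(W_inj gW) -> /(W_inj gW) ->.
- by move=> [a b] /= hab; exists (h a, h b) => //=; rewrite !hg.
Qed.

(** A finite set of representatives of the pairs at distance at most K. *)
Definition bandset (K : int) : set (int * int) :=
  [set p | 0 <= p.1 < D /\ `|p.2 - p.1| <= K].

Lemma bandset_finite K : finite_set (bandset K).
Proof.
apply: (@sub_finite_set _ _ ([set x | 0 <= x <= D] `*` [set y | - K <= y <= D + K])).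
  by move=> [x y] [/= h1 h2]; split => /=; lia.
by apply: finite_setX; exact: finite_zrange.
Qed.

(** Support within bounded distance of the diagonal. *)
Definition banded (F : int -> int -> int) :=
  exists K, forall x y, F x y <> 0 -> `|y - x| <= K.

Lemma banded_fin F : banded F ->
  finite_set ([set p : int * int | 0 <= p.1 < D] `&` [set p | F p.1 p.2 <> 0]).
Proof.
move=> [K hK]; apply: sub_finite_set (bandset_finite K) => -[x y] /= [h1 h2].
by split => //; exact: hK.
Qed.

Lemma psum2_add F G : banded F -> banded G ->
  psum2 (fun x y => F x y + G x y) = psum2 F + psum2 G.
Proof. by move=> bF bG; rewrite /psum2 fsum_add //; exact: banded_fin. Qed.

Lemma eq_psum2 F G : (forall x y, F x y = G x y) -> psum2 F = psum2 G.
Proof. by move=> e; apply: eq_fsbigr => p _. Qed.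

(** Eight times the length of g: the number of inversions modulo D, each counted
    with the product of the weights of its two members.  The weights make every
    simple reflection contribute 8, see [coxinv_sum]. *)
Definition inv8 (g : int -> int) : int :=
  psum2 (fun x y => om x * om y * ((x < y) && (g y < g x))%:Z).

Lemma inv8_ge0 g : 0 <= inv8 g.
Proof.
apply: fsumr_ge0 => p _; have := om_gt0 p.1; have := om_gt0 p.2.
by case: (_ && _); rewrite ?mulr0 ?mulr1 // => *; rewrite ltW // mulr_gt0.
Qed.

(** The same count for s \o g, in terms of the inverse h of g. *)
Lemma inv8_comp s g h : Wgrp d g -> cancel g h -> cancel h g -> Wgrp d s ->
  inv8 (s \o g) = psum2 (fun x y => om x * om y * ((h x < h y) && (s y < s x))%:Z).
Proof.
move=> gW gh hg sW; have hW := W_canW gW gh hg.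
rewrite [RHS](@psum2_conj g _ gW); last first.
  by move=> k x y; rewrite !omD !(W_shift hW) !(W_shift sW) !ltrD2r.
by apply: eq_psum2 => x y /=; rewrite !(W_om gW) !gh.
Qed.

Lemma band_inv s h : Wgrp d s -> Wgrp d h ->
  banded (fun x y => om x * om y * ((h x < h y) && (s y < s x))%:Z).
Proof.
move=> sW hW; have [K1 k1] := W_bound sW; have [K2 k2] := W_bound hW.
exists (2 * K1 + 2 * K2) => x y.
case: andP => [[h1 h2] _|]; last by rewrite mulr0.
by have := k1 x; have := k1 y; have := k2 x; have := k2 y; lia.
Qed.
End Length.

(** * Simple reflections and inversions *)

(** Case analysis on all innermost conditions. *)
Ltac ifs := repeat match goal with |- context [if ?b then _ else _] =>
  lazymatch b with context [if _ then _ else _] => fail | _ =>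
  let E := fresh in destruct b eqn:E end end.

Section Length2.
Variable d : nat.
Let D : int := (Dper d)%:Z.
Let DE : D = 2 * d%:Z + 2. Proof. by rewrite /D /Dper; lia. Qed.
Let Dgt0 : 0 < D. Proof. by rewrite DE; lia. Qed.

Lemma W_normal (x : int) : exists m q, x = m + q * D /\ - d%:Z <= m <= d%:Z + 1.
Proof.
exists (((x + d%:Z) %% D)%Z - d%:Z), ((x + d%:Z) %/ D)%Z.
have := divz_eq (x + d%:Z) D; have := modz_ge0 (x + d%:Z) (lt0r_neq0 Dgt0).
have := ltz_pmod (x + d%:Z) Dgt0; rewrite DE; move: (_ %/ _)%Z (_ %% _)%Z => a b.
by lia.
Qed.

Hypothesis hd : (2 <= d)%N.

(** The action of the k-th simple reflection on the window from - d to d + 1. *)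
Definition cox0 (k : nat) (m : int) : int :=
  if k == 0%N then (if m == 1 then -1 else if m == -1 then 1 else m)
  else if k == d then
    (if m == d%:Z then d%:Z + 2 else if m == - d%:Z then - d%:Z - 2 else m)
  else if m == k%:Z then k%:Z + 1 else if m == k%:Z + 1 then k%:Z
  else if m == - k%:Z then - k%:Z - 1 else if m == - k%:Z - 1 then - k%:Z else m.

Lemma eqmod_near m q i : `|m - i| < 2 * D ->
  (m + q * D == i %[mod D])%Z = [|| m == i, m == i + D | m == i - D].
Proof.
move=> h; apply/eqmodP/idP => [[c e]|].
  have {}e : m = i + (c - q) * D by rewrite mulrBl; lia.
  move: (c - q) e => u e; have [u0|[u0|[u0|u0]]] :
    u = 0 \/ u = 1 \/ u = -1 \/ 2 <= `|u| by lia.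
  - by apply/orP; left; apply/eqP; rewrite e u0; lia.
  - by apply/orP; right; apply/orP; left; apply/eqP; rewrite e u0; lia.
  - by apply/orP; right; apply/orP; right; apply/eqP; rewrite e u0; lia.
  - exfalso; move: h; rewrite e addrC addKr normrM (gtr0_norm Dgt0).
    by rewrite ltr_pM2r //; move: u0; case: lerP => //; lia.
case/or3P => /eqP ->; [exists q|exists (q + 1)|exists (q - 1)]; lia.
Qed.

Lemma cox_norm k m q : (k <= d)%N -> - d%:Z <= m <= d%:Z + 1 ->
  cox d k (m + q * D) = cox0 k m + q * D.
Proof.
move=> kd hm; rewrite /cox /cox0 /cswap -/D.
case: eqVneq => [_|k0].
  rewrite !eqmod_near; try (rewrite DE; lia).
  by rewrite DE; ifs; lia.
case: eqVneq => [_|kd'].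
  rewrite !eqmod_near; try (rewrite DE; lia).
  by rewrite DE; ifs; lia.
rewrite !eqmod_near; try (rewrite DE; lia).
by rewrite DE; ifs; lia.
Qed.

Lemma coxK k : (k <= d)%N -> involutive (cox d k).
Proof.
move=> kd x.
have [m [q [-> hm]]] := W_normal x; rewrite cox_norm //.
  have [hm'|[hm'|hm']] : - d%:Z <= cox0 k m <= d%:Z + 1 \/ cox0 k m = d%:Z + 2
     \/ cox0 k m = - d%:Z - 2.
  - by move: hm; rewrite /cox0; ifs; lia.
  - rewrite cox_norm //; congr (_ + _); move: hm hm'; rewrite /cox0.
    by ifs; lia.
  - have -> : cox0 k m + q * D = - d%:Z + (q + 1) * D by rewrite hm' mulrDl DE; lia.
    rewrite cox_norm //; last lia.
    move: hm hm'; rewrite mulrDl DE /cox0.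
    by ifs; lia.
  - have -> : cox0 k m + q * D = d%:Z + (q - 1) * D by rewrite hm' mulrBl DE; lia.
    rewrite cox_norm //; last lia.
    move: hm hm'; rewrite mulrBl DE /cox0.
    by ifs; lia.
Qed.

Lemma cox_W k : (k <= d)%N -> Wgrp d (cox d k).
Proof.
move=> kd; have inv := coxK kd.
split; first by exists (cox d k).
split=> x; have [m [q [-> hm]]] := W_normal x.
  have -> : m + q * D + (Dper d)%:Z = m + (q + 1) * D by rewrite -/D; lia.
  by rewrite !cox_norm // -/D; lia.
case: (eqVneq m (d%:Z + 1)) => [me|mn].
  have -> : - (m + q * D) = m + (- q - 1) * D by rewrite me DE; lia.
  rewrite !cox_norm // me /cox0 DE.
  by ifs; lia.
have -> : - (m + q * D) = - m + (- q) * D by lia.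
rewrite !cox_norm //; try lia.
rewrite mulNr opprD; congr (_ + _); move: hm mn; rewrite /cox0.
by ifs; lia.
Qed.

(** Representatives of the pairs inverted by the k-th simple reflection. *)
Definition coxinv (k : nat) : seq (int * int) :=
  if k == 0%N then [:: (-1, 0); (0, 1); (-1, 1)]
  else if k == d then
    [:: (d%:Z, d%:Z + 1); (d%:Z + 1, d%:Z + 2); (d%:Z, d%:Z + 2)]
  else [:: (k%:Z, k%:Z + 1); (- k%:Z - 1, - k%:Z)].

Lemma coxinvP k x y : (k <= d)%N -> x < y -> cox d k y < cox d k x ->
  exists q, (x - q * D, y - q * D) \in coxinv k.
Proof.
move=> kd; have [m [q [-> hm]]] := W_normal x; have [m' [q' [-> hm']]] := W_normal y.
rewrite !cox_norm // => xy syx; exists q.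
have hb z : - d%:Z <= z <= d%:Z + 1 -> - d%:Z - 2 <= cox0 k z <= d%:Z + 2.
  by rewrite /cox0; ifs; lia.
have e01 : q' - q = 0 \/ q' - q = 1.
  have := hb _ hm; have := hb _ hm'; move: xy syx; rewrite DE => xy syx h1 h2.
  have [h|[h|h]] : q' - q <= -1 \/ 2 <= q' - q \/ (q' - q = 0 \/ q' - q = 1) by lia.
  - by exfalso; nia.
  - by exfalso; nia.
  - by [].
rewrite addrK.
case: e01 => e.
  have qe : q' = q by lia.
  rewrite qe addrK; move: hm hm' xy syx; rewrite qe /cox0 /coxinv.
  by ifs; rewrite ?inE /= -?pair_eqE /=; lia.
have qe : q' = q + 1 by lia.
have -> : m' + q' * D - q * D = m' + D by rewrite qe; lia.
move: hm hm' xy syx; rewrite qe mulrDl mul1r DE /cox0 /coxinv.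
by ifs; rewrite ?inE /= -?pair_eqE /=; lia.
Qed.

Lemma coxinv_inv k p : (k <= d)%N -> p \in coxinv k ->
  p.1 < p.2 /\ cox d k p.2 < cox d k p.1.
Proof.
move=> kd; have c m : - d%:Z <= m <= d%:Z + 1 -> cox d k m = cox0 k m.
  by move=> h; have := @cox_norm k m 0 kd h; rewrite mul0r !addr0.
have c2 : cox d k (d%:Z + 2) = cox0 k (- d%:Z) + D.
  have := @cox_norm k (- d%:Z) 1 kd; rewrite mul1r => <-; last lia.
  by congr (cox _ _ _); rewrite DE; lia.
rewrite /coxinv; case: ifP => [/eqP k0|/eqP k0].
  by rewrite !inE => /or3P[] /eqP -> /=; rewrite !c /cox0 ?k0 //=; lia.
case: ifP => [/eqP k1|/eqP k1].
  by rewrite !inE => /or3P[] /eqP -> /=; rewrite ?c2 ?c ?DE /cox0 ?k1 //=;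
    ifs; lia.
by rewrite !inE => /orP[] /eqP -> /=; rewrite !c /cox0; try lia;
    ifs; lia.
Qed.

Lemma coxinv_asc h k p : (k <= d)%N -> Wgrp d h -> h k%:Z < h (k%:Z + 1) ->
  p \in coxinv k -> h p.1 < h p.2.
Proof.
move=> kd hW; rewrite /coxinv; case: ifP => [/eqP k0|/eqP k0].
  have h1 := W_opp hW 1; have h0 := W0 hW.
  have -> : k%:Z = 0 by rewrite k0.
  case: p => x y; rewrite add0r h0 !inE => a1 pin; have {}a1 : 0 < h 1 := a1; change (h x < h y).
  case/or3P: pin => /eqP[-> ->]; rewrite ?h0 ?h1 ?oppr_lt0 //.
  by rewrite (lt_trans _ a1) // oppr_lt0.
case: ifP => [/eqP k1|/eqP k1].
  have := W_mid hW; have : h (d%:Z + 2) = - h d%:Z + D.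
    rewrite -(W_opp hW) -[D]mul1r -(W_shift hW); congr (h _).
    by rewrite -/D DE; lia.
  by rewrite k1 DE !inE => ? ? ? /or3P[] /eqP -> /=; lia.
have h1 := W_opp hW k%:Z; have h2 := W_opp hW (k%:Z + 1).
rewrite !inE => ? /orP[] /eqP -> //=.
by rewrite (_ : - k%:Z - 1 = - (k%:Z + 1)) ?h1 ?h2; lia.
Qed.

Lemma coxinv_window k p : (k <= d)%N -> p \in coxinv k ->
  - d%:Z <= p.1 < - d%:Z + D.
Proof.
move=> kd; rewrite DE /coxinv; case: ifP => [/eqP k0|/eqP k0].
  by rewrite !inE => /or3P[] /eqP -> /=; lia.
case: ifP => [/eqP k1|/eqP k1].
  by rewrite !inE => /or3P[] /eqP -> /=; lia.
by rewrite !inE => /orP[] /eqP -> /=; lia.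
Qed.

Lemma coxinv_sum k : (k <= d)%N ->
  uniq (coxinv k) /\ \sum_(p <- coxinv k) om d p.1 * om d p.2 = 8.
Proof.
have d2 x : 0 < x <= d%:Z -> om d x = 2 by exact: om2.
have d1 : om d (d%:Z + 1) = 1 by apply om1; right.
have d0 : om d 0 = 1 by apply om1; left.
have m1 : om d (-1) = 2 by rewrite omN d2 //; lia.
move=> kd; rewrite /coxinv; case: ifP => [/eqP k0|/eqP k0].
  by rewrite !big_cons big_nil /= d0 m1 d2 //; lia.
case: ifP => [/eqP k1|/eqP k1].
  split; first by rewrite /= !inE -!pair_eqE /=; lia.
  rewrite !big_cons big_nil /= d1 d2; last lia.
  have -> : om d (d%:Z + 2) = 2 by
    rewrite (_ : d%:Z + 2 = - d%:Z + 1 * D) ?omD ?omN ?d2 ?DE //; lia.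
  by [].
split; first by rewrite /= !inE -!pair_eqE /=; lia.
rewrite !big_cons big_nil /= d2; last lia.
rewrite d2; last lia.
by rewrite omN (_ : - k%:Z - 1 = - (k%:Z + 1)) ?omN ?d2; lia.
Qed.

(** Multiplication by a simple reflection that is not a descent adds exactly the
    inversions of that reflection. *)
Lemma inv8_asc k g h : (k <= d)%N -> Wgrp d g -> cancel g h -> cancel h g ->
  h k%:Z < h (k%:Z + 1) -> inv8 d (cox d k \o g) = inv8 d g + 8.
Proof.
move=> kd gW gh hg asc; have hW := W_canW gW gh hg.
have sW := cox_W kd.
have -> : inv8 d g = inv8 d (id \o g) by [].
rewrite !(inv8_comp _ gh hg) //; last exact: W_id.
pose dl x y := om d x * om d y * ((h x < h y)%R%:Z * ((cox d k y < cox d k x)%R%:Z - (y < x)%R%:Z)).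
have dl0 x y : dl x y <> 0 -> exists q, (x - q * D, y - q * D) \in coxinv k.
  rewrite /dl; case: (ltrP (h x) (h y)) => hxy; last by rewrite mul0r mulr0.
  have xy : x <> y by move=> e; move: hxy; rewrite e ltxx.
  have sxy : cox d k x <> cox d k y by move=> /(W_inj sW).
  case: (ltrP (cox d k y) (cox d k x)) => s1; case: (ltrP y x) => s2;
    rewrite ?subrr ?mulr0 // => _.
    by apply: coxinvP => //; lia.
  have [q hq] : exists q, (y - q * D, x - q * D) \in coxinv k by apply: coxinvP => //; lia.
  have /= := coxinv_asc kd hW asc hq.
  have hS z : h (z - q * D) = h z - q * D by rewrite -!mulNr (W_shift hW).
  by rewrite !hS; lia.
have sdl : shinv d dl.
  by move=> q x y; rewrite /dl !omD !(W_shift hW) !(W_shift sW) !ltrD2r.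
transitivity (psum2 d (fun x y => om d x * om d y * ((h x < h y) && (id y < id x))%:Z + dl x y)).
  apply: eq_psum2 => x y; rewrite /dl -mulrDr; congr (_ * _).
  by case: (h x < h y); case: (_ < _); case: (_ < _); lia.
rewrite psum2_add; last first.
- have [K1 k1] := band_inv sW hW; have [K2 k2] := band_inv (W_id d) hW.
  exists (`|K1| + `|K2|) => x y dn.
  case: (eqVneq (om d x * om d y * ((h x < h y) && (cox d k y < cox d k x))%:Z) 0) => e1.
    case: (eqVneq (om d x * om d y * ((h x < h y) && (id y < id x))%:Z) 0) => e2.
      exfalso; apply: dn; rewrite /dl.
      move: e1 e2; have := om_gt0 d x; have := om_gt0 d y.
      by case: (h x < h y); case: (_ < _) => /=; case: (_ < _) => /=;
        rewrite ?mulr0 ?mulr1 ?subrr ?mul1r ?mul0r ?mulr0 //; nia.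
    by have := k2 x y (elimN eqP e2); lia.
  by have := k1 x y (elimN eqP e1); lia.
- exact: (band_inv (W_id d) hW).
congr (_ + _).
rewrite (psum2_window (- d%:Z) sdl) -/D.
have [ucox <-] := coxinv_sum kd.
rewrite (fsbigE (coxinv k)) //.
- rewrite big_seq_cond [RHS]big_seq_cond; apply: eq_big => p.
    rewrite andbT; apply: andb_idr => hp; rewrite inE /=; exact: coxinv_window hp.
  move=> /andP[hp _]; have [a b] := coxinv_inv kd hp.
  have c := coxinv_asc kd hW asc hp; rewrite /dl c b ltNge ltW //=.
  by rewrite subr0 !mulr1.
- by move=> p /= hp; exact: coxinv_window hp.
- move=> [x y] /= hx; apply: contraNeq => /eqP/dl0[q hq].
  have /= := coxinv_window kd hq => hx'.
  have q0 : q = 0.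
    have [c|[c|c]] : q <= -1 \/ 1 <= q \/ q = 0 by lia.
    - by exfalso; nia.
    - by exfalso; nia.
    - by [].
  by move: hq; rewrite q0 mul0r !subr0.
Qed.
End Length2.

(** * The length as a number of inversions *)

Section Length3.
Variable d : nat.
Let D : int := (Dper d)%:Z.
Let DE : D = 2 * d%:Z + 2. Proof. by rewrite /D /Dper; lia. Qed.
Let Dgt0 : 0 < D. Proof. by rewrite DE; lia. Qed.
Hypothesis hd : (2 <= d)%N.

Lemma W_normal0 (x : int) : exists m q, 0 <= m <= d%:Z + 1 /\
  (x = m + q * D \/ x = - m + q * D).
Proof.
have [m [q [-> hm]]] := W_normal d x.
by case: (leP 0 m) => m0; [exists m, q|exists (- m), q]; split; lia.
Qed.

Lemma cox_flip k h : (k <= d)%N -> Wgrp d h -> h (k%:Z + 1) < h k%:Z ->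
  h (cox d k k%:Z) < h (cox d k (k%:Z + 1)).
Proof.
move=> kd hW.
have c m : - d%:Z <= m <= d%:Z + 1 -> cox d k m = cox0 d k m.
  by move=> hm; have := @cox_norm d hd k m 0 kd hm; rewrite mul0r !addr0.
rewrite !c; try lia.
have [k0|k0] := eqVneq k 0%N.
  have h1 : h (-1) = - h 1 := W_opp hW 1; have h0 := W0 hW.
  have -> : k%:Z = 0 by rewrite k0.
  have -> : (0 : int) + 1 = 1 by [].
  have -> : cox0 d k 0 = 0 by rewrite /cox0 k0 eqxx; ifs; lia.
  have -> : cox0 d k 1 = -1 by rewrite /cox0 k0 eqxx.
  by rewrite h0 h1 oppr_gt0.
have [k1|k1] := eqVneq k d.
  have -> : cox0 d k k%:Z = - d%:Z + 1 * D by rewrite /cox0 k1 DE; ifs; lia.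
  have -> : cox0 d k (k%:Z + 1) = d%:Z + 1 by rewrite /cox0 k1; ifs; lia.
  rewrite k1 (W_mid hW) (W_shift hW) (W_opp hW) -/D DE.
  by move: (h d%:Z) => z; lia.
have -> : cox0 d k k%:Z = k%:Z + 1 by rewrite /cox0; ifs; lia.
have -> : cox0 d k (k%:Z + 1) = k%:Z by rewrite /cox0; ifs; lia.
by [].
Qed.

Lemma inv8_desc k g h : (k <= d)%N -> Wgrp d g -> cancel g h -> cancel h g ->
  h (k%:Z + 1) < h k%:Z -> inv8 d (cox d k \o g) = inv8 d g - 8.
Proof.
move=> kd gW gh hg ds; have hW := W_canW gW gh hg; have sK := coxK hd kd.
have g'W := W_comp (cox_W hd kd) gW.
have := @inv8_asc d hd k (cox d k \o g) (h \o cox d k) kd g'W.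
have -> : cox d k \o (cox d k \o g) = g by apply/funext => x /=; rewrite sK.
move=> -> //; first by rewrite addrK.
- by move=> x /=; rewrite sK gh.
- by move=> x /=; rewrite hg sK.
- exact: cox_flip.
Qed.

Lemma inv8_step k g h : (k <= d)%N -> Wgrp d g -> cancel g h -> cancel h g ->
  (h k%:Z < h (k%:Z + 1) /\ inv8 d (cox d k \o g) = inv8 d g + 8) \/
  (h (k%:Z + 1) < h k%:Z /\ inv8 d (cox d k \o g) = inv8 d g - 8).
Proof.
move=> kd gW gh hg; have hW := W_canW gW gh hg.
case: (ltgtP (h k%:Z) (h (k%:Z + 1))) => [c|c|/(W_inj hW) e]; last by lia.
  by left; split => //; exact: inv8_asc gh hg c.
by right; split => //; exact: inv8_desc gh hg c.
Qed.

(** An element without descents is the identity: it is increasing on all integers. *)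
Lemma no_desc h : Wgrp d h ->
  (forall k : nat, (k <= d)%N -> h k%:Z <= h (k%:Z + 1)) -> h = id.
Proof.
move=> hW mono.
have st (k : nat) : (k <= d)%N -> h k%:Z < h (k%:Z + 1).
  by move=> kd; rewrite lt_neqAle mono // andbT; apply/eqP => /(W_inj hW); lia.
have lo (k : nat) : (k <= d.+1)%N -> k%:Z <= h k%:Z.
  elim: k => [|k IH] kd; first by rewrite (W0 hW).
  have := st k kd; have -> : k.+1%:Z = k%:Z + 1 by lia.
  have := IH (ltnW kd).
  by move: (h k%:Z) (h _) => a b; lia.
have hi (k : nat) : (k <= d.+1)%N -> h (d.+1 - k)%N%:Z <= (d.+1 - k)%N%:Z.
  elim: k => [|k IH] kd.
    by rewrite subn0 -[d.+1]addn1 PoszD (W_mid hW).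
  have := st (d.+1 - k.+1)%N; have := IH (ltnW kd).
  have -> : (d.+1 - k)%N%:Z = (d.+1 - k.+1)%N%:Z + 1 by lia.
  by move: (h _) (h _) => a b; lia.
have fx (k : nat) : (k <= d.+1)%N -> h k%:Z = k%:Z.
  move=> kd; have := lo k kd; have := hi (d.+1 - k)%N; rewrite subKn //.
  by move: (h _) => a; lia.
apply/funext => x; have [m [q [hm hx]]] := W_normal0 x.
have hmm : h m = m by rewrite -(gez0_abs (proj1 (andP hm))) fx //; lia.
by case: hx => ->; rewrite (W_shift hW) ?(W_opp hW) hmm.
Qed.

Lemma inv8_id : inv8 d id = 0.
Proof.
apply: fsbig1 => -[x y] _ /=; case: (ltgtP x y); rewrite ?mulr0 //=.
Qed.

(** Every element has a word of length one eighth of its inversion count; if the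
    element preserves a monotone labelling be, so do the letters of the word. *)
Lemma word_ex (be : int -> int) g : {homo be : x y / x <= y} ->
  (forall k : nat, (k <= d)%N -> be k%:Z = be (k%:Z + 1) ->
     forall x, be (cox d k x) = be x) ->
  Wgrp d g -> (forall x, be (g x) = be x) ->
  exists w, [/\ word d w, word_eval d w = g,
    {in w, forall k : nat, be k%:Z = be (k%:Z + 1)} & (size w)%:Z * 8 = inv8 d g].
Proof.
move=> bm bc; have [n] := ubnP (`|inv8 d g|%N); elim: n g => // n IH g ng gW bg.
have [h [hW gh hg]] := W_inv gW.
have [[k [kd ds]]|nods] := pselect (exists k : nat, (k <= d)%N /\ h (k%:Z + 1) < h k%:Z); last first.
  have hid : h = id.
    apply: no_desc => // k kd; rewrite leNgt; apply/negP => c.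
    by apply: nods; exists k.
  have gid : g = id by apply/funext => x; rewrite -[LHS]/(id (g x)) -hid gh.
  by exists [::]; split => //; rewrite gid ?inv8_id.
have bk : be k%:Z = be (k%:Z + 1).
  have bh x : be (h x) = be x by rewrite -bg hg.
  have le1 := bm k%:Z (k%:Z + 1) ltac:(lia).
  have le2 := bm _ _ (ltW ds); rewrite !bh in le2.
  by apply/le_anti; rewrite le1.
have e := inv8_desc kd gW gh hg ds.
have [||| w [ww we wb ws]] := IH (cox d k \o g).
- have := inv8_ge0 d (cox d k \o g); rewrite e.
  by move: ng; move: (inv8 d g) => z; lia.
- exact: W_comp (cox_W hd kd) gW.
- by move=> x /=; rewrite bc.
exists (k :: w); split.
- by rewrite /word /= kd.
- by rewrite /= -/(word_eval d w) we; apply/funext => x /=; rewrite coxK.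
- by move=> j; rewrite inE => /predU1P[->|/wb].
- by move: ws; rewrite e /=; move: (inv8 d g) => z; lia.
Qed.

Lemma word_W w : word d w -> Wgrp d (word_eval d w).
Proof.
elim: w => [|k w IH] /=; first by move=> _; exact: W_id.
by move=> /andP[kd /IH]; apply: W_comp; exact: cox_W.
Qed.

Lemma inv8_word w : word d w -> inv8 d (word_eval d w) <= (size w)%:Z * 8.
Proof.
elim: w => [|k w IH] /=; first by rewrite inv8_id.
move=> /andP[kd ww]; have gW := word_W ww; have [h [hW gh hg]] := W_inv gW.
have := IH ww; rewrite -/(word_eval d w).
by case: (inv8_step kd gW gh hg) => -[_ ->]; move: (inv8 _ _) => z; lia.
Qed.

Lemma ell_inv8 g : Wgrp d g -> (ell d g)%:Z * 8 = inv8 d g.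
Proof.
move=> gW; have [w [ww we _ ws]] := @word_ex (fun=> 0) g (fun _ _ _ => lexx _)
  (fun _ _ _ _ => erefl) gW (fun=> erefl).
rewrite -ws; congr (_%:Z * _); rewrite /ell.
case: xgetP => [m -> [[w' [ww' [we' <-]]] mn]|].
  apply/eqP; rewrite eqn_leq mn //=.
  by have := inv8_word ww'; rewrite we' -ws; lia.
move=> /(_ (size w)) []; split; first by exists w.
by move=> w' ww' we'; have := inv8_word ww'; rewrite we' -ws; lia.
Qed.

Lemma ell_asc k g h : (k <= d)%N -> Wgrp d g -> cancel g h -> cancel h g ->
  (ell d g <= ell d (cox d k \o g))%N -> h k%:Z < h (k%:Z + 1).
Proof.
move=> kd gW gh hg; have := ell_inv8 gW.
have := ell_inv8 (W_comp (cox_W hd kd) gW).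
case: (inv8_step kd gW gh hg) => -[c ->] // e1 e2; lia.
Qed.

End Length3.

(** * Blocks, parabolic subgroups and minimal representatives *)

Section Blocks.
Variables (d r' : nat) (l : (r'.+2).-tuple nat).
Let D : int := (Dper d)%:Z.
Let N : int := (period r')%:Z.
Let DE : D = 2 * d%:Z + 2. Proof. by rewrite /D /Dper; lia. Qed.
Let Dgt0 : 0 < D. Proof. by rewrite DE; lia. Qed.
Let NE : N = 2 * r'%:Z + 2. Proof. by rewrite /N /period; lia. Qed.
Let Ngt0 : 0 < N. Proof. by rewrite NE; lia. Qed.
Hypothesis hl : Lambda d l.

Lemma psumS i : (i < r'.+1)%N -> psum l i.+1 = (psum l i + nth 0%N l i.+1)%N.
Proof.
by move=> h; rewrite /psum (take_nth 0%N) ?size_tuple // sumn_rcons.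
Qed.

Lemma psum0 : psum l 0 = nth 0%N l 0.
Proof. by rewrite /psum; case: l => -[|a t] //= _; rewrite take0 /= addn0. Qed.

Lemma psum_last : psum l r'.+1 = d.
Proof. by rewrite /psum take_oversize ?size_tuple //; exact: hl. Qed.

Lemma psum_mono i j : (i <= j <= r'.+1)%N -> (psum l i <= psum l j)%N.
Proof.
elim: j => [|j IH]; first by case: i.
rewrite leq_eqVlt => /andP[/orP[/eqP->//|ij] jr].
by rewrite psumS //; apply: leq_trans (leq_addr _ _); apply: IH; lia.
Qed.

Lemma psum_le i : (i <= r'.+1)%N -> (psum l i <= d)%N.
Proof. by move=> h; rewrite -[X in (_ <= X)%N]psum_last psum_mono // h leqnn. Qed.

(** The index of the block containing y, for y between 0 and d + 1. *)
Definition beta0 (y : int) : nat := find (fun i => y <= (psum l i)%:Z) (iota 0 r'.+1).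

Lemma beta0_le y : (beta0 y <= r'.+1)%N.
Proof. by rewrite -[X in (_ <= X)%N](size_iota 0) find_size. Qed.

Lemma beta0_lt y i : (i < beta0 y)%N -> (psum l i)%:Z < y.
Proof.
move=> h; have := before_find 0%N h; rewrite nth_iota; last exact: leq_trans (beta0_le y).
by rewrite add0n ltNge => ->.
Qed.

Lemma beta0_ge y : (beta0 y <= r')%N -> y <= (psum l (beta0 y))%:Z.
Proof.
move=> h; have hf : has (fun i => y <= (psum l i)%:Z) (iota 0 r'.+1).
  by rewrite has_find size_iota.
by have := nth_find 0%N hf; rewrite -/(beta0 y) nth_iota.
Qed.

Lemma beta0_uniq y m : (m <= r'.+1)%N ->
  (forall i, (i < m)%N -> (psum l i)%:Z < y) ->
  ((m <= r')%N -> y <= (psum l m)%:Z) -> beta0 y = m.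
Proof.
move=> mr h1 h2; case: (ltngtP (beta0 y) m) => // c.
  have := h1 _ c; have := @beta0_ge y; have -> : (beta0 y <= r')%N by lia.
  by move=> /(_ isT); lia.
have mr' : (m <= r')%N by have := beta0_le y; lia.
by have := beta0_lt c; have := h2 mr'; lia.
Qed.

Lemma beta0_mono y z : y <= z -> (beta0 y <= beta0 z)%N.
Proof.
move=> yz; rewrite leqNgt; apply/negP => c.
have h : (beta0 z <= r')%N by have := beta0_le y; lia.
by have := beta0_lt c; have := beta0_ge h; lia.
Qed.

(** The index i of the block R_i that contains x. *)
Definition beta (x : int) : int :=
  let m := ((x + d%:Z) %% D)%Z - d%:Z in
  let q := ((x + d%:Z) %/ D)%Z in
  if m < 0 then q * N - (beta0 (- m))%:Z else q * N + (beta0 m)%:Z.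

Lemma beta_norm m q : - d%:Z <= m <= d%:Z + 1 ->
  beta (m + q * D) = if m < 0 then q * N - (beta0 (- m))%:Z else q * N + (beta0 m)%:Z.
Proof.
move=> hm; rewrite /beta.
have -> : m + q * D + d%:Z = q * D + (m + d%:Z) by lia.
rewrite modzMDl divzMDl ?gt_eqF // modz_small ?divz_small ?addr0 ?addrK //.
- by rewrite DE; lia.
- by rewrite DE; lia.
Qed.

Lemma beta_shift k x : beta (x + k * D) = beta x + k * N.
Proof.
rewrite /beta; have -> : x + k * D + d%:Z = k * D + (x + d%:Z) by lia.
rewrite modzMDl divzMDl ?gt_eqF //.
move: ((x + d%:Z) %% D)%Z ((x + d%:Z) %/ D)%Z => a b.
by ifs; lia.
Qed.

Lemma beta_pos y : 0 <= y <= d%:Z + 1 -> beta y = (beta0 y)%:Z.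
Proof.
move=> h; have := @beta_norm y 0; rewrite mul0r addr0 => ->; last by lia.
by rewrite ltNge; case: ifP; lia.
Qed.

Lemma beta0_top : beta0 (d%:Z + 1) = r'.+1.
Proof.
by apply: beta0_uniq => // [i h|]; [have := @psum_le i|]; lia.
Qed.

Lemma beta0_0 : beta0 0 = 0%N.
Proof. by apply: beta0_uniq. Qed.

Lemma beta_opp x : beta (- x) = - beta x.
Proof.
have [m [q [-> hm]]] := W_normal d x.
case: (eqVneq m (d%:Z + 1)) => [me|mn].
  have -> : - (m + q * D) = m + (- q - 1) * D by rewrite me DE; lia.
  rewrite !beta_norm // me beta0_top.
  by ifs; rewrite NE; lia.
have -> : - (m + q * D) = - m + (- q) * D by lia.
rewrite !beta_norm //; try lia.
case: (ltgtP m 0) => [c|c|->].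
- rewrite /= opprB mulNr; ifs; [lia|by rewrite addrC].
- by rewrite opprK /=; ifs; lia.
- by rewrite oppr0 ltxx beta0_0; lia.
Qed.

Lemma beta_mono : {homo beta : x y / x <= y}.
Proof.
have st x : beta x <= beta (x + 1).
  have [m [q [-> hm]]] := W_normal d x.
  case: (eqVneq m (d%:Z + 1)) => [me|mn].
    have -> : m + q * D + 1 = - d%:Z + (q + 1) * D by rewrite me DE; lia.
    rewrite !beta_norm //; try lia.
    rewrite me; have := beta0_le (d%:Z + 1); have := beta0_le (- - d%:Z).
    have := beta0_le (- d%:Z); case: (eqVneq d 0%N) => [->|d0].
      by ifs; rewrite ?oppr0 ?beta0_0 NE; lia.
    rewrite mulrDl mul1r NE; move: (beta0 _) (beta0 _) (beta0 _) => a b c.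
    by ifs; lia.
  rewrite addrAC !beta_norm //; try lia.
  case: (ltP m 0) => m0; case: (ltP (m + 1) 0) => m1.
  - by rewrite lerD2l lerN2 lez_nat beta0_mono //; lia.
  - by lia.
  - by lia.
  - by rewrite lerD2l lez_nat beta0_mono //; lia.
move=> x y xy; have [k ->] : exists k : nat, y = x + k%:Z by exists `|y - x|%N; lia.
elim: k => [|k IH]; first by rewrite addr0.
by apply: (le_trans IH); have -> : x + k.+1%:Z = x + k%:Z + 1 by lia.
Qed.

(** Two neighbours k, k + 1 lie in the same block exactly when the k-th reflection
    is a generator of the parabolic subgroup. *)
Lemma beta_adj k : (k <= d)%N ->
  (beta k%:Z = beta (k%:Z + 1)) <-> (k \notin [seq psum l i | i <- iota 0 r'.+1]).
Proof.
move=> kd; rewrite !beta_pos; try lia.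
split.
  move=> /eqP e; apply/negP => /mapP[i]; rewrite mem_iota add0n => /andP[_ ir] ke.
  have h1 : (beta0 k%:Z <= i)%N.
    by rewrite leqNgt; apply/negP => /beta0_lt; lia.
  have h2 : (beta0 (k%:Z + 1) <= r')%N by lia.
  have := beta0_ge h2; have := @psum_mono (beta0 (k%:Z + 1)) i.
  by move: e; rewrite eqz_nat => /eqP <-; lia.
move=> nk; congr (_%:Z); have := @beta0_mono k%:Z (k%:Z + 1) ltac:(lia).
rewrite leq_eqVlt => /orP[/eqP //|c].
have h : (beta0 k%:Z <= r')%N by have := beta0_le (k%:Z + 1); lia.
case/negP: nk; apply/mapP; exists (beta0 k%:Z); first by rewrite mem_iota; lia.
by have := beta0_ge h; have := beta0_lt c; lia.
Qed.

Lemma RbaseP m x : (m <= r'.+1)%N -> Rbase d l m x -> beta x = m%:Z.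
Proof.
move=> mr; rewrite /Rbase.
have d0 := psum_le (leq0n r'.+1); rewrite psum0 in d0.
case: eqVneq => [->|m0] /=.
  have p z : 0 <= z <= (nth 0%N l 0)%:Z -> beta z = 0.
    by move=> h; rewrite beta_pos ?(@beta0_uniq _ 0%N) ?psum0; lia.
  case: (leP 0 x) => x0 h; first by apply: p; lia.
  by apply: oppr_inj; rewrite -beta_opp p ?oppr0; lia.
case: eqVneq => [->|m1] /=.
  have e := psumS (ltnSn r'); rewrite psum_last in e.
  have p z : d%:Z + 1 - (nth 0%N l r'.+1)%:Z <= z <= d%:Z + 1 -> beta z = r'.+1.
    move=> h; rewrite beta_pos ?(@beta0_uniq _ r'.+1) //; try lia.
    by move=> i ir; have := @psum_mono i r'; lia.
  case: (leP x (d%:Z + 1)) => x0 h; first by apply: p; lia.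
  have := beta_shift (-1) (x); rewrite -[x + _]opprK beta_opp p; last first.
    by rewrite DE; lia.
  by rewrite NE; lia.
move=> h; have m2 : (m.-1 < m)%N by lia.
have := @psum_le m mr => h2.
rewrite beta_pos; last by lia.
rewrite (@beta0_uniq _ m) //; last by lia.
by move=> i im; have := @psum_mono i m.-1; lia.
Qed.

Lemma Rbase_beta0 y : 0 <= y <= d%:Z + 1 -> Rbase d l (beta0 y) y.
Proof.
move=> hy; rewrite /Rbase.
have hb := @beta0_lt y; have hg := @beta0_ge y; have hle := beta0_le y.
case: eqVneq => [e|e] /=.
  by move: hg; rewrite e psum0 => /(_ isT); lia.
case: eqVneq => [e1|e1] /=.
  have := hb r'; rewrite e1 => /(_ (ltnSn _)).
  by have := psumS (ltnSn r'); rewrite psum_last; lia.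
by have := hb (beta0 y).-1; have := hg; lia.
Qed.

Lemma RblockP i x : Rblock d l i x <-> beta x = i.
Proof.
have divN k q : 0 <= k < N -> ((k + q * N) %/ N)%Z = q /\ ((k + q * N) %% N)%Z = k.
  move=> h; rewrite [_ + q * N]addrC modzMDl divzMDl ?gt_eqF // modz_small //.
  by rewrite divz_small ?addr0 //; lia.
split.
  rewrite /Rblock -/N.
  have := divz_eq i N; have := modz_ge0 i (lt0r_neq0 Ngt0); have := ltz_pmod i Ngt0.
  move: (i %/ N)%Z (i %% N)%Z => q k kN k0 ie.
  case: ifP => kr /=.
    move/(RbaseP kr) => e; have := beta_shift (- q) x; rewrite mulNr e ie.
    by lia.
  move/RbaseP => e; have : beta ((q + 1) * D - x) = (period r' - `|k|)%N%:Z.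
    by apply: e; rewrite /period; lia.
  by rewrite addrC beta_shift beta_opp ie; move: kN; rewrite NE /period; lia.
move=> <-; have [m [q [hm hx]]] : exists m q, 0 <= m <= d%:Z + 1 /\
  (x = m + q * D \/ x = - m + q * D).
  have [m [q [-> hm]]] := W_normal d x.
  by case: (leP 0 m) => m0; [exists m, q|exists (- m), q]; split; lia.
have hR := Rbase_beta0 hm; have hle := beta0_le m.
have hs z : Rbase d l 0 z -> Rbase d l 0 (- z) by rewrite /Rbase /=; lia.
have ht z : Rbase d l r'.+1 z -> Rbase d l r'.+1 (D - z).
  by rewrite /Rbase /= eqxx DE /=; lia.
case: hx => ->; rewrite beta_shift ?beta_opp beta_pos //.
  have [e1 e2] := divN (beta0 m)%:Z q ltac:(rewrite NE; lia).
  by rewrite /Rblock -/N -/D e1 e2 absz_nat hle /mkset addrK.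
case: (posnP (beta0 m)) => b0.
  have [e1 e2] := divN 0 q ltac:(rewrite NE; lia).
  rewrite b0 oppr0 /Rblock -/N -/D e1 e2 /= addrK.
  by apply: hs; rewrite b0 in hR.
have -> : - (beta0 m)%:Z + q * N = (N - (beta0 m)%:Z) + (q - 1) * N by lia.
have [e1 e2] := divN (N - (beta0 m)%:Z) (q - 1) ltac:(rewrite NE; lia).
rewrite /Rblock -/N -/D e1 e2; case: ifP => c.
  have b1 : beta0 m = r'.+1 by move: c; rewrite NE; lia.
  have -> : `|N - (beta0 m)%:Z|%N = r'.+1 by rewrite b1 NE; lia.
  rewrite /=; have -> : - m + q * D - (q - 1) * D = D - m by lia.
  by apply: ht; rewrite b1 in hR.
rewrite /=.
have -> : (period r' - `|N - (beta0 m)%:Z|)%N = beta0 m by rewrite /N /period; lia.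
by have -> : (q - 1 + 1) * D - (- m + q * D) = m by lia.
Qed.

Lemma RblockE i : Rblock d l i = [set x | beta x = i].
Proof. by apply/funext => x; apply/propext; exact: RblockP. Qed.

Hypothesis hd : (2 <= d)%N.

Lemma beta_cox k : (k <= d)%N -> beta k%:Z = beta (k%:Z + 1) ->
  forall x, beta (cox d k x) = beta x.
Proof.
move=> kd e x; have [m [q [-> hm]]] := W_normal d x.
rewrite cox_norm // !beta_shift; congr (_ + _).
have e' := beta_opp k%:Z; have e'' := beta_opp (k%:Z + 1).
have e0 := beta_opp 0; have e1 := beta_opp 1; rewrite oppr0 in e0.
have ed : beta (d%:Z + 2) = - beta d%:Z + N.
  by rewrite -beta_opp -[N]mul1r -(beta_shift 1); congr beta; rewrite DE; lia.
have em : beta (d%:Z + 1) = - beta (d%:Z + 1) + N.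
  by rewrite -beta_opp -[N in RHS]mul1r -(beta_shift 1); congr beta; rewrite DE; lia.
rewrite /cox0; case: eqVneq => [k0|k0].
  move: e; have -> : k%:Z = 0 :> int by rewrite k0.
  have b0 : beta 0 = 0 by move: e0; move: (beta 0) => z; lia.
  rewrite add0r => e; case: eqVneq => [->|_]; first by rewrite e1 -e b0.
  by case: eqVneq => [->|_] //; rewrite e1 -e b0.
case: eqVneq => [k1|k1].
  rewrite k1 in e e' e''; case: eqVneq => [->|_]; first by rewrite ed; lia.
  case: eqVneq => [->|_] //.
  have -> : - d%:Z - 2 = - (d%:Z + 2) by lia.
  by rewrite beta_opp ed; lia.
case: eqVneq => [->|_] //; case: eqVneq => [->|_] //; case: eqVneq => [->|_].
  by rewrite (_ : - k%:Z - 1 = - (k%:Z + 1)) ?e'' ?e' ?e //; lia.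
case: eqVneq => [->|_] //.
by rewrite (_ : - k%:Z - 1 = - (k%:Z + 1)) ?e'' ?e' ?e //; lia.
Qed.

Lemma Wpar_W w : Wpar d l w -> Wgrp d w.
Proof. by move=> [s [ss [_ <-]]]; exact: word_W. Qed.

Lemma Wpar_beta w : Wpar d l w -> forall x, beta (w x) = beta x.
Proof.
move=> [s [ss [al <-]]]; elim: s ss al => [|k s IH] //= /andP[kd ss] /andP[nk al] x.
rewrite beta_cox // ?IH //; exact/beta_adj.
Qed.

Lemma beta_Wpar w : Wgrp d w -> (forall x, beta (w x) = beta x) -> Wpar d l w.
Proof.
move=> wW wb; have [s [ss se sb _]] := word_ex hd beta_mono beta_cox wW wb.
exists s; split => //; split => //; apply/allP => k ks; apply/beta_adj; last exact: sb.
by move/allP: ss; apply.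
Qed.

(** An element which increases along the letters of the parabolic subgroup is
    increasing on all blocks. *)
Lemma incr_blocks h : Wgrp d h ->
  (forall k : nat, (k <= d)%N -> beta k%:Z = beta (k%:Z + 1) -> h k%:Z < h (k%:Z + 1)) ->
  forall x y, beta x = beta y -> x < y -> h x < h y.
Proof.
move=> hW H.
have st x : beta x = beta (x + 1) -> h x < h (x + 1).
  have [m [q [-> hm]]] := W_normal d x.
  rewrite addrAC !beta_shift !(W_shift hW) ltrD2r => /addIr.
  case: (leP 0 m) => m0.
    case: (eqVneq m (d%:Z + 1)) => [->|mn].
      have -> : d%:Z + 1 + 1 = - d%:Z + 1 * D by rewrite DE; lia.
      rewrite beta_shift beta_opp (W_shift hW) (W_opp hW) (W_mid hW) => e.
      have -> : - h d%:Z + 1 * D = (d%:Z + 1) + ((d%:Z + 1) - h d%:Z) by rewrite DE; lia.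
      rewrite ltrDl subr_gt0 -(W_mid hW); apply: H => //.
      have em : beta (d%:Z + 1) = - beta (d%:Z + 1) + N.
        by rewrite -beta_opp -[N in RHS]mul1r -(beta_shift 1); congr beta; rewrite DE; lia.
      by rewrite -/N in e; lia.
    have -> : m = `|m|%N%:Z by lia.
    by apply: H; lia.
  have -> : m = - (`|(m + 1)%R|%N%:Z + 1) by lia.
  have -> : - (`|(m + 1)%R|%N%:Z + 1) + 1 = - `|(m + 1)%R|%N%:Z by lia.
  rewrite !beta_opp !(W_opp hW) ltrN2 => /oppr_inj e.
  by apply: H; lia.
move=> x y e xy; have [k yk] : exists k : nat, y = x + k.+1%:Z.
  by exists `|y - x|%N.-1; lia.
elim: k y yk e {xy} => [|k IH] y -> e; first by apply: st.
have b1 := beta_mono (_ : x <= x + k.+1%:Z); have b2 := beta_mono (_ : x + k.+1%:Z <= x + k.+2%:Z).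
have e1 : beta x = beta (x + k.+1%:Z).
  by apply/le_anti; rewrite b1 ?lerDl //= e b2 //; lia.
apply: lt_trans (IH _ erefl e1) _.
rewrite [X in _ < h X](_ : _ = x + k.+1%:Z + 1); last by lia.
by apply: st; rewrite -e1 e; congr beta; lia.
Qed.

(** The minimal representatives g of the cosets W_l g are those whose inverse h is
    increasing on every block. *)
Lemma DminP g h : Wgrp d g -> cancel g h -> cancel h g ->
  Dmin d l g <-> (forall x y, beta x = beta y -> x < y -> h x < h y).
Proof.
move=> gW gh hg; have hW := W_canW gW gh hg; split.
  move=> [_ H]; apply: incr_blocks => // k kd e.
  apply: (ell_asc hd kd gW gh hg); rewrite H; first by rewrite leq_addl.
  by apply: beta_Wpar; [exact: cox_W|exact: beta_cox].
move=> H; split => // w ww; have wW := Wpar_W ww; have wb := Wpar_beta ww.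
apply/eqP; rewrite -eqz_nat PoszD -(inj_eq (mulIf (_ : 8 != 0 :> int))) //.
rewrite mulrDl !ell_inv8 //; last exact: W_comp.
have -> : inv8 d g = inv8 d (id \o g) by [].
rewrite !(inv8_comp gW gh hg) //; last exact: W_id.
rewrite /inv8 -psum2_add; last first.
- exact: (band_inv (W_id d) hW).
- exact: (band_inv wW (W_id d)).
apply/eqP/eq_psum2 => x y; rewrite -mulrDr; congr (_ * _).
have xy : x = y -> (h x < h y) = false by move=> ->; rewrite ltxx.
case: (eqVneq (beta x) (beta y)) => e.
  have c1 := H x y e; have c2 := H y x (esym e).
  case: (ltgtP x y) => [xy'|xy'|->] /=; rewrite ?ltxx ?andbF //=.
    by rewrite c1 //= ?andbF ?addr0.
  by rewrite ltNge ltW ?c2.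
have nb u v : beta u != beta v -> u < v -> w u < w v.
  move=> n uv; have lt1 : beta (w u) < beta (w v).
    by rewrite !wb lt_neqAle n beta_mono // ltW.
  by rewrite ltNge; apply/negP => /beta_mono; rewrite leNgt lt1.
case: (ltgtP x y) => [xy'|xy'|->] /=; rewrite ?ltxx ?andbF //=.
  by have := nb _ _ e xy'; rewrite ltNge le_eqVlt => /norP[_ /negbTE ->]; rewrite andbF.
by rewrite (nb y x) // 1?eq_sym //.
Qed.

Lemma Dmin_invP g : Dmin_inv d l g -> Wgrp d g ->
  forall x y, beta x = beta y -> x < y -> g x < g y.
Proof.
move=> [h [hD [gh hg]]] gW; have hW := W_canW gW gh hg.
by apply/(DminP hW hg gh).
Qed.
End Blocks.

(** * Elements of W with prescribed intersections of blocks *)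

Section Fibres.
Variables (K : choiceType).

(** The fibre of a labelling of the integers, as an increasing sequence. *)
Definition fib (be : int -> K) (k : K) : seq int :=
  sort <=%O (fset_set [set x | be x = k]).

(** All fibres are finite. *)
Definition finfib (be : int -> K) := forall k, finite_set [set x | be x = k].

Variable be : int -> K.
Hypothesis fb : finfib be.

Lemma mem_fib x k : (x \in fib be k) = (be x == k).
Proof.
rewrite mem_sort in_fset_set //; apply/idP/eqP; first by move/set_mem.
by move=> e; apply/mem_set.
Qed.

Lemma fib_sorted k : sorted <=%O (fib be k).
Proof. exact: sort_le_sorted. Qed.

Lemma fib_uniq k : uniq (fib be k).
Proof. by rewrite sort_uniq fset_uniq. Qed.

Lemma fib_eq k s : uniq s -> sorted <=%O s -> (forall x, (x \in s) = (be x == k)) ->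
  fib be k = s.
Proof.
move=> us ss ms; apply: le_sorted_eq => //; first exact: fib_sorted.
by apply: uniq_perm => //; [exact: fib_uniq|move=> x; rewrite mem_fib ms].
Qed.

Lemma index_fib x : (index x (fib be (be x)) < size (fib be (be x)))%N.
Proof. by rewrite index_mem mem_fib. Qed.

Lemma nth_fib k i : (i < size (fib be k))%N ->
  be (nth 0 (fib be k) i) = k.
Proof. by move=> h; apply/eqP; rewrite -mem_fib mem_nth. Qed.

Lemma index_nth_fib k i : (i < size (fib be k))%N ->
  index (nth 0 (fib be k) i) (fib be k) = i.
Proof. by move=> h; rewrite index_uniq ?fib_uniq. Qed.

Lemma fib_nth_lt k i j : (i < j)%N -> (j < size (fib be k))%N ->
  nth 0 (fib be k) i < nth 0 (fib be k) j.
Proof.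
move=> ij js; have : sorted <%O (fib be k) by rewrite lt_sorted_uniq_le fib_uniq fib_sorted.
move=> h; rewrite (lt_sorted_ltn_nth 0 h) // inE //.
exact: ltn_trans js.
Qed.

Lemma index_lt x y : be x = be y -> x < y ->
  (index x (fib be (be x)) < index y (fib be (be y)))%N.
Proof.
move=> e xy; rewrite ltnNge; apply/negP.
have mx : x \in fib be (be x) by rewrite mem_fib.
have my : y \in fib be (be y) by rewrite mem_fib.
rewrite leq_eqVlt => /orP[/eqP i|i].
  by have := nth_index 0 my; rewrite i -e nth_index // => h; rewrite h ltxx in xy.
rewrite e in mx i.
have js : (index x (fib be (be y)) < size (fib be (be y)))%N by rewrite index_mem.
have := fib_nth_lt i js; rewrite !nth_index //.
by rewrite ltNge ltW.
Qed.
End Fibres.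

Section Equivariant.
Variable d : nat.
Let D : int := (Dper d)%:Z.

(** Translations and a negation on a set of labels. *)
Record actions (K : choiceType) := Actions {
  sh : int -> K -> K;
  ng : K -> K;
  shK : forall k, cancel (sh k) (sh (- k));
  ngK : involutive ng }.

(** Labellings of the integers with finite fibres that are compatible with
    translation by D and with negation. *)
Record eqv (K : choiceType) (a : actions K) (be : int -> K) : Prop := Eqv {
  eqv_sh : forall k x, be (x + k * D) = sh a k (be x);
  eqv_ng : forall x, be (- x) = ng a (be x);
  eqv_fin : finfib be }.

Lemma fib_sh (K : choiceType) (a : actions K) be k kp : eqv a be ->
  fib be (sh a k kp) = [seq x + k * D | x <- fib be kp].
Proof.
move=> [es en fb]; apply: fib_eq => //.
- by rewrite map_inj_uniq ?fib_uniq // => x y /addIr.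
- rewrite sorted_map; apply: sub_sorted (fib_sorted be kp) => x y /=.
  by rewrite lerD2r.
- move=> x; have -> : (x \in [seq z + k * D | z <- fib be kp]) = (x - k * D \in fib be kp).
    apply/mapP/idP => [[y yi ->]|h]; first by rewrite addrK.
    by exists (x - k * D); rewrite ?subrK.
  rewrite mem_fib //; have := es (- k) x; rewrite mulNr => ->.
  apply/eqP/eqP => [<-|->]; last by rewrite shK.
  by have := shK a (- k) (be x); rewrite opprK.
Qed.

Lemma fib_ng (K : choiceType) (a : actions K) be kp : eqv a be ->
  fib be (ng a kp) = rev [seq - x | x <- fib be kp].
Proof.
move=> [es en fb]; apply: fib_eq => //.
- by rewrite rev_uniq map_inj_uniq ?fib_uniq //; exact: oppr_inj.
- rewrite rev_sorted sorted_map; apply: sub_sorted (fib_sorted be kp) => x y /=.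
  by rewrite lerN2.
- move=> x; rewrite mem_rev -[x in x \in _]opprK mem_map; last exact: oppr_inj.
  rewrite mem_fib // en; apply/eqP/eqP => [<-|->]; by rewrite ngK.
Qed.

Lemma index_sh (K : choiceType) (a : actions K) be k x : eqv a be ->
  index (x + k * D) (fib be (be (x + k * D))) = index x (fib be (be x)).
Proof.
move=> e; rewrite (eqv_sh e) (fib_sh _ _ e).
have i : injective (fun z : int => z + k * D) by move=> u v /addIr.
exact: (index_map i).
Qed.

Lemma index_ng (K : choiceType) (a : actions K) be x : eqv a be ->
  index (- x) (fib be (be (- x))) = (size (fib be (be x)) - (index x (fib be (be x))).+1)%N.
Proof.
move=> e; have fb := eqv_fin e; rewrite (eqv_ng e) (fib_ng _ e).
have xm : (index x (fib be (be x)) < size (fib be (be x)))%N by exact: index_fib.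
rewrite -{1}(nth_index 0 (_ : x \in fib be (be x))) ?mem_fib //.
rewrite -(nth_map 0 0) //.
set s := [seq - _ | _ <- _].
have ss : size s = size (fib be (be x)) by rewrite size_map.
have -> : nth 0 s (index x (fib be (be x))) =
  nth 0 (rev s) (size (fib be (be x)) - (index x (fib be (be x))).+1).
  by rewrite nth_rev ?ss; [congr nth; lia|lia].
rewrite index_uniq ?size_rev ?ss //; first by lia.
by rewrite rev_uniq map_inj_uniq ?fib_uniq //; exact: oppr_inj.
Qed.

(** Two equivariant labellings whose fibres have the same sizes differ by an
    element of W, which may be chosen increasing on the fibres. *)
Lemma matching (K : choiceType) (a : actions K) (be1 be2 : int -> K) :
  eqv a be1 -> eqv a be2 -> (forall k, size (fib be1 k) = size (fib be2 k)) ->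
  exists g, [/\ Wgrp d g, (forall x, be2 (g x) = be1 x) &
     forall x y, be1 x = be1 y -> x < y -> g x < g y].
Proof.
move=> e1 e2 sz.
have f1 := eqv_fin e1; have f2 := eqv_fin e2.
pose mt (b1 b2 : int -> K) x := nth 0 (fib b2 (b1 x)) (index x (fib b1 (b1 x))).
have lab b1 b2 : finfib b1 -> finfib b2 -> (forall k, size (fib b1 k) = size (fib b2 k)) ->
  forall x, b2 (mt b1 b2 x) = b1 x.
  by move=> fb1 fb2 s x; rewrite /mt nth_fib // -s index_fib.
have inv b1 b2 : finfib b1 -> finfib b2 -> (forall k, size (fib b1 k) = size (fib b2 k)) ->
  cancel (mt b1 b2) (mt b2 b1).
  move=> fb1 fb2 s x; rewrite {1}/mt lab // {1}/mt index_nth_fib ?nth_index ?mem_fib //.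
  by rewrite -s index_fib.
exists (mt be1 be2); split.
- split; first by exists (mt be2 be1); apply: inv.
  have c x k : mt be1 be2 (x + k * D) = mt be1 be2 x + k * D.
    rewrite /mt (index_sh _ _ e1) (eqv_sh e1) (fib_sh _ _ e2) (nth_map 0) //.
    by rewrite -sz index_fib.
  split=> x; first by have := c x 1; rewrite mul1r.
  rewrite /mt (index_ng _ e1) (eqv_ng e1) (fib_ng _ e2).
  have xs := index_fib f1 x.
  rewrite nth_rev size_map -sz; last by lia.
  rewrite (nth_map 0) -?sz; last by lia.
  congr (- _); move: (index x _) (size _) xs => i n xs.
  by have -> : (n - (n - i.+1).+1)%N = i by lia.
- exact: lab.
- move=> x y e xy; rewrite /mt -e; apply: fib_nth_lt => //.
    by rewrite {2}e; exact: index_lt.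
  by rewrite -sz e index_fib.
Qed.

Section Refine.
Variables (K1 K2 : choiceType) (a1 : actions K1) (a2 : actions K2).
Variables (be : int -> K1) (L : K1 -> seq K2) (k0 : K2).
Hypothesis eb : eqv a1 be.
Hypothesis Lsz : forall k, size (L k) = size (fib be k).
Hypothesis Lsh : forall q k, L (sh a1 q k) = [seq sh a2 q x | x <- L k].
Hypothesis Lng : forall k, L (ng a1 k) = rev [seq ng a2 x | x <- L k].

(** A second labelling: the list L k gives the labels of the successive elements
    of the fibre over k. *)
Definition refine (x : int) : K2 := nth k0 (L (be x)) (index x (fib be (be x))).

Lemma refine_sh q x : refine (x + q * D) = sh a2 q (refine x).
Proof.
rewrite /refine (index_sh _ _ eb) (eqv_sh eb) Lsh (nth_map k0) //.
by rewrite Lsz index_fib //; exact: eqv_fin eb.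
Qed.

Lemma refine_ng x : refine (- x) = ng a2 (refine x).
Proof.
have xs := index_fib (eqv_fin eb) x.
rewrite /refine (index_ng _ eb) (eqv_ng eb) Lng nth_rev size_map Lsz; last by lia.
rewrite (nth_map k0) ?Lsz; last by lia.
congr (ng _ _); move: (index x _) (size _) xs => i n xs.
by have -> : (n - (n - i.+1).+1)%N = i by lia.
Qed.

Lemma map_refine k : [seq refine x | x <- fib be k] = L k.
Proof.
apply: (@eq_from_nth _ k0); rewrite size_map ?Lsz // => i hi.
rewrite (nth_map 0) // /refine nth_fib //; last exact: eqv_fin eb.
by rewrite index_nth_fib //; exact: eqv_fin eb.
Qed.

Lemma refine_rel (R : rel K2) x y : (forall k, pairwise R (L k)) ->
  be x = be y -> x < y -> R (refine x) (refine y).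
Proof.
move=> pw e xy; rewrite /refine -e; have fb := eqv_fin eb.
have /(pairwiseP k0) := pw (be x); apply.
- by rewrite inE Lsz; exact: index_fib.
- by rewrite inE Lsz e; exact: index_fib.
- by rewrite {2}e; exact: index_lt.
Qed.
End Refine.

(** The componentwise action on pairs of labels. *)
Definition act_prod (K1 K2 : choiceType) (a1 : actions K1) (a2 : actions K2) :
  actions (K1 * K2)%type.
Proof.
exists (fun q p => (sh a1 q p.1, sh a2 q p.2)) (fun p => (ng a1 p.1, ng a2 p.2)).
- by move=> k [x y] /=; rewrite !shK.
- by move=> [x y] /=; rewrite !ngK.
Defined.

Lemma size_fib_pair (K1 K2 : choiceType) (b1 : int -> K1) (b2 : int -> K2) k1 k2 :
  finfib b1 ->
  size (fib (fun x => (b1 x, b2 x)) (k1, k2)) = count (fun x => b2 x == k2) (fib b1 k1)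
  /\ finfib (fun x => (b1 x, b2 x)).
Proof.
move=> f1; have f12 : finfib (fun x => (b1 x, b2 x)).
  by move=> [u1 u2]; apply: sub_finite_set (f1 u1) => x /= [].
split => //; rewrite -size_filter; apply: perm_size; apply: uniq_perm.
- exact: fib_uniq.
- by rewrite filter_uniq // fib_uniq.
- by move=> x; rewrite mem_filter !mem_fib // xpair_eqE andbC.
Qed.

Lemma size_fib_pair_swap (K1 K2 : choiceType) (b1 : int -> K1) (b2 : int -> K2) k1 k2 :
  finfib b2 ->
  size (fib (fun x => (b1 x, b2 x)) (k1, k2)) = count (fun x => b1 x == k1) (fib b2 k2)
  /\ finfib (fun x => (b1 x, b2 x)).
Proof.
move=> f2; have f12 : finfib (fun x => (b1 x, b2 x)).
  by move=> [u1 u2]; apply: sub_finite_set (f2 u2) => x /= [].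
split => //; rewrite -size_filter; apply: perm_size; apply: uniq_perm.
- exact: fib_uniq.
- by rewrite filter_uniq // fib_uniq.
- by move=> x; rewrite mem_filter !mem_fib // xpair_eqE andbC.
Qed.

(** Given two labellings and, for each label of one, the list of labels of the
    other that its fibre has to meet, some element of W realizes these numbers and
    is as increasing as the lists permit. *)
Lemma realize (K1 K2 : choiceType) (a1 : actions K1) (a2 : actions K2)
    (b1 : int -> K1) (b2 : int -> K2) (L1 : K1 -> seq K2) (L2 : K2 -> seq K1)
    (k01 : K1) (k02 : K2) (R1 : rel K2) (R2 : rel K1) :
  eqv a1 b1 -> eqv a2 b2 ->
  (forall k, size (L1 k) = size (fib b1 k)) ->
  (forall k, size (L2 k) = size (fib b2 k)) ->
  (forall q k, L1 (sh a1 q k) = [seq sh a2 q x | x <- L1 k]) ->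
  (forall k, L1 (ng a1 k) = rev [seq ng a2 x | x <- L1 k]) ->
  (forall q k, L2 (sh a2 q k) = [seq sh a1 q x | x <- L2 k]) ->
  (forall k, L2 (ng a2 k) = rev [seq ng a1 x | x <- L2 k]) ->
  (forall k, pairwise R1 (L1 k)) -> (forall k, pairwise R2 (L2 k)) ->
  (forall k1 k2, count_mem k2 (L1 k1) = count_mem k1 (L2 k2)) ->
  exists g, [/\ Wgrp d g,
    (forall k1 k2, count (fun x => b1 (g x) == k1) (fib b2 k2) = count_mem k1 (L2 k2)),
    (forall x y, b2 x = b2 y -> x < y ->
       R2 (b1 (g x)) (b1 (g y)) /\ (b1 (g x) = b1 (g y) -> g x < g y)) &
    (forall x y, b1 (g x) = b1 (g y) -> g x < g y -> R1 (b2 x) (b2 y))].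
Proof.
move=> e1 e2 s1 s2 h1 n1 h2 n2 p1 p2 ct.
pose P1 := refine b1 L1 k02; pose P2 := refine b2 L2 k01.
have cnt1 k1 k2 : size (fib (fun x => (b1 x, P1 x)) (k1, k2)) = count_mem k2 (L1 k1).
  rewrite (size_fib_pair _ _ _ (eqv_fin e1)).1 -(map_refine k02 e1 s1) count_map.
  by apply: eq_count.
have cnt2 k1 k2 : size (fib (fun x => (P2 x, b2 x)) (k1, k2)) = count_mem k1 (L2 k2).
  rewrite (size_fib_pair_swap _ _ _ (eqv_fin e2)).1 -(map_refine k01 e2 s2) count_map.
  by apply: eq_count.
have E1 : eqv (act_prod a1 a2) (fun x => (b1 x, P1 x)).
  split=> [q x|x|]; last by case: (size_fib_pair P1 k01 k02 (eqv_fin e1)).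
    by rewrite /= (eqv_sh e1) /P1 (refine_sh _ e1 s1 h1).
  by rewrite /= (eqv_ng e1) /P1 (refine_ng _ e1 s1 n1).
have E2 : eqv (act_prod a1 a2) (fun x => (P2 x, b2 x)).
  split=> [q x|x|]; last by case: (size_fib_pair_swap P2 k01 k02 (eqv_fin e2)).
    by rewrite /= (eqv_sh e2) /P2 (refine_sh _ e2 s2 h2).
  by rewrite /= (eqv_ng e2) /P2 (refine_ng _ e2 s2 n2).
have [|g [gW lab mono]] := matching E2 E1; first by move=> [k1 k2]; rewrite cnt1 cnt2 ct.
have l1 x : b1 (g x) = P2 x by case: (lab x).
have l2 x : P1 (g x) = b2 x by case: (lab x).
exists g; split => //.
- move=> k1 k2; rewrite -(map_refine k01 e2 s2) count_map; apply: eq_count => x /=.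
  by rewrite l1.
- move=> x y e xy; split; first by rewrite !l1; apply: (refine_rel k01 e2 s2 p2).
  by rewrite !l1 => e'; apply: mono => //; rewrite e e'.
- by move=> x y e xy; rewrite -!l2; apply: (refine_rel k02 e1 s1 p1).
Qed.
End Equivariant.

(** * Inversions counted by labels *)

Lemma fsum_partition (T K : choiceType) (V : zmodType) (P : set T) (f : T -> K)
    (F : T -> V) : finite_set P ->
  \sum_(p \in P) F p = \sum_(k \in f @` P) \sum_(p \in P `&` [set p | f p = k]) F p.
Proof.
move=> fP; rewrite [RHS]fsbig_finite; last exact: finite_image.
rewrite [LHS]fsbig_finite // (partition_big_imfset _ f) fset_set_image //.
apply: eq_bigr => k _; rewrite (@fsbigE_cond _ _ _ _ _ (fset_set P)) //; last first.
- by move=> p [Pp _]; rewrite in_fset_set // => /negP; case; exact/mem_set.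
rewrite big_seq_cond [RHS]big_seq_cond; apply: eq_bigl => p.
rewrite in_fset_set //; apply/idP/idP => /andP[h1 h2]; rewrite h1 /=.
  by apply/mem_set; split; [exact: set_mem|exact/eqP].
by move/set_mem: h2 => [_ /= ->].
Qed.

Section LabelSums.
Variable d : nat.
Let D : int := (Dper d)%:Z.
Let DE : D = 2 * d%:Z + 2. Proof. by rewrite /D /Dper; lia. Qed.
Let Dgt0 : 0 < D. Proof. by rewrite DE; lia. Qed.

(** Integer labels, on which translation by D acts as translation by N. *)
Definition actZ (N : int) : actions int.
Proof.
exists (fun q i => i + q * N) (fun i => - i).
- by move=> k x /=; rewrite mulNr addrK.
- exact: opprK.
Defined.

(** Pairs of integer labels. *)
Definition actZ2 (N1 N2 : int) := act_prod (actZ N1) (actZ N2).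

(** The total weight of the integers with label (i, j). *)
Definition wt (Lab : int -> int * int) (i j : int) : int :=
  \sum_(x <- fib Lab (i, j)) om d x.

(** The quadratic form with matrix entries M and indicator E, over pairs of
    positions modulo simultaneous translation. *)
Definition qsum (N2 : int) (M : int -> int -> int)
    (E : int * int -> int * int -> bool) : int :=
  \sum_(q \in [set q : (int * int) * (int * int) | 0 <= q.1.2 < N2])
     (M q.1.1 q.1.2 * M q.2.1 q.2.2 * (E q.1 q.2)%:Z).

Lemma eq_qsum N2 M M' E E' : (forall i j, M i j = M' i j) ->
  (forall p q, E p q = E' p q) -> qsum N2 M E = qsum N2 M' E'.
Proof. by move=> e1 e2; apply: eq_fsbigr => q _; rewrite !e1 e2. Qed.

(** Weighted counts of pairs of integers that depend only on their labels. *)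
Lemma psum2_lab (Lab : int -> int * int) (N1 N2 : int)
    (E : int * int -> int * int -> bool) : 0 < N2 ->
  eqv d (actZ2 N1 N2) Lab ->
  (forall q p p', E (sh (actZ2 N1 N2) q p) (sh (actZ2 N1 N2) q p') = E p p') ->
  banded (fun x y => (E (Lab x) (Lab y))%:Z) ->
  psum2 d (fun x y => om d x * om d y * (E (Lab x) (Lab y))%:Z)
    = qsum N2 (wt Lab) E.
Proof.
move=> N2p eL Es [K hK]; have fL := eqv_fin eL.
pose F x y := om d x * om d y * (E (Lab x) (Lab y))%:Z.
have Fs : shinv d F.
  by move=> k x y; rewrite /F !omD !(eqv_sh eL) Es.
rewrite -/(psum2 d F) (@psum2_fdom d F (fun p => (Lab p.1).2) N2) //; last first.
  by move=> k p /=; rewrite (eqv_sh eL).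
pose P : set (int * int) := [set p | 0 <= (Lab p.1).2 < N2 /\ F p.1 p.2 <> 0].
have fP : finite_set P.
  have [B hB] : exists B, forall x, 0 <= (Lab x).2 < N2 -> `|x| <= B.
    exists (\sum_(m < Dper d) (`|m%:Z| + `|(Lab m%:Z).2| * D + N2 * D)) => x hx.
    pose m := `|(x %% D)%Z|%N.
    have me : (x %% D)%Z = m%:Z by rewrite /m gez0_abs // modz_ge0 // gt_eqF.
    have mD : (m < Dper d)%N by rewrite -ltz_nat -me ltz_pmod.
    have xe := divz_eq x D; rewrite me in xe.
    apply: (@le_trans _ _ (`|m%:Z| + `|(Lab m%:Z).2| * D + N2 * D)); last first.
      rewrite (bigD1 (Ordinal mD)) //= lerDl sumr_ge0 // => i _.
      by rewrite !addr_ge0 // mulr_ge0 // ltW.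
    move: hx; rewrite xe addrC (eqv_sh eL) /=.
    move: (Lab m%:Z).2 (x %/ D)%Z => a q ha.
    have : `|q| * D <= (`|a| + N2) * D.
      rewrite ler_pM2r //.
      have [q0|q0] : q <= 0 \/ 1 <= q by lia.
        by nia.
      by nia.
    have -> : `|m%:Z + q * D| <= `|m%:Z| + `|a| * D + N2 * D = (`|m%:Z + q * D| <= `|m%:Z| + (`|a| + N2) * D) by rewrite mulrDl addrA.
    move=> h; apply: le_trans (ler_normD _ _) _; rewrite lerD2l normrM.
    by rewrite (gtr0_norm Dgt0).
  apply: (@sub_finite_set _ _ ([set x | - B <= x <= B] `*` [set y | - B - K <= y <= B + K])).
    move=> [x y] [/= h1 h2].
    have e : (E (Lab x) (Lab y))%:Z <> 0 by move=> e; apply: h2; rewrite /F e mulr0.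
    by have := hB x h1; have := hK _ _ e; split => /=; lia.
  by apply: finite_setX; exact: finite_zrange.
rewrite -(fsbig_widen P) //; last first.
- by move=> p /= [h1 h2]; apply: contrapT => h3; apply: h2.
- by move=> p /= [].
rewrite (fsum_partition (fun p => (Lab p.1, Lab p.2))) //.
have wt0 i j : wt Lab i j <> 0 -> exists x, Lab x = (i, j).
  rewrite /wt; case e : (fib Lab (i, j)) => [|x s]; first by rewrite big_nil.
  by exists x; apply/eqP; rewrite -mem_fib // e mem_head.
rewrite /qsum -[RHS](fsbig_widen ((fun p => (Lab p.1, Lab p.2)) @` P)).
- apply: eq_fsbigr => -[[i j] [k l]] /set_mem [[x y] /= [h1 h2]] [lx ly].
  have EE : E (i, j) (k, l).
    move: h2; rewrite /F lx ly; case: (E _ _) => //; by rewrite mulr0.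
  rewrite (fsbig_fwiden [seq (u, v) | u <- fib Lab (i, j), v <- fib Lab (k, l)]).
  + rewrite big_allpairs_dep /= EE mulr1 /wt big_distrl /=; apply: eq_big_seq => u ui.
    rewrite big_distrr /=; apply: eq_big_seq => v vi.
    rewrite !mem_fib // in ui vi; rewrite /F (eqP ui) (eqP vi) EE mulr1 //.
  + move=> [u v] [/= _ [lu lv]]; apply/allpairsP; exists (u, v) => /=.
    by rewrite !mem_fib // lu lv !eqxx.
  + by apply: allpairs_uniq; rewrite ?fib_uniq // => -[? ?] [? ?] _ _ [-> ->].
  + move=> [u v] /= [/allpairsP[[u' v'] /= [hu hv [-> ->]]]] np.
    exfalso; apply: np; rewrite !mem_fib // in hu hv.
    split; last by rewrite (eqP hu) (eqP hv).
    split; first by rewrite (eqP hu); move: h1; rewrite lx.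
    rewrite /F (eqP hu) (eqP hv) EE.
    by apply/eqP; rewrite mulr1 mulf_neq0 // lt0r_neq0 // om_gt0.
- by move=> [[i j] [k l]] [[x y] /= [h1 _]] [lx _]; move: h1; rewrite lx.
- move=> [[i j] [k l]] /= [hj ni]; apply: contrapT => /eqP.
  rewrite !mulf_eq0 !negb_or => /andP[/andP[/eqP w1 /eqP w2] EE].
  have [x lx] := wt0 _ _ w1; have [y ly] := wt0 _ _ w2.
  apply: ni; exists (x, y); last by rewrite /= lx ly.
  split; first by rewrite /= lx.
  rewrite /F /= lx ly; move: EE; case: (E _ _) => // _.
  by apply/eqP; rewrite mulr1 mulf_neq0 // lt0r_neq0 // om_gt0.
Qed.

(** Weights of the labels: the fixed points 0, d + 1 modulo D count for one. *)
Lemma wtE (Lab : int -> int * int) (N1 N2 : int) i j :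
  eqv d (actZ2 N1 N2) Lab ->
  wt Lab i j = 2 * (size (fib Lab (i, j)))%:Z
     - (count (fun x => (d.+1%:Z %| x)%Z) (fib Lab (i, j)))%:Z.
Proof.
move=> eL; rewrite /wt; elim: (fib _ _) => [|x s IH]; first by rewrite big_nil.
rewrite big_cons IH /= /om; case: ifP => _; lia.
Qed.
End LabelSums.

(** * Sizes and weights of blocks *)

(** The increasing list in which each integer j occurs f j times. *)
Definition slist (f : int -> nat) : seq int :=
  sort <=%O (flatten [seq nseq (f j) j | j <- fset_set [set j | f j <> 0%N]]).

Lemma slist_count f j : finite_set [set j | f j <> 0%N] -> count_mem j (slist f) = f j.
Proof.
move=> ff; rewrite /slist (permP (permEl (perm_sort _ _))) count_flatten -map_comp.
case: (boolP (j \in fset_set [set j | f j <> 0%N])) => hj.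
  rewrite sumnE big_map (big_rem j) //= count_nseq /= eqxx mul1n.
  rewrite big_seq big1 ?addn0 // => k; rewrite mem_rem_uniq ?fset_uniq // !inE.
  by move=> /andP[kj _]; rewrite /= count_nseq /= (negbTE kj) mul0n.
rewrite sumnE big_map big_seq big1 => [|k hk].
  rewrite in_fset_set // in hj; symmetry; apply: contrapT => h.
  by move/negP: hj; apply; apply/mem_set.
rewrite /= count_nseq /=; case: (eqVneq k j) => [e|]; rewrite ?mul0n //.
by rewrite -e hk in hj.
Qed.

Lemma slist_sorted f : sorted <=%O (slist f).
Proof. exact: sort_le_sorted. Qed.

Lemma slist_uniq f s : finite_set [set j | f j <> 0%N] -> sorted <=%O s ->
  (forall j, count_mem j s = f j) -> slist f = s.
Proof.
move=> ff ss cs; apply: le_sorted_eq => //; first exact: slist_sorted.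
by apply/allP => j _ /=; rewrite slist_count // cs.
Qed.

Lemma slist_size f : finite_set [set j | f j <> 0%N] ->
  (size (slist f))%:Z = \sum_(j \in [set: int]) (f j)%:Z.
Proof.
move=> ff; rewrite size_sort size_flatten sumnE big_map big_map.
rewrite (@fsbigE_cond _ _ _ _ _ (fset_set [set j | f j <> 0%N])) //; last first.
  move=> i _; rewrite in_fset_set // => /negP h; congr Posz.
  by apply: contrapT => h'; apply: h; apply/mem_set.
rewrite -natz raddf_sum /=; apply: eq_big => [j|j _]; first by rewrite in_setT.
by rewrite size_nseq natz.
Qed.

Lemma slist_sh f q : finite_set [set j | f j <> 0%N] ->
  slist (fun j => f (j - q)) = [seq j + q | j <- slist f].
Proof.
move=> ff; apply: slist_uniq.
- apply: (@sub_finite_set _ _ ((fun j => j + q) @` [set j | f j <> 0%N])).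
    by move=> j /= h; exists (j - q); rewrite ?subrK.
  exact: finite_image.
- rewrite sorted_map; apply: sub_sorted (slist_sorted f) => x y /=; by rewrite lerD2r.
- move=> j; rewrite count_map -slist_count //; apply: eq_count => x /=.
  by apply/eqP/eqP; lia.
Qed.

Lemma slist_ng f : finite_set [set j | f j <> 0%N] ->
  slist (fun j => f (- j)) = rev [seq - j | j <- slist f].
Proof.
move=> ff; apply: slist_uniq.
- apply: (@sub_finite_set _ _ ((fun j => - j) @` [set j | f j <> 0%N])).
    by move=> j /= h; exists (- j); rewrite ?opprK.
  exact: finite_image.
- rewrite rev_sorted sorted_map; apply: sub_sorted (slist_sorted f) => x y /=.
  by rewrite lerN2.
- move=> j; rewrite count_rev count_map -slist_count //; apply: eq_count => x /=; lia.
Qed.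

Lemma per_even_eq (T : Type) (R : nat) (f g : int -> T) : (0 < R)%N ->
  (forall i q, f (i + q * (2 * R%:Z)) = f i) -> (forall i, f (- i) = f i) ->
  (forall i q, g (i + q * (2 * R%:Z)) = g i) -> (forall i, g (- i) = g i) ->
  (forall i : nat, (i <= R)%N -> f i%:Z = g i%:Z) -> f =1 g.
Proof.
move=> R0 fp fe gp ge fg i.
pose N : int := 2 * R%:Z.
have N0 : 0 < N by rewrite /N; lia.
have ie := divz_eq i N; have := modz_ge0 i (lt0r_neq0 N0); have := ltz_pmod i N0.
move: ie; move: (i %/ N)%Z (i %% N)%Z => q m -> mN m0.
rewrite addrC fp gp; have [c|c] : m <= R%:Z \/ R%:Z < m by lia.
  have -> : m = `|m|%N%:Z by lia.
  by apply: fg; lia.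
have -> : m = - `|N - m|%N%:Z + 1 * N by lia.
by rewrite fp gp fe ge; apply: fg; lia.
Qed.

(** The m consecutive integers starting at a. *)
Definition zseq (a : int) (m : nat) : seq int := [seq a + k%:Z | k <- iota 0 m].

Lemma mem_zseq a m x : (x \in zseq a m) = (a <= x < a + m%:Z).
Proof.
apply/mapP/idP => [[k]|h]; first by rewrite mem_iota add0n => ? ->; lia.
by exists `|x - a|%N; rewrite ?mem_iota; lia.
Qed.

Lemma zseq_sorted a m : sorted <=%O (zseq a m).
Proof.
rewrite sorted_map; apply: sub_sorted (iota_sorted 0 m) => x y /=; lia.
Qed.

Lemma zseq_uniq a m : uniq (zseq a m).
Proof. by rewrite map_inj_uniq ?iota_uniq // => x y; lia. Qed.

Section BlockSizes.
Variables (d r' : nat) (l : (r'.+2).-tuple nat).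
Let D : int := (Dper d)%:Z.
Let N : int := (period r')%:Z.
Let DE : D = 2 * d%:Z + 2. Proof. by rewrite /D /Dper; lia. Qed.
Let Dgt0 : 0 < D. Proof. by rewrite DE; lia. Qed.
Let NE : N = 2 * (r'.+1)%:Z. Proof. by rewrite /N /period; lia. Qed.
Let Ngt0 : 0 < N. Proof. by rewrite NE; lia. Qed.
Hypothesis hl : Lambda d l.
Let be := beta d l.

Lemma fib_interval a m i : finfib be -> (forall x, be x = i <-> a <= x < a + m%:Z) ->
  size (fib be i) = m.
Proof.
move=> fb h; rewrite (@fib_eq _ be fb i (zseq a m)) ?size_map ?size_iota //.
- exact: zseq_uniq.
- exact: zseq_sorted.
- by move=> x; rewrite mem_zseq; apply/idP/eqP => /h.
Qed.

Lemma beta_fin : finfib be.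
Proof.
move=> i; apply: (@sub_finite_set _ _ [set x | - (`|i| + 1) * D <= x <= (`|i| + 1) * D]); last exact: finite_zrange.
move=> x /= e.
have b0 : be 0 = 0 by rewrite /be beta_pos ?beta0_0 //; lia.
have hi : be ((`|i| + 1) * D) = (`|i| + 1) * N.
  by have := @beta_shift d r' l (`|i| + 1) 0; rewrite !add0r -/be -/D -/N b0 add0r.
have lo : be (- (`|i| + 1) * D) = - (`|i| + 1) * N.
  by have := @beta_shift d r' l (- (`|i| + 1)) 0; rewrite !add0r -/be -/D -/N b0 add0r.
apply/andP; split; rewrite leNgt; apply/negP => /ltW /(@beta_mono d r' l);
  rewrite -/be ?hi ?lo e NE; nia.
Qed.

Lemma beta_eqv : eqv d (actZ N) be.
Proof.
split=> [q x|x|]; [exact: beta_shift|exact: beta_opp|exact: beta_fin].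
Qed.

Lemma size_fib_per i q : size (fib be (i + q * N)) = size (fib be i).
Proof. by rewrite (fib_sh q i beta_eqv) size_map. Qed.

Lemma size_fib_even i : size (fib be (- i)) = size (fib be i).
Proof. by rewrite (fib_ng i beta_eqv) size_rev size_map. Qed.

Lemma size_fib_nth (i : nat) : (i <= r'.+1)%N -> size (fib be i%:Z) =
  (if i == 0 then (2 * nth 0 l 0).+1 else if i == r'.+1 then (2 * nth 0 l r'.+1).+1
   else nth 0 l i)%N.
Proof.
move=> ir.
have Rb i' x : be x = i' <-> Rblock d l i' x by rewrite RblockE.
have Rbi x : be x = i%:Z <-> Rbase d l i x.
  rewrite Rb /Rblock -/N divz_small ?modz_small ?NE; try lia.
  by rewrite absz_nat ir /mkset mul0r subr0.
have [i0|i0] := eqVneq i 0%N.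
  rewrite (@fib_interval (- (nth 0%N l 0)%:Z) (2 * nth 0%N l 0).+1) //.
    exact: beta_fin.
  by move=> x; rewrite Rbi i0 /Rbase /=; split; lia.
have [i1|i1] := eqVneq i r'.+1.
  rewrite (@fib_interval (d%:Z + 1 - (nth 0%N l r'.+1)%:Z) (2 * nth 0%N l r'.+1).+1) //.
    exact: beta_fin.
  by move=> x; rewrite Rbi /Rbase i1 /= eqxx /=; split; lia.
rewrite (@fib_interval ((psum l i.-1)%:Z + 1) (nth 0%N l i)) //; first exact: beta_fin.
move=> x; rewrite Rbi /Rbase (negbTE i0) (negbTE i1) /=.
have := @psumS r' l i.-1; rewrite prednK ?lt0n // => e.
by rewrite e; last lia; split; lia.
Qed.

Lemma size_fib_beta (f : int -> int) :
  (forall i q, f (i + q * N) = f i) -> (forall i, f (- i) = f i) ->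
  f 0 = 2 * (nth 0%N l 0)%:Z + 1 -> f r'.+1%:Z = 2 * (nth 0%N l r'.+1)%:Z + 1 ->
  (forall m : nat, (0 < m <= r')%N -> f m%:Z = (nth 0%N l m)%:Z) ->
  forall i, (size (fib be i))%:Z = f i.
Proof.
move=> fp fe f0 f1 fm.
apply: (@per_even_eq _ r'.+1 (fun i => (size (fib be i))%:Z) f) => //; rewrite -?NE //.
- by move=> i q; rewrite size_fib_per.
- by move=> i; rewrite size_fib_even.
move=> i ir; rewrite size_fib_nth //; case: eqVneq => [->|i0]; first by rewrite f0; lia.
case: eqVneq => [->|i1]; first by rewrite f1; lia.
by rewrite fm //; lia.
Qed.

Lemma beta_fixed q : be (q * d.+1%:Z) = q * r'.+1%:Z.
Proof.
have := divz_eq q 2.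
have : (0 <= (q %% 2)%Z < 2) by rewrite modz_ge0 //= ltz_pmod.
set e := (q %% 2)%Z => he qe.
have b0 : be 0 = 0 by rewrite /be beta_pos ?beta0_0 //; lia.
have b1 : be (d%:Z + 1) = r'.+1%:Z by rewrite /be beta_pos ?beta0_top //; lia.
have [e0|e0] : e = 0 \/ e = 1 by lia.
  have -> : q * d.+1%:Z = 0 + (q %/ 2)%Z * D by rewrite {1}qe e0 DE; lia.
  by rewrite /be beta_shift -/be b0 {2}qe e0 -/N NE; lia.
have -> : q * d.+1%:Z = d%:Z + 1 + (q %/ 2)%Z * D by rewrite {1}qe e0 DE; lia.
by rewrite /be beta_shift -/be b1 {2}qe e0 -/N NE; lia.
Qed.
End BlockSizes.

Lemma Lambda_sum (d r' : nat) (l : (r'.+2).-tuple nat) (f : int -> int) :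
  (forall i q, f (i + q * (period r')%:Z) = f i) -> (forall i, f (- i) = f i) ->
  f 0 = 2 * (nth 0%N l 0)%:Z + 1 -> f r'.+1%:Z = 2 * (nth 0%N l r'.+1)%:Z + 1 ->
  (forall m : nat, (0 < m <= r')%N -> f m%:Z = (nth 0%N l m)%:Z) ->
  \sum_(1 <= i < (period r').+1) f i%:Z = (Dper d)%:Z -> Lambda d l.
Proof.
move=> fp fe f0 f1 fm.
have half : \sum_(r'.+2 <= i < (2 * r' + 2)%N) f i%:Z = \sum_(1 <= i < r'.+1) f i%:Z.
  rewrite big_nat_rev (_ : r'.+2 = 1 + r'.+1)%N // big_addn.
  have -> : (2 * r' + 2 - r'.+1 = r'.+1)%N by lia.
  apply: eq_big_nat => i hi.
  have -> : ((1 + r'.+1 + (2 * r' + 2) - (i + r'.+1).+1)%N)%:Z = - i%:Z + 1 * (period r')%:Z.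
    by rewrite /period; lia.
  by rewrite fp fe.
have fN : f (2 * r' + 2)%N%:Z = f 0.
  by have := fp 0 1; rewrite add0r mul1r.
rewrite /period big_nat_recr /=; last by lia.
rewrite (@big_cat_nat _ _ _ r'.+2) /=; [|lia|lia].
rewrite half big_nat_recr //= fN f0 f1.
have -> : \sum_(1 <= i < r'.+1) f i%:Z = \sum_(1 <= i < r'.+1) (nth 0%N l i)%:Z.
  by apply: eq_big_nat => i hi; apply: fm; lia.
rewrite /Lambda /=.
have -> : sumn l = (nth 0%N l 0 + (\sum_(0 <= i < r') nth 0%N l i.+1 + nth 0%N l r'.+1))%N.
  by rewrite sumnE (big_nth 0%N) size_tuple big_nat_recl // big_nat_recr.
rewrite big_add1 /= /Dper.
have -> : \sum_(0 <= i < r') (nth 0%N l i.+1)%:Z = (\sum_(0 <= i < r') nth 0%N l i.+1)%N%:Z.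
  by rewrite (big_morph Posz PoszD (erefl _)).
by lia.
Qed.

(** The number of fixed points x, that is of multiples of d + 1, with label (i, j),
    when these are labelled by (c k R, k R). *)
Definition Jm (c R : int) (i j : int) : int := ((i == c * j) && (R %| j)%Z)%:Z.

Section FixedPoints.
Variables (d : nat) (N1 N2 c : int) (R : nat) (Lab : int -> int * int).
Hypothesis eL : eqv d (actZ2 N1 N2) Lab.
Hypothesis R0 : (0 < R)%N.
Hypothesis Lfix : forall q, Lab (q * d.+1%:Z) = (c * (q * R%:Z), q * R%:Z).

(** Fixed points count for one and all other integers for two. *)
Lemma wt_label i j : wt d Lab i j = 2 * (size (fib Lab (i, j)))%:Z - Jm c R%:Z i j.
Proof.
rewrite (wtE i j eL); congr (_ - Posz _); rewrite /Jm.
rewrite -size_filter; set s := filter _ _.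
have us : uniq s by rewrite filter_uniq // fib_uniq.
have ms x : (x \in s) = (d.+1%:Z %| x)%Z && (Lab x == (i, j)).
  by rewrite mem_filter mem_fib //; exact: eqv_fin eL.
case: andP => [[/eqP ie /dvdzP[q je]]|h].
  have : perm_eq s [:: q * d.+1%:Z].
    apply: uniq_perm => // x; rewrite ms inE; apply/andP/eqP.
      move=> [/dvdzP[q' ->] /eqP]; rewrite Lfix je => -[_ e]; congr (_ * _).
      by apply: (mulIf (_ : R%:Z != 0)) e; lia.
    by move=> ->; rewrite dvdz_mull // Lfix ie je eqxx.
  by move/perm_size.
case e : s => [|x t] //; exfalso; apply: h.
have := ms x; rewrite e mem_head => /esym /andP[/dvdzP[q ->]].
by rewrite Lfix => /eqP[<- <-]; rewrite eqxx dvdz_mull.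
Qed.
End FixedPoints.

(** * Rows of the matrices in Xi *)

Lemma finite_bounded (S : set int) : finite_set S -> exists K : nat, forall x, S x -> `|x| <= K%:Z.
Proof.
move=> fS; exists (\sum_(x <- fset_set S) `|x|)%N => x Sx.
have xS : x \in fset_set S by rewrite in_fset_set //; exact/mem_set.
by rewrite (big_rem x) //=; lia.
Qed.

Lemma bounded_finite (S : set int) (K : int) : (forall x, S x -> `|x| <= K) -> finite_set S.
Proof.
move=> h; apply: (@sub_finite_set int _ _ _ (finite_zrange (- K) K)).
by move=> x /h /=; lia.
Qed.

(** A finitely supported sum, restricted to a finite window. *)
Lemma fsum_zseq (F : int -> int) (P : set int) (a : int) (m : nat) :
  (forall j, P j -> F j <> 0 -> a <= j < a + m%:Z) ->
  \sum_(j \in P) F j = \sum_(j <- zseq a m | j \in P) F j.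
Proof.
move=> h; apply: fsbigE_cond; first exact: zseq_uniq.
by move=> j Pj nj; apply: contrapT => /(h j Pj) hj; move/negP: nj; rewrite mem_zseq; apply.
Qed.

(** Sums over a fundamental domain, by rows. *)
Lemma psum2_rows (r : nat) (F : int -> int -> int) (a : int) :
  shinv r F -> banded F ->
  psum2 r F = \sum_(i <- zseq a (period r)) \sum_(j \in [set: int]) F i j.
Proof.
move=> Fs [K hK]; rewrite (psum2_window a Fs).
pose W := zseq (a - `|K|) (period r + 2 * `|K| + 1)%N.
have inner i : i \in zseq a (period r) -> \sum_(j \in [set: int]) F i j = \sum_(j <- W) F i j.
  rewrite mem_zseq => hi; rewrite (@fsum_zseq _ _ (a - `|K|) (period r + 2 * `|K| + 1)%N).
    by apply: eq_bigl => j; rewrite in_setT.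
  by move=> j _ /hK; lia.
rewrite (eq_big_seq _ inner).
rewrite (@fsbigE_cond _ _ _ _ _ [seq (i, j) | i <- zseq a (period r), j <- W]).
- set W2 := [seq _ | _ <- _, _ <- _]; transitivity (\sum_(p <- W2) F p.1 p.2); last first.
    by rewrite big_allpairs_dep.
  rewrite big_seq_cond [RHS]big_seq; apply: eq_bigl => p.
  apply: andb_idr => /allpairsP[[i j] /= [hi hj ->]]; apply/mem_set => /=.
  by rewrite mem_zseq in hi.
- by apply: allpairs_uniq; rewrite ?zseq_uniq // => -[? ?] [? ?] _ _ [-> ->].
- move=> [i j] /= hi np; apply: contrapT => /hK h; move/negP: np; apply.
  by apply/allpairsP; exists (i, j); rewrite /= !mem_zseq; split => //; move: hi h;
    rewrite /Dper /period; lia.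
Qed.

Section Reflection.
Variables (f : int -> int) (c : int).
Hypothesis ff : finite_set [set j | f j <> 0].
Hypothesis fr : forall j, f (2 * c - j) = f j.

Lemma sum_reflect_lt :
  \sum_(j \in [set j : int | j < c]) f j = \sum_(j \in [set j : int | c < j]) f j.
Proof.
rewrite (reindex_fsbig (fun j => 2 * c - j) [set j : int | c < j] [set j : int | j < c]).
  by apply: eq_fsbigr => j _; rewrite fr.
split=> [j /=|x y _ _|j /= h]; [lia|lia|].
by exists (2 * c - j); rewrite /=; lia.
Qed.

Lemma sum_split3 :
  \sum_(j \in [set: int]) f j = \sum_(j \in [set j : int | j < c]) f j + f c
    + \sum_(j \in [set j : int | c < j]) f j.
Proof.
have [K hK] := finite_bounded ff.
pose m := (`|K| + `|c|)%N.
have W (P : set int) : \sum_(j \in P) f j = \sum_(j <- zseq (- m%:Z) (2 * m + 1) | j \in P) f j.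
  by apply: fsum_zseq => j _ /hK; rewrite /m; lia.
have -> : f c = \sum_(j \in [set c]) f j by rewrite fsbig_set1.
rewrite !W !(big_mkcond (fun j => j \in _)) -!big_split /=; apply: eq_bigr => j _.
rewrite in_setT; have e1 : (j \in [set j : int | j < c]) = (j < c) by apply/idP/idP; rewrite inE.
have e2 : (j \in [set j : int | c < j]) = (c < j) by apply/idP/idP; rewrite inE.
have e3 : (j \in [set c]) = (j == c) by apply/idP/eqP; rewrite inE.
rewrite e1 e2 e3; case: ltgtP; lia.
Qed.
End Reflection.

Section XiFacts.
Variables (r d : nat) (C : mat).
Hypothesis hC : Xi r d C.
Let n : int := (period r)%:Z.
Let nE : n = 2 * r%:Z + 2. Proof. by rewrite /n /period; lia. Qed.
Let ngt0 : 0 < n. Proof. by rewrite nE; lia. Qed.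

Lemma Xi_ge0 i j : 0 <= C i j. Proof. by case: hC => [[]]. Qed.

Lemma Theta_sh M : Theta r M -> forall q i j, M (i + q * n) (j + q * n) = M i j.
Proof.
move=> [_ p1].
have pn (k : nat) i j : M (i + k%:Z * n) (j + k%:Z * n) = M i j.
  elim: k i j => [|k IH] i j; first by rewrite mul0r !addr0.
  by rewrite -addn1 PoszD mulrDl mul1r !addrA p1 IH.
case=> k i j; first exact: pn.
have := pn k.+1 (i + Negz k * n) (j + Negz k * n); rewrite NegzE.
have a x : x + - k.+1%:Z * n + k.+1%:Z * n = x by lia.
by rewrite !a.
Qed.

Lemma Xi_sh q i j : C (i + q * n) (j + q * n) = C i j.
Proof. by apply: Theta_sh; case: hC. Qed.

Lemma Xi_opp i j : C (- i) (- j) = C i j.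
Proof. by case: hC => _ [+ _]; apply. Qed.

Lemma Xi_odd0 : (C 0 0 = 1 %[mod 2])%Z. Proof. by case: hC => _ [_ [+ _]]. Qed.
Lemma Xi_odd1 : (C r.+1%:Z r.+1%:Z = 1 %[mod 2])%Z.
Proof. by case: hC => _ [_ [_ [+ _]]]. Qed.
Lemma Xi_fin i : finite_set [set j | C i j <> 0].
Proof. by case: hC => _ [_ [_ [_ [+ _]]]]; apply. Qed.

Lemma Xi_band : exists K : nat, forall i j, C i j <> 0 -> `|j - i| <= K%:Z.
Proof.
have /cid2 : exists2 K : nat -> nat, True & forall (i : nat) j, C i%:Z j <> 0 -> `|j| <= (K i)%:Z.
  have := fun i : nat => finite_bounded (Xi_fin i%:Z).
  by move=> /choice[K hK]; exists K.
move=> [K _ hK]; exists (\sum_(i < period r) (K i + i))%N => i j.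
have ie := divz_eq i n; have := modz_ge0 i (lt0r_neq0 ngt0); have := ltz_pmod i ngt0.
move: ie; move: (i %/ n)%Z (i %% n)%Z => q m -> mn m0.
rewrite addrC -[j](subrK (q * n)) Xi_sh.
have me : m = `|m|%N%:Z by lia.
have mi : (`|m|%N < period r)%N by move: mn; rewrite /n; lia.
rewrite me => /hK; rewrite -me (bigD1 (Ordinal mi)) //=.
by move: (\sum_(i0 < _ | _) _)%N => S; lia.
Qed.

Lemma row_sh q i : row_a C (i + q * n) = row_a C i.
Proof.
rewrite /row_a (reindex_fsbigT (fun j => j + q * n)).
  by apply: eq_fsbigr => j _; rewrite Xi_sh.
by exists (fun j => j - q * n) => j; [rewrite addrK|rewrite subrK].
Qed.

Lemma row_opp i : row_a C (- i) = row_a C i.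
Proof.
rewrite /row_a (reindex_fsbigT (fun j => - j)).
  by apply: eq_fsbigr => j _; rewrite Xi_opp.
by exists (fun j => - j) => j; rewrite opprK.
Qed.

Lemma row0 : row_a C 0 = 2 * tnth (row_c r C) ord0 + 1.
Proof.
have fr j : C 0 (2 * 0 - j) = C 0 j by rewrite mulr0 sub0r -{1}oppr0 Xi_opp.
rewrite tnth_mktuple /= /row_a (@sum_split3 _ 0 (Xi_fin 0)) (sum_reflect_lt fr).
rewrite /prim !eqxx /=.
have -> : [set j : int | 0 < j] = [set j : int | 1 <= j].
  by apply/funext => j /=; apply/propext; lia.
by have := Xi_odd0; move: (\sum_(_ \in _) _) (C 0 0) => a b; lia.
Qed.

Lemma row1 : row_a C r.+1%:Z = 2 * tnth (row_c r C) ord_max + 1.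
Proof.
have fr j : C r.+1%:Z (2 * r.+1%:Z - j) = C r.+1%:Z j.
  rewrite -Xi_opp -[RHS](Xi_sh (-1)); congr (C _ _); rewrite nE; lia.
rewrite tnth_mktuple /= eqxx /row_a (@sum_split3 _ r.+1%:Z (Xi_fin _)) -(sum_reflect_lt fr).
rewrite /prim eqxx /=.
have -> : [set j : int | j < r.+1%:Z] = [set j : int | j <= r%:Z].
  by apply/funext => j /=; apply/propext; lia.
rewrite eqxx orbT.
by have := Xi_odd1; move: (\sum_(_ \in _) _) (C r.+1%:Z r.+1%:Z) => a b; lia.
Qed.

Lemma row_mid (k : 'I_r.+2) : (0 < k <= r)%N -> tnth (row_c r C) k = row_a C (val k)%:Z.
Proof.
case: k => m hm /= h; rewrite tnth_mktuple /=.
have -> : (m == 0%N) = false by lia.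
by have -> : (m == r.+1) = false by lia.
Qed.

Lemma row_ge0 i : 0 <= row_a C i.
Proof. by apply: fsumr_ge0 => j _; exact: Xi_ge0. Qed.

Lemma row_c_ge0 k : 0 <= tnth (row_c r C) k.
Proof.
have [k0|k0] := eqVneq (val k) 0%N.
  have -> : k = ord0 by exact/val_inj.
  by have := row0; have := row_ge0 0; lia.
have [k1|k1] := eqVneq (val k) r.+1.
  have -> : k = ord_max by exact/val_inj.
  by have := row1; have := row_ge0 r.+1%:Z; lia.
by rewrite row_mid ?row_ge0 //; have := ltn_ord k; move: k0 k1; rewrite /=; lia.
Qed.

(** The composition row_c(C), as a tuple of natural numbers. *)
Definition lam : (r.+2).-tuple nat := [tuple `|tnth (row_c r C) k|%N | k < r.+2].

Lemma lam_nth (k : 'I_r.+2) : (nth 0%N lam (val k))%:Z = tnth (row_c r C) k.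
Proof.
by rewrite -tnth_nth tnth_mktuple; have := row_c_ge0 k; lia.
Qed.

Lemma lam0 : row_a C 0 = 2 * (nth 0%N lam 0)%:Z + 1.
Proof. by rewrite (lam_nth ord0) row0. Qed.
Lemma lam1 : row_a C r.+1%:Z = 2 * (nth 0%N lam r.+1)%:Z + 1.
Proof. by rewrite (lam_nth ord_max) row1. Qed.
Lemma lamk (m : nat) : (0 < m <= r)%N -> row_a C m%:Z = (nth 0%N lam m)%:Z.
Proof.
move=> h; have mr : (m < r.+2)%N by lia.
by rewrite (lam_nth (Ordinal mr)) row_mid.
Qed.

Lemma lam_Lambda : Lambda d lam.
Proof.
apply: (@Lambda_sum d r lam (row_a C)) => //.
- by move=> i q; exact: row_sh.
- exact: row_opp.
- exact: lam0.
- exact: lam1.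
- exact: lamk.
- by case: hC => _ [_ [_ [_ [_ <-]]]].
Qed.

(** The blocks of the composition row_c(C) have the sizes of the rows of C. *)
Lemma lam_size i : (size (fib (beta d lam) i))%:Z = row_a C i.
Proof.
apply: (size_fib_beta lam_Lambda) => //.
- by move=> j q; exact: row_sh.
- exact: row_opp.
- exact: lam0.
- exact: lam1.
- exact: lamk.
Qed.

Lemma Xi_shinv : shinv r C.
Proof. by move=> q i j; exact: Xi_sh. Qed.

Lemma Xi_banded : banded C.
Proof. by have [K hK] := Xi_band; exists K%:Z. Qed.

Lemma Xi_finc j : finite_set [set i | C i j <> 0].
Proof.
have [K hK] := Xi_band; apply: (@bounded_finite _ (`|j| + K%:Z)) => i /= /hK; lia.
Qed.

Lemma Xi_tr : Xi r d (trmat C).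
Proof.
case: hC => [[N1 N2] [hs [h0 [h1 [hf hsum]]]]].
split; first by split=> [i j|i j]; rewrite /trmat.
split; first by move=> i j; rewrite /trmat.
do 3!split => //; first exact: Xi_finc.
have to_rows (M : mat) : \sum_(1 <= i < (period r).+1) \sum_(j \in [set: int]) M i%:Z j
   = \sum_(i <- zseq 1 (period r)) \sum_(j \in [set: int]) M i j.
  rewrite /zseq big_map /index_iota subSS subn0 -[1%N]addn0 iotaDl big_map.
  by apply: eq_bigr => i _; rewrite PoszD.
rewrite to_rows -psum2_rows //; last first.
- by have [K hK] := Xi_band; exists K%:Z => i j /hK; lia.
- by move=> q i j; rewrite /trmat Xi_sh.
rewrite -hsum to_rows -psum2_rows //; [|exact: Xi_shinv|exact: Xi_banded].
rewrite (@psum2_fdom r C (fun p => p.2) n) //; last exact: Xi_shinv.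
rewrite /psum2 (reindex_fsbig (fun p : int * int => (p.2, p.1))
  [set p | 0 <= p.2 < n] [set p | 0 <= p.1 < n]) //.
split=> [p //|[? ?] [? ?] _ _ [-> ->] //|[i j] /= h]; by exists (j, i).
Qed.
End XiFacts.

Lemma fib_comp (K : choiceType) (be : int -> K) g h k : cancel g h -> cancel h g ->
  finfib be -> finfib (be \o g) /\ size (fib (be \o g) k) = size (fib be k).
Proof.
move=> gh hg fb.
have fb' : finfib (be \o g).
  move=> k'; apply: (@sub_finite_set _ _ (h @` [set x | be x = k'])).
    by move=> x /= e; exists (g x); rewrite ?gh.
  exact: finite_image.
split=> //; rewrite -(size_map g); apply: perm_size; apply: uniq_perm.
- by rewrite map_inj_uniq ?fib_uniq //; exact: can_inj gh.
- exact: fib_uniq.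
- move=> x; rewrite -{1}(hg x) mem_map; last exact: can_inj gh.
  by rewrite !mem_fib //= hg.
Qed.

Lemma card_fib (K : choiceType) (be : int -> K) k :
  card_int [set x | be x = k] = (size (fib be k))%:Z.
Proof. by rewrite /card_int /fib size_sort cardfE. Qed.

(** * The length of a matrix *)

(** Positions p and q in a matrix whose contributions to the number of inversions
    multiply. *)
Definition einv (p q : int * int) : bool := (p.2 < q.2) && (q.1 < p.1).

Section Datum.
Variables (r d : nat).
Hypothesis hd : (2 <= d)%N.
Let n : int := (period r)%:Z.
Let nE : n = 2 * r%:Z + 2. Proof. by rewrite /n /period; lia. Qed.
Let ngt0 : 0 < n. Proof. by rewrite nE; lia. Qed.

Lemma lab_eqv (N1 N2 : int) b1 b2 g h : Wgrp d g -> cancel g h -> cancel h g ->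
  eqv d (actZ N1) b1 -> eqv d (actZ N2) b2 ->
  eqv d (actZ2 N1 N2) (fun x => (b1 (g x), b2 x)).
Proof.
move=> gW gh hg e1 e2; split=> [q x|x|].
- by rewrite /= (W_shift gW) (eqv_sh e1) (eqv_sh e2).
- by rewrite /= (W_opp gW) (eqv_ng e1) (eqv_ng e2).
- by case: (size_fib_pair_swap (b1 \o g) 0 0 (eqv_fin e2)).
Qed.

Lemma kappa_fib (l m : (r.+2).-tuple nat) g h i j : Lambda d l -> Lambda d m ->
  Wgrp d g -> cancel g h -> cancel h g ->
  kappa d l g m i j = (size (fib (fun x => (beta d l (g x), beta d m x)) (i, j)))%:Z.
Proof.
move=> hl hm gW gh hg.
have fL : finfib (fun x => (beta d l (g x), beta d m x)).
  by case: (size_fib_pair_swap (beta d l \o g) 0 0 (beta_fin d m)).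
rewrite -(fib_comp (i, j) hg gh fL).2.
rewrite -card_fib /kappa !RblockE //; congr card_int; apply/funext => z; apply/propext.
split=> /= [[lz [x mx xz]]|[lz mz]]; first by rewrite hg lz -xz gh mx.
by rewrite hg in lz; split => //; exists (h z); rewrite ?hg.
Qed.

(** Every C in Xi is the matrix of a double coset. *)
Lemma datum_exists (C : mat) : Xi r d C ->
  exists p : (r.+2).-tuple nat * (int -> int) * (r.+2).-tuple nat,
    [/\ Lambda d p.1.1, Lambda d p.2, Ddouble d p.1.1 p.2 p.1.2
      & C = kappa d p.1.1 p.1.2 p.2].
Proof.
move=> hC; have hT := Xi_tr hC.
pose l := lam r C; pose m := lam r (trmat C).
have hl := lam_Lambda hC; have hm := lam_Lambda hT.
rewrite -/l in hl; rewrite -/m in hm.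
have ff (M : mat) i : Xi r d M -> finite_set [set j | `|M i j|%N <> 0%N].
  move=> hM; apply: sub_finite_set (Xi_fin hM i) => j /= h e; apply: h.
  by rewrite e.
have Lz (M : mat) i : Xi r d M -> size (slist (fun j => `|M i j|%N)) = size (fib (beta d (lam r M)) i).
  move=> hM; apply/eqP; rewrite -eqz_nat slist_size ?lam_size //; last exact: ff.
  by apply/eqP; apply: eq_fsbigr => j _; rewrite gez0_abs // (Xi_ge0 hM).
have Lsh (M : mat) (q i : int) : Xi r d M ->
   slist (fun j => absz (M (i + q * n) j)) = [seq x + q * n | x <- slist (fun j => `|M i j|%N)].
  move=> hM; rewrite -slist_sh; last exact: ff.
  congr slist; apply/funext => j; congr (`|_|%N).
  by rewrite -{1}(subrK (q * n) j) (Xi_sh hM).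
have Lng (M : mat) (i : int) : Xi r d M ->
   slist (fun j => absz (M (- i) j)) = rev [seq - x | x <- slist (fun j => `|M i j|%N)].
  move=> hM; rewrite -slist_ng; last exact: ff.
  by congr slist; apply/funext => j; congr (`|_|%N); rewrite -(Xi_opp hM) opprK.
have pw f : pairwise <=%O (slist f) by rewrite -le_sorted_pairwise slist_sorted.
have [||||||||||| g [gW ct bb cc]] := @realize d _ _ (actZ n) (actZ n) (beta d l) (beta d m)
  (fun i => slist (fun j => `|C i j|%N)) (fun i => slist (fun j => `|trmat C i j|%N)) 0 0
  <=%O <=%O.
- exact: beta_eqv.
- exact: beta_eqv.
- by move=> i; exact: Lz.
- by move=> i; exact: Lz.
- by move=> q i; exact: Lsh.
- by move=> i; exact: Lng.
- by move=> q i; exact: Lsh.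
- by move=> i; exact: Lng.
- by move=> i; exact: pw.
- by move=> i; exact: pw.
- by move=> i j; rewrite !slist_count //; exact: ff.
have [h [hW gh hg]] := W_inv gW.
have lt_of_beta (l' : (r.+2).-tuple nat) x y : beta d l' x < beta d l' y -> x < y.
  by move=> c; rewrite ltNge; apply/negP => /(@beta_mono d r l'); rewrite leNgt c.
have ne_lt (x y : int) : x <> y -> x <= y -> x < y.
  by move=> ne; rewrite le_eqVlt => /orP[/eqP|].
exists (l, g, m); split => //=.
  split; first (apply/(DminP hl hd gW gh hg) => x y e xy).
    rewrite -(hg x) -(hg y) in e xy.
    have le := cc _ _ e xy.
    have [eb|nb] := pselect (beta d m (h x) = beta d m (h y)); last first.
      by apply: (lt_of_beta m); exact: ne_lt.
    case: (ltgtP (h x) (h y)) => // c; last by rewrite c ltxx in xy.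
    by have := (bb _ _ (esym eb) c).2 (esym e); rewrite ltNge ltW.
  exists h; split=> //; apply/(DminP hm hd hW hg gh) => x y e xy.
  have [le mo] := bb x y e xy.
  have [eb|nb] := pselect (beta d l (g x) = beta d l (g y)); first exact: mo.
  by apply: (lt_of_beta l); exact: ne_lt.
apply/funext => i; apply/funext => j.
rewrite (kappa_fib i j hl hm gW gh hg).
rewrite (size_fib_pair_swap (beta d l \o g) i j (beta_fin d m)).1 /= ct.
by rewrite slist_count ?gez0_abs ?(Xi_ge0 hC) //; exact: ff.
Qed.

Lemma kappa_datumP (C : mat) : Xi r d C ->
  exists l g m, [/\ kappa_datum d r C = (l, g, m), Lambda d l, Lambda d m,
    Ddouble d l m g & C = kappa d l g m].
Proof.
move=> /datum_exists; rewrite /kappa_datum => -[p hp].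
case: xgetP => [[[l g] m] e [h1 h2 h3 h4]|/(_ p) //].
by exists l, g, m.
Qed.

(** The length of a matrix is a quadratic form in its entries; the diagonal entries
    at multiples of r + 1 are corrected by the fixed points. *)
Lemma ell_matE (C : mat) : Xi r d C ->
  (ell_mat d r C)%:Z * 8 = qsum n (fun i j => 2 * C i j - Jm 1 r.+1%:Z i j) einv.
Proof.
move=> hC; have [l [g [m [e hl hm [gD gD'] Ce]]]] := kappa_datumP hC.
rewrite /ell_mat e /=; have gW : Wgrp d g by case: gD.
rewrite ell_inv8 //.
have [h [hW gh hg]] := W_inv gW.
have gm := Dmin_invP hm hd gD' gW; have hm' := (DminP hl hd gW gh hg).1 gD.
pose Lab x := (beta d l (g x), beta d m x).
have eL : eqv d (actZ2 n n) Lab.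
  by apply: (lab_eqv gW gh hg); exact: beta_eqv.
have lt_of_beta (l' : (r.+2).-tuple nat) x y : beta d l' x < beta d l' y -> x < y.
  by move=> c; rewrite ltNge; apply/negP => /(@beta_mono d r l'); rewrite leNgt c.
have ne_lt (x y : int) : x <> y -> x <= y -> x < y.
  by move=> ne; rewrite le_eqVlt => /orP[/eqP|].
have pt x y : (x < y) && (g y < g x) = einv (Lab x) (Lab y).
  rewrite /einv /=; apply/andP/andP => -[c1 c2]; last by split; apply: lt_of_beta; eauto.
  split; apply: ne_lt.
  - by move=> eb; have := gm _ _ eb c1; rewrite ltNge ltW.
  - by apply: beta_mono; exact: ltW.
  - by move=> eb; have := hm' _ _ eb c2; rewrite !gh ltNge ltW.
  - by apply: beta_mono; exact: ltW.
transitivity (psum2 d (fun x y => om d x * om d y * (einv (Lab x) (Lab y))%:Z)).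
  by apply: eq_psum2 => x y; rewrite pt.
rewrite (psum2_lab ngt0 eL).
- apply: eq_qsum => // i j; rewrite (@wt_label d n n 1 r.+1 Lab eL) //.
    by rewrite -(kappa_fib i j hl hm gW gh hg) -Ce.
  move=> q; rewrite /Lab (W_fix gW) ?dvdz_mull // !beta_fixed // mul1r //.
- by move=> q p p'; rewrite /einv /= !ltrD2r.
- have [K hK] := band_inv gW (W_id d); exists K => x y h1; apply: hK.
  move: h1; rewrite -pt /=; case: (_ && _) => // _.
  by apply/eqP; rewrite mulr1 mulf_neq0 // lt0r_neq0 // om_gt0.
Qed.
End Datum.

(** * The blocks of the composition delta *)

Lemma sum_count (T : Type) (b : T -> int) (s : seq T) :
  \sum_(j \in [set: int]) (count (fun x => b x == j) s)%:Z = (size s)%:Z.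
Proof.
have fin (s' : seq T) : finite_set [set j | (count (fun x => b x == j) s')%:Z <> 0].
  apply: (@sub_finite_set int _ [set` [seq b x | x <- s']]); last exact: finite_seq.
  move=> j /= h; rewrite -has_pred1 has_count count_map lt0n.
  by apply/negP => /eqP e; apply: h; congr Posz; exact: e.
elim: s => [|x s IH]; first by apply: fsbig1.
have -> : (fun j => (count (fun x => b x == j) (x :: s))%:Z) =
   (fun j => (b x == j)%:Z + (count (fun x => b x == j) s)%:Z) by apply/funext => j /=; lia.
rewrite fsum_add; last by rewrite setTI; exact: fin.
  rewrite IH (@fsbigE_cond _ _ _ _ _ [:: b x]) //.
    by rewrite big_cons big_nil in_setT eqxx /=; lia.
  by move=> j _; rewrite inE eq_sym => /negbTE ->.
rewrite setTI; apply: (@sub_finite_set _ _ [set b x]); last exact: finite_set1.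
by move=> j /=; case: eqVneq => // -> _.
Qed.

(** The blocks of delta are numbered by m = 3 i - 1, 3 i, 3 i + 1, which together
    make up the i-th block of mu: [fl m] is the index i and [md m] the position
    within the triple. *)
Definition fl (m : int) : int := ((m + 1) %/ 3)%Z.
Definition md (m : int) : int := ((m + 1) %% 3)%Z.

Lemma flmd m : m = 3 * fl m + md m - 1 /\ 0 <= md m < 3.
Proof.
rewrite /fl /md; have := divz_eq (m + 1) 3; have := modz_ge0 (m + 1) (isT : 3 != 0 :> int).
have := ltz_pmod (m + 1) (isT : 0 < 3 :> int); move: (_ %/ _)%Z (_ %% _)%Z => a b; lia.
Qed.

Lemma flmdE i e : 0 <= e < 3 -> fl (3 * i + e - 1) = i /\ md (3 * i + e - 1) = e.
Proof. by have := flmd (3 * i + e - 1); move: (fl _) (md _) => a b; lia. Qed.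

Lemma fl_sh m k : fl (m + 3 * k) = fl m + k.
Proof.
have [e he] := flmd m; rewrite [in LHS]e.
have -> : 3 * fl m + md m - 1 + 3 * k = 3 * (fl m + k) + md m - 1 by lia.
by rewrite (flmdE _ he).1.
Qed.
Lemma md_sh m k : md (m + 3 * k) = md m.
Proof.
have [e he] := flmd m; rewrite [in LHS]e.
have -> : 3 * fl m + md m - 1 + 3 * k = 3 * (fl m + k) + md m - 1 by lia.
by rewrite (flmdE _ he).2.
Qed.
Lemma fl_ng m : fl (- m) = - fl m.
Proof.
have [e he] := flmd m; rewrite [in LHS]e.
have -> : - (3 * fl m + md m - 1) = 3 * (- fl m) + (2 - md m) - 1 by lia.
by rewrite (flmdE _ (_ : 0 <= 2 - md m < 3)).1 //; lia.
Qed.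
Lemma md_ng m : md (- m) = 2 - md m.
Proof.
have [e he] := flmd m; rewrite [in LHS]e.
have -> : - (3 * fl m + md m - 1) = 3 * (- fl m) + (2 - md m) - 1 by lia.
by rewrite (flmdE _ (_ : 0 <= 2 - md m < 3)).2 //; lia.
Qed.

Section DeltaBlocks.
Variables (r d : nat).
Hypothesis hd : (2 <= d)%N.
Variables (A B : mat).
Hypotheses (hA : Xi r d A) (hB : Xi r d B) (hBtri : tridiagonal B).
Hypothesis hAB : row_c r A = col_c r B.
Let n : int := (period r)%:Z.
Let nE : n = 2 * r%:Z + 2. Proof. by rewrite /n /period; lia. Qed.
Let n3E : (period (3 * r + 2))%:Z = 3 * n :> int.
Proof. by rewrite /n /period; lia. Qed.
Let dl := delta r B.

(** The column sums of the tridiagonal matrix B. *)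
Definition colB i : int := B (i - 1) i + B i i + B (i + 1) i.

Lemma colBE i : row_a (trmat B) i = colB i.
Proof.
rewrite /row_a /trmat (@fsum_zseq _ _ (i - 1) 3).
  rewrite /zseq /= !big_cons big_nil !in_setT /= /colB.
  have -> : i - 1 + 1%N%:Z = i by lia.
  have -> : i - 1 + 2%N%:Z = i + 1 by lia.
  by rewrite !addr0 addrA.
move=> j _ h; have : `|j - i| <= 1 by apply/negPn/negP => /hBtri.
by lia.
Qed.

Lemma rowA_colB i : row_a A i = colB i.
Proof.
rewrite -colBE; have hT := Xi_tr hB.
apply: (@per_even_eq _ r.+1 (row_a A) (row_a (trmat B))) => //.
- move=> j q; rewrite -(row_sh hA q j); congr row_a; rewrite /period; lia.
- exact: row_opp hA.
- move=> j q; rewrite -(row_sh hT q j); congr row_a; rewrite /period; lia.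
- exact: row_opp hT.
move=> k kr; have [->|k0] := eqVneq k 0%N.
  by rewrite (row0 hA) (row0 hT) hAB.
have [->|k1] := eqVneq k r.+1; first by rewrite (row1 hA) (row1 hT) hAB.
have kr' : (k < r.+2)%N by lia.
have := @row_mid r A (Ordinal kr') ; have := @row_mid r (trmat B) (Ordinal kr').
by rewrite /= hAB => <- //; last (by lia); move=> <- //; lia.
Qed.

(** The sizes of the blocks of delta. *)
Definition bs (m : int) : int := B (fl m + md m - 1) (fl m).

Lemma bs_sh m q : bs (m + q * (3 * n)) = bs m.
Proof.
have -> : q * (3 * n) = 3 * (q * n) by lia.
rewrite /bs fl_sh md_sh -(Xi_sh hB q (fl m + md m - 1)); congr B; rewrite -/n; lia.
Qed.

Lemma bs_ng m : bs (- m) = bs m.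
Proof. by rewrite /bs fl_ng md_ng -(Xi_opp hB (fl m + md m - 1)); congr B; lia. Qed.

Lemma dl_nth (k : nat) : (k < (3 * r + 2).+2)%N -> (nth 0%N dl k)%:Z =
  prim r B (fl k%:Z + md k%:Z - 1) (fl k%:Z).
Proof.
move=> hk; rewrite (_ : nth 0%N dl k = tnth dl (Ordinal hk)); last by rewrite (tnth_nth 0%N).
rewrite tnth_mktuple /=.
have -> : ((k.+1 %/ 3)%N)%:Z = fl k%:Z by rewrite /fl; lia.
have -> : ((k.+1 %% 3)%N)%:Z = md k%:Z by rewrite /md; lia.
rewrite gez0_abs // /prim; case: ifP => [/andP[/eqP e c]|_]; last exact: (Xi_ge0 hB).
rewrite e in c; rewrite e; suff : 1 <= B (fl k%:Z) (fl k%:Z) by lia.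
have odd_pos (x : int) : 0 <= x -> (x = 1 %[mod 2])%Z -> 1 <= x by lia.
case/orP: c => /eqmodP[q ->].
  apply: odd_pos; first exact: (Xi_ge0 hB).
  by rewrite (Xi_sh hB q 0 0); exact: (Xi_odd0 hB).
apply: odd_pos; first exact: (Xi_ge0 hB).
by rewrite (Xi_sh hB q); exact: (Xi_odd1 hB).
Qed.

Lemma bs0 : bs 0 = 2 * (nth 0%N dl 0)%:Z + 1.
Proof.
rewrite (@dl_nth 0) //; change (B 0 0 = 2 * prim r B 0 0 + 1).
rewrite /prim !eqxx /=.
by have := Xi_odd0 hB; move: (B _ _) => x; lia.
Qed.

Lemma bs1 : bs (3 * r + 2).+1%:Z = 2 * (nth 0%N dl (3 * r + 2).+1)%:Z + 1.
Proof.
rewrite (@dl_nth (3 * r + 2).+1) // /bs.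
have [e1 e2] := @flmdE r.+1%:Z 1 isT.
have -> : (3 * r + 2).+1%:Z = 3 * r.+1%:Z + 1 - 1 by lia.
rewrite /prim e1 e2 addrK !eqxx orbT /=.
by have := Xi_odd1 hB; move: (B _ _) => x; lia.
Qed.

Lemma bsk (m : nat) : (0 < m <= 3 * r + 2)%N -> bs m%:Z = (nth 0%N dl m)%:Z.
Proof.
move=> hm; rewrite dl_nth; last by lia.
rewrite /bs /prim; case: ifP => // /andP[/eqP e c].
have [e1 e2] := flmd m%:Z.
case/orP: c => /eqmodP[q]; rewrite -/n nE; move: e e1 e2; move: (fl _) (md _) => a b *;
  exfalso; have [q0|[q0|q0]] : q <= -1 \/ 1 <= q \/ q = 0 by lia.
- by nia.
- by nia.
- by nia.
- by nia.
- by nia.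
- by nia.
Qed.

Lemma sum3 (f : nat -> int) k :
  \sum_(2 <= m < (3 * k + 2)%N) f m
   = \sum_(0 <= i < k) (f (3 * i + 2)%N + f (3 * i + 3)%N + f (3 * i + 4)%N).
Proof.
elim: k => [|k IH]; first by rewrite !big_geq.
rewrite [RHS]big_nat_recr //= -IH.
have -> : (3 * k.+1 + 2 = (3 * k + 2).+3)%N by lia.
rewrite !big_nat_recr /=; [|lia|lia|lia].
rewrite !addrA; congr (_ + f _ + f _); lia.
Qed.

Lemma dl_Lambda : Lambda d dl.
Proof.
apply: (@Lambda_sum d (3 * r + 2) dl bs).
- by move=> i q; rewrite n3E bs_sh.
- exact: bs_ng.
- exact: bs0.
- exact: bs1.
- exact: bsk.
case: hA => _ [_ [_ [_ [_ <-]]]].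
have -> : \sum_(1 <= i < (period (3 * r + 2)).+1) bs i%:Z
   = \sum_(2 <= i < (3 * period r + 2)%N) bs i%:Z.
  have e : (period (3 * r + 2) = 3 * period r)%N by rewrite /period; lia.
  rewrite e big_ltn; last by rewrite /period; lia.
  rewrite addrC; have -> : (3 * period r + 2 = (3 * period r).+2)%N by lia.
  rewrite [RHS]big_nat_recr /=; last by rewrite /period; lia.
  congr (_ + _); have := bs_sh 1 1 => <-; congr bs; rewrite /n; lia.
rewrite sum3 [RHS]big_add1 /=; apply: eq_bigr => i _.
rewrite -/(row_a A _) rowA_colB /colB /bs.
have [-> ->] : fl (3 * i + 2)%N%:Z = i.+1%:Z /\ md (3 * i + 2)%N%:Z = 0.
  by have := @flmdE i.+1%:Z 0 isT; rewrite (_ : 3 * _ + _ - _ = (3 * i + 2)%N%:Z); lia.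
have [-> ->] : fl (3 * i + 3)%N%:Z = i.+1%:Z /\ md (3 * i + 3)%N%:Z = 1.
  by have := @flmdE i.+1%:Z 1 isT; rewrite (_ : 3 * _ + _ - _ = (3 * i + 3)%N%:Z); lia.
have [-> ->] : fl (3 * i + 4)%N%:Z = i.+1%:Z /\ md (3 * i + 4)%N%:Z = 2.
  by have := @flmdE i.+1%:Z 2 isT; rewrite (_ : 3 * _ + _ - _ = (3 * i + 4)%N%:Z); lia.
by congr (B _ _ + B _ _ + B _ _); lia.
Qed.

Lemma dl_size m : (size (fib (beta d dl) m))%:Z = bs m.
Proof.
apply: (size_fib_beta dl_Lambda).
- by move=> i q; rewrite n3E bs_sh.
- exact: bs_ng.
- exact: bs0.
- exact: bs1.
- exact: bsk.
Qed.

Section Coarse.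
Variables (mu nu : (r.+2).-tuple nat) (g2 h2 : int -> int).
Hypotheses (hmu : Lambda d mu) (hnu : Lambda d nu) (g2W : Wgrp d g2)
  (gh : cancel g2 h2) (hg : cancel h2 g2) (Ae : A = kappa d mu g2 nu).

Lemma mu_size i : (size (fib (beta d mu) i))%:Z = colB i.
Proof.
rewrite -rowA_colB /row_a Ae.
have [_ <-] := fib_comp i gh hg (beta_fin d mu).
rewrite -(sum_count (beta d nu)); apply: eq_fsbigr => j _.
rewrite (kappa_fib i j hmu hnu g2W gh hg).
have [_ fm] := fib_comp i gh hg (beta_fin d mu).
have [fm' _] := fib_comp i gh hg (beta_fin d mu).
by rewrite (size_fib_pair (beta d nu) i j fm').1.
Qed.

Lemma psum_mu_dl (i : nat) : (i <= r)%N -> psum mu i = psum dl (3 * i + 1).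
Proof.
elim: i => [|i IH] ir.
  rewrite muln0 add0n psumS ?psum0 //.
  have e0 := dl_nth (isT : (0 < (3 * r + 2).+2)%N).
  have := bs0; have := bsk (m := 1).
  have es : size (fib (beta d mu) 0%:Z) = (2 * nth 0%N mu 0).+1 := size_fib_nth hmu (leq0n r.+1).
  have := mu_size 0; rewrite es /colB => e b1 b0.
  have [f1 f2] := @flmdE 0 1 isT; have [f3 f4] := @flmdE 0 2 isT.
  have b1' := b1 ltac:(lia); move: b0 b1'; rewrite /bs.
  have -> : fl 1%N%:Z = 0 by [].
  have -> : md 1%N%:Z = 2 by [].
  have -> : fl 0 = 0 by [].
  have -> : md 0 = 1 by [].
  have := Xi_opp hB 1 0; rewrite oppr0 => e1.
  move: e; rewrite !add0r !addrK subrr -e1.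
  move=> ea eb ec; rewrite !ec eb in ea; move: ea.
  move: (nth 0%N mu 0) (nth 0%N dl 0) (nth 0%N dl 1) => x y z; lia.
rewrite psumS; last by lia.
have -> : (3 * i.+1 + 1 = (3 * i + 1).+3)%N by lia.
rewrite !psumS ?IH; try lia.
rewrite -!addnA; congr (_ + _)%N; apply/eqP; rewrite -eqz_nat !PoszD.
rewrite -!bsk; try lia.
have := size_fib_nth hmu (_ : (i.+1 <= r.+1)%N); rewrite (_ : i.+1 == r.+1 = false); last by lia.
move=> /(_ (ltac:(lia))) /= <-; rewrite mu_size /colB /bs.
have [-> ->] : fl (3 * i + 1).+1%:Z = i.+1%:Z /\ md (3 * i + 1).+1%:Z = 0.
  by have := @flmdE i.+1%:Z 0 isT; rewrite (_ : 3 * _ + _ - _ = (3 * i + 1).+1%:Z); lia.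
have [-> ->] : fl (3 * i + 1).+2%:Z = i.+1%:Z /\ md (3 * i + 1).+2%:Z = 1.
  by have := @flmdE i.+1%:Z 1 isT; rewrite (_ : 3 * _ + _ - _ = (3 * i + 1).+2%:Z); lia.
have [-> ->] : fl (3 * i + 1).+3%:Z = i.+1%:Z /\ md (3 * i + 1).+3%:Z = 2.
  by have := @flmdE i.+1%:Z 2 isT; rewrite (_ : 3 * _ + _ - _ = (3 * i + 1).+3%:Z); lia.
by rewrite -addrA; apply/eqP; congr (B _ _ + (B _ _ + B _ _)); lia.
Qed.

(** The blocks of mu are unions of three consecutive blocks of delta. *)
Lemma beta_coarse x : beta d mu x = fl (beta d dl x).
Proof.
have pos y : 0 <= y <= d%:Z + 1 -> beta d mu y = fl (beta d dl y).
  move=> hy; rewrite !beta_pos //; set b := beta0 dl y.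
  have [e1 e2] := flmd b%:Z; have bl := beta0_le dl y; rewrite -/b in bl.
  have f0 : 0 <= fl b%:Z <= r.+1%:Z by move: e1 e2; move: (fl _) (md _) => u w; lia.
  rewrite (@beta0_uniq 0 _ _ _ (`|fl b%:Z|%N)); try lia.
    move=> i hi; rewrite psum_mu_dl; last by lia.
    by apply: beta0_lt; rewrite -/b; move: e1 e2 f0 hi; move: (fl _) (md _) => u w; lia.
  move=> hr; rewrite psum_mu_dl //.
  have b2 : (b <= 3 * r + 2)%N by move: e1 e2 f0 hr; move: (fl _) (md _) => u w; lia.
  have := beta0_ge b2; rewrite -/b => h; apply: (le_trans h); rewrite lez_nat.
  apply: (psum_mono 0); move: e1 e2 f0 hr b2; move: (fl _) (md _) => u w; lia.
have [m [q [hm [->|->]]]] := W_normal0 hd x.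
  rewrite !beta_shift pos // n3E (_ : q * (3 * n) = 3 * (q * n)); last by lia.
  by rewrite fl_sh.
rewrite !beta_shift (beta_opp hmu) (beta_opp dl_Lambda) pos // n3E.
rewrite (_ : q * (3 * n) = 3 * (q * n)); last by lia.
by rewrite fl_sh fl_ng.
Qed.
End Coarse.
End DeltaBlocks.

(** * The length of the element w attached to A and T *)

(** The sizes of the intersections of the m-th block of delta with the j-th block
    of nu, transported by w g_2, when phi(w) = T. *)
Definition cp (A T : mat) (m j : int) : int :=
  if md m == 0 then T (fl m) j
  else if md m == 1 then A (fl m) j - T (fl m) j - T (- fl m) (- j)
  else T (- fl m) (- j).

(** Positions that w may be forced to invert: those in the same block of mu. *)
Definition winv (p q : int * int) : bool :=
  [&& fl p.1 == fl q.1, p.2 < q.2 & q.1 < p.1].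

Lemma sum_three (F : int -> int) i : (forall m, fl m != i -> F m = 0) ->
  \sum_(m \in [set: int]) F m = F (3 * i - 1) + F (3 * i) + F (3 * i + 1).
Proof.
move=> h; rewrite (@fsum_zseq _ _ (3 * i - 1) 3).
  rewrite /zseq /= !big_cons big_nil !in_setT /=.
  have -> : 3 * i - 1 + 1%N%:Z = 3 * i by lia.
  have -> : 3 * i - 1 + 2%N%:Z = 3 * i + 1 by lia.
  by rewrite !addr0 addrA.
move=> m _ hm; have [e he] := flmd m.
have fi : fl m = i by apply/eqP/negPn/negP => /h.
by rewrite -fi; lia.
Qed.

Lemma flmd3 i : [/\ fl (3 * i - 1) = i, md (3 * i - 1) = 0, fl (3 * i) = i, md (3 * i) = 1
  & fl (3 * i + 1) = i] /\ md (3 * i + 1) = 2.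
Proof.
have [a1 a2] := @flmdE i 0 isT; have [b1 b2] := @flmdE i 1 isT.
have [c1 c2] := @flmdE i 2 isT.
have e0 : 3 * i + 0 - 1 = 3 * i - 1 by lia.
have e1 : 3 * i + 1 - 1 = 3 * i by lia.
have e2 : 3 * i + 2 - 1 = 3 * i + 1 by lia.
by rewrite e0 in a1 a2; rewrite e1 in b1 b2; rewrite e2 in c1 c2.
Qed.

Section MinimalElement.
Variables (r d : nat).
Variables (A B : mat).
Hypotheses (hA : Xi r d A) (hB : Xi r d B) (hBtri : tridiagonal B).
Hypothesis hAB : row_c r A = col_c r B.
Variable T : mat.
Hypothesis hT : Theta_BA r B A T.
Let n : int := (period r)%:Z.
Let nE : n = 2 * r%:Z + 2. Proof. by rewrite /n /period; lia. Qed.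
Let ngt0 : 0 < n. Proof. by rewrite nE; lia. Qed.
Let n3E : (period (3 * r + 2))%:Z = 3 * n :> int.
Proof. by rewrite /n /period; lia. Qed.
Let dl := delta r B.

Lemma T_ge0 i j : 0 <= T i j. Proof. by case: hT => -[]. Qed.
Lemma T_sh q i j : T (i + q * n) (j + q * n) = T i j.
Proof. by apply: Theta_sh; case: hT. Qed.
Lemma T_le i j : T i j + T (- i) (- j) <= A i j.
Proof. by case: hT => _ + _; apply. Qed.
Lemma T_row i : row_a T i = B (i - 1) i. Proof. by case: hT. Qed.
Lemma T_fin i : finite_set [set j | T i j <> 0].
Proof.
apply: sub_finite_set (Xi_fin hA i) => j /= h; have := T_le i j.
by have := T_ge0 i j; have := T_ge0 (- i) (- j); lia.
Qed.
Lemma T_fin' i : finite_set [set j | T i (- j) <> 0].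
Proof.
apply: (@sub_finite_set _ _ ((fun j => - j) @` [set j | T i j <> 0])).
  by move=> j /= h; exists (- j); rewrite ?opprK.
by apply: finite_image; exact: T_fin.
Qed.
Lemma T_row' i : \sum_(j \in [set: int]) T i (- j) = row_a T i.
Proof.
rewrite /row_a [RHS](reindex_fsbigT (fun j => - j)) //.
Qed.

Lemma cp_ge0 m j : 0 <= cp A T m j.
Proof.
rewrite /cp; case: ifP => _; first exact: T_ge0.
case: ifP => _; last exact: T_ge0.
by have := T_le (fl m) j; lia.
Qed.

Lemma cp_sh q m j : cp A T (m + q * (3 * n)) (j + q * n) = cp A T m j.
Proof.
rewrite /cp (_ : q * (3 * n) = 3 * (q * n)); last by lia.
rewrite fl_sh md_sh !T_sh (Xi_sh hA).
have -> : - (fl m + q * n) = - fl m + (- q) * n by lia.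
have -> : - (j + q * n) = - j + (- q) * n by lia.
by rewrite T_sh.
Qed.

Lemma cp_ng m j : cp A T (- m) (- j) = cp A T m j.
Proof.
rewrite /cp fl_ng md_ng !opprK (Xi_opp hA); have [_] := flmd m.
by move: (md m) => e he; ifs; lia.
Qed.

Lemma cp_fin m : finite_set [set j | cp A T m j <> 0].
Proof.
apply: sub_finite_set (Xi_fin hA (fl m)) => j /= h e; apply: h.
rewrite /cp; have := T_le (fl m) j; have := T_ge0 (fl m) j; have := T_ge0 (- fl m) (- j).
by rewrite e; ifs; lia.
Qed.

Hypothesis hd : (2 <= d)%N.

Lemma cp_row m : \sum_(j \in [set: int]) cp A T m j = bs B m.
Proof.
rewrite /cp /bs; have [_ he] := flmd m; set i := fl m.
have [e|[e|e]] : md m = 0 \/ md m = 1 \/ md m = 2 by lia.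
- by rewrite e eqxx -/(row_a T i) T_row; congr B; lia.
- rewrite e /=.
  have fN (f : int -> int) : finite_set [set j | f j <> 0] -> finite_set [set j | - f j <> 0].
    by apply: sub_finite_set => j /= h e'; apply: h; rewrite e' oppr0.
  have sN (f : int -> int) : \sum_(j \in [set: int]) - f j = - \sum_(j \in [set: int]) f j.
    by rewrite -mulN1r mulr_fsumr; apply: eq_fsbigr => j _; rewrite mulN1r.
  have F1 : finite_set [set j | - T i j <> 0] by apply: fN; exact: T_fin.
  have F2 : finite_set [set j | - T (- i) (- j) <> 0] by apply: fN; exact: T_fin'.
  have F3 : finite_set [set j | A i j - T i j <> 0].
    apply: sub_finite_set (Xi_fin hA i) => j /= h e'; apply: h.
    by have := T_le i j; have := T_ge0 i j; have := T_ge0 (- i) (- j); rewrite e'; lia.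
  rewrite fsum_add ?setTI // fsum_add ?setTI //; last exact: Xi_fin hA _.
  rewrite !sN T_row' -/(row_a A i) -/(row_a T i) !T_row (rowA_colB hd hA hB hBtri hAB) /colB.
  have -> : B (- i - 1) (- i) = B (i + 1) i by rewrite -(Xi_opp hB); congr B; lia.
  have -> : i + 1 - 1 = i by lia.
  by move: (B (i - 1) i) (B i i) (B (i + 1) i) => p q s; lia.
- rewrite e /= T_row' T_row -(Xi_opp hB); congr B; lia.
Qed.

Section Construction.
Variables (mu nu : (r.+2).-tuple nat) (g2 h2 : int -> int).
Hypotheses (hmu : Lambda d mu) (hnu : Lambda d nu) (g2W : Wgrp d g2)
  (gh : cancel g2 h2) (hg : cancel h2 g2) (Ae : A = kappa d mu g2 nu).
Hypotheses (hD : Ddouble d mu nu g2).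

Let bD := beta d dl.
Let bM := beta d mu.
Let bN y := beta d nu (h2 y).

Let h2W : Wgrp d h2 := W_canW g2W gh hg.
Let hdl : Lambda d dl := dl_Lambda hd hA hB hBtri hAB.

Lemma bME y : bM y = fl (bD y).
Proof. exact: (beta_coarse hd hA hB hBtri hAB hmu hnu g2W gh hg Ae). Qed.

Lemma bN_eqv : eqv d (actZ n) bN.
Proof.
have e := beta_eqv hnu; split.
- by move=> q x; rewrite /bN (W_shift h2W) (eqv_sh e).
- by move=> x; rewrite /bN (W_opp h2W) (eqv_ng e).
- by move=> k; case: (fib_comp k hg gh (beta_fin d nu)).
Qed.

Lemma h2_incr x y : bM x = bM y -> x < y -> h2 x < h2 y.
Proof. exact: ((DminP hmu hd g2W gh hg).1 hD.1 x y). Qed.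

Lemma fib_mn i j : (size (fib (fun y => (bM y, bN y)) (i, j)))%:Z = A i j.
Proof.
rewrite Ae (kappa_fib i j hmu hnu g2W gh hg).
have [f1 f2] := size_fib_pair bN i j (beta_fin d mu).
have [_ <-] := fib_comp (i, j) gh hg f2.
congr (size (fib _ _))%:Z; apply/funext => x; by rewrite /= /bN gh.
Qed.

Lemma col_lt x y : bM x = bM y -> bN x < bN y -> x < y.
Proof.
move=> e c; case: (ltgtP x y) => // c'; last by rewrite c' ltxx in c.
have /ltW/(@beta_mono d r nu) := h2_incr (esym e) c'.
by rewrite leNgt; move: c; rewrite /bN => ->.
Qed.

Lemma blk_lt x y : bD x < bD y -> x < y.
Proof. by move=> c; rewrite ltNge; apply/negP => /(@beta_mono d _ dl); rewrite leNgt c. Qed.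

(** Any w with these intersections inverts at least the pairs counted by [winv],
    and no others if it is as increasing as possible. *)
Lemma w_length_ge w hw : Wgrp d w -> cancel w hw -> cancel hw w ->
  (forall y, bM (w y) = bM y) ->
  (forall m j, (size (fib (fun y => (bD (w y), bN y)) (m, j)))%:Z = cp A T m j) ->
  qsum n (fun m j => 2 * cp A T m j - Jm 3 r.+1%:Z m j) winv <= inv8 d w /\
  ((forall x y, x < y -> w y < w x -> winv (bD (w x), bN x) (bD (w y), bN y)) ->
   inv8 d w = qsum n (fun m j => 2 * cp A T m j - Jm 3 r.+1%:Z m j) winv).
Proof.
move=> wW wh hwK wM sz.
pose Lab y := (bD (w y), bN y).
have eL : eqv d (actZ2 (3 * n) n) Lab.
  apply: (lab_eqv wW wh hwK); last exact: bN_eqv.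
  by rewrite -n3E; exact: beta_eqv.
have pt x y : winv (Lab x) (Lab y) -> (x < y) && (w y < w x).
  rewrite /winv /= => /and3P[/eqP e1 c1 c2]; apply/andP; split; last exact: blk_lt.
  by apply: col_lt => //; rewrite -(wM x) -(wM y) !bME.
have bd : banded (fun x y => (winv (Lab x) (Lab y))%:Z).
  have [K hK] := band_inv wW (W_id d); exists K => x y h1; apply: hK.
  case e : (winv (Lab x) (Lab y)) h1 => // _; rewrite pt //.
  by apply/eqP; rewrite mulr1 mulf_neq0 // lt0r_neq0 // om_gt0.
have e : psum2 d (fun x y => om d x * om d y * (winv (Lab x) (Lab y))%:Z)
   = qsum n (fun m j => 2 * cp A T m j - Jm 3 r.+1%:Z m j) winv.
  rewrite (psum2_lab ngt0 eL) //.
    apply: eq_qsum => // m j; rewrite (@wt_label d (3 * n) n 3 r.+1 Lab eL) ?sz //.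
    move=> q; rewrite /Lab /bN (W_fix wW) ?dvdz_mull // (W_fix h2W) ?dvdz_mull //.
    by rewrite /bD !beta_fixed //; congr pair; lia.
  move=> q p p'; rewrite /winv /= (_ : q * (3 * n) = 3 * (q * n)); last by lia.
  by rewrite !fl_sh !ltrD2r (inj_eq (addIr _)).
rewrite -e; split; last first.
  move=> H; apply: eq_psum2 => x y; congr (_ * (nat_of_bool _)%:Z).
  by apply/idP/idP => [/andP[c1 c2]|/pt //]; exact: H.
rewrite /inv8 -subr_ge0 -[X in _ - X]mul1r -mulNr mulr_fsumr -fsum_add.
- apply: fsumr_ge0 => -[x y] _ /=.
  have := om_gt0 d x; have := om_gt0 d y; have := pt x y.
  case: (winv _ _) => [/(_ isT) ->|_]; first by rewrite mulN1r subrr.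
  by case: (_ && _); rewrite ?mulr0 ?mulr1 ?addr0 // => *; rewrite ltW // mulr_gt0.
- exact: banded_fin (band_inv wW (W_id d)).
- have [K hK] := bd; apply: (@banded_fin d (fun x y => -1 * (om d x * om d y * (winv (Lab x) (Lab y))%:Z))).
  exists K => x y h; apply: hK => h'; apply: h; by rewrite h' !mulr0.
Qed.

(** The same sizes as natural numbers. *)
Definition cpn m j : nat := `|cp A T m j|%N.
Lemma cpnE m j : (cpn m j)%:Z = cp A T m j.
Proof. by rewrite /cpn gez0_abs // cp_ge0. Qed.
Lemma cpn_fin m : finite_set [set j | cpn m j <> 0%N].
Proof.
by apply: sub_finite_set (cp_fin m) => j /= h e; apply: h; rewrite /cpn e.
Qed.

(** The labels, in increasing order, which the m-th block of delta has to meet. *)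
Definition Lrow (m : int) : seq (int * int) := [seq (fl m, j) | j <- slist (cpn m)].

(** The blocks of delta which the integers with label p have to meet. *)
Definition Lcol (p : int * int) : seq int :=
  slist (fun m => if fl m == p.1 then cpn m p.2 else 0%N).

Lemma Lcol_fin (p : int * int) :
  finite_set [set m | (if fl m == p.1 then cpn m p.2 else 0%N) <> 0%N].
Proof.
apply: (@bounded_finite _ (3 * `|p.1| + 3)) => m /=; case: eqVneq => // e _.
by have [e1 e2] := flmd m; move: e1 e2; rewrite e; move: (md m) => u; lia.
Qed.

(** Elements w whose block matrix with respect to delta and nu is [cp]. *)
Lemma w_exists : exists w hw, [/\ [/\ Wgrp d w, cancel w hw & cancel hw w],
    (forall y, bM (w y) = bM y),
    (forall m j, (size (fib (fun y => (bD (w y), bN y)) (m, j)))%:Z = cp A T m j),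
    (forall x y, x < y -> w y < w x -> winv (bD (w x), bN x) (bD (w y), bN y)) &
    (forall x y, bD x = bD y -> x < y -> hw x < hw y)].
Proof.
pose b2 y := (bM y, bN y).
have e1 : eqv d (actZ (3 * n)) bD by rewrite -n3E; exact: beta_eqv.
have e2 : eqv d (actZ2 n n) b2.
  by apply: (lab_eqv (W_id d) (h := id)) => //; [exact: beta_eqv|exact: bN_eqv].
have ctn m p : count_mem p (Lrow m) = count_mem m (Lcol p).
  case: p => i j; rewrite slist_count; last exact: Lcol_fin.
  rewrite /= count_map; case: eqVneq => [e|ne].
    rewrite -(slist_count j (cpn_fin m)); apply: eq_count => j' /=.
    by rewrite xpair_eqE e eqxx.
  rewrite (eq_count (a2 := pred0)) ?count_pred0 // => j' /=.
  by rewrite xpair_eqE (negbTE ne).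
have s1 m : size (Lrow m) = size (fib bD m).
  apply/eqP; rewrite -eqz_nat size_map slist_size; last exact: cpn_fin.
  rewrite (dl_size hd hA hB hBtri hAB) -cp_row; apply/eqP; apply: eq_fsbigr => j _.
  exact: cpnE.
have s2 p : size (Lcol p) = size (fib b2 p).
  case: p => i j; apply/eqP; rewrite -eqz_nat fib_mn slist_size; last exact: Lcol_fin.
  rewrite (@sum_three _ i) /=; last by move=> m /negbTE ->.
  have [[f1 m1 f2 m2 f3] m3] := flmd3 i.
  rewrite f1 f2 f3 eqxx !cpnE /cp f1 f2 f3 m1 m2 m3 /=; apply/eqP.
  by move: (A i j) (T i j) (T _ _) => x y z; lia.
have h1 q m : Lrow (m + q * (3 * n)) = [seq sh (actZ2 n n) q x | x <- Lrow m].
  rewrite /Lrow (_ : slist (cpn (m + q * (3 * n))) = [seq j + q * n | j <- slist (cpn m)]).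
    rewrite -!map_comp; apply: eq_map => j /=; congr pair.
    by rewrite (_ : q * (3 * n) = 3 * (q * n)) ?fl_sh //; lia.
  rewrite -slist_sh; last exact: cpn_fin.
  congr slist; apply/funext => j; rewrite /cpn -(cp_sh q m); congr (`|cp _ _ _ _|%N); lia.
have n1 m : Lrow (- m) = rev [seq ng (actZ2 n n) x | x <- Lrow m].
  rewrite /Lrow (_ : slist (cpn (- m)) = rev [seq - j | j <- slist (cpn m)]).
    by rewrite map_rev -!map_comp; congr rev; apply: eq_map => j /=; rewrite fl_ng.
  rewrite -slist_ng; last exact: cpn_fin.
  by congr slist; apply/funext => j; rewrite /cpn -cp_ng opprK.
have h2' q p : Lcol (sh (actZ2 n n) q p) = [seq x + q * (3 * n) | x <- Lcol p].
  rewrite /Lcol -slist_sh; last exact: Lcol_fin.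
  congr slist; apply/funext => m /=.
  have em : m = m - q * (3 * n) + q * (3 * n) by lia.
  rewrite {1 2}em /cpn cp_sh (_ : q * (3 * n) = 3 * (q * n)) ?fl_sh; last by lia.
  by rewrite (inj_eq (addIr _)).
have n2 p : Lcol (ng (actZ2 n n) p) = rev [seq - x | x <- Lcol p].
  rewrite /Lcol -slist_ng; last exact: Lcol_fin.
  congr slist; apply/funext => m /=.
  have -> : (fl m == - p.1) = (fl (- m) == p.1) by rewrite fl_ng; lia.
  by have -> : cpn m (- p.2) = cpn (- m) p.2 by rewrite /cpn -cp_ng opprK.
have pw f : pairwise <=%O (slist f) by rewrite -le_sorted_pairwise slist_sorted.
pose R1 (p q : int * int) := p.2 <= q.2.
have p1 m : pairwise R1 (Lrow m).
  by rewrite /Lrow pairwise_map; exact: pw.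
have p2 p : pairwise <=%O (Lcol p) by exact: pw.
have [w [wW ct bb cc]] := realize 0 (0, 0) e1 e2 s1 s2 h1 n1 h2' n2 p1 p2 ctn.
have [hw [hwW wh hwK]] := W_inv wW.
have fb2 := eqv_fin e2.
have wM y : bM (w y) = bM y.
  rewrite bME; have : (0 < count (fun x => bD (w x) == bD (w y)) (fib b2 (b2 y)))%N.
    by rewrite -has_count; apply/hasP; exists y; rewrite ?mem_fib.
  rewrite ct slist_count; last exact: Lcol_fin.
  by rewrite /=; case: eqVneq.
have inc x y : b2 x = b2 y -> x < y -> bD (w x) = bD (w y) -> w x < w y.
  by move=> e xy; case: (bb x y e xy).
have ne_lt (x y : int) : x <> y -> x <= y -> x < y.
  by move=> ne; rewrite le_eqVlt => /orP[/eqP|].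
exists w, hw; split=> //.
- move=> m j; have fN := eqv_fin bN_eqv.
  rewrite (size_fib_pair_swap (bD \o w) m j fN).1.
  have -> : count (fun x => bD (w x) == m) (fib bN j) = count (fun x => bD (w x) == m) (fib b2 (fl m, j)).
    rewrite -!size_filter; apply: perm_size; apply: uniq_perm.
    - by rewrite filter_uniq // fib_uniq.
    - by rewrite filter_uniq // fib_uniq.
    - move=> x; rewrite !mem_filter !mem_fib // xpair_eqE -(wM x) bME.
      by case: eqVneq => // ->; rewrite eqxx.
  rewrite ct slist_count; last exact: Lcol_fin.
  by rewrite /= eqxx cpnE.
- move=> x y xy wyx.
  have f1 : fl (bD (w y)) <= fl (bD (w x)) by rewrite -!bME; apply: beta_mono; exact: ltW.
  have f2 : fl (bD (w x)) <= fl (bD (w y)).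
    by rewrite -!bME !wM; apply: beta_mono; exact: ltW.
  have fe : fl (bD (w x)) = fl (bD (w y)) by apply/le_anti; rewrite f1 f2.
  have eM : bM x = bM y by rewrite -(wM x) -(wM y) !bME.
  have cle : bN x <= bN y by apply: beta_mono; apply: ltW; exact: h2_incr.
  have mle : bD (w y) <= bD (w x) by apply: beta_mono; exact: ltW.
  have mlt : bD (w y) < bD (w x).
    apply: ne_lt => // e; have := cc _ _ e wyx; rewrite /R1 /= => cge.
    have ce : bN x = bN y by apply/le_anti; rewrite cle cge.
    have := inc x y; rewrite /b2 eM ce => /(_ erefl xy (esym e)).
    by rewrite ltNge ltW.
  rewrite /winv /= fe eqxx mlt andbT /=; apply: ne_lt => // ce.
  have := (bb x y); rewrite /b2 eM ce => /(_ erefl xy) [+ _].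
  by rewrite leNgt mlt.
- move=> x y; rewrite -{1 2}(hwK x) -{1 2}(hwK y) => e xy.
  have := cc _ _ e xy; rewrite /R1 /= => cle.
  have eM : bM (hw x) = bM (hw y) by rewrite -(wM (hw x)) -(wM (hw y)) !bME e.
  have [ce|cn] := pselect (bN (hw x) = bN (hw y)); last first.
    by apply: col_lt => //; exact: ne_lt.
  case: (ltgtP (hw x) (hw y)) => // c; last by rewrite c ltxx in xy.
  have := inc (hw y) (hw x); rewrite /b2 eM ce => /(_ erefl c (esym e)).
  by rewrite ltNge ltW.
Qed.

(** Membership in the fibre of phi determines the whole block matrix, since T
    prescribes one block of each triple, symmetry a second one, and A the third. *)
Lemma phi_cp w hw : Wgrp d w -> cancel w hw -> cancel hw w ->
  (forall y, bM (w y) = bM y) ->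
  (phi d dl g2 nu w = T <->
   (forall m j, (size (fib (fun y => (bD (w y), bN y)) (m, j)))%:Z = cp A T m j)).
Proof.
move=> wW wh hwK wM.
pose Lab y := (bD (w y), bN y).
have eL : eqv d (actZ2 (3 * n) n) Lab.
  apply: (lab_eqv wW wh hwK); last exact: bN_eqv.
  by rewrite -n3E; exact: beta_eqv.
have ph i j : phi d dl g2 nu w i j = (size (fib Lab (3 * i - 1, j)))%:Z.
  rewrite -(fib_comp (3 * i - 1, j) hwK wh (eqv_fin eL)).2 -card_fib /phi !RblockE //.
  congr card_int; apply/funext => z; apply/propext.
  split=> /= [[lz [x mx xz]]|[lz mz]].
    by rewrite /Lab /bD hwK lz -xz wh /bN gh mx.
  rewrite hwK in lz; split => //; exists (h2 (hw z)); rewrite ?hg ?hwK //.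
split.
  move=> pT; have s0 i j : (size (fib Lab (3 * i - 1, j)))%:Z = T i j by rewrite -ph pT.
  have s2 i j : (size (fib Lab (3 * i + 1, j)))%:Z = T (- i) (- j).
    rewrite -s0; have := fib_ng (3 * i + 1, j) eL => /(congr1 size).
    rewrite size_rev size_map => <-; congr (size (fib _ _))%:Z => /=.
    by congr pair; lia.
  have s1 i j : (size (fib Lab (3 * i, j)))%:Z = A i j - T i j - T (- i) (- j).
    have fN := eqv_fin bN_eqv.
    have := fib_mn i j; rewrite -(sum_count (fun y => bD (w y))).
    have e m : (count (fun x => bD (w x) == m) (fib (fun y => (bM y, bN y)) (i, j))) =
       (if fl m == i then size (fib Lab (m, j)) else 0)%N.
      have [f1 f2] := size_fib_pair bN i j (beta_fin d mu).
      case: eqVneq => [fi|ni].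
        rewrite (size_fib_pair_swap (bD \o w) m j fN).1 -!size_filter.
        apply: perm_size; apply: uniq_perm.
        - by rewrite filter_uniq // fib_uniq.
        - by rewrite filter_uniq // fib_uniq.
        - move=> x; rewrite !mem_filter !mem_fib // xpair_eqE -(wM x) bME.
          by case: eqVneq => // ->; rewrite fi eqxx.
      rewrite -size_filter; apply/eqP; rewrite size_eq0; apply/eqP.
      apply/eqP; rewrite -[_ == _]negbK -has_filter; apply/hasPn => x.
      rewrite mem_fib // xpair_eqE -(wM x) bME => /andP[/eqP xi _].
      by apply: contra ni => /eqP <-; rewrite xi.
    rewrite (@sum_three _ i) => [|m]; last by rewrite e => /negbTE ->.
    have [[f1 m1 f2 m2 f3] m3] := flmd3 i.
    rewrite !e f1 f2 f3 eqxx s0 s2.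
    by move: (A i j) (T i j) (T _ _) (_%:Z) => x y z u; lia.
  move=> m j; rewrite /cp; have [em he] := flmd m.
  have [e|[e|e]] : md m = 0 \/ md m = 1 \/ md m = 2 by lia.
  - by rewrite e /= -s0; congr (size (fib _ (_, _)))%:Z; rewrite {1}em e; lia.
  - by rewrite e /= -s1; congr (size (fib _ (_, _)))%:Z; rewrite {1}em e; lia.
  - by rewrite e /= -s2; congr (size (fib _ (_, _)))%:Z; rewrite {1}em e; lia.
move=> H; apply/funext => i; apply/funext => j; rewrite ph H /cp.
by have [[-> -> _ _ _] _] := flmd3 i.
Qed.
End Construction.

Lemma ell_wAT : (ell d (w_AT d r A B T))%:Z * 8
  = qsum n (fun m j => 2 * cp A T m j - Jm 3 r.+1%:Z m j) winv.
Proof.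
have [mu [g2 [nu [e hmu hnu hD Ae]]]] := kappa_datumP hd hA.
have g2W : Wgrp d g2 by case: hD => -[].
have [h2 [h2W gh hg]] := W_inv g2W.
have hdl : Lambda d dl := dl_Lambda hd hA hB hBtri hAB.
have pf w : phi_fiber d r A B T w <-> Dmin d dl w /\ Wpar d mu w /\ phi d dl g2 nu w = T.
  by rewrite /phi_fiber e.
have wge w : phi_fiber d r A B T w ->
  qsum n (fun m j => 2 * cp A T m j - Jm 3 r.+1%:Z m j) winv <= (ell d w)%:Z * 8.
  move=> /pf[wD [wP wT]]; have wW := Wpar_W hd wP; have [hw [hwW wh hwK]] := W_inv wW.
  have wM := Wpar_beta hmu hd wP.
  rewrite ell_inv8 //; apply: (w_length_ge hmu hnu g2W gh hg Ae hD wW wh hwK wM _).1.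
  exact: (phi_cp hmu hnu g2W gh hg Ae wW wh hwK wM).1 wT.
have [w [hw [[wW wh hwK] wM wsz winvs winc]]] := w_exists hmu hnu g2W gh hg Ae hD.
have we : (ell d w)%:Z * 8 = qsum n (fun m j => 2 * cp A T m j - Jm 3 r.+1%:Z m j) winv.
  by rewrite ell_inv8 //; apply: (w_length_ge hmu hnu g2W gh hg Ae hD wW wh hwK wM wsz).2.
have wf : phi_fiber d r A B T w.
  apply/pf; split; first exact/(DminP hdl hd wW wh hwK).
  split; first exact: beta_Wpar.
  exact: (phi_cp hmu hnu g2W gh hg Ae wW wh hwK wM).2 wsz.
rewrite /w_AT; case: xgetP => [w' -> [w'f w'm]|no].
  apply/le_anti; rewrite (wge _ w'f) andbT -we; have := w'm w wf; lia.
exfalso; apply: (no w); split => // w' w'f; have := wge _ w'f; rewrite -we; lia.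
Qed.
End MinimalElement.

(** * Gaussian binomial coefficients *)

Lemma v_neq0 : v != 0.
Proof. by rewrite /v tofrac_eq0 polyX_eq0. Qed.

Lemma v_exp_neq1 (k : nat) : (0 < k)%N -> v ^+ k != 1.
Proof.
move=> k0; rewrite /v -rmorphXn /= -tofrac1 tofrac_eq.
by apply/eqP => /(congr1 (size \o val)) /=; rewrite size_polyXn size_poly1; case: k k0.
Qed.

Opaque Qv v.

Lemma v2_neq1 : v ^+ 2 - 1 != 0.
Proof. by rewrite subr_eq0 v_exp_neq1. Qed.

Lemma qint0 : qint 0 = 0. Proof. by rewrite /qint mulr0 expr0z subrr mul0r. Qed.

Lemma qint_neq0 (k : nat) : (0 < k)%N -> qint k%:Z != 0.
Proof.
move=> k0; rewrite /qint; apply: mulf_neq0; last by rewrite invr_eq0 v2_neq1.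
rewrite subr_eq0 (_ : 2 * k%:Z = (2 * k)%N%:Z); last by lia.
by rewrite -exprnP; apply: v_exp_neq1; lia.
Qed.

Lemma qintD m k : qint (m + k) = qint m + v ^ (2 * m) * qint k.
Proof.
rewrite /qint mulrA -mulrDl; congr (_ / _).
rewrite mulrDr expfzDr ?v_neq0 // mulrBr mulr1.
by rewrite [RHS]addrC addrA subrK.
Qed.

Lemma qfact0 : qfact 0 = 1. Proof. by rewrite /qfact big_geq. Qed.

Lemma qfactS (k : nat) : qfact k.+1%:Z = qfact k%:Z * qint k.+1%:Z.
Proof. by rewrite /qfact !absz_nat big_nat_recr. Qed.

Lemma qfact_neq0 k : qfact k != 0.
Proof.
rewrite /qfact; elim: `|k|%N => [|m IH]; first by rewrite big_geq ?oner_neq0.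
by rewrite big_nat_recr; [apply: mulf_neq0; [exact: IH|exact: qint_neq0]|].
Qed.

(** The falling product [m] [m - 1] ... [m - k + 1]. *)
Definition qfall (m : int) (k : nat) : Qv := \prod_(0 <= i < k) qint (m - i%:Z).

Lemma qfallS m k : qfall m k.+1 = qfall m k * qint (m - k%:Z).
Proof. by rewrite /qfall big_nat_recr. Qed.

Lemma qfallSl m k : qfall (m + 1) k.+1 = qint (m + 1) * qfall m k.
Proof.
rewrite /qfall big_nat_recl // subr0; congr (_ * _).
by apply: eq_bigr => i _; congr qint; lia.
Qed.

Lemma qbinomE m (k : nat) : qbinom m k%:Z = qfall m k / qfact k%:Z.
Proof. by rewrite /qbinom absz_nat. Qed.

Lemma qbinom0 m : qbinom m 0 = 1.
Proof. by rewrite (qbinomE m 0) /qfall big_geq // qfact0 divr1. Qed.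

Lemma qfall_fact (m k : nat) : (k <= m)%N ->
  qfall m%:Z k * qfact (m - k)%N%:Z = qfact m%:Z.
Proof.
elim: k => [|k IH] km; first by rewrite /qfall big_geq // mul1r subn0.
rewrite -(IH (ltnW km)) qfallS (_ : (m - k = (m - k.+1).+1)%N); last by lia.
rewrite qfactS -mulrA; congr (_ * _); rewrite mulrC; congr (_ * qint _); lia.
Qed.

Lemma qfall_small (m k : nat) : (m < k)%N -> qfall m%:Z k = 0.
Proof.
move=> mk; rewrite /qfall (big_cat_nat (n := m)) //=; last exact: ltnW.
by rewrite [X in _ * X]big_ltn // subrr qint0 mul0r mulr0.
Qed.

Lemma qbinom_fact (m k : int) : 0 <= k <= m ->
  qbinom m k = qfact m / (qfact k * qfact (m - k)).
Proof.
move=> h; have -> : m = `|m|%N%:Z by lia.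
have -> : k = `|k|%N%:Z by lia.
have km : (`|k| <= `|m|)%N by lia.
rewrite qbinomE -(qfall_fact km) (_ : `|m|%N%:Z - `|k|%N%:Z = (`|m| - `|k|)%N%:Z); last by lia.
by rewrite -mulf_div divff ?qfact_neq0 // mulr1.
Qed.

Lemma qbinom_small (m k : int) : 0 <= m < k -> qbinom m k = 0.
Proof.
move=> h; have -> : m = `|m|%N%:Z by lia.
have -> : k = `|k|%N%:Z by lia.
by rewrite qbinomE qfall_small ?mul0r //; lia.
Qed.

Lemma frac_common (F : fieldType) (K Q f : F) : K != 0 -> Q / f = Q * K / (f * K).
Proof. by move=> K0; rewrite -[LHS]mulr1 -(divff K0) mulf_div. Qed.

Lemma pascal_frac1 (F : fieldType) (K w z Q f : F) : K != 0 ->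
  (K + w * z) * Q / (f * K) = w * (Q * z / (f * K)) + Q / f.
Proof.
move=> K0; rewrite (frac_common Q f K0) (mulrA w) -mulrDl; congr (_ / _).
by rewrite mulrDl addrC (mulrC K) -mulrA (mulrC z).
Qed.

Lemma pascal_frac2 (F : fieldType) (K w z Q f : F) : K != 0 ->
  (z + w * K) * Q / (f * K) = Q * z / (f * K) + w * (Q / f).
Proof.
move=> K0; rewrite (frac_common Q f K0) (mulrA w) -mulrDl; congr (_ / _).
by rewrite mulrDl (mulrC z) -mulrA (mulrC K).
Qed.

Lemma pascal1 m (k : nat) :
  qbinom (m + 1) k.+1%:Z = v ^ (2 * k.+1%:Z) * qbinom m k.+1%:Z + qbinom m k%:Z.
Proof.
rewrite !qbinomE qfallSl qfallS (_ : m + 1 = k.+1%:Z + (m - k%:Z)); last by lia.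
by rewrite qintD qfactS; apply: pascal_frac1; exact: qint_neq0.
Qed.

Lemma pascal2 m (k : nat) :
  qbinom (m + 1) k.+1%:Z = qbinom m k.+1%:Z + v ^ (2 * (m - k%:Z)) * qbinom m k%:Z.
Proof.
rewrite !qbinomE qfallSl qfallS (_ : m + 1 = (m - k%:Z) + k.+1%:Z); last by lia.
by rewrite (qintD (m - k%:Z)) qfactS; apply: pascal_frac2; exact: qint_neq0.
Qed.

(** The q-analogue of the Vandermonde convolution; S may be any integer. *)
Lemma vandermonde (m : nat) (S : int) (c : nat) :
  \sum_(0 <= i < c.+1) qbinom m%:Z i%:Z * qbinom S (c%:Z - i%:Z)
      * v ^ (2 * (i%:Z * (S - c%:Z + i%:Z)))
  = qbinom (S + m%:Z) c%:Z.
Proof.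
elim: m S => [|m IH] S.
  rewrite big_nat_recl // big1_seq => [|i /= _].
    by rewrite qbinom0 mul1r mul0r mulr0 expr0z mulr1 subr0 !addr0.
  by rewrite qbinom_small ?mul0r //; lia.
have -> : S + m.+1%:Z = (S + 1) + m%:Z by lia.
rewrite -IH.
have step i : qbinom m.+1%:Z i.+1%:Z = v ^ (2 * i.+1%:Z) * qbinom m%:Z i.+1%:Z + qbinom m%:Z i%:Z.
  by rewrite -pascal1; congr (qbinom _ _); lia.
pose A i := qbinom m%:Z i%:Z * qbinom S (c%:Z - i%:Z) * v ^ (2 * (i%:Z * (S + 1 - c%:Z + i%:Z))).
pose B i := qbinom m%:Z i%:Z * qbinom S (c%:Z - i.+1%:Z)
  * v ^ (2 * (i.+1%:Z * (S - c%:Z + i.+1%:Z))).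
transitivity (\sum_(0 <= i < c.+1) A i + \sum_(0 <= i < c) B i).
  rewrite [LHS]big_nat_recl // [X in _ = X + _]big_nat_recl // -[RHS]addrA -big_split /=.
  congr (_ + _); first by rewrite /A !qbinom0 !mul0r.
  apply: eq_bigr => i _; rewrite step /A /B mulrDl mulrDl; congr (_ + _).
  rewrite [v ^ _ * qbinom _ _]mulrC [_ * v ^ _ * qbinom _ _]mulrAC -[_ * v ^ _ * v ^ _]mulrA -expfzDr ?v_neq0 //.
  by congr (_ * v ^ _); lia.
rewrite [RHS]big_nat_recr //= [X in X + _ = _]big_nat_recr //= -addrA [A c + _]addrC addrA.
rewrite -big_split /=; congr (_ + _); last first.
  by rewrite /A subrr !qbinom0.
apply: eq_big_nat => i hi.
have -> : c%:Z - i%:Z = (c - i.+1)%N.+1%:Z by lia.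
rewrite pascal2 mulrDr mulrDl /A /B; congr (_ + _).
  by congr (_ * qbinom _ _ * v ^ _); lia.
rewrite (_ : c%:Z - i.+1%:Z = (c - i.+1)%N%:Z); last by lia.
rewrite [v ^ _ * qbinom _ _]mulrC [qbinom _ _ * (_ * v ^ _)]mulrA -[_ * v ^ _ * v ^ _]mulrA -expfzDr ?v_neq0 //.
by congr (_ * v ^ _); lia.
Qed.

(** * The Vandermonde identity in several variables *)

Lemma fsum_partition_sub (T K : choiceType) (V : zmodType) (P : set T) (Q : set K)
    (f : T -> K) (F : T -> V) : finite_set P -> (forall p, P p -> Q (f p)) ->
  \sum_(p \in P) F p = \sum_(k \in Q) \sum_(p \in P `&` [set p | f p = k]) F p.
Proof.
move=> fP PQ; rewrite (fsum_partition f) //; apply: fsbig_widen.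
  by move=> k [p Pp <-]; exact: PQ.
move=> k [_ nk]; apply: fsbig1 => p [Pp fp]; exfalso; apply: nk; by exists p.
Qed.

Lemma finite_box (I : choiceType) (W : seq I) (B : I -> int) :
  finite_set [set p : I -> int | (forall k, k \notin W -> p k = 0) /\
     (forall k, 0 <= p k <= B k)].
Proof.
elim: W => [|k W IH].
  apply: (@sub_finite_set _ _ [set (fun _ => 0 : int)]); last exact: finite_set1.
  by move=> p [p0 _] /=; apply/funext => k; exact: p0.
pose g (q : int * (I -> int)) : I -> int := fun j => if j == k then q.1 else q.2 j.
apply: (@sub_finite_set _ _ (g @` ([set x : int | 0 <= x <= B k] `*`
  [set p : I -> int | (forall k, k \notin W -> p k = 0) /\
     (forall k, 0 <= p k <= B k)]))); last first.
  by apply: finite_image; apply: finite_setX; first exact: finite_zrange.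
move=> p [p0 pB]; exists (p k, fun j => if j == k then 0 else p j).
  split; first exact: pB.
  split=> j /=.
    by move=> jW; case: eqVneq => // jk; apply: p0; rewrite inE negb_or jk.
  by case: eqVneq => // _; have := pB j; lia.
by apply/funext => j; rewrite /g /=; case: eqVneq => // ->.
Qed.

Section Window.
Variable W : seq int.
Hypothesis uW : uniq W.

Lemma sumW (F : int -> int) k : k \in W ->
  \sum_(j <- W) F j = F k + \sum_(j <- W | j != k) F j.
Proof. by move=> kW; rewrite (bigD1_seq k). Qed.

Lemma prodW (F : int -> Qv) k : k \in W ->
  \prod_(j <- W) F j = F k * \prod_(j <- W | j != k) F j.
Proof. by move=> kW; rewrite (bigD1_seq k). Qed.

(** The vector p with its entry at b replaced by i. *)
Definition upd (p : int -> int) (b i : int) : int -> int :=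
  fun k => if k == b then i else p k.

(** Vectors below s with entries on W, below position b, and with sum t. *)
Definition Pset (b : int) (s : int -> int) (t : int) : set (int -> int) :=
  [set p | [/\ (forall k, k \notin W -> p k = 0), (forall k, b <= k -> p k = 0),
     (forall k, 0 <= p k <= s k) & \sum_(k <- W) p k = t]].

(** The exponent of v^2 in the several-variable identity. *)
Definition evec (s p : int -> int) : int :=
  \sum_(k <- W) p k * \sum_(j <- W | j < k) (s j - p j).

Lemma Pset_fin b s t : finite_set (Pset b s t).
Proof. by apply: sub_finite_set (finite_box W s) => p [h1 _ h2 _]. Qed.

Lemma sum_upd p b i : b \in W -> p b = 0 ->
  \sum_(k <- W) upd p b i k = \sum_(k <- W) p k + i.
Proof.
move=> bW pb; rewrite (sumW _ bW) [in RHS](sumW _ bW) /upd eqxx pb add0r addrC.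
by congr (_ + _); apply: eq_bigr => k /negbTE ->.
Qed.

Lemma evec_upd s p b i t : b \in W -> (forall k, b <= k -> p k = 0) ->
  \sum_(k <- W) p k = t ->
  evec s (upd p b i) = evec s p + i * (\sum_(j <- W | j < b) s j - t).
Proof.
move=> bW p0 pt; rewrite /evec (sumW _ bW) [X in _ = X + _](sumW _ bW).
rewrite p0 // mul0r add0r /upd eqxx addrC; congr (_ + _).
  apply: eq_bigr => k /negbTE kb; rewrite kb.
  case: (ltP b k) => c; first by rewrite p0 ?mul0r // ltW.
  congr (_ * _); apply: eq_bigr => j jk; rewrite (_ : (j == b) = false) //.
  by apply/negP => /eqP jb; move: jk; rewrite jb ltNge c.
have pb j : (j == b) = false -> (b <= j) = false -> True by [].
have tb : t = \sum_(j <- W | j < b) p j.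
  rewrite -pt [RHS]big_mkcond; apply: eq_bigr => j _.
  by case: ltP => // bj; rewrite p0.
congr (_ * _); rewrite tb -sumrB; apply: eq_bigr => j jb.
by rewrite lt_eqF.
Qed.

Lemma qfact_prod_neq0 (f : int -> int) : \prod_(k <- W) qfact (f k) != 0.
Proof.
by apply: (big_ind (fun x => x != 0)) => [|x y|k _];
  [exact: oner_neq0|exact: mulf_neq0|exact: qfact_neq0].
Qed.

Lemma sumW0 (s : int -> int) : (forall k, 0 <= s k) -> \sum_(k <- W) s k = 0 ->
  forall k, k \in W -> s k = 0.
Proof.
move=> s0 e k kW; move: e; rewrite (sumW _ kW) => e.
have : 0 <= \sum_(j <- W | j != k) s j by apply: sumr_ge0.
by have := s0 k; lia.
Qed.

(** The summand of the several-variable identity. *)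
Definition vterm (s p : int -> int) : Qv :=
  v ^ (2 * evec s p) / ((\prod_(k <- W) qfact (p k)) * \prod_(k <- W) qfact (s k - p k)).

Lemma Pset_upd b s t (i : nat) : b \in W -> (i%:Z <= s b) -> 
  set_bij (Pset b s (t - i%:Z)) (Pset (b + 1) s t `&` [set p | `|p b|%N = i])
    (fun p => upd p b i%:Z).
Proof.
move=> bW ib; split.
- move=> p [h1 h2 h3 h4]; have pb : p b = 0 by apply: h2.
  split; last by rewrite /= /upd eqxx.
  split=> [k kW|k bk|k|].
  + by rewrite /upd; case: eqVneq => [e|_]; [rewrite -e (negbTE kW) in bW|exact: h1].
  + by rewrite /upd; case: eqVneq => [e|_]; [lia|apply: h2; lia].
  + by rewrite /upd; case: eqVneq => [->|_]; [rewrite ib|exact: h3].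
  + by rewrite sum_upd // h4; lia.
- move=> p p' /set_mem[_ h2 _ _] /set_mem[_ h2' _ _] e; apply/funext => k.
  have := congr1 (fun f => f k) e; rewrite /upd; case: eqVneq => // -> _.
  by rewrite h2 // h2'.
- move=> p [[h1 h2 h3 h4] /= pb].
  have pbi : p b = i%:Z by have := h3 b; lia.
  exists (upd p b 0); last first.
    by apply/funext => k; rewrite /upd; case: eqVneq => // ->.
  split=> [k kW|k bk|k|].
  + by rewrite /upd; case: eqVneq => // _; exact: h1.
  + by rewrite /upd; case: eqVneq => // ne; apply: h2; lia.
  + by rewrite /upd; case: eqVneq => [->|_]; [have := h3 b; lia|exact: h3].
  + have e : upd (upd p b 0) b i%:Z = p.
      by apply/funext => k; rewrite /upd; case: eqVneq => // ->.
    have := @sum_upd (upd p b 0) b i%:Z bW; rewrite e h4 => -> //; first by rewrite addrK.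
    by rewrite /upd eqxx.
Qed.

Lemma frac_upd (F : fieldType) (x y fi fd fs P1 P2 : F) : fs != 0 ->
  x * y / (fi * P1 * (fd * P2)) = fs / (fi * fd) * y * (x / (P1 * (fs * P2))).
Proof.
move=> fs0; rewrite (frac_common _ _ fs0) [X in _ = X * _]mulrAC mulf_div; congr (_ / _).
  by rewrite mulrC (mulrC x) mulrA.
by rewrite [fi * P1 * _]mulrACA [P1 * (fs * _)]mulrCA [RHS]mulrA [LHS]mulrAC.
Qed.

Lemma vterm_upd b s t p (i : nat) : b \in W -> i%:Z <= s b -> Pset b s (t - i%:Z) p ->
  vterm s (upd p b i%:Z) =
  qbinom (s b) i%:Z * v ^ (2 * (i%:Z * (\sum_(j <- W | j < b) s j - t + i%:Z))) * vterm s p.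
Proof.
move=> bW ib [h1 h2 h3 h4]; rewrite /vterm (evec_upd _ _ bW h2 h4).
have pb : p b = 0 by apply: h2.
rewrite mulrDr expfzDr ?v_neq0 // [in LHS](prodW _ bW) [X in _ / (_ * X)](prodW _ bW).
rewrite [X in _ = _ * (_ / (X * _))](prodW _ bW) [X in _ = _ * (_ / (_ * X))](prodW _ bW).
rewrite /upd eqxx pb subr0 qfact0 mul1r.
set P1 := \prod_(_ <- _ | _) qfact (p _).
set P2 := \prod_(_ <- _ | _) qfact (_ - p _).
have -> : \prod_(j <- W | j != b) qfact (if j == b then i%:Z else p j) = P1.
  by apply: eq_bigr => j /negbTE ->.
have -> : \prod_(j <- W | j != b) qfact (s j - (if j == b then i%:Z else p j)) = P2.
  by apply: eq_bigr => j /negbTE ->.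
rewrite qbinom_fact; last by rewrite ib.
rewrite (_ : \sum_(j <- W | j < b) s j - (t - i%:Z) = \sum_(j <- W | j < b) s j - t + i%:Z); last by lia.
by apply: frac_upd; exact: qfact_neq0.
Qed.

Lemma Pset_base b s t : (forall k, k \in W -> b <= k) ->
  Pset b s t = [set p | p = (fun=> 0) /\ t = 0 /\ forall k, 0 <= s k].
Proof.
move=> bW; apply/funext => p; apply/propext; split.
  move=> [h1 h2 h3 h4].
  have p0 : p = (fun=> 0).
    by apply/funext => k; case: (boolP (k \in W)) => [/bW|]; [exact: h2|exact: h1].
  split=> //; split; first by rewrite -h4 p0 big1.
  by move=> k; have := h3 k; lia.
move=> [-> [-> s0]]; split; [by []|by []|by move=> k; rewrite lexx s0|].
by rewrite big1.
Qed.

Lemma vandermonde_base b s t : (forall k, 0 <= s k) -> 0 <= t ->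
  (forall k, k \in W -> b <= k) ->
  \sum_(p \in Pset b s t) vterm s p =
    qbinom (\sum_(k <- W | k < b) s k) t / \prod_(k <- W) qfact (s k).
Proof.
move=> s0 t0 bW; rewrite Pset_base //.
have -> : \sum_(k <- W | k < b) s k = 0.
  rewrite big_seq_cond big1 // => k /andP[/bW]; by rewrite leNgt => /negbTE ->.
case: (eqVneq t 0) => [->|tn].
  have -> : [set p : int -> int | p = (fun=> 0) /\ (0 : int) = 0 /\ (forall k, 0 <= s k)] = [set (fun=> 0 : int)].
    by apply/funext => p; apply/propext; split => /= [[]|->].
  rewrite fsbig_set1 qbinom0 /vterm /evec (big1 _ _ (fun=> 0 * _)) => [|k _]; last by rewrite mul0r.
  rewrite mulr0 expr0z [X in _ / (X * _)]big1 => [|k _]; last by rewrite qfact0.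
  by rewrite !mul1r; congr (_^-1); apply: eq_bigr => k _; rewrite subr0.
rewrite qbinom_small ?mul0r; last by lia.
by apply: fsbig1 => p [_ [t0' _]]; rewrite t0' eqxx in tn.
Qed.

(** The Vandermonde identity in several variables: one column of a strictly upper
    triangular matrix is summed out. *)
Lemma vandermonde_multi b s t : (forall k, 0 <= s k) -> (forall k, k \notin W -> s k = 0) ->
  (0 <= t) ->
  \sum_(p \in Pset b s t) vterm s p =
    qbinom (\sum_(k <- W | k < b) s k) t / \prod_(k <- W) qfact (s k).
Proof.
move=> s0 sW t0; have [K hK] : exists K : nat, forall k, k \in W -> - K%:Z <= k.
  exists (\sum_(k <- W) `|k|)%N => k kW; rewrite (big_rem k) //=; lia.
have [j ->] : exists j : int, b = j - K%:Z by exists (b + K%:Z); lia.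
case: j => [j|j]; last by apply: vandermonde_base => // k /hK; lia.
elim: j t t0 => [|j IH] t t0; first by apply: vandermonde_base => // k /hK; lia.
have -> : j.+1%:Z - K%:Z = (j%:Z - K%:Z) + 1 by lia.
move: (j%:Z - K%:Z) IH => {}b IH.
case: (boolP (b \in W)) => bW; last first.
  have -> : Pset (b + 1) s t = Pset b s t.
    apply/funext => p; apply/propext; split=> -[h1 h2 h3 h4]; split=> // k bk.
      by case: (eqVneq k b) => [->|kb]; [exact: h1|apply: h2; lia].
    by apply: h2; lia.
  rewrite IH //; congr (qbinom _ _ / _).
  rewrite big_seq_cond [RHS]big_seq_cond; apply: eq_bigl => k.
  case: (boolP (k \in W)) => //= kW; have : k != b by apply: contra bW => /eqP <-.
  by lia.
rewrite (@fsum_partition_sub _ _ _ _ `I_(`|t|.+1) (fun p => `|p b|%N)); last 2 first.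
- exact: Pset_fin.
- move=> p [h1 h2 h3 h4] /=; have := h3 b; rewrite -h4 (sumW _ bW).
  have : 0 <= \sum_(j0 <- W | j0 != b) p j0 by apply: sumr_ge0 => k _; have := h3 k; lia.
  by move: (\sum_(_ <- _ | _) _) (s b) => x y; lia.
rewrite -fsbig_ord.
have -> : \sum_(k <- W | k < b + 1) s k = \sum_(k <- W | k < b) s k + s b.
  rewrite big_mkcond [X in _ = X + _]big_mkcond !(sumW _ bW) ltxx ltrDl ltr01 add0r addrC.
  by congr (_ + _); apply: eq_bigr => k kb; rewrite (_ : (k < b + 1) = (k < b)) //; lia.
have [sb sbE] : exists sb : nat, s b = sb%:Z by exists `|s b|%N; have := s0 b; lia.
have [tn tE] : exists tn : nat, t = tn%:Z by exists `|t|%N; lia.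
rewrite sbE tE -vandermonde big_mkord mulr_suml absz_nat; apply: eq_bigr => i _.
case: (leqP i sb) => isb; last first.
  rewrite (@qbinom_small sb%:Z) ?mul0r; last by lia.
  apply: fsbig1 => p [[_ _ h3 _] /= e]; have := h3 b; lia.
rewrite (reindex_fsbig (fun p => upd p b i%:Z) (Pset b s (t - i%:Z))); last first.
  by rewrite -tE; apply: Pset_upd => //; rewrite sbE; lia.
rewrite (eq_fsbigr (fun p => qbinom (s b) i%:Z * v ^ (2 * (i%:Z * (\sum_(j <- W | j < b) s j - t + i%:Z))) * vterm s p)); last first.
  by move=> p /set_mem hp; apply: (vterm_upd bW _ hp); rewrite sbE; lia.
rewrite -mulr_fsumr IH //; last by rewrite tE; have := ltn_ord i; lia.
rewrite tE sbE [LHS]mulrA; congr (_ / _); rewrite mulrAC; congr (_ * v ^ _); lia.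
Qed.
End Window.

(** * Sums over strictly upper triangular matrices *)

Section Window.
Variable W : seq int.
Hypothesis uW : uniq W.

(** Strictly upper triangular matrices on W with row sums s and column sums c. *)
Definition SU (s c : int -> int) : set mat :=
  [set t | [/\ (forall k l, (k \notin W) || (l \notin W) -> t k l = 0),
    (forall k l, 0 <= t k l), (forall k l, l <= k -> t k l = 0),
    (forall k, \sum_(l <- W) t k l = s k) & (forall l, \sum_(k <- W) t k l = c l)]].

(** The number of nested pairs of entries of t and u. *)
Definition nest (t u : mat) : int :=
  \sum_(k <- W) \sum_(l <- W) \sum_(p <- W | p < k) \sum_(q <- W | l < q) t k l * u p q.

(** The product of the factorials of the entries. *)
Definition mprod (t : mat) : Qv := \prod_(k <- W) \prod_(l <- W) qfact (t k l).

Lemma mat_box (B : int) : finite_set [set t : mat |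
   (forall k l, (k \notin W) || (l \notin W) -> t k l = 0) /\
   (forall k l, 0 <= t k l <= B)].
Proof.
pose I := [seq (k, l) | k <- W, l <- W].
pose g (p : int * int -> int) : mat := fun k l => p (k, l).
apply: (@sub_finite_set _ _ (g @` [set p : int * int -> int | (forall k, k \notin I -> p k = 0) /\
  (forall k, 0 <= p k <= B)])); last first.
  by apply: finite_image; exact: (finite_box I (fun=> B)).
move=> t [t0 tB]; exists (fun p => t p.1 p.2) => //; split=> [[k l] kl|[k l]]; last exact: tB.
apply: t0; rewrite -negb_and; apply: contra kl => /andP[kW lW].
by apply/allpairsP; exists (k, l).
Qed.

Lemma SU_le s c t k l : SU s c t -> t k l <= s k.
Proof.
move=> [h1 h2 h3 h4 h5]; rewrite -h4; case: (boolP (l \in W)) => lW; last first.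
  by rewrite h1 ?lW ?orbT //; apply: sumr_ge0.
by rewrite (sumW uW _ lW) lerDl; apply: sumr_ge0.
Qed.

Lemma SU_fin s c : finite_set (SU s c).
Proof.
have fB : forall t k l, SU s c t -> t k l <= \sum_(j <- W) `|s j|.
  move=> t k l ht; case: (boolP (k \in W)) => kW; last first.
    by case: ht => -> //; rewrite ?kW // => _ _ _ _; apply: sumr_ge0.
  apply: (le_trans (SU_le k l ht)); rewrite (sumW uW _ kW).
  have : 0 <= \sum_(j <- W | j != k) `|s j| by apply: sumr_ge0.
  by move: (\sum_(_ <- _ | _) _) => x; lia.
apply: sub_finite_set (mat_box (\sum_(j <- W) `|s j|)) => t ht.
split; first by case: ht.
by move=> k l; rewrite fB //; case: ht => _ -> .
Qed.

(** The matrix t with its column l0 replaced by p. *)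
Definition setcol (p : int -> int) (l0 : int) (t : mat) : mat :=
  fun k l => if l == l0 then p k else t k l.

Lemma SU_col s c l0 p : l0 \in W -> (forall k, 0 <= s k) -> (forall k, k \notin W -> s k = 0) ->
  Pset W l0 s (c l0) p ->
  set_bij (SU (fun k => s k - p k) (upd c l0 0)) (SU s c `&` [set t | (fun k => t k l0) = p])
    (setcol p l0).
Proof.
move=> lW s0 sW [p1 p2 p3 p4]; split.
- move=> t [h1 h2 h3 h4 h5].
  have t0 k : t k l0 = 0.
    case: (boolP (k \in W)) => kW; last by rewrite h1 ?kW.
    by apply: (@sumW0 W uW (t^~ l0)) => //; rewrite h5 /upd eqxx.
  split; last by apply/funext => k; rewrite /setcol eqxx.
  split=> [k l|k l|k l|k|l].
  + rewrite /setcol; case: eqVneq => [->|_]; last exact: h1.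
    by rewrite lW orbF; exact: p1.
  + by rewrite /setcol; case: eqVneq => _ //; have := p3 k; lia.
  + by rewrite /setcol; case: eqVneq => [->|_]; [exact: p2|exact: h3].
  + have := h4 k; rewrite !(sumW uW _ lW) /setcol eqxx t0 add0r => e.
    rewrite (eq_bigr (t k)); last by move=> j /negbTE ->.
    by rewrite e; lia.
  + rewrite /setcol; case: eqVneq => [->|ne]; first exact: p4.
    by rewrite h5 /upd (negbTE ne).
- move=> t t' /set_mem[h1 h2 h3 h4 h5] /set_mem[h1' h2' h3' h4' h5'] e.
  apply/funext => k; apply/funext => l.
  have := congr1 (fun f => f k l) e; rewrite /setcol; case: eqVneq => // -> _.
  have z (u : mat) : (forall k l, (k \notin W) || (l \notin W) -> u k l = 0) ->
     (forall k l, 0 <= u k l) -> \sum_(k <- W) u k l0 = 0 -> u k l0 = 0.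
    move=> u1 u2 u5; case: (boolP (k \in W)) => kW; last by rewrite u1 ?kW.
    exact: (@sumW0 W uW (u^~ l0)).
  by rewrite !z // ?h5 ?h5' /upd eqxx.
- move=> t [[h1 h2 h3 h4 h5] /= tp].
  have tpk k : t k l0 = p k by rewrite -tp.
  exists (setcol (fun=> 0) l0 t); last first.
    by apply/funext => k; apply/funext => l; rewrite /setcol; case: eqVneq => // ->; rewrite tpk.
  split=> [k l|k l|k l|k|l].
  + by rewrite /setcol; case: eqVneq => // _; exact: h1.
  + by rewrite /setcol; case: eqVneq.
  + by rewrite /setcol; case: eqVneq => // _; exact: h3.
  + have := h4 k; rewrite !(sumW uW _ lW) /setcol eqxx tpk => e.
    rewrite (eq_bigr (t k)); last by move=> j /negbTE ->.
    by rewrite -e add0r [p k + _]addrC addrK.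
  + rewrite /setcol /upd; case: eqVneq => [_|ne]; last exact: h5.
    by rewrite big1.
Qed.

Lemma sum_cond (P : pred int) (F : int -> int) :
  \sum_(j <- W | P j) F j = \sum_(j <- W) (P j)%:Z * F j.
Proof. by rewrite big_mkcond; apply: eq_bigr => j _; case: (P j); rewrite ?mul1r ?mul0r. Qed.

Lemma nest_setcol s c l0 p t : l0 \in W -> (forall l, l < l0 -> c l = 0) ->
  (forall k, k \notin W -> s k = 0) -> Pset W l0 s (c l0) p ->
  SU (fun k => s k - p k) (upd c l0 0) t ->
  nest (setcol p l0 t) (setcol p l0 t) = nest t t + evec W s p.
Proof.
move=> lW c0 sW [p1 p2 p3 p4] [h1 h2 h3 h4 h5].
have t0 k l : l <= l0 -> t k l = 0.
  move=> ll; case: (boolP (k \in W)) => kW; last by rewrite h1 ?kW.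
  case: (boolP (l \in W)) => lW'; last by rewrite h1 ?lW' ?orbT.
  apply: (@sumW0 W uW (t^~ l)) => //; rewrite h5 /upd; case: eqVneq => // ne.
  by apply: c0; lia.
rewrite /nest /evec -big_split /=; apply: eq_bigr => k _.
rewrite !(sumW uW _ lW) /setcol eqxx.
rewrite [X in _ = X + _ + _]big1 => [|q _]; last first.
  by rewrite big1 // => q' _; rewrite t0 // mul0r.
rewrite add0r [RHS]addrC; congr (_ + _).
  rewrite mulr_sumr; apply: eq_bigr => j jk.
  rewrite -h4 mulr_sumr [LHS]big_mkcond; apply: eq_bigr => l _.
  case: ltP => ll; last by rewrite t0 // mulr0.
  by rewrite (gt_eqF ll).
apply: eq_bigr => l /negbTE ll; rewrite ll; apply: eq_bigr => j jk.
case: (leP l l0) => c1; first by rewrite t0 // !big1 // => q _; rewrite mul0r.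
by apply: eq_bigr => q lq; rewrite (gt_eqF (lt_trans c1 lq)).
Qed.

Lemma mprod_setcol p l0 t : l0 \in W -> (forall k, t k l0 = 0) ->
  mprod (setcol p l0 t) = (\prod_(k <- W) qfact (p k)) * mprod t.
Proof.
move=> lW t0; rewrite /mprod -big_split /=; apply: eq_bigr => k _.
rewrite !(prodW uW _ lW) /setcol eqxx t0 qfact0 mul1r; congr (_ * _).
by apply: eq_bigr => l /negbTE ->.
Qed.

(** By induction on the number of nonzero column sums: the leftmost column can be
    summed out by [vandermonde_multi]. *)
Lemma strict_sum (s c : int -> int) : (forall k, 0 <= s k) -> (forall k, k \notin W -> s k = 0) ->
  (forall k, 0 <= c k) -> (forall k, k \notin W -> c k = 0) ->
  \sum_(k <- W) s k = \sum_(k <- W) c k ->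
  \sum_(t \in SU s c) v ^ (2 * nest t t) / mprod t
  = (\prod_(l <- W) qbinom (\sum_(k <- W | k < l) (s k - c k)) (c l))
    / \prod_(k <- W) qfact (s k).
Proof.
have [e hE] : exists e : int, forall k, k \in W -> k < e.
  exists (\sum_(k <- W) `|k| + 1) => k kW.
  rewrite (sumW uW _ kW); have : 0 <= \sum_(j <- W | j != k) `|j| by apply: sumr_ge0.
  by move: (\sum_(_ <- _ | _) _) => x; lia.
move=> s0 sW c0 cW sc.
have [j cj] : exists j : nat, forall l, l < e - j%:Z -> c l = 0.
  exists (\sum_(k <- W) `|e - k|)%N => l le; apply: cW; apply/negP => lW.
  by move: le; rewrite (big_rem l) //=; lia.
elim: j s c s0 sW c0 cW sc cj => [|j IH] s c s0 sW c0 cW sc cj.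
  have cz l : c l = 0.
    by case: (boolP (l \in W)) => lW; [apply: cj; have := hE l lW; lia|exact: cW].
  have sz k : s k = 0.
    case: (boolP (k \in W)) => kW; last exact: sW.
    apply: (@sumW0 W uW s) => //; rewrite sc big1 // => l _; exact: cz.
  have -> : SU s c = [set (fun _ _ => 0)].
    apply/funext => t; apply/propext; split.
      move=> ht; apply/funext => k; apply/funext => l; have := SU_le k l ht.
      by rewrite sz; case: ht => _ /(_ k l) + _ _ _; lia.
    move=> ->; split=> // [k|l]; first by rewrite big1.
    by rewrite big1.
  rewrite fsbig_set1 /nest big1 => [|k _]; last first.
    by rewrite big1 // => l _; rewrite big1 // => p _; rewrite big1.
  rewrite mulr0 expr0z; congr (_ / _).
    by rewrite big1 // => l _; rewrite cz qbinom0.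
  have -> : mprod (fun _ _ => 0) = 1.
    by rewrite /mprod big1 // => k _; rewrite big1 // => l _; rewrite qfact0.
  by rewrite big1 // => k _; rewrite sz qfact0.
set l0 := e - j.+1%:Z in cj.
case: (boolP (l0 \in W)) => lW; last first.
  apply: IH => // l le; case: (eqVneq l l0) => [->|ne]; first exact: cW.
  by apply: cj; rewrite /l0 in ne *; lia.
rewrite (@fsum_partition_sub _ _ _ (SU s c) (Pset W l0 s (c l0)) (fun t k => t k l0)); last 2 first.
- exact: SU_fin.
- move=> t ht; have hle := SU_le _ l0 ht; case: ht => [h1 h2 h3 h4 h5].
  by split=> // [k kW|k lk|k]; [apply: h1; rewrite kW|exact: h3|rewrite h2 hle].
have inner p : Pset W l0 s (c l0) p ->
  \sum_(t \in SU s c `&` [set t | (fun k => t k l0) = p]) v ^ (2 * nest t t) / mprod t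
  = (\prod_(l <- W | l != l0) qbinom (\sum_(k <- W | k < l) (s k - c k)) (c l)) * vterm W s p.
  move=> hp; have [p1 p2 p3 p4] := hp.
  rewrite (reindex_fsbig (setcol p l0) (SU (fun k => s k - p k) (upd c l0 0))); last exact: SU_col.
  rewrite (eq_fsbigr (fun t => (v ^ (2 * evec W s p) / \prod_(k <- W) qfact (p k))
     * (v ^ (2 * nest t t) / mprod t))); last first.
    move=> t /set_mem ht; rewrite (nest_setcol lW _ sW hp ht); last exact: cj.
    have t0 k : t k l0 = 0.
      case: ht => h1 h2 h3 h4 h5.
      case: (boolP (k \in W)) => kW; last by rewrite h1 ?kW.
      by apply: (@sumW0 W uW (t^~ l0)) => //; rewrite h5 /upd eqxx.
    rewrite mprod_setcol // mulrDr expfzDr ?v_neq0 // mulf_div [v ^ _ * _]mulrC.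
    by [].
  rewrite -mulr_fsumr IH.
  - rewrite /vterm; set P1 := \prod_(k <- W) qfact (p k).
    set P2 := \prod_(k <- W) qfact (s k - p k).
    have -> : \prod_(l <- W) qbinom (\sum_(k <- W | k < l) (s k - p k - upd c l0 0 k)) (upd c l0 0 l)
      = \prod_(l <- W | l != l0) qbinom (\sum_(k <- W | k < l) (s k - c k)) (c l).
      rewrite (prodW uW _ lW) [upd c l0 0 l0]/upd eqxx qbinom0 mul1r.
      apply: eq_bigr => l ll; rewrite [upd c l0 0 l]/upd (negbTE ll).
      case: (ltP l l0) => c1; first by rewrite cj // !qbinom0.
      congr (qbinom _ _); rewrite !(sum_cond (fun k => k < l)) !(sumW uW _ lW).
      have l0l : l0 < l by lia.
      rewrite l0l !mul1r /upd eqxx.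
      have sp : \sum_(k <- W | k != l0) p k = c l0.
        by rewrite -p4 (sumW uW _ lW) p2 // add0r.
      rewrite (eq_bigr (fun k => (k < l)%R%:Z * (s k - c k) - p k)); last first.
        move=> k kl; rewrite (negbTE kl); case: (ltP k l) => kl'; rewrite ?mul1r ?mul0r; first by lia.
        by rewrite p2 ?subrr //; lia.
      rewrite sumrB sp p2 //; move: (\sum_(_ <- _ | _) _) => x; lia.
    by rewrite mulf_div [RHS]mulrA [v ^ _ * _]mulrC.
  - by move=> k; have := p3 k; lia.
  - by move=> k kW; rewrite sW // p1 // subrr.
  - by move=> k; rewrite /upd; case: eqVneq.
  - by move=> k kW; rewrite /upd; case: eqVneq => // _; exact: cW.
  - rewrite sumrB p4 sc !(sumW uW _ lW) /upd eqxx.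
    rewrite [X in _ = 0 + X](eq_bigr c); last by move=> k /negbTE ->.
    by rewrite add0r addrAC subrr add0r.
  - move=> l ll; rewrite /upd; case: eqVneq => // ne; apply: cj.
    by rewrite /l0 in ne *; lia.
rewrite (eq_fsbigr (fun p => (\prod_(l <- W | l != l0) qbinom (\sum_(k <- W | k < l) (s k - c k)) (c l)) * vterm W s p)); last first.
  by move=> p /set_mem; exact: inner.
rewrite -mulr_fsumr vandermonde_multi // [X in _ = X / _](prodW uW _ lW).
rewrite [LHS]mulrA; congr (_ / _).
rewrite [LHS]mulrC; congr (_ * _); congr (qbinom _ (c l0)).
by apply: eq_bigr => k kl; rewrite cj ?subr0.
Qed.
End Window.

(** * Evaluation of n(a, gamma, beta) *)

Section Window.
Variable W : seq int.
Hypothesis uW : uniq W.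

(** Sums over all integers of a function supported on W. *)
Lemma fsW (R : Type) (idx : R) (op : Monoid.com_law idx) (F : int -> R) :
  (forall j, j \notin W -> F j = idx) ->
  \big[op/idx]_(j \in [set: int]) F j = \big[op/idx]_(j <- W) F j.
Proof.
move=> h; rewrite (@fsbigE_cond _ _ _ _ _ W) //; last by move=> j _; exact: h.
by apply: eq_bigl => j; rewrite in_setT.
Qed.

Lemma fsWc (F : int -> int) (P : pred int) :
  (forall j, j \notin W -> F j = 0) ->
  \sum_(j \in [set j | P j]) F j = \sum_(j <- W | P j) F j.
Proof.
move=> h; rewrite (@fsbigE_cond _ _ _ _ _ W) //; last by move=> j _; exact: h.
by apply: eq_bigl => j; apply/idP/idP; rewrite inE.
Qed.

Section NVec.
Variables x y x' : int -> int.
Hypotheses (x0 : forall k, 0 <= x k) (xW : forall k, k \notin W -> x k = 0).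
Hypotheses (y0 : forall k, 0 <= y k) (yW : forall k, k \notin W -> y k = 0).
Hypotheses (z0 : forall k, 0 <= x' k) (zW : forall k, k \notin W -> x' k = 0).

(** Upper triangular matrices on W with row sums x' and column sums y. *)
Definition UTW : set mat := [set t | [/\ (forall k l, (k \notin W) || (l \notin W) -> t k l = 0),
    (forall k l, 0 <= t k l), (forall k l, l < k -> t k l = 0),
    (forall k, \sum_(l <- W) t k l = x' k) & (forall l, \sum_(k <- W) t k l = y l)]].

Lemma has_sum_ge0 (f : int -> int) (m : int) j : (forall k, 0 <= f k) -> has_sum f m -> f j <= m.
Proof.
move=> f0 [ff <-]; have [->|fj] := eqVneq (f j) 0; first exact: fsumr_ge0.
rewrite (@fsbigE_cond _ _ _ _ _ (fset_set [set j | f j <> 0])) //; last first.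
  by move=> i _; rewrite in_fset_set // => /negP h; apply: contrapT => h'; apply: h; exact/mem_set.
have jf : j \in fset_set [set j | f j <> 0] by rewrite in_fset_set //; apply/mem_set/eqP.
rewrite big_mkcond (bigD1_seq j jf) ?fset_uniq // in_setT /= lerDl; apply: sumr_ge0 => i _.
by case: ifP.
Qed.

Lemma upper_triangularE : upper_triangular y x' = UTW.
Proof.
apply/funext => t; apply/propext; split.
  move=> [h1 h2 h3 h4].
  have tW k l : (k \notin W) || (l \notin W) -> t k l = 0.
    case/orP => h.
      by have := has_sum_ge0 l (h1 k) (h3 k); rewrite zW //; have := h1 k l; lia.
    by have := has_sum_ge0 k (h1^~ l) (h4 l); rewrite yW //; have := h1 k l; lia.
  split=> // [k|l].
    by case: (h3 k) => _ <-; rewrite fsW // => j jW; rewrite tW // jW orbT.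
  by case: (h4 l) => _ <-; rewrite fsW // => j jW; rewrite tW // jW.
move=> [h1 h2 h3 h4 h5]; split=> // [k|l].
  split; last by rewrite -h4 fsW // => j jW; rewrite h1 // jW orbT.
  apply: (@sub_finite_set int _ [set` W]); last exact: finite_seq.
  by move=> j /= h; apply/negPn/negP => jW; apply: h; rewrite h1 // jW orbT.
split; last by rewrite -h5 fsW // => j jW; rewrite h1 // jW.
apply: (@sub_finite_set int _ [set` W]); last exact: finite_seq.
by move=> j /= h; apply/negPn/negP => jW; apply: h; rewrite h1 // jW.
Qed.

(** The possible differences u between the column sums and the diagonal of an upper
    triangular matrix with row sums x' and column sums y. *)
Definition adm : set (int -> int) := [set u | (forall k, k \notin W -> u k = 0) /\
  (forall k, 0 <= u k <= y k /\ 0 <= u k + x' k - y k)].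

(** The row sums of the strictly upper triangular part; its column sums are u. *)
Definition offdiag (u : int -> int) (k : int) : int := u k + x' k - y k.

(** The upper triangular matrix with diagonal y - u and strict part t. *)
Definition withdiag (u : int -> int) (t : mat) : mat :=
  fun k l => if k == l then y k - u k else t k l.

Lemma UTW_fin : finite_set UTW.
Proof.
apply: sub_finite_set (mat_box W (\sum_(j <- W) x' j)) => t [h1 h2 h3 h4 h5].
split=> // k l; rewrite h2 /=; case: (boolP (k \in W)) => kW; last first.
  by rewrite h1 ?kW //; apply: sumr_ge0.
case: (boolP (l \in W)) => lW; last by rewrite h1 ?lW ?orbT //; apply: sumr_ge0.
apply: (@le_trans _ _ (x' k)); first by rewrite -h4 (sumW uW _ lW) lerDl; apply: sumr_ge0.
by rewrite (sumW uW _ kW) lerDl; apply: sumr_ge0.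
Qed.

Lemma UTW_adm t : UTW t -> adm (fun l => y l - t l l).
Proof.
move=> [h1 h2 h3 h4 h5]; split=> [k kW|k]; first by rewrite h1 ?kW // yW ?subrr.
have ty : t k k <= y k.
  case: (boolP (k \in W)) => kW; last by rewrite h1 ?kW.
  by rewrite -h5 (sumW uW _ kW) lerDl; apply: sumr_ge0.
have tx : t k k <= x' k.
  case: (boolP (k \in W)) => kW; last by rewrite h1 ?kW.
  by rewrite -h4 (sumW uW _ kW) lerDl; apply: sumr_ge0.
by have := h2 k k; lia.
Qed.

Lemma UTW_bij u : adm u ->
  set_bij (SU W (offdiag u) u) (UTW `&` [set t | (fun l => y l - t l l) = u]) (withdiag u).
Proof.
move=> [u1 u2]; split.
- move=> t [h1 h2 h3 h4 h5]; split; last first.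
    by apply/funext => l; rewrite /withdiag eqxx; lia.
  split=> [k l|k l|k l|k|l].
  + rewrite /withdiag; case: eqVneq => [->|_]; last exact: h1.
    by rewrite orbb => lW; rewrite yW // u1 // subrr.
  + by rewrite /withdiag; case: eqVneq => _ //; have := u2 k; lia.
  + by rewrite /withdiag; case: eqVneq => [->|_] lk; [lia|apply: h3; exact: ltW].
  + case: (boolP (k \in W)) => kW; last first.
      rewrite zW // big_seq big1 // => l lW; rewrite /withdiag; case: eqVneq => [e|_]; last by rewrite h1 ?kW.
      by rewrite e lW in kW.
    have := h4 k; rewrite !(sumW uW _ kW) /withdiag eqxx (h3 k k) // add0r => e.
    rewrite (eq_bigr (t k)); last by move=> j; rewrite eq_sym => /negbTE ->.
    by rewrite e /offdiag; lia.
  + case: (boolP (l \in W)) => lW; last first.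
      rewrite yW // big_seq big1 // => k kW; rewrite /withdiag; case: eqVneq => [e|_]; last by rewrite h1 ?lW ?orbT.
      by rewrite -e kW in lW.
    have := h5 l; rewrite !(sumW uW _ lW) /withdiag eqxx (h3 l l) // add0r => e.
    rewrite (eq_bigr (t^~ l)); last by move=> j /negbTE ->.
    by rewrite e; lia.
- move=> t t' /set_mem[_ _ h3 _ _] /set_mem[_ _ h3' _ _] e.
  apply/funext => k; apply/funext => l.
  have := congr1 (fun f => f k l) e; rewrite /withdiag; case: eqVneq => // -> _.
  by rewrite h3 // h3'.
- move=> t [[h1 h2 h3 h4 h5] /= tu].
  have tk k : t k k = y k - u k by rewrite -tu; lia.
  exists (fun k l => if k == l then 0 else t k l); last first.
    by apply/funext => k; apply/funext => l; rewrite /withdiag; case: eqVneq => // <-; rewrite tk.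
  split=> [k l|k l|k l|k|l].
  + by case: eqVneq => // _; exact: h1.
  + by case: eqVneq.
  + by case: eqVneq => // ne lk; apply: h3; lia.
  + case: (boolP (k \in W)) => kW; last first.
      rewrite /offdiag zW // yW // u1 // big1 // => l _; case: eqVneq => // _; by rewrite h1 ?kW.
    have := h4 k; rewrite !(sumW uW _ kW) eqxx tk => e.
    rewrite (eq_bigr (t k)); last by move=> j; rewrite eq_sym => /negbTE ->.
    rewrite /offdiag -e add0r; move: (\sum_(_ <- _ | _) _) => z; lia.
  + case: (boolP (l \in W)) => lW; last first.
      rewrite u1 // big1 // => k _; case: eqVneq => // _; by rewrite h1 ?lW ?orbT.
    have := h5 l; rewrite !(sumW uW _ lW) eqxx tk => e.
    rewrite (eq_bigr (t^~ l)); last by move=> j /negbTE ->.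
    by move: e; rewrite add0r; move: (\sum_(_ <- _ | _) _) => z; lia.
Qed.

(** The exponent of v^2 in n(x, y, x') apart from the nesting number. *)
Definition neps (u : int -> int) : int :=
  \sum_(l <- W) y l * \sum_(p <- W | p < l) x p
  + \sum_(k <- W) (y k - u k) * (x k + \sum_(p <- W | p < k) offdiag u p
       - \sum_(q <- W | q <= k) u q).

Lemma n_exp_withdiag u t : adm u -> SU W (offdiag u) u t ->
  n_exp x (withdiag u t) = neps u + nest W t t.
Proof.
move=> hu ht; have [s1 s2 s3 s4 s5] := ht; have [u1 u2] := hu.
have [hw _] : UTW (withdiag u t) /\ True.
  by split=> //; have [/(_ t ht) [] ] := UTW_bij hu.
have [h1 h2 h3 h4 h5] := hw; set w := withdiag u t in h1 h2 h3 h4 h5 *.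
have hk k l : k \notin W -> w k l = 0 by move=> kW; rewrite h1 ?kW.
have hl k l : l \notin W -> w k l = 0 by move=> lW; rewrite h1 ?lW ?orbT.
rewrite /n_exp.
have -> : \sum_(k \in [set: int]) \sum_(l \in [set: int])
     \sum_(p \in [set p : int | p < l]) w k l * x p
  = \sum_(l <- W) y l * \sum_(p <- W | p < l) x p.
  rewrite fsW => [|k kW]; last by apply: fsbig1 => l _; apply: fsbig1 => p _; rewrite hk ?mul0r.
  rewrite (eq_bigr (fun k => \sum_(l <- W) w k l * \sum_(p <- W | p < l) x p)); last first.
    move=> k _; rewrite fsW => [|l lW]; last by apply: fsbig1 => p _; rewrite hl ?mul0r.
    apply: eq_bigr => l _; rewrite (fsWc (fun p => p < l)) ?mulr_sumr // => p pW.
    by rewrite xW ?mulr0.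
  by rewrite exchange_big /=; apply: eq_bigr => l _; rewrite -mulr_suml h5.
have -> : \sum_(k \in [set: int]) w k k * x k = \sum_(k <- W) (y k - u k) * x k.
  rewrite fsW => [|k kW]; last by rewrite hk ?mul0r.
  by apply: eq_bigr => k _; rewrite /w /withdiag eqxx.
have -> : \sum_(k \in [set: int]) \sum_(l \in [set: int])
     \sum_(p \in [set p : int | p < k]) \sum_(q \in [set q : int | l < q])
       w k l * w p q = nest W w w.
  rewrite fsW => [|k kW]; last first.
    by apply: fsbig1 => l _; apply: fsbig1 => p _; apply: fsbig1 => q _; rewrite hk ?mul0r.
  apply: eq_bigr => k _; rewrite fsW => [|l lW]; last first.
    by apply: fsbig1 => p _; apply: fsbig1 => q _; rewrite hl ?mul0r.
  apply: eq_bigr => l _; rewrite (fsWc (fun p => p < k)) => [|p pW]; last first.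
    by apply: fsbig1 => q _; rewrite (hk p) ?mulr0.
  apply: eq_bigr => p _; rewrite (fsWc (fun q => l < q)) // => q qW.
  by rewrite (hl p q) ?mulr0.
have -> : nest W w w = nest W t t + \sum_(k <- W) (y k - u k) *
   (\sum_(p <- W | p < k) offdiag u p - \sum_(q <- W | q <= k) u q).
  rewrite /nest -big_split /=; apply: eq_big_seq => k kW.
  have over l : k <= l -> \sum_(p <- W | p < k) \sum_(q <- W | l < q) w p q
     = \sum_(p <- W | p < k) \sum_(q <- W | l < q) t p q.
    move=> kl; apply: eq_bigr => p pk; apply: eq_bigr => q lq.
    by rewrite /w /withdiag lt_eqF //; apply: lt_trans lq; exact: lt_le_trans kl.
  have pull (f : mat) a l : \sum_(p <- W | p < k) \sum_(q <- W | l < q) a * f p q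
     = a * \sum_(p <- W | p < k) \sum_(q <- W | l < q) f p q.
    by rewrite mulr_sumr; apply: eq_bigr => p _; rewrite mulr_sumr.
  rewrite !(sumW uW _ kW) !pull s3 // mul0r add0r addrC; congr (_ + _); last first.
    apply: eq_bigr => l lk; rewrite !pull; case: (ltP l k) => c.
      by rewrite h3 // s3 ?mul0r // ltW.
    by rewrite over // /w /withdiag eq_sym (negbTE lk).
  rewrite /w {1}/withdiag eqxx; congr (_ * _); rewrite -/w over //.
  have -> : \sum_(q <- W | q <= k) u q = \sum_(p <- W | p < k) \sum_(q <- W | q <= k) t p q.
    rewrite exchange_big /=; apply: eq_bigr => q qk; rewrite -s5 [RHS]big_mkcond.
    apply: eq_bigr => p _; case: ltP => // kp; rewrite s3 //; exact: le_trans kp.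
  rewrite -sumrB; apply: eq_bigr => p pk; rewrite -s4.
  rewrite [in RHS](bigID (fun q => q <= k)) /= [RHS]addrC addKr; apply: eq_bigl => q.
  by rewrite -ltNge.
rewrite /neps -!addrA; congr (_ + _); rewrite [nest W t t + _]addrC addrA -big_split /=.
by congr (_ + _); apply: eq_bigr => k _; rewrite -mulrDr addrA.
Qed.

(** The u-summand of n(x, y, x'), see [n_vecE]. *)
Definition nvterm (u : int -> int) : Qv :=
  (v ^+ 2 - 1) ^ (\sum_(k <- W) u k)
  * v ^ (2 * neps u + \sum_(k <- W) u k * (u k - 1))
  * ((\prod_(k <- W) qfact (x k)) * \prod_(k <- W) qfact (x' k))
  * (\prod_(l <- W) qbinom (\sum_(k <- W | k < l) (offdiag u k - u k)) (u l))
  / ((\prod_(k <- W) qfact (offdiag u k)) * (\prod_(k <- W) qfact (x k - u k))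
     * \prod_(k <- W) qfact (y k - u k)).

Lemma vfall (a : int) (u : nat) :
  \prod_(0 <= m < u) (v ^ (2 * a) - v ^ (2 * m%:Z))
  = (v ^+ 2 - 1) ^+ u * v ^ (u%:Z * (u%:Z - 1)) * qfall a u.
Proof.
elim: u => [|u IH]; first by rewrite /qfall !big_geq // mul0r expr0z expr0 !mulr1.
rewrite big_nat_recr //= IH qfallS [_ ^+ u.+1]exprS.
have -> : v ^ (2 * a) - v ^ (2 * u%:Z) = (v ^+ 2 - 1) * v ^ (2 * u%:Z) * qint (a - u%:Z).
  have e : qint (a - u%:Z) * (v ^+ 2 - 1) = v ^ (2 * (a - u%:Z)) - 1.
    by rewrite /qint divfK // v2_neq1.
  rewrite mulrAC [_ * qint _]mulrC e mulrBl mul1r -expfzDr ?v_neq0 //.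
  by congr (v ^ _ - _); lia.
rewrite mulrACA; congr (_ * _); rewrite mulrACA -expfzDr ?v_neq0 // [_ ^+ u * _]mulrC.
have -> : u.+1%:Z = u%:Z + 1 by lia.
by congr (_ * v ^ _); lia.
Qed.

Lemma prod_exprz (f : int -> int) : \prod_(k <- W) v ^ (f k) = v ^ (\sum_(k <- W) f k).
Proof.
elim: W => [|k s IH]; first by rewrite !big_nil expr0z.
by rewrite !big_cons IH expfzDr ?v_neq0.
Qed.

Lemma prod_v2_exprz (f : int -> int) :
  \prod_(k <- W) (v ^+ 2 - 1) ^ (f k) = (v ^+ 2 - 1) ^ (\sum_(k <- W) f k).
Proof.
elim: W => [|k s IH]; first by rewrite !big_nil expr0z.
by rewrite !big_cons IH expfzDr ?v2_neq1.
Qed.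

Lemma nv_frac (F : fieldType) (E X' QB S Yu P1 V X Xu : F) :
  E * X' * QB / (S * Yu) * (P1 * V * (X / Xu))
  = P1 * (E * V) * (X * X') * QB / (S * Xu * Yu).
Proof.
rewrite [P1 * V * (X / Xu)]mulrA mulf_div [S * Yu * Xu]mulrAC; congr (_ / _).
by rewrite (AC (3*3) (4*(1*5)*(6*2)*3)).
Qed.

Lemma nv_frac2 (F : fieldType) (E N X' Yu M Z : F) :
  E * N * (X' / (Yu * M)) * Z = E * X' / Yu * Z * (N / M).
Proof.
rewrite -[X' / _ in LHS]mulr1 invfM !mulrA mulr1.
by rewrite (AC 6 (1*3*4*6*2*5)).
Qed.

Lemma nv_frac3 (F : fieldType) (E X' Yu Z Q S : F) :
  E * X' / Yu * Z * (Q / S) = E * X' * Q / (S * Yu) * Z.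
Proof. by rewrite invfM !mulrA (AC 6 (1*2*5*6*3*4)). Qed.

(** The terms with u k > x k for some k vanish, as then some factor
    v^(2 x k) - v^(2 m) does. *)
Lemma n_vecE : \sum_(k <- W) x' k = \sum_(k <- W) y k ->
  n_vec x y x' = \sum_(u \in [set u | adm u /\ forall k, u k <= x k]) nvterm u.
Proof.
move=> xy; rewrite /n_vec upper_triangularE.
rewrite (@fsum_partition_sub _ _ _ UTW adm (fun t l => y l - t l l)); last 2 first.
- exact: UTW_fin.
- exact: UTW_adm.
have inner u : adm u -> \sum_(t \in UTW `&` [set t | (fun l => y l - t l l) = u])
    v ^ (2 * n_exp x t) * ((\prod_(k \in [set: int]) qfact (x' k))
       / \prod_(k \in [set: int]) \prod_(l \in [set: int]) qfact (t k l))
    * \prod_(l \in [set: int]) \prod_(0 <= m < `|y l - t l l|%N)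
          (v ^ (2 * x l) - v ^ (2 * m%:Z))
  = v ^ (2 * neps u) * (\prod_(k <- W) qfact (x' k))
    * (\prod_(l <- W) qbinom (\sum_(k <- W | k < l) (offdiag u k - u k)) (u l))
    / ((\prod_(k <- W) qfact (offdiag u k)) * \prod_(k <- W) qfact (y k - u k))
    * \prod_(l <- W) ((v ^+ 2 - 1) ^ u l * v ^ (u l * (u l - 1)) * qfall (x l) `|u l|%N).
  move=> hu; have [u1 u2] := hu.
  rewrite (reindex_fsbig (withdiag u) (SU W (offdiag u) u)); last exact: UTW_bij.
  set Z := \prod_(l <- W) (_ * _ * qfall _ _).
  rewrite (eq_fsbigr (fun t => (v ^ (2 * neps u) * (\prod_(k <- W) qfact (x' k))
     / (\prod_(k <- W) qfact (y k - u k)) * Z) * (v ^ (2 * nest W t t) / mprod W t))); last first.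
    move=> t /set_mem ht; rewrite n_exp_withdiag // mulrDr expfzDr ?v_neq0 //.
    have [t1 t2 t3 t4 t5] := ht.
    have dl l : withdiag u t l l = y l - u l by rewrite /withdiag eqxx.
    have -> : \prod_(l \in [set: int]) \prod_(0 <= m < `|y l - withdiag u t l l|%N)
          (v ^ (2 * x l) - v ^ (2 * m%:Z)) = Z.
      rewrite fsW => [|l lW]; last by rewrite dl yW // u1 // subrr big_geq.
      apply: eq_bigr => l _; rewrite dl (_ : y l - (y l - u l) = u l); last by lia.
      have ul : u l = `|u l|%N%:Z by have := u2 l; lia.
      by rewrite vfall exprnP -ul.
    have -> : \prod_(k \in [set: int]) qfact (x' k) = \prod_(k <- W) qfact (x' k).
      by rewrite fsW // => k kW; rewrite zW // qfact0.
    have -> : \prod_(k \in [set: int]) \prod_(l \in [set: int]) qfact (withdiag u t k l)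
      = (\prod_(k <- W) qfact (y k - u k)) * mprod W t.
      rewrite fsW => [|k kW]; last first.
        apply: fsbig1 => l _; rewrite /withdiag; case: eqVneq => _.
          by rewrite yW // u1 // subrr qfact0.
        by rewrite t1 ?kW // qfact0.
      rewrite /mprod -big_split /=; apply: eq_big_seq => k kW; rewrite fsW => [|l lW]; last first.
        rewrite /withdiag; case: eqVneq => [e|_]; last by rewrite t1 ?lW ?orbT // qfact0.
        by rewrite -e kW in lW.
      rewrite !(prodW uW _ kW) dl (t3 k k) // qfact0 mul1r; congr (_ * _).
      by apply: eq_bigr => l lk; rewrite /withdiag eq_sym (negbTE lk).
    by rewrite nv_frac2.
  rewrite -mulr_fsumr strict_sum //.
  - by rewrite nv_frac3.
  - by move=> k; case: (u2 k).
  - by move=> k kW; rewrite /offdiag zW // yW // u1.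
  - by move=> k; case: (u2 k); lia.
  - by rewrite /offdiag sumrB big_split /= xy addrK.
under eq_fsbigr => u /set_mem hu do rewrite (inner u hu).
symmetry; rewrite (eq_fsbigr (fun u => v ^ (2 * neps u) * (\prod_(k <- W) qfact (x' k))
    * (\prod_(l <- W) qbinom (\sum_(k <- W | k < l) (offdiag u k - u k)) (u l))
    / ((\prod_(k <- W) qfact (offdiag u k)) * \prod_(k <- W) qfact (y k - u k))
    * \prod_(l <- W) ((v ^+ 2 - 1) ^ u l * v ^ (u l * (u l - 1)) * qfall (x l) `|u l|%N))).
  (* If u k > x k for some k, the falling product [x k] [x k - 1] ... contains [0]. *)
  apply: fsbig_widen => [u [] //|u [/= hu nu]].
  have [k [kW uk]] : exists k, k \in W /\ x k < u k.
    apply: contrapT => h; apply: nu; split=> // k; rewrite leNgt; apply/negP => c.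
    apply: h; exists k; split=> //; apply/negPn/negP => kW.
    by move: c; case: hu => -> // _; have := x0 k; lia.
  rewrite /preimage /= [X in _ * X](prodW uW _ kW).
  have -> : x k = `|x k|%N%:Z by have := x0 k; lia.
  by rewrite qfall_small ?mulr0 ?mul0r ?mulr0 //; have := x0 k; lia.
move=> u /set_mem[hu ux]; have [u1 u2] := hu.
rewrite /nvterm !big_split /= prod_exprz prod_v2_exprz expfzDr ?v_neq0 //.
have -> : \prod_(l <- W) qfall (x l) `|u l|%N
  = (\prod_(k <- W) qfact (x k)) / \prod_(k <- W) qfact (x k - u k).
  rewrite -prodf_div; apply: eq_bigr => l _.
  have xl : x l = `|x l|%N%:Z by have := x0 l; lia.
  have ul : x l - u l = (`|x l| - `|u l|)%N%:Z by have := u2 l; have := ux l; have := x0 l; lia.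
  rewrite ul xl -(@qfall_fact `|x l| `|u l|) ?mulfK ?qfact_neq0 //.
  by have := u2 l; have := ux l; have := x0 l; lia.
by rewrite nv_frac.
Qed.
End NVec.
End Window.

(** * The order pairing of rows *)

(** The order pairing of two rows inside a window W. *)
Definition ipW (W : seq int) (p q : int -> int) : int :=
  \sum_(l <- W) \sum_(j <- W | j < l) p j * q l.

(** The order pairing of two finitely supported rows. *)
Definition ip (p q : int -> int) : int :=
  \sum_(l \in [set: int]) \sum_(j \in [set j : int | j < l]) p j * q l.

(** The row p read backwards. *)
Definition opr (p : int -> int) : int -> int := fun j => p (- j).

Section WindowPairing.
Variable W : seq int.

Lemma ipWDl p q s : ipW W (p + q) s = ipW W p s + ipW W q s.
Proof.
rewrite /ipW -big_split; apply: eq_bigr => l _; rewrite -big_split.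
by apply: eq_bigr => j _; exact: mulrDl.
Qed.

Lemma ipWDr p q s : ipW W s (p + q) = ipW W s p + ipW W s q.
Proof.
rewrite /ipW -big_split; apply: eq_bigr => l _; rewrite -big_split.
by apply: eq_bigr => j _; exact: mulrDr.
Qed.

Lemma ipWNl p s : ipW W (- p) s = - ipW W p s.
Proof.
rewrite /ipW -sumrN; apply: eq_bigr => l _; rewrite -sumrN.
by apply: eq_bigr => j _; rewrite -mulNr.
Qed.

Lemma ipWNr p s : ipW W s (- p) = - ipW W s p.
Proof.
rewrite /ipW -sumrN; apply: eq_bigr => l _; rewrite -sumrN.
by apply: eq_bigr => j _; rewrite -mulrN.
Qed.

(** The scalar product of two rows inside the window. *)
Definition dotW (p q : int -> int) : int := \sum_(j <- W) p j * q j.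

(** The sum of a row inside the window. *)
Definition totW (p : int -> int) : int := \sum_(j <- W) p j.

Hypothesis uW : uniq W.

(** The only relation between pairings that is needed besides bilinearity. *)
Lemma ipW_sym p q : ipW W p q + ipW W q p + dotW p q = totW p * totW q.
Proof.
have -> : ipW W q p = \sum_(l <- W) \sum_(j <- W | l < j) p j * q l.
  rewrite /ipW (exchange_big_dep xpredT) //=; apply: eq_bigr => l _.
  by apply: eq_bigr => j _; rewrite mulrC.
rewrite /ipW -!big_split /= /totW [in RHS]mulrC mulr_suml; apply: eq_big_seq => l lW.
rewrite [RHS]mulrC mulr_suml (@sumW _ uW (fun j => p j * q l) l lW) addrC; congr (_ + _).
rewrite [RHS](bigID (fun j => j < l)) /=; congr (_ + _); apply: eq_bigl => j.
  by case: ltgtP.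
by case: ltgtP.
Qed.
End WindowPairing.

Lemma ipW_opp W p q : ipW (map -%R W) (opr p) (opr q) = ipW W q p.
Proof.
transitivity (\sum_(l <- W) \sum_(j <- W | l < j) p j * q l).
  rewrite /ipW big_map; apply: eq_bigr => l _; rewrite big_map.
  by apply: eq_big => [j|j _]; [lia|rewrite /opr !opprK].
rewrite (exchange_big_dep xpredT) //=; apply: eq_bigr => l _.
by apply: eq_bigr => j _; rewrite mulrC.
Qed.

(** Rows of finite support. *)
Definition finf (p : int -> int) := finite_set [set j | p j <> 0].

Lemma finf_sub (p q : int -> int) : finf q -> (forall j, q j = 0 -> p j = 0) -> finf p.
Proof. by move=> fq h; apply: sub_finite_set fq => j /= pj; move=> /h. Qed.

Lemma finf2 (p q s : int -> int) : finf p -> finf q ->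
  (forall j, p j = 0 -> q j = 0 -> s j = 0) -> finf s.
Proof.
move=> fp fq h; apply: (@sub_finite_set _ _ ([set j | p j <> 0] `|` [set j | q j <> 0])).
  by move=> j /= sj; case: (eqVneq (p j) 0) => [pj|/eqP]; [right => /(h _ pj)|left].
by rewrite finite_setU.
Qed.

Lemma finfD p q : finf p -> finf q -> finf (p + q).
Proof. by move=> fp fq; apply: (finf2 fp fq) => j pj qj; rewrite [LHS](_ : _ = p j + q j) // pj qj. Qed.

Lemma finfN p : finf p -> finf (- p).
Proof. by move=> fp; apply: (finf_sub fp) => j pj; rewrite [LHS](_ : _ = - p j) // pj. Qed.

Lemma finf_opr p : finf p -> finf (opr p).
Proof.
by move=> /finite_bounded[K hK]; apply: (@bounded_finite _ K%:Z) => j /= /hK; rewrite normrN.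
Qed.

Lemma finf_window p q s : finf p -> finf q -> finf s -> exists W, [/\ uniq W,
  forall j, j \notin W -> p j = 0, forall j, j \notin W -> q j = 0
  & forall j, j \notin W -> s j = 0].
Proof.
move=> /finite_bounded[K1 h1] /finite_bounded[K2 h2] /finite_bounded[K3 h3].
pose m := (K1 + K2 + K3)%N; exists (zseq (- m%:Z) (2 * m + 1)).
by split; rewrite ?zseq_uniq // => j; rewrite mem_zseq => jW; apply: contrapT => H;
   [move/h1: H|move/h2: H|move/h3: H]; move: jW; rewrite /m; lia.
Qed.

Lemma ipE W p q : uniq W -> (forall j, j \notin W -> p j = 0) ->
  (forall j, j \notin W -> q j = 0) -> ip p q = ipW W p q.
Proof.
move=> uW pW qW; rewrite /ip (fsW uW) => [|l lW]; last first.
  by apply: fsbig1 => j _; rewrite (qW l lW) mulr0.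
by apply: eq_bigr => l _; rewrite (fsWc uW) // => j jW; rewrite pW // mul0r.
Qed.

Lemma dsupp (p q : int -> int) (W : seq int) :
  (forall j, j \notin W -> p j = 0) -> (forall j, j \notin W -> q j = 0) ->
  forall j, j \notin W -> (p + q) j = 0.
Proof. by move=> h1 h2 j jW; rewrite [LHS](_ : _ = p j + q j) // h1 // h2. Qed.

Lemma ipDl p q s : finf p -> finf q -> finf s -> ip (p + q) s = ip p s + ip q s.
Proof.
move=> fp fq fs; have [W [uW pW qW sW]] := finf_window fp fq fs.
by rewrite !(ipE uW) // ?ipWDl //; exact: dsupp.
Qed.

Lemma ipDr p q s : finf p -> finf q -> finf s -> ip s (p + q) = ip s p + ip s q.
Proof.
move=> fp fq fs; have [W [uW pW qW sW]] := finf_window fp fq fs.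
by rewrite !(ipE uW) // ?ipWDr //; exact: dsupp.
Qed.

Lemma ipNl p s : finf p -> finf s -> ip (- p) s = - ip p s.
Proof.
move=> fp fs; have [W [uW pW _ sW]] := finf_window fp fp fs.
by rewrite !(ipE uW) ?ipWNl // => j jW; rewrite [LHS](_ : _ = - p j) // pW.
Qed.

Lemma ipNr p s : finf p -> finf s -> ip s (- p) = - ip s p.
Proof.
move=> fp fs; have [W [uW pW _ sW]] := finf_window fp fp fs.
by rewrite !(ipE uW) ?ipWNr // => j jW; rewrite [LHS](_ : _ = - p j) // pW.
Qed.

Lemma ip_opr p q : finf p -> finf q -> ip (opr p) (opr q) = ip q p.
Proof.
move=> fp fq; have [W [uW pW qW _]] := finf_window fp fq fq.
have u' : uniq (map -%R W) by rewrite map_inj_uniq //; exact: oppr_inj.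
have m' j : j \notin map -%R W -> - j \notin W.
  by apply: contra => h; rewrite -[j]opprK map_f.
rewrite (ipE uW qW pW) (ipE u') ?ipW_opp // => j /m' h; rewrite /opr; [exact: pW|exact: qW].
Qed.

Lemma ip_trans (k : int) p q :
  ip (fun j => p (j + k)) (fun j => q (j + k)) = ip p q.
Proof.
have bij (P Q : set int) : (forall j, P j <-> Q (j + k)) -> set_bij P Q (fun j => j + k).
  move=> PQ; split=> [j /= /PQ //|x y _ _|j Qj]; first by lia.
  by exists (j - k); rewrite /= ?subrK //; apply/PQ; rewrite subrK.
rewrite /ip [in RHS](reindex_fsbig (fun j => j + k) [set: int] [set: int]); last exact: bij.
apply: eq_fsbigr => l _.
rewrite [in RHS](reindex_fsbig (fun j => j + k) [set j : int | j < l]); first by [].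
by apply: bij => j /=; lia.
Qed.

(** * Sums over the rows modulo the period *)

Lemma sum_zseq_nat (V : zmodType) (g : int -> V) a m :
  \sum_(i <- zseq a m) g i = \sum_(0 <= k < m) g (a + k%:Z).
Proof. by rewrite /zseq big_map /index_iota subn0. Qed.

Lemma zseq_tele (V : zmodType) (H : int -> V) a m :
  \sum_(k <- zseq a m) (H k - H (k - 1)) = H (a + m%:Z - 1) - H (a - 1).
Proof.
rewrite sum_zseq_nat (eq_bigr (fun k : nat => H (a + k.+1%:Z - 1) - H (a + k%:Z - 1))).
  by rewrite telescope_sumr // addr0.
by move=> k _; congr (H _ - _); lia.
Qed.

Lemma per_window (V : zmodType) (g : int -> V) (m : nat) a b : (forall i, g (i + m%:Z) = g i) ->
  \sum_(i <- zseq a m) g i = \sum_(i <- zseq b m) g i.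
Proof.
move=> gm; have S c : \sum_(i <- zseq (c + 1) m) g i = \sum_(i <- zseq c m) g i.
  rewrite !sum_zseq_nat; case: m gm => [|m] gm; first by rewrite !big_geq.
  rewrite big_nat_recr //= [RHS]big_nat_recl //= addrC addr0; congr (_ + _).
    by rewrite -[RHS]gm; congr g; lia.
  by apply: eq_bigr => i _; congr g; lia.
have S' c (k : nat) : \sum_(i <- zseq (c + k%:Z) m) g i = \sum_(i <- zseq c m) g i.
  elim: k => [|k IH]; first by rewrite addr0.
  by rewrite (_ : c + k.+1%:Z = c + k%:Z + 1) ?S ?IH //; lia.
wlog le : a b / a <= b.
  by move=> h; case: (leP a b) => [/h //|/ltW/h ->].
by rewrite -(S' a `|b - a|%N); congr (\sum_(i <- zseq _ m) _); lia.
Qed.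

Section RowSums.
Variable r : nat.
Let n : int := (period r)%:Z.
Let nE : n = 2 * r%:Z + 2. Proof. by rewrite /n /period; lia. Qed.

(** The sum over the rows modulo n, for the window from - r - 1 to r, which is
    stable under i -> - i - 1. *)
Definition rsum (g : int -> int) : int := \sum_(i <- zseq (- r.+1%:Z) (period r)) g i.

Lemma rsum_shift (m : int) g : (forall i, g (i + n) = g i) ->
  rsum (fun i => g (i + m)) = rsum g.
Proof.
move=> gn; rewrite /rsum -(@per_window _ g _ (- r.+1%:Z + m) _ gn) !sum_zseq_nat.
by apply: eq_bigr => k _; congr g; lia.
Qed.

Lemma rsum_refl g : rsum (fun i => g (- i - 1)) = rsum g.
Proof.
rewrite /rsum -(big_map (fun i => - i - 1) xpredT g); apply: perm_big; apply: uniq_perm.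
- by rewrite map_inj_uniq ?zseq_uniq // => x y; lia.
- exact: zseq_uniq.
move=> x; apply/mapP/idP => [[i]|].
  by rewrite !mem_zseq => h ->; move: h; rewrite -/n; lia.
by rewrite mem_zseq -/n => h; exists (- x - 1); rewrite ?mem_zseq -/n; lia.
Qed.

Lemma rsum_opp g : (forall i, g (i + n) = g i) -> rsum (fun i => g (- i)) = rsum g.
Proof.
move=> gn; rewrite -(rsum_refl g) -(@rsum_shift (-1) (fun i => g (- i - 1))) => [|i].
  by apply: eq_bigr => i _; congr g; lia.
by rewrite -[LHS]gn; congr g; lia.
Qed.

Lemma rsum_half g : rsum g = \sum_(0 <= i < r.+1) (g i%:Z + g (- i%:Z - 1)).
Proof.
rewrite big_split /= /rsum sum_zseq_nat (big_cat_nat (n := r.+1)) //=; last by rewrite /period; lia.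
rewrite addrC; congr (_ + _).
  rewrite -{1}[r.+1]add0n big_addn (_ : (period r - r.+1)%N = r.+1); last by rewrite /period; lia.
  by apply: eq_bigr => i _; congr g; lia.
rewrite big_nat_rev /=; apply: eq_big_nat => i hi; congr g; lia.
Qed.

Lemma eq_rsum f g : (forall i, f i = g i) -> rsum f = rsum g.
Proof. by move=> e; apply: eq_bigr => i _. Qed.

Lemma rsumD f g : rsum (fun i => f i + g i) = rsum f + rsum g.
Proof. exact: big_split. Qed.

Lemma rsumN f : rsum (fun i => - f i) = - rsum f.
Proof. exact: sumrN. Qed.

Lemma rsumM c f : rsum (fun i => c * f i) = c * rsum f.
Proof. by rewrite /rsum mulr_sumr. Qed.

(** Quadratic forms over pairs of positions, as sums of pairings of rows; L bounds
    the distance of the rows that contribute. *)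
Lemma qsum_rows (N1 L : nat) (a : int) (M : mat) (c : int -> int -> bool)
    (E : int * int -> int * int -> bool) : (0 < N1)%N ->
  (forall k m j, M (m + k * N1%:Z) (j + k * n) = M m j) -> (forall m, finf (M m)) ->
  (forall k m j m' l, E (m + k * N1%:Z, j + k * n) (m' + k * N1%:Z, l + k * n) = E (m, j) (m', l)) ->
  (forall m j m' l, M m j <> 0 -> M m' l <> 0 ->
     E (m, j) (m', l) = [&& c m m', j < l & m - L%:Z <= m' < m]) ->
  qsum n M E = \sum_(m <- zseq a N1) \sum_(m' <- zseq (m - L%:Z) L | c m m') ip (M m) (M m').
Proof.
move=> N0 Msh Mfin Esh Ec; rewrite /qsum.
pose tau (k : int) (q : (int * int) * (int * int)) :=
  ((q.1.1 + k * N1%:Z, q.1.2 + k * n), (q.2.1 + k * N1%:Z, q.2.2 + k * n)).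
rewrite (@fsum_fdom _ _ tau (fun q => q.1.2) (fun q => q.1.1 - a) n N1%:Z); last 7 first.
- by move=> x y [[m j] [m' l]]; rewrite /tau /=; congr ((_, _), (_, _)); lia.
- by move=> [[m j] [m' l]]; rewrite /tau /=; congr ((_, _), (_, _)); lia.
- by rewrite nE; lia.
- by lia.
- by [].
- by move=> k q /=; lia.
- by move=> k [[m j] [m' l]]; rewrite /tau /= !Msh Esh.
have [K hK] : exists K : nat, forall m j, a - L%:Z <= m < a + N1%:Z -> M m j <> 0 -> `|j| <= K%:Z.
  have : finite_set (\bigcup_(m in [set m : int | a - L%:Z <= m <= a + N1%:Z]) [set j | M m j <> 0]).
    by apply: bigcup_finite => [|m _]; [exact: finite_zrange|exact: Mfin].
  move=> /finite_bounded[K hK]; exists K => m j hm h; apply: hK; exists m => //=; lia.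
pose W := zseq (- K%:Z) (2 * K + 1); have uW : uniq W by exact: zseq_uniq.
have MW m j : a - L%:Z <= m < a + N1%:Z -> j \notin W -> M m j = 0.
  by move=> hm jW; apply: contrapT => /(hK _ _ hm); move: jW; rewrite mem_zseq; lia.
pose V := zseq (a - L%:Z) (N1 + L).
pose P1 := [seq (m, j) | m <- zseq a N1, j <- W]; pose P2 := [seq (m, j) | m <- V, j <- W].
pose PP := [seq (p, q) | p <- P1, q <- P2].
have uPP : uniq PP.
  apply: allpairs_uniq => [||[? ?] [? ?] _ _ [-> ->] //];
  by apply: allpairs_uniq => [||[? ?] [? ?] _ _ [-> ->] //]; exact: zseq_uniq.
rewrite (@fsbigE_cond _ _ _ _ _ PP) //; last first.
  move=> [[m j] [m' l]] /= hm np; apply: contrapT => h.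
  have [h1 h2 h3] : [/\ M m j <> 0, M m' l <> 0 & E (m, j) (m', l)].
    by move: h; case: (E _ _); rewrite ?mulr0 // mulr1 => h; split=> // e; apply: h;
      rewrite e ?mul0r ?mulr0.
  move: (h3); rewrite Ec // => /and3P[_ _ hm']; move/negP: np; apply.
  apply/allpairsP; exists ((m, j), (m', l)); split => //=; apply/allpairsP;
    [exists (m, j)|exists (m', l)]; split => //=.
  - by rewrite mem_zseq; lia.
  - by apply: contrapT => /negP nW; apply: h1; apply: MW nW; lia.
  - by rewrite mem_zseq; lia.
  - by apply: contrapT => /negP nW; apply: h2; apply: MW nW; lia.
transitivity (\sum_(q <- PP) M q.1.1 q.1.2 * M q.2.1 q.2.2 * (E q.1 q.2)%:Z).
  rewrite big_seq_cond [RHS]big_seq; apply: eq_bigl => q.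
  apply: andb_idr => /allpairsP[[p q'] /= [/allpairsP[[m j] /= [hm _ ->]] _ ->]].
  by apply/mem_set => /=; rewrite mem_zseq in hm; lia.
rewrite /PP big_allpairs_dep /P1 big_allpairs_dep /=; apply: eq_big_seq => m; rewrite mem_zseq => hm.
pose f m' := if c m m' && (m - L%:Z <= m' < m) then ip (M m) (M m') else 0.
transitivity (\sum_(m' <- V) f m').
  under eq_bigr => j _ do rewrite /P2 big_allpairs_dep.
  rewrite exchange_big; apply: eq_big_seq => m' /=; rewrite mem_zseq => hm'.
  rewrite exchange_big /= /f.
  transitivity (if c m m' && (m - L%:Z <= m' < m) then ipW W (M m) (M m') else 0); last first.
    by case: ifP => // cm; rewrite (ipE uW) // => j jW; apply: MW => //; lia.
  have e l j : M m j * M m' l * (E (m, j) (m', l))%:Z =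
    if c m m' && (m - L%:Z <= m' < m) then if j < l then M m j * M m' l else 0 else 0.
    case: (eqVneq (M m j) 0) => [->|/eqP h1]; first by rewrite !mul0r !if_same.
    case: (eqVneq (M m' l) 0) => [->|/eqP h2]; first by rewrite !mulr0 mul0r !if_same.
    by rewrite Ec //; case: (c m m') => //=; case: (j < l) => //=; case: (m - L%:Z <= m' < m); rewrite ?mulr1 ?mulr0 ?if_same.
  under eq_bigr => l _ do under eq_bigr => j _ do rewrite e.
  case: ifP => _; last by rewrite big1 // => l _; rewrite big1.
  by apply: eq_bigr => l _; rewrite [RHS]big_mkcond.
rewrite -(fsW (zseq_uniq _ _)) => [|m' h]; last first.
  by rewrite /f; case: ifP => // /andP[_ hm']; move: h; rewrite mem_zseq; lia.
rewrite (fsW (zseq_uniq (m - L%:Z) L)) => [|m' h]; last first.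
  by rewrite /f; case: ifP => // /andP[_ hm']; move: h; rewrite mem_zseq; lia.
rewrite [RHS]big_mkcond; apply: eq_big_seq => m'; rewrite mem_zseq /f => hm'.
by rewrite (_ : _ <= _ < _) ?andbT //; lia.
Qed.
End RowSums.

(** * The difference of two lengths *)

(** Periodicity under simultaneous translation of rows and columns. *)
Definition periodic (r : nat) (F : mat) : Prop :=
  forall i j, F (i + (period r)%:Z) (j + (period r)%:Z) = F i j.

Lemma per_sh r F : periodic r F -> forall k i j,
  F (i + k * (period r)%:Z) (j + k * (period r)%:Z) = F i j.
Proof.
rewrite /periodic; move: (period r)%:Z => N p; have P (k : nat) i j : F (i + k%:Z * N) (j + k%:Z * N) = F i j.
  elim: k i j => [|k IH] i j; first by rewrite !mul0r !addr0.
  have -> : k.+1%:Z = k%:Z + 1 by lia.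
  by rewrite mulrDl mul1r !addrA p IH.
move=> [k|k] i j; first exact: P.
by rewrite -[LHS](P k.+1); congr F; rewrite NegzE mulNr subrK.
Qed.

Lemma ip_per r F G m : periodic r F -> periodic r G ->
  forall i, ip (F (i + (period r)%:Z)) (G (i + (period r)%:Z + m)) = ip (F i) (G (i + m)).
Proof.
rewrite /periodic; move: (period r)%:Z => N pF pG i.
have e1 : F i = fun j => F (i + N) (j + N) by apply: funext => j; rewrite pF.
have e2 : G (i + m) = fun j => G (i + N + m) (j + N) by apply: funext => j; rewrite addrAC pG.
by rewrite e1 e2 ip_trans.
Qed.

Lemma ip_band (a : int) p q : (forall j, p j <> 0 -> a <= j) -> (forall j, q j <> 0 -> j <= a) ->
  ip p q = 0.
Proof.
move=> hp hq; apply: fsbig1 => l _; apply: fsbig1 => j /= jl.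
apply/eqP; rewrite mulf_eq0; apply/orP.
case: (eqVneq (p j) 0) => [_|/eqP /hp h1]; first by left.
by right; apply/eqP; apply: contrapT => /hq h2; lia.
Qed.

Section LengthDifference.
Variables (r b : nat) (f z : mat).
Let n : int := (period r)%:Z.
Hypotheses (fper : periodic r f) (zper : periodic r z).
Hypotheses (ffin : forall i, finf (f i)) (zfin : forall i, finf (z i)).
Hypotheses (fband : forall i j, f i j <> 0 -> `|j - i| <= b%:Z)
           (zband : forall i j, z i j <> 0 -> `|j - i| <= b%:Z).
Let L := (2 * b)%N.

(** The pairings of all rows of F with the 2 b preceding rows of G.  If b bounds the
    distance of the supports from the diagonal, earlier rows do not contribute. *)
Definition Qb (F G : mat) : int := 
  rsum r (fun m => \sum_(k <- zseq (m - (2 * b)%N%:Z) (2 * b)) ip (F m) (G k)).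

(** The difference of consecutive rows of z. *)
Definition dz : mat := fun i => z i - z (i - 1).

Lemma finfB p q : finf p -> finf q -> finf (p - q).
Proof. by move=> fp fq; apply: finfD => //; exact: finfN. Qed.

Lemma dz_fin i : finf (dz i).
Proof. exact: finfB. Qed.

Lemma ipBr p q s : finf p -> finf q -> finf s -> ip s (p - q) = ip s p - ip s q.
Proof. by move=> fp fq fs; rewrite ipDr ?ipNr //; exact: finfN. Qed.

Lemma ipBl p q s : finf p -> finf q -> finf s -> ip (p - q) s = ip p s - ip q s.
Proof. by move=> fp fq fs; rewrite ipDl ?ipNl //; exact: finfN. Qed.

(** The sum over the preceding rows telescopes. *)
Lemma Qb_right (F : mat) : (forall i, finf (F i)) ->
  (forall i j, F i j <> 0 -> i - b%:Z - 1 <= j) ->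
  Qb F dz = rsum r (fun i => ip (F i) (z (i - 1))).
Proof.
move=> Ffin Fband; apply: eq_rsum => m.
under eq_bigr => k _ do rewrite ipBr //.
rewrite (zseq_tele (fun k => ip (F m) (z k))).
rewrite [X in _ - X](@ip_band (m - b%:Z - 1)); last 2 first.
- by move=> j /Fband; lia.
- by move=> j /zband; lia.
by rewrite subr0; congr (ip _ (z _)); lia.
Qed.

Lemma Qb_left : Qb dz f = - rsum r (fun i => ip (z i) (f i)).
Proof.
rewrite /Qb /rsum; under eq_bigr => m _ do rewrite sum_zseq_nat.
rewrite exchange_big /=.
have dper : periodic r dz.
  move=> i j.
  change (z (i + n) (j + n) - z (i + n - 1) (j + n) = z i j - z (i - 1) j).
  by rewrite zper addrAC zper.
transitivity (\sum_(0 <= k < L) rsum r (fun m => ip (dz (m + (L%:Z - k%:Z))) (f m))).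
  apply: eq_bigr => k _; rewrite -[LHS](@rsum_shift r (L%:Z - k%:Z)); last first.
    by move=> i /=; have := ip_per (- L%:Z + k%:Z) dper fper i; rewrite !addrA.
  by apply: eq_rsum => m; congr (ip _ (f _)); rewrite /L; lia.
rewrite /rsum exchange_big /= -sumrN; apply: eq_bigr => m _.
under eq_bigr => k _ do rewrite /dz ipBl //.
have -> : \sum_(0 <= k < L) (ip (z (m + (L%:Z - k%:Z))) (f m) - ip (z (m + (L%:Z - k%:Z) - 1)) (f m))
   = \sum_(0 <= k < L) - (ip (z (m + (L%:Z - k.+1%:Z))) (f m) - ip (z (m + (L%:Z - k%:Z))) (f m)).
  by apply: eq_bigr => k _; rewrite opprB (_ : m + (L%:Z - k.+1%:Z) = m + (L%:Z - k%:Z) - 1) //; lia.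
rewrite sumrN telescope_sumr // subrr addr0 subr0.
rewrite [X in _ - X](@ip_band (m + b%:Z)) ?subr0 //.
- by move=> j /zband; rewrite /L; lia.
- by move=> j /fband; lia.
Qed.

(** The change of the quadratic form when 2 (z_i - z_(i-1)) is added to row i. *)
Lemma Qb_diff :
  Qb (fun i => f i + (dz i + dz i)) (fun i => f i + (dz i + dz i))
  = Qb f f + 2 * rsum r (fun i => ip (f i) (z (i - 1))) - 2 * rsum r (fun i => ip (z i) (f i))
    + 4 * rsum r (fun i => ip (dz i) (z (i - 1))).
Proof.
have dfin := dz_fin.
have E : Qb (fun i => f i + (dz i + dz i)) (fun i => f i + (dz i + dz i))
   = Qb f f + (Qb f dz + Qb f dz) + (Qb dz f + Qb dz f) + (Qb dz dz + Qb dz dz + (Qb dz dz + Qb dz dz)).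
  move: dz dfin => D Dfin; rewrite /Qb -!rsumD; apply: eq_rsum => m.
  rewrite -!big_split; apply: eq_bigr => k _ /=.
  have dd i : finf (D i + D i) by exact: finfD.
  have fdd i : finf (f i + (D i + D i)) by exact: finfD.
  rewrite !ipDl // !ipDr //.
  move: (ip (f m) (f k)) (ip (f m) (D k)) (ip (D m) (f k)) (ip (D m) (D k)) => *; lia.
rewrite E Qb_left !Qb_right //; [lia| |].
- move=> i j; rewrite /dz => h; case: (eqVneq (z i j) 0) => [e|/eqP /zband]; last by lia.
  case: (eqVneq (z (i - 1) j) 0) => [e'|/eqP /zband]; last by lia.
  by case: h; rewrite [LHS](_ : _ = z i j - z (i - 1) j) // e e'.
- by move=> i j /fband; lia.
Qed.

End LengthDifference.

Lemma qsum_Qb (r b : nat) (f : mat) : periodic r f -> (forall i, finf (f i)) ->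
  (forall i j, f i j <> 0 -> `|j - i| <= b%:Z) ->
  qsum (period r)%:Z f einv = Qb r b f f.
Proof.
move=> fper ffin fband.
rewrite (@qsum_rows r (period r) (2 * b) (- r.+1%:Z) f (fun _ _ => true)) //.
- by rewrite /period; lia.
- by move=> k m j; exact: per_sh.
- by move=> k m j m' l; rewrite /einv /=; congr (_ && _); lia.
- by move=> m j m' l /fband h1 /fband h2; rewrite /einv /=; lia.
Qed.

(** * Lengths of A and B in terms of pairings *)

(** The sum of a row. *)
Definition tot (p : int -> int) : int := \sum_(j \in [set: int]) p j.

Lemma tot_opr p : tot (opr p) = tot p.
Proof.
rewrite /tot [RHS](reindex_fsbigT (fun j => - j)) //.
Qed.

Section DoubledRows.
Variables (r d : nat).
Let n : int := (period r)%:Z.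
Let nE : n = 2 * r%:Z + 2. Proof. by rewrite /n /period; lia. Qed.

Lemma Jm_per c : periodic r (Jm 1 r.+1%:Z) /\
  forall i j k, Jm c r.+1%:Z (i + k * (c * n)) (j + k * n) = Jm c r.+1%:Z i j.
Proof.
have dv j k : (r.+1%:Z %| j + k * n)%Z = (r.+1%:Z %| j)%Z.
  have -> : n = r.+1%:Z * 2 by rewrite nE; lia.
  by rewrite mulrCA addrC rpredDl ?dvdz_mulr.
split=> [i j|i j k]; rewrite /Jm; congr (nat_of_bool _)%:Z.
  by rewrite -/n -[n in j + n]mul1r dv; congr (_ && _); lia.
by rewrite dv; congr (_ && _); rewrite mulrDr mulrCA (inj_eq (addIr _)).
Qed.

Variable C : mat.
Hypothesis hC : Xi r d C.

(** Twice the matrix C, minus its fixed points: the total weights of the labels. *)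
Definition dbl : mat := fun i j => 2 * C i j - Jm 1 r.+1%:Z i j.

Lemma dbl_per : periodic r dbl.
Proof.
move=> i j; rewrite /dbl (Jm_per 1).1.
by have := Xi_sh hC 1 i j; rewrite !mul1r => ->.
Qed.

Lemma Jm_fin i : finf (Jm 1 r.+1%:Z i).
Proof.
apply: (@bounded_finite _ `|i|) => j /=; rewrite /Jm mul1r.
by case: eqP => [->|].
Qed.

Lemma dbl_fin i : finf (dbl i).
Proof.
apply: (@finf2 (C i) (Jm 1 r.+1%:Z i)) => [||j e1 e2]; [exact: (Xi_fin hC)|exact: Jm_fin|].
by rewrite /dbl e1 e2.
Qed.

Lemma dbl_band : exists b : nat, forall i j, dbl i j <> 0 -> `|j - i| <= b%:Z.
Proof.
have [K hK] := Xi_band hC; exists K => i j h.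
case: (eqVneq (C i j) 0) => [e|/eqP /hK //].
by move: h; rewrite /dbl e /Jm mul1r; case: eqP => [->|//]; rewrite subrr normr0.
Qed.

Lemma dbl_opp i : dbl (- i) = opr (dbl i).
Proof.
apply: funext => j; rewrite /opr /dbl -[in LHS](Xi_opp hC) opprK; congr (_ - _).
by rewrite /Jm !mul1r rpredN; congr (nat_of_bool (_ && _))%:Z; lia.
Qed.

Lemma ell_Qb b : (2 <= d)%N -> (forall i j, dbl i j <> 0 -> `|j - i| <= b%:Z) ->
  (ell_mat d r C)%:Z * 8 = Qb r b dbl dbl.
Proof.
move=> hd hb; rewrite (ell_matE hd hC); apply: qsum_Qb => //; first exact: dbl_per.
exact: dbl_fin.
Qed.
End DoubledRows.

Section LengthDiff.
Variables (r d : nat).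
Hypothesis hd : (2 <= d)%N.
Let n : int := (period r)%:Z.
Variables (A C z : mat).
Hypotheses (hA : Xi r d A) (hC : Xi r d C).
Hypotheses (zper : periodic r z) (zfin : forall i, finf (z i)).
Hypothesis zband : exists b : nat, forall i j, z i j <> 0 -> `|j - i| <= b%:Z.
Hypothesis zopp : forall i, z (- i - 1) = - opr (z i).
Hypothesis CE : forall i j, C i j = A i j + (z i j - z (i - 1) j).

Lemma ell_diff :
  ((ell_mat d r A)%:Z - (ell_mat d r C)%:Z) * 2 
  = rsum r (fun i => ip (z i) (dbl r A i)) - rsum r (fun i => ip (dz z i) (z (i - 1))).
Proof.
have [b1 h1] := dbl_band hA; have [b2 h2] := dbl_band hC; have [b3 h3] := zband.
pose b := (b1 + b2 + b3)%N.
have hb1 i j : dbl r A i j <> 0 -> `|j - i| <= b%:Z by move/h1; rewrite /b; lia.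
have hb2 i j : dbl r C i j <> 0 -> `|j - i| <= b%:Z by move/h2; rewrite /b; lia.
have hb3 i j : z i j <> 0 -> `|j - i| <= b%:Z by move/h3; rewrite /b; lia.
have eA := ell_Qb hA hd hb1; have eC := ell_Qb hC hd hb2.
have eF : dbl r C = fun i => dbl r A i + (dz z i + dz z i).
  apply: funext => i; apply: funext => j.
  rewrite [RHS](_ : _ = dbl r A i j + ((z i j - z (i - 1) j) + (z i j - z (i - 1) j))) //.
  rewrite /dbl CE; move: (A i j) (z i j) (z (i - 1) j) (Jm _ _ _ _) => *; lia.
have := Qb_diff (dbl_per hA) zper (dbl_fin hA) zfin hb1 hb3.
rewrite -eF -eA -eC.
have -> : rsum r (fun i => ip (dbl r A i) (z (i - 1))) = - rsum r (fun i => ip (z i) (dbl r A i)).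
  rewrite -(@rsum_opp r (fun i => ip (dbl r A i) (z (i - 1)))); last first.
    by move=> i; exact: (ip_per (-1) (dbl_per hA) zper).
  rewrite -rsumN; apply: eq_rsum => i.
  have ff := dbl_fin hA i; have fz := zfin i.
  rewrite zopp (dbl_opp hA) ipNr ?ip_opr //; exact: finf_opr.
by lia.
Qed.
End LengthDiff.

Section TriLength.
Variables (r d : nat).
Hypothesis hd : (2 <= d)%N.
Let n : int := (period r)%:Z.
Variable B : mat.
Hypotheses (hB : Xi r d B) (hBtri : tridiagonal B).

Lemma tri0 i j : ~ `|j - i| <= 1 -> B i j = 0.
Proof. by move=> h; apply: hBtri; apply/negP => h'; apply: h; lia. Qed.

Lemma dblB_band i j : dbl r B i j <> 0 -> `|j - i| <= 1%N%:Z.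
Proof.
move=> h; apply: contrapT => nb; apply: h; rewrite /dbl tri0 // /Jm mul1r.
by case: eqP nb => [->|//]; rewrite subrr normr0.
Qed.

(** Only the pairs of positions (i, i - 1) and (i - 1, i) are inverted. *)
Lemma ell_tri :
  (ell_mat d r B)%:Z * 2 = rsum r (fun i => B i (i - 1) * B (i - 1) i).
Proof.
have e := ell_Qb hB hd dblB_band.
suff: (ell_mat d r B)%:Z * 8 = 4 * rsum r (fun i => B i (i - 1) * B (i - 1) i) by lia.
rewrite e -rsumM; apply: eq_rsum => m.
rewrite sum_zseq_nat unlock /= addr0 (_ : m - 2 + 1 = m - 1); last by lia.
have dB k : dbl r B k = (fun j => 2 * B k j - Jm 1 r.+1%:Z k j) by [].
rewrite (@ip_band (m - 1)) ?addr0 ?add0r; last 2 first.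
- by move=> j /dblB_band; lia.
- by move=> j /dblB_band; lia.
rewrite /ip (@fsbigE_cond _ _ _ _ _ [:: m]) //; last first.
  move=> l _; rewrite inE => /eqP lm; apply: fsbig1 => j /= jl.
  apply/eqP; rewrite mulf_eq0; apply/orP.
  case: (eqVneq (dbl r B m j) 0) => [_|/eqP /dblB_band h1]; first by left.
  by right; apply/eqP; apply: contrapT => /dblB_band h2; lia.
rewrite big_cons big_nil in_setT (@fsbigE_cond _ _ _ _ _ [:: m - 1]) //; last first.
  move=> j /= jm; rewrite inE => /eqP lm.
  have -> : dbl r B m j = 0 by apply: contrapT => /dblB_band h1; lia.
  by rewrite mul0r.
rewrite big_cons big_nil mem_set /=; last by lia.
rewrite addr0 addr0.
by rewrite /dbl /Jm !mul1r; do 2 (case: eqP => [?|_]; first lia); rewrite !subr0 mulrACA.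
Qed.
End TriLength.

(** * The length of w in terms of pairings *)

(** Finiteness of the support of sums and differences of rows. *)
Ltac fin_tac := lazymatch goal with
  | |- finf (_ + _)%R => apply: finfD; fin_tac
  | |- finf (- _)%R => apply: finfN; fin_tac
  | |- finf _ => first [assumption | match goal with H : forall i, finf _ |- _ => exact: H end]
  | |- _ => idtac end.

Lemma w_expand (g y t : int -> int) : finf g -> finf y -> finf t ->
  ip g (t + t) + (ip (y + y) (t + t) + ip (y + y) g) = 2 * ip g t + 4 * ip y t + 2 * ip y g.
Proof.
move=> fg fy ft; rewrite !(ipDl, ipDr); fin_tac.
by move: (ip g t) (ip y t) (ip y g) => *; lia.
Qed.

Lemma w_expand2 (f y t : int -> int) : finf f -> finf y -> finf t ->
  ip y (f - (y + y) - (t + t)) = ip y f - 2 * ip y y - 2 * ip y t.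
Proof.
move=> ff fy ft; rewrite !(ipDr, ipNr); fin_tac.
by move: (ip y f) (ip y t) (ip y y) => *; lia.
Qed.

Lemma zseq3 (g : int -> int) a N :
  \sum_(m <- zseq (3 * a - 1) (3 * N)) g m
  = \sum_(i <- zseq a N) (g (3 * i - 1) + g (3 * i) + g (3 * i + 1)).
Proof.
rewrite !sum_zseq_nat; elim: N => [|N IH]; first by rewrite muln0 !big_geq.
rewrite mulnS addnC addn3 !big_nat_recr //= IH -!addrA; congr (_ + _).
by congr (g _ + (g _ + g _)); lia.
Qed.

Section MinimalElementLength.
Variables (r d : nat).
Variables (A B : mat).
Hypotheses (hA : Xi r d A) (hB : Xi r d B) (hBtri : tridiagonal B).
Hypothesis hAB : row_c r A = col_c r B.
Variable T : mat.
Hypothesis hT : Theta_BA r B A T.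
Let n : int := (period r)%:Z.
Let nE : n = 2 * r%:Z + 2. Proof. by rewrite /n /period; lia. Qed.

(** The matrix with entries t_(-i,-j). *)
Definition refl (T : mat) : mat := fun i => opr (T (- i)).

Let f := dbl r A.
Let Y := refl T.

Lemma T_per : periodic r T.
Proof. by move=> i j; have := T_sh hT 1 i j; rewrite !mul1r. Qed.

Lemma refl_per (F : mat) : periodic r F -> periodic r (refl F).
Proof.
move=> p i j; have := per_sh p (-1) (- i) (- j); rewrite /refl /opr => <-.
by congr F; lia.
Qed.

Lemma refl_fin i : finf (Y i).
Proof. exact/finf_opr/(T_fin hA hT). Qed.

(** The weights of the intersections prescribed by A and T: the rows 3 i - 1, 3 i
    and 3 i + 1 add up to the i-th row of [dbl]. *)
Definition three : mat := fun m j => 2 * cp A T m j - Jm 3 r.+1%:Z m j.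

Lemma three_rows i : [/\ three (3 * i - 1) = T i + T i,
  three (3 * i) = f i - (Y i + Y i) - (T i + T i) & three (3 * i + 1) = Y i + Y i].
Proof.
have [[a1 a2 a3 a4 a5] a6] := flmd3 i.
split; apply: funext => j; rewrite /three /cp ?a1 ?a2 ?a3 ?a4 ?a5 ?a6 /=.
- have -> : Jm 3 r.+1%:Z (3 * i - 1) j = 0 by rewrite /Jm; case: eqP => //; lia.
  by rewrite [RHS](_ : _ = T i j + T i j) //; move: (T i j) => t; lia.
- have -> : Jm 3 r.+1%:Z (3 * i) j = Jm 1 r.+1%:Z i j.
    by rewrite /Jm mul1r; congr (nat_of_bool (_ && _))%:Z; lia.
  rewrite [RHS](_ : _ = 2 * A i j - Jm 1 r.+1%:Z i j - (T (- i) (- j) + T (- i) (- j))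
                        - (T i j + T i j)) //.
  have lem (a t t' x : int) : 2 * (a - t - t') - x = 2 * a - x - (t' + t') - (t + t) by lia.
  exact: lem.
have -> : Jm 3 r.+1%:Z (3 * i + 1) j = 0 by rewrite /Jm; case: eqP => //; lia.
by rewrite [RHS](_ : _ = T (- i) (- j) + T (- i) (- j)) //; move: (T _ _) => t; lia.
Qed.

Lemma three_fin m : finf (three m).
Proof.
apply: (@finf2 (cp A T m) (Jm 3 r.+1%:Z m)) => [||j e1 e2]; last by rewrite /three e1 e2.
  exact: (cp_fin hA hT).
apply: (@bounded_finite _ `|m|) => j /=; rewrite /Jm.
by case: eqP => [->|] //= _; lia.
Qed.

Hypothesis hd : (2 <= d)%N.

Lemma ell_w : (ell d (w_AT d r A B T))%:Z * 2
  = rsum r (fun i => ip (Y i) (f i) - 2 * ip (Y i) (Y i) - ip (Y i) (T i)).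
Proof.
have fT i : finf (T i) := T_fin hA hT i; have fY : forall i, finf (Y i) := refl_fin.
have ff i : finf (f i) := dbl_fin hA i.
have Tper := T_per; have Yper := refl_per Tper; have fper := dbl_per hA.
pose g i := f i - (Y i + Y i) - (T i + T i).
have fD p q : finf p -> finf q -> finf (p + q) := @finfD p q.
have fg i : finf (g i).
  by rewrite /g; apply: finfB; [apply: finfB => //|]; exact: finfD.
have gper : periodic r g.
  move=> i j; change (f (i + n) (j + n) - (Y (i + n) (j + n) + Y (i + n) (j + n)) -
    (T (i + n) (j + n) + T (i + n) (j + n)) = f i j - (Y i j + Y i j) - (T i j + T i j)).
  have -> : f (i + n) (j + n) = f i j by exact: fper.
  have -> : Y (i + n) (j + n) = Y i j by exact: Yper.
  by have -> : T (i + n) (j + n) = T i j by exact: Tper.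
have e8 : (ell d (w_AT d r A B T))%:Z * 8 = rsum r (fun i =>
    ip (g i) (T i + T i) + (ip (Y i + Y i) (T i + T i) + ip (Y i + Y i) (g i))).
  rewrite (ell_wAT hA hB hBtri hAB hT hd) -/three.
  rewrite (@qsum_rows r (3 * period r) 2 (3 * (- r.+1%:Z) - 1) three (fun m m' => fl m == fl m')).
  - rewrite zseq3; apply: eq_bigr => i _.
    have [t1 t2 t3] := three_rows i; have [[a1 a2 a3 a4 a5] a6] := flmd3 i.
    have b1 : fl (3 * i - 3) = i - 1 by have := flmd (3 * i - 3); lia.
    have b2 : fl (3 * i - 2) = i - 1 by have := flmd (3 * i - 2); lia.
    have S2 m : \sum_(m' <- zseq (m - 2%N%:Z) 2 | fl m == fl m') ip (three m) (three m')
      = (if fl m == fl (m - 2) then ip (three m) (three (m - 2)) else 0)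
       + (if fl m == fl (m - 1) then ip (three m) (three (m - 1)) else 0).
      rewrite big_mkcond sum_zseq_nat unlock /= addr0.
      by rewrite (_ : m - 2 + 1 = m - 1) ?addr0 //; lia.
    rewrite !S2 (_ : 3 * i - 1 - 2 = 3 * i - 3); last by lia.
    rewrite (_ : 3 * i - 1 - 1 = 3 * i - 2); last by lia.
    rewrite (_ : 3 * i + 1 - 2 = 3 * i - 1); last by lia.
    rewrite (_ : 3 * i + 1 - 1 = 3 * i); last by lia.
    rewrite a1 a3 a5 b1 b2 eqxx t1 t2 t3 (_ : i == i - 1 = false); last by lia.
    by rewrite !addr0 !add0r.
  - by rewrite /period; lia.
  - move=> k m j; rewrite /three (_ : (3 * period r)%N%:Z = 3 * n); last by rewrite /n; lia.
    by rewrite (cp_sh hA hT) (Jm_per r 3).2.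
  - exact: three_fin.
  - move=> k m j m' l; rewrite /winv /= (_ : (3 * period r)%N%:Z = 3 * n); last by rewrite /n; lia.
    by rewrite mulrCA !fl_sh; congr [&& _, _ & _]; lia.
  move=> m j m' l _ _; rewrite /winv /=.
  have := flmd m; have := flmd m'; case: eqP => [->|_ _ _] //=; lia.
(* The reflection i -> - i exchanges the first and the third row of each triple. *)
have refl_gT : rsum r (fun i => ip (g i) (T i)) = rsum r (fun i => ip (Y i) (g i)).
  rewrite -(@rsum_opp r (fun i => ip (g i) (T i))); last first.
    by move=> i; have := ip_per 0 gper Tper i; rewrite !addr0.
  apply: eq_rsum => i; have -> : T (- i) = opr (Y i) by apply: funext => j; rewrite /Y /refl /opr opprK.
  have -> : g (- i) = opr (g i).
    apply: funext => j; change (f (- i) j - (T (- - i) (- j) + T (- - i) (- j)) - (T (- i) j + T (- i) j)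
      = f i (- j) - (T (- i) (- - j) + T (- i) (- - j)) - (T i (- j) + T i (- j))).
    rewrite !opprK; have -> : f (- i) j = f i (- j) by rewrite /f (dbl_opp hA).
    by move: (f i (- j)) (T i (- j)) (T (- i) j) => *; lia.
  by rewrite ip_opr.
have e4 : (ell d (w_AT d r A B T))%:Z * 8
  = 4 * rsum r (fun i => ip (Y i) (T i)) + 4 * rsum r (fun i => ip (Y i) (g i)).
  have -> : 4 * rsum r (fun i => ip (Y i) (g i)) 
     = 2 * rsum r (fun i => ip (g i) (T i)) + 2 * rsum r (fun i => ip (Y i) (g i)).
    by rewrite refl_gT; move: (rsum _ _) => *; lia.
  rewrite e8 -!rsumM -!rsumD; apply: eq_rsum => i.
  by rewrite w_expand //; move: (ip _ _) (ip _ _) (ip _ _) => *; lia.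
have half (a b : int) : a * 8 = 4 * b -> a * 2 = b by lia.
apply: half.
rewrite e4 -!rsumM -!rsumD; apply: eq_rsum => i.
by rewrite /g w_expand2 //; move: (ip _ _) (ip _ _) (ip _ _) => *; lia.
Qed.
End MinimalElementLength.

(** * The exponent xi in terms of pairings *)

Lemma ip_alt p q : finf p -> finf q ->
  \sum_(l \in [set: int]) \sum_(j \in [set j : int | l < j]) q j * p l = ip p q.
Proof.
move=> fp fq; have [W [uW pW qW _]] := finf_window fp fq fq.
rewrite (ipE uW pW qW) (fsW uW) => [|l lW]; last first.
  by apply: fsbig1 => j _; rewrite pW // mulr0.
rewrite /ipW (exchange_big_dep xpredT) //=; apply: eq_bigr => l _.
rewrite (fsWc uW) => [|j jW]; last by rewrite qW // mul0r.
by apply: eq_bigr => j _; rewrite mulrC.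
Qed.

Lemma fsum_interval (g : int -> int) a b m : b + 1 = a + m%:Z ->
  \sum_(i \in [set i : int | a <= i <= b]) g i = \sum_(i <- zseq a m) g i.
Proof.
move=> e; rewrite (@fsum_zseq g _ a m) => [|j /= h _]; last by lia.
rewrite big_seq_cond [RHS]big_seq; apply: eq_bigl => i.
by apply: andb_idr; rewrite mem_zseq => h; apply/mem_set => /=; lia.
Qed.

Lemma reflect_window (f : int -> int) (c : int) (K : nat) :
  \sum_(j <- zseq (c - K%:Z) (2 * K + 1)) f (2 * c - j) = \sum_(j <- zseq (c - K%:Z) (2 * K + 1)) f j.
Proof.
rewrite -(big_map (fun j => 2 * c - j) xpredT f); apply: perm_big; apply: uniq_perm.
- by rewrite map_inj_uniq ?zseq_uniq // => x y; lia.
- exact: zseq_uniq.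
move=> x; apply/mapP/idP => [[i]|].
  by rewrite !mem_zseq => h ->; lia.
by rewrite mem_zseq => h; exists (2 * c - x); rewrite ?mem_zseq; lia.
Qed.

(** The pairing of a row with its reflection about c: each unordered pair of
    positions occurs twice, and the pairs (l, l) with l < c once. *)
Lemma self_reflection p c : finf p ->
  ip p (fun j => p (2 * c - j))
  = 2 * \sum_(l \in [set: int]) \sum_(j \in [set j : int | l < j /\ j < 2 * c - l])
          p (2 * c - j) * p l
    + \sum_(j \in [set j : int | j < c]) p j * p j.
Proof.
move=> /finite_bounded[K0 hK]; pose K := (K0 + `|c|)%N.
pose W := zseq (c - K%:Z) (2 * K + 1); have uW : uniq W by exact: zseq_uniq.
have pW j : j \notin W -> p j = 0.
  by rewrite mem_zseq => jW; apply: contrapT => /hK; move: jW; rewrite /K; lia.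
have rW j : j \notin W -> p (2 * c - j) = 0.
  by move=> jW; apply: pW; move: jW; rewrite !mem_zseq; lia.
have W2 (f : int -> int) : \sum_(j <- W) f (2 * c - j) = \sum_(j <- W) f j by exact: reflect_window.
rewrite (ipE uW pW rW) (fsWc uW) => [|j jW]; last by rewrite pW // mul0r.
have -> : \sum_(l \in [set: int]) \sum_(j \in [set j : int | l < j /\ j < 2 * c - l])
          p (2 * c - j) * p l = \sum_(l <- W) \sum_(j <- W | (l < j) && (j < 2 * c - l)) p j * p l.
  rewrite (fsW uW) => [|l lW]; last by apply: fsbig1 => j _; rewrite (pW l) // mulr0.
  apply: eq_bigr => l _.
  have -> : [set j : int | l < j /\ j < 2 * c - l] = [set j | (l < j) && (j < 2 * c - l)].
    by apply/seteqP; split=> j /= => [[-> ->]|/andP[]].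
  rewrite (@fsWc _ uW _ (fun j => (l < j) && (j < 2 * c - l))) => [|j jW]; last by rewrite rW // mul0r.
  rewrite big_mkcond [RHS]big_mkcond -(W2 (fun j => if (l < j) && (j < 2 * c - l) then _ else _)); apply: eq_bigr => j _.
  rewrite (_ : 2 * c - (2 * c - j) = j); last by lia.
  by case: ifP => h1; case: ifP => h2 //; exfalso; move: h1 h2; lia.
have -> : ipW W p (fun j => p (2 * c - j)) = \sum_(l <- W) \sum_(j <- W | j < 2 * c - l) p j * p l.
  rewrite /ipW -[LHS]W2; apply: eq_bigr => l _.
  by apply: eq_bigr => j _; rewrite (_ : 2 * c - (2 * c - l) = l) //; lia.
have e3 : \sum_(l <- W) \sum_(j <- W | (l < j) && (j < 2 * c - l)) p j * p l
   = \sum_(l <- W) \sum_(j <- W | (j < l) && (j < 2 * c - l)) p j * p l.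
  rewrite (exchange_big_dep xpredT) //=; apply: eq_bigr => l _.
  by apply: eq_big => [j|j _]; [lia|rewrite mulrC].
have tw (s : int) : 2 * s = s + s by lia.
rewrite tw {2}e3 [X in _ + X]big_mkcond -!big_split /=.
apply: eq_big_seq => l lW; rewrite (bigID (fun j => j == l)) /= addrC.
have -> : \sum_(j <- W | (j < 2 * c - l) && (j == l)) p j * p l = if l < c then p l * p l else 0.
  case: ifP => h.
    rewrite (eq_bigl (fun j => j == l)) => [|j]; last by lia.
    by rewrite -big_filter filter_pred1_uniq // big_seq1.
  by rewrite big_pred0 // => j; lia.
congr (_ + _); rewrite !(big_mkcond (fun j => _ && _)) -big_split; apply: eq_bigr => j _ /=.
by case: (ltgtP j l) => jl; rewrite ?andbT ?andbF ?addr0 ?add0r.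
Qed.

Lemma ip_delta p (c : int) (q : int -> int) : (forall j, q j = (j == c)%:Z) ->
  ip p q = \sum_(j \in [set j : int | j < c]) p j.
Proof.
move=> qE; rewrite /ip (fsW (W := [:: c])) // => [|l]; last first.
  rewrite inE => /negbTE lc; apply: fsbig1 => j _; rewrite qE lc mulr0 //.
rewrite big_seq1; apply: eq_fsbigr => j _.
by rewrite qE eqxx mulr1.
Qed.

Section Xi.
Variables (r : nat) (X M : mat).
Let n : int := (period r)%:Z.
Let nE : n = 2 * r%:Z + 2. Proof. by rewrite /n /period; lia. Qed.
Hypotheses (Xper : periodic r X) (Xfin : forall i, finf (X i)) (Mfin : forall i, finf (M i)).
Hypothesis X0 : forall i j, 0 <= X i j.

Lemma rsum_split g : (forall i, g (- i) = g i) ->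
  rsum r g = g (- r%:Z - 1) + g 0 + 2 * \sum_(i \in [set i : int | - r%:Z <= i <= -1]) g i.
Proof.
move=> gs; rewrite rsum_half big_split /= big_nat_recl //= [X in _ + X]big_nat_recr //=.
rewrite (@fsum_interval g (- r%:Z) (-1) r); last by lia.
rewrite sum_zseq_nat [X in 2 * X]big_nat_rev /=.
have -> : \sum_(0 <= i < r) g (- r%:Z + (0 + r - i.+1)%N%:Z) = \sum_(0 <= i < r) g (- i%:Z - 1).
  by apply: eq_big_nat => i hi; congr g; lia.
have -> : \sum_(0 <= i < r) g i.+1%:Z = \sum_(0 <= i < r) g (- i%:Z - 1).
  by apply: eq_bigr => i _; rewrite -gs; congr g; lia.
by move: (\sum_(_ <= _ < _) _) (g 0) (g _) => *; lia.
Qed.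

(** The rows 0 and - r - 1 are their own reflections. *)
Lemma xi_center (i : int) : i = - r%:Z - 1 \/ i = 0 ->
  ip (X i) (refl X i) + ip (X i) (Jm 1 r.+1%:Z i)
  = 2 * (\sum_(l \in [set: int]) \sum_(j \in [set j : int | l < j /\ j < 2 * i - l])
           X (- i) (- j) * X i l)
   + 2 * \sum_(j \in [set j : int | j < i]) (X i j * (X i j + 1) %/ 2)%Z.
Proof.
move=> hi.
have Xr j : X (- i) (- j) = X i (2 * i - j).
  case: hi => ->; last by congr X; lia.
  have := per_sh Xper (-1) (- (- r%:Z - 1)) (- j); rewrite -/n nE => <-.
  by congr X; lia.
have -> : refl X i = fun j => X i (2 * i - j) by apply: funext => j; rewrite /refl /opr Xr.
rewrite self_reflection // (@ip_delta _ i); last first.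
  move=> j; rewrite /Jm mul1r eq_sym andb_idr // => /eqP ->.
  by case: hi => ->; rewrite ?dvdz0 // (_ : - r%:Z - 1 = -1 * r.+1%:Z) ?dvdz_mull //; lia.
rewrite -addrA; congr (_ + _).
  by congr (_ * _); apply: eq_fsbigr => l _; apply: eq_fsbigr => j _; rewrite Xr.
have [K hK] := finite_bounded (Xfin i).
pose W := zseq (- K%:Z) (2 * K + 1); have uW : uniq W by exact: zseq_uniq.
have pW j : j \notin W -> X i j = 0.
  by rewrite mem_zseq => jW; apply: contrapT => /hK; move: jW; lia.
rewrite !(fsWc uW) => [|j /pW -> //|j /pW -> //|j /pW -> //].
rewrite -big_split mulr_sumr; apply: eq_bigr => j _ /=.
have : (2 %| X i j * (X i j + 1))%Z.
  have := X0 i j; case: (X i j) => // m _; rewrite -PoszD -PoszM dvdzE /= addn1.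
  by rewrite dvdn2 oddM addn1 /=; case: (odd m).
move/divzK; move: (X i j) (_ %/ _)%Z => x h; lia.
Qed.

Lemma xi_rsum : xi_MX r M X * 2
  = rsum r (fun i => 2 * ip (X i) (M i - X i) - ip (X i) (refl X i) - ip (X i) (Jm 1 r.+1%:Z i)).
Proof.
pose G i := ip (X i) (refl X i).
have Gs i : G (- i) = G i.
  rewrite /G (_ : X (- i) = opr (refl X i)); last first.
    by apply: funext => j; rewrite /refl /opr opprK.
  rewrite (_ : refl X (- i) = opr (X i)); last by apply: funext => j; rewrite /refl opprK.
  by rewrite ip_opr //; exact: finf_opr.
pose H i := ip (X i) (Jm 1 r.+1%:Z i).
have Hz i : ~~ (r.+1%:Z %| i)%Z -> H i = 0.
  move=> ni; apply: fsbig1 => l _; apply: fsbig1 => j _; rewrite /Jm mul1r.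
  by case: eqP => [<-|]; rewrite ?(negbTE ni) mulr0.
(* Only the rows 0 and - r - 1 of the window contain fixed points. *)
have Hs : rsum r H = H (- r%:Z - 1) + H 0.
  rewrite rsum_half big_split /= big_nat_recl //= [X in _ + X]big_nat_recr //=.
  rewrite !big_nat big1 ?big1 ?addr0 ?add0r => [|i hi|i hi].
  - by rewrite addrC.
  - by apply: Hz; rewrite dvdzE gtnNdvd //; lia.
  - by apply: Hz; rewrite dvdzE gtnNdvd //; lia.
have -> : rsum r (fun i => 2 * ip (X i) (M i - X i) - G i - H i)
  = 2 * rsum r (fun i => ip (X i) (M i - X i)) - rsum r G - rsum r H.
  by rewrite -rsumM -!rsumN -!rsumD.
rewrite Hs (rsum_split Gs) /xi_MX (@fsum_interval _ _ _ (period r)); last by rewrite -/n nE; lia.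
have -> : \sum_(i <- zseq (- r%:Z - 1) (period r)) \sum_(l \in [set: int])
     \sum_(j \in [set j : int | l < j]) (M i j - X i j) * X i l
   = rsum r (fun i => ip (X i) (M i - X i)).
  rewrite /rsum (_ : - r%:Z - 1 = - r.+1%:Z); last by lia.
  by apply: eq_bigr => i _; apply: (@ip_alt (X i) (M i - X i)) => //; fin_tac.
have -> : \sum_(i \in [set i : int | - r%:Z <= i <= -1]) \sum_(l \in [set: int])
     \sum_(j \in [set j : int | l < j]) X (- i) (- j) * X i l
   = \sum_(i \in [set i : int | - r%:Z <= i <= -1]) G i.
  by apply: eq_fsbigr => i _; apply: (@ip_alt (X i) (refl X i)) => //; exact: finf_opr.
rewrite !big_cons !big_nil !addr0.
have := xi_center (or_introl erefl); have := xi_center (or_intror erefl); rewrite -!/(G _) -!/(H _).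
move: (\sum_(_ \in [set j : int | j < 0]) _) (\sum_(_ \in [set j : int | j < - r%:Z - 1]) _) => a b.
move: (\sum_(_ \in _) \sum_(_ \in [set j : int | _ < j /\ j < 2 * 0 - _]) _) => c.
move: (\sum_(_ \in _) \sum_(_ \in [set j : int | _ < j /\ j < 2 * (- r%:Z - 1) - _]) _) => e.
move: (\sum_(_ \in _) G _) (rsum _ _) (G 0) (H 0) (G _) (H _) => *; lia.
Qed.
End Xi.

(** * The matrices X and Y attached to T and S *)

(** The matrix X attached to T and S; the matrix Y is [refl T]. *)
Definition XTS (T S : mat) : mat := fun i j => T (i + 1) j - S (i + 1) j + S (- i) (- j).

Lemma neg_sub1 (i : int) : - (i + 1) = - i - 1. Proof. lia. Qed.

Section PairShape.
Variables A T S : mat.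
Let X := XTS T S.
Let Y := refl T.

Lemma refl_XTS i : refl X i = S i - opr (S (1 - i)) + opr (T (1 - i)).
Proof.
apply: funext => j; rewrite [RHS](_ : _ = S i j - S (1 - i) (- j) + T (1 - i) (- j)) //.
rewrite /refl /opr /X /XTS !opprK addrC [- i + 1]addrC; move: (T _ _) (S _ _) (S i j) => *; lia.
Qed.

(** The difference X - Y, so that A_(X,Y) = A + Z - check Z. *)
Definition zTS : mat := fun i => X i - Y i.

Lemma zTSE i j : zTS i j = (T (i + 1) j - S (i + 1) j + S (- i) (- j)) - T (- i) (- j).
Proof. by []. Qed.

(** The rows of X and Y with index i - 1, in terms of the reflected rows i. *)
Lemma z_prev i : zTS (i - 1) = T i - refl X i.
Proof.
apply: funext => j; rewrite refl_XTS zTSE subrK [- (i - 1)]opprB [RHS](_ : _ = T i j -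
  (S i j - S (1 - i) (- j) + T (1 - i) (- j))) //.
by move: (T _ _) (S _ _) (T i j) (S i j) => *; lia.
Qed.

Lemma A_TSE i j : A_TS A T S i j = A i j + (zTS i j - zTS (i - 1) j).
Proof.
rewrite !zTSE subrK [- (i - 1)]opprB [LHS](_ : _ = A i j - ((T i j - S i j) + (T (- i) (- j) - S (- i) (- j)))
  + ((T (i + 1) j - S (i + 1) j) + (T (- i + 1) (- j) - S (- i + 1) (- j)))) //.
rewrite [- i + 1]addrC; move: (A i j) (T i j) (S i j) (T (i + 1) j) (S (i + 1) j) => ? ? ? ? ?.
by move: (T (- i) _) (S (- i) _) (T (1 - i) _) (S (1 - i) _) => *; lia.
Qed.

Lemma z_opp i : zTS (- i - 1) = - opr (zTS i).
Proof.
apply: funext => j; rewrite [RHS](_ : _ = - zTS i (- j)) // !zTSE subrK !opprK.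
have -> : - (- i - 1) = i + 1 by lia.
by move: (T (- i) _) (S (- i) _) (T (i + 1) _) (S (i + 1) _) => *; lia.
Qed.
End PairShape.

Section Pair.
Variables (r d : nat).
Variables (A B : mat).
Hypotheses (hA : Xi r d A) (hB : Xi r d B).
Variables T S : mat.
Hypotheses (hT : Theta_BA r B A T) (hS : Gamma r T S).
Let n : int := (period r)%:Z.
Let nE : n = 2 * r%:Z + 2. Proof. by rewrite /n /period; lia. Qed.

Lemma S_ge0 i j : 0 <= S i j. Proof. by case: hS => -[]. Qed.
Lemma S_le i j : S i j <= T i j. Proof. by case: hS. Qed.
Lemma S_per : periodic r S. Proof. by case: hS => -[]. Qed.

Lemma S_fin i : finf (S i).
Proof.
apply: (finf_sub (T_fin hA hT i)) => j Tj.
by have := S_ge0 i j; have := S_le i j; rewrite Tj; lia.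
Qed.

Lemma S_row i : tot (S i) = tot (opr (S (1 - i))).
Proof. by case: hS => _ _ /(_ i). Qed.

Let X := XTS T S.
Let Y := refl T.

Lemma X_per : periodic r X.
Proof.
have Tp : periodic r T := T_per hT; have Sp := S_per; have rp := refl_per S_per.
move=> i j; rewrite /X /XTS -[S (- (i + _)) _]/(refl S _ _) rp.
by rewrite -[_ + _ + 1]addrAC Tp Sp.
Qed.

Lemma X_fin i : finf (X i).
Proof.
have fT := T_fin hA hT; have fS := S_fin.
apply: finfD; first by apply: finfB; [exact: fT|exact: fS].
exact/finf_opr/fS.
Qed.

Lemma X_ge0 i j : 0 <= X i j.
Proof. by rewrite /X /XTS; have := S_le (i + 1) j; have := S_ge0 (- i) (- j); lia. Qed.

Lemma Y_fin i : finf (Y i).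
Proof. exact: (refl_fin hA hT). Qed.

Lemma z_per : periodic r (zTS T S).
Proof.
move=> i j; change (X (i + n) (j + n) - Y (i + n) (j + n) = X i j - Y i j).
have -> : X (i + n) (j + n) = X i j by exact: X_per.
have Tp : periodic r T := T_per hT.
by have -> : Y (i + n) (j + n) = Y i j by exact: (refl_per Tp).
Qed.

Lemma z_fin i : finf (zTS T S i).
Proof. by apply: finfB; [exact: X_fin|exact: Y_fin]. Qed.

Lemma z_band : exists b : nat, forall i j, zTS T S i j <> 0 -> `|j - i| <= b%:Z.
Proof.
have [K hK] := Xi_band hA; exists K.+1 => i j h; apply: contrapT => nb; apply: h.
have TA k l : (K%:Z < `|l - k|) -> T k l = 0 /\ S k l = 0.
  move=> kl; have a0 : A k l = 0 by apply: contrapT => /hK; lia.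
  have := T_le hT k l; have := T_ge0 hT k l; have := T_ge0 hT (- k) (- l).
  have := S_ge0 k l; have := S_le k l; rewrite a0.
  by move: (T (- k) _) (S k l) (T k l) => *; lia.
have [e1 e2] : T (i + 1) j = 0 /\ S (i + 1) j = 0 by apply: TA; lia.
have [e3 e4] : T (- i) (- j) = 0 /\ S (- i) (- j) = 0 by apply: TA; lia.
by rewrite zTSE e1 e2 e3 e4.
Qed.

Lemma A_TS_sub i j : A i j - T i j - T (- i) (- j) + S i j + S (- i) (- j) <= A_TS A T S i j.
Proof.
rewrite A_TSE !zTSE subrK [- (i - 1)]opprB; have := S_le (i + 1) j; have := S_le (1 - i) (- j).
move: (A i j) (T i j) (S i j) (T (i + 1) j) (S (i + 1) j) => ? ? ? ? ?.
by move: (T (- i) _) (S (- i) _) (T (1 - i) _) (S (1 - i) _) => *; lia.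
Qed.

Lemma zW_row i : tot (zTS T S i) = tot (T (i + 1)) - tot (T (- i)).
Proof.
have [W [uW tW yW _]] := finf_window (T_fin hA hT (i + 1)) (Y_fin i) (z_fin i).
have sW j : j \notin W -> S (i + 1) j = 0.
  by move=> /tW tj; have := S_ge0 (i + 1) j; have := S_le (i + 1) j; rewrite tj; lia.
have uW' j : j \notin W -> S (- i) (- j) = 0.
  move=> /yW tj; have := S_ge0 (- i) (- j); have := S_le (- i) (- j).
  by move: tj; rewrite /Y /refl /opr => ->; lia.
have := S_row (i + 1); rewrite -(tot_opr (T (- i))) /tot.
rewrite (_ : 1 - (i + 1) = - i); last by lia.
rewrite !(fsW uW) // => [es|j jW]; last first.
  by rewrite zTSE tW // sW // uW' // -[T _ _]/(Y i j) yW.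
under eq_bigr => j _ do rewrite zTSE.
by rewrite sumrB big_split sumrB /= es subrK.
Qed.

(** The matrices A^(T-S) lie in Xi. *)
Lemma A_TS_Xi : Xi r d (A_TS A T S).
Proof.
have Cfin i : finf (A_TS A T S i).
  have -> : A_TS A T S i = A i + (zTS T S i - zTS T S (i - 1)) by apply: funext => j; rewrite A_TSE.
  apply: finfD; first exact: (Xi_fin hA).
  by apply: finfB; exact: z_fin.
split; [split|split; [|split; [|split; [|split]]]] => //.
- move=> i j; apply: le_trans (A_TS_sub i j); have := T_le hT i j.
  have := S_ge0 i j; have := S_ge0 (- i) (- j); lia.
- move=> i j; rewrite !A_TSE (_ : i + _ - 1 = i - 1 + n); last by rewrite addrAC.
  have zp := z_per.
  have -> : zTS T S (i + n) (j + n) = zTS T S i j by exact: zp.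
  have -> : zTS T S (i - 1 + n) (j + n) = zTS T S (i - 1) j by exact: zp.
  congr (_ + _).
  by have := Xi_sh hA 1 i j; rewrite !mul1r.
- move=> i j; rewrite !A_TSE (Xi_opp hA); congr (_ + _).
  have -> : zTS T S (- i) = - opr (zTS T S (i - 1)).
    by rewrite -z_opp; congr (zTS T S _); lia.
  rewrite z_opp [LHS](_ : _ = - zTS T S (i - 1) (- - j) - - zTS T S i (- - j)) // !opprK addrC //.
- rewrite A_TSE !zTSE (_ : 0 - 1 + 1 = 0) // (_ : - (0 - 1) = 1) // (_ : - 0 = 0) // add0r.
  have := Xi_odd0 hA.
  move: (A 0 0) (T 0 0) (S 0 0) (T 1 0) (S 1 0) => a t s t1 s1 h.
  rewrite -(modzMDl (t - s - t1 + s1)) -h; congr (_ %% _)%Z; lia.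
- have e : forall F, periodic r F -> F (- r.+1%:Z) (- r.+1%:Z) = F r.+1%:Z r.+1%:Z /\
     F (- r%:Z) (- r.+1%:Z) = F (r.+1%:Z + 1) r.+1%:Z.
    move=> F pF; rewrite -(pF (- r.+1%:Z)) -(pF (- r%:Z)) -/n nE.
    by split; congr F; lia.
  have [e1 e2] := e _ (T_per hT); have [e3 e4] := e _ S_per.
  rewrite A_TSE !zTSE subrK e1 e3 (_ : - (r.+1%:Z - 1) = - r%:Z) ?e2 ?e4; last by lia.
  have := Xi_odd1 hA.
  move: (A _ _) (T _ _) (S _ _) (T _ _) (S _ _) => a t1 s1 t s h.
  rewrite -(modzMDl (s - t + t1 - s1)) -h; congr (_ %% _)%Z; lia.
have CR i : row_a (A_TS A T S) i = row_a A i + (tot (zTS T S i) - tot (zTS T S (i - 1))).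
  rewrite /row_a /tot; have [W [uW aW zW z'W]] := finf_window (Xi_fin hA i) (z_fin i) (z_fin (i - 1)).
  rewrite !(fsW uW) // => [|j jW]; last by rewrite A_TSE aW // zW // z'W.
  by rewrite -sumrB -big_split; apply: eq_bigr => j _; rewrite A_TSE.
have tper i : tot (zTS T S (i + n)) = tot (zTS T S i).
  rewrite !zW_row !/(tot _) -!/(row_a T _) !(T_row hT).
  have Bn a b : B (a + n) (b + n) = B a b by have := Xi_sh hB 1 a b; rewrite !mul1r.
  rewrite -[B (- (i + n) - 1) _]Bn; congr (_ - _); last by congr B; lia.
  by rewrite -[RHS]Bn; congr B; lia.
have -> : \sum_(1 <= i < (period r).+1) \sum_(j \in [set: int]) A_TS A T S i%:Z j
  = \sum_(1 <= i < (period r).+1) row_a A i%:Z.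
  under eq_bigr => i _ do rewrite -/(row_a _ _) CR.
  rewrite big_split /= -[RHS]addr0; congr (_ + _).
  rewrite big_add1 /= (eq_bigr (fun i : nat => tot (zTS T S (i.+1%:Z)) - tot (zTS T S i%:Z))).
    by rewrite telescope_sumr // -[X in _ - tot (zTS T S X)]/(0 : int) -(tper 0) add0r subrr.
  by move=> i _; congr (_ - tot (zTS T S _)); lia.
by case: hA => _ [_ [_ [_ [_ <-]]]].
Qed.
End Pair.

(** * The identity between the exponents *)

Section Local.
Variable W : seq int.

Lemma dotWDl p q s : dotW W (p + q) s = dotW W p s + dotW W q s.
Proof. by rewrite /dotW -big_split; apply: eq_bigr => j _; exact: mulrDl. Qed.
Lemma dotWC p q : dotW W p q = dotW W q p.
Proof. by apply: eq_bigr => j _; rewrite mulrC. Qed.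
Lemma dotWNl p s : dotW W (- p) s = - dotW W p s.
Proof. by rewrite /dotW -sumrN; apply: eq_bigr => j _; exact: mulNr. Qed.
Lemma dotWDr p q s : dotW W s (p + q) = dotW W s p + dotW W s q.
Proof. by rewrite dotWC dotWDl !(dotWC s). Qed.
Lemma dotWNr p s : dotW W s (- p) = - dotW W s p.
Proof. by rewrite dotWC dotWNl (dotWC s). Qed.

(** Bilinearity of the pairing and the scalar product, as rewriting rules. *)
Definition linW := (ipWDl, ipWDr, ipWNl, ipWNr, dotWDl, dotWDr, dotWNl, dotWNr).

Hypothesis uW : uniq W.

(** The contribution of a pair of rows of S and T to h(T, S): t, s are the rows i
    and y, u the rows 1 - i read backwards. *)
Definition hW (t s u y : int -> int) : int :=
  \sum_(j <- W) (s j * (\sum_(k <- W | k <= j) t k) - (s j * (s j + 1) %/ 2)%Z)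
  + \sum_(j <- W) (y j - u j)
    * (\sum_(k <- W | k <= j - 1) t k + \sum_(k <- W | j <= k) s k - \sum_(k <- W | j + 1 <= k) u k).

Lemma sum_le_ip t s : \sum_(j <- W) s j * (\sum_(k <- W | k <= j) t k) = ipW W t s + dotW W t s.
Proof.
rewrite /ipW /dotW -big_split; apply: eq_big_seq => j jW /=.
rewrite mulr_sumr (bigID (fun k => k < j)) /=; congr (_ + _).
  apply: eq_big => [k|k _]; [lia|exact: mulrC].
rewrite (eq_bigl (fun k => k == j)) => [|k]; last by lia.
by rewrite -big_filter filter_pred1_uniq // big_seq1 mulrC.
Qed.

Lemma sum_lt_ip t s : \sum_(j <- W) s j * (\sum_(k <- W | k < j) t k) = ipW W t s.
Proof.
by apply: eq_bigr => j _; rewrite mulr_sumr; apply: eq_bigr => k _; rewrite mulrC.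
Qed.

Lemma sum_gt_ip t s : \sum_(j <- W) s j * (\sum_(k <- W | j < k) t k) = ipW W s t.
Proof.
rewrite /ipW (exchange_big_dep xpredT) //=; apply: eq_bigr => j _.
by rewrite mulr_sumr.
Qed.

Lemma sum_ge_ip t s : \sum_(j <- W) s j * (\sum_(k <- W | j <= k) t k) = ipW W s t + dotW W s t.
Proof.
rewrite -sum_gt_ip /dotW -big_split; apply: eq_big_seq => j jW /=.
rewrite -mulrDr; congr (_ * _); rewrite (bigID (fun k => j < k)) /=; congr (_ + _).
  by apply: eq_bigl => k; lia.
rewrite (eq_bigl (fun k => k == j)) => [|k]; last by lia.
by rewrite -big_filter filter_pred1_uniq // big_seq1.
Qed.

Lemma hW_ip t s u y : (forall j, 0 <= s j) ->
  2 * hW t s u y = 2 * (ipW W t s + dotW W t s) - dotW W s s - totW W s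
    + 2 * (ipW W t (y - u) + ipW W (y - u) s + dotW W (y - u) s - ipW W (y - u) u).
Proof.
move=> s0; rewrite /hW sumrB sum_le_ip.
have -> : \sum_(j <- W) (y j - u j)
    * (\sum_(k <- W | k <= j - 1) t k + \sum_(k <- W | j <= k) s k - \sum_(k <- W | j + 1 <= k) u k)
  = ipW W t (y - u) + (ipW W (y - u) s + dotW W (y - u) s) - ipW W (y - u) u.
  rewrite -sum_lt_ip -sum_ge_ip -sum_gt_ip -!big_split -sumrB; apply: eq_bigr => j _ /=.
  rewrite -mulrDr -mulrBr; congr (_ * (_ + _ - _)); apply: eq_bigl => k; lia.
have : 2 * \sum_(j <- W) ((s j * (s j + 1)) %/ 2)%Z = dotW W s s + totW W s.
  rewrite mulr_sumr -big_split; apply: eq_bigr => j _ /=.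
  have : (2 %| s j * (s j + 1))%Z.
    have := s0 j; case: (s j) => // m _; rewrite -PoszD -PoszM dvdzE /= addn1.
    by rewrite dvdn2 oddM addn1 /=; case: (odd m).
  move/divzK; move: (s j) (_ %/ _)%Z => x h; lia.
move: (\sum_(j <- W) _) (ipW W t s) (dotW W t s) (dotW W s s) (totW W s) => *; lia.
Qed.

Lemma neps_ip x y x' u :
  neps W x y x' u = ipW W x y + dotW W (y - u) x
    + ipW W (fun k => u k + x' k - y k) (y - u) - ipW W u (y - u) - dotW W u (y - u).
Proof.
rewrite /neps sum_lt_ip -!addrA; congr (_ + _).
rewrite -sum_lt_ip -opprD -sum_le_ip /dotW -sumrB -big_split; apply: eq_bigr => k _ /=.
by rewrite -addrA mulrDr; congr (_ + _); rewrite -mulrBr.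
Qed.

(** The identity between exponents for one pair of rows. *)
Lemma local_identity t s u y : (forall j, 0 <= s j) -> totW W s = totW W u ->
  2 * totW W s + 2 * hW t s u y
  + (2 * neps W (t - s + u) y (s - u + y) u + \sum_(k <- W) u k * (u k - 1))
  = ipW W (t - s + u) (t - s + u) - ipW W y y + ipW W (t - s + u) y - ipW W y (t - s + u)
    + ipW W (s - u + y) (s - u + y) - ipW W t t + ipW W t (s - u + y) - ipW W (s - u + y) t
    + 2 * (totW W y * totW W t).
Proof.
move=> s0 su; rewrite hW_ip // neps_ip.
have -> : (fun k => u k + (s - u + y) k - y k) = s.
  by apply: funext => k; rewrite [(_ + y) k](_ : _ = s k - u k + y k) //; lia.
have -> : \sum_(k <- W) u k * (u k - 1) = dotW W u u - totW W u.
  by rewrite -sumrB; apply: eq_bigr => k _; rewrite mulrBr mulr1.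
rewrite !linW.
have := ipW_sym uW t s; have := ipW_sym uW t u; have := ipW_sym uW t y; have := ipW_sym uW s u.
have := ipW_sym uW s y; have := ipW_sym uW u y; have := ipW_sym uW t t; have := ipW_sym uW s s.
have := ipW_sym uW u u; have := ipW_sym uW y y.
rewrite ?(dotWC s t) ?(dotWC u t) ?(dotWC y t) ?(dotWC u s) ?(dotWC y s) ?(dotWC y u) -su.
move: (totW W s) (totW W t) (totW W y) => ts tt ty.
move: (ipW W s s) (ipW W t t) (ipW W u u) (ipW W y y) => ? ? ? ?.
move: (ipW W s t) (ipW W t s) (ipW W s u) (ipW W u s) (ipW W s y) (ipW W y s) => ? ? ? ? ? ?.
move: (ipW W t u) (ipW W u t) (ipW W t y) (ipW W y t) (ipW W u y) (ipW W y u) => ? ? ? ? ? ?.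
move: (dotW W s s) (dotW W t t) (dotW W u u) (dotW W y y) => ? ? ? ?.
move: (dotW W t s) (dotW W t u) (dotW W t y) (dotW W s u) (dotW W s y) (dotW W u y) => *.
lia.
Qed.
End Local.

(** For x = x_i, y = y_i, t = t_i and w the reflection of x_(-i): apart from the
    last two terms, only pairings of x and y with each other remain. *)
Lemma global_expand (x y t w f J m : int -> int) :
  finf x -> finf y -> finf t -> finf w -> finf f -> finf J -> finf m ->
  m + m = f + J + (x - y - (t - w)) + (x - y - (t - w)) ->
  ip (x - y) f - ip (x - y - (t - w)) (t - w) + (ip y f - 2 * ip y y - ip y t)
  - (2 * ip x (m - x) - ip x w - ip x J) + (ip (x - y) (x - y) - ip (t - w) (t - w))
  = ip x x - ip y y + ip x y - ip y x + (ip x t - ip y w).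
Proof.
move=> fx fy ft fw ff fJ fm mm.
have : 2 * ip x m = ip x (m + m) by rewrite ipDr //; move: (ip x m) => *; lia.
rewrite mm !(ipDl, ipDr, ipNl, ipNr); fin_tac.
move: (ip x m) (ip x f) (ip y f) (ip x J) (ip x x) (ip x y) (ip y x) (ip y y).
move: (ip x t) (ip x w) (ip y t) (ip y w) (ip t t) (ip t w) (ip w t) (ip w w) => *; lia.
Qed.

Section Exponent.
Variables (r d : nat).
Hypothesis hd : (2 <= d)%N.
Variables (A B : mat).
Hypotheses (hA : Xi r d A) (hB : Xi r d B) (hBtri : tridiagonal B).
Hypothesis hAB : row_c r A = col_c r B.
Variables T S : mat.
Hypotheses (hT : Theta_BA r B A T) (hS : Gamma r T S).
Let n : int := (period r)%:Z.
Let nE : n = 2 * r%:Z + 2. Proof. by rewrite /n /period; lia. Qed.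
Let X := XTS T S.
Let Y := refl T.
Let C := A_TS A T S.

Let hC : Xi r d C := A_TS_Xi hA hB hT hS.
Let Xfin : forall i, finf (X i) := X_fin hA hT hS.
Let Yfin : forall i, finf (Y i) := Y_fin hA hT.
Let Tfin : forall i, finf (T i) := T_fin hA hT.
Let Xper : periodic r X := X_per hT hS.
Let Tper : periodic r T := T_per hT.
Let Yper : periodic r Y := refl_per Tper.

Lemma global_exponent :
  (ell_ABST r d A B S T - xi_MX r C X) * 2
  = rsum r (fun i => ip (X i) (X i) - ip (Y i) (Y i) + ip (X i) (Y i) - ip (Y i) (X i)
      + tot (Y i) * tot (T (i + 1))).
Proof.
have zper := z_per hT hS; have zfin := z_fin hA hT hS.
have e1 := ell_diff hd hA hC zper zfin (z_band hA hT hS) (z_opp T S) (A_TSE A T S).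
have e2 := ell_tri hd hB hBtri; have e3 := ell_w hA hB hBtri hAB hT hd.
have X0 : forall i j, 0 <= X i j := X_ge0 hS.
have Cfin : forall i, finf (C i) := Xi_fin hC.
have e4 := xi_rsum Xper Xfin Cfin X0.
have Rfin i : finf (refl X i) by exact: finf_opr.
have e2' : rsum r (fun i => B i (i - 1) * B (i - 1) i)
   = rsum r (fun i => tot (Y i) * tot (T (i + 1))).
  have Bn a b : B (a + n) (b + n) = B a b by have := Xi_sh hB 1 a b; rewrite !mul1r.
  rewrite -(@rsum_shift r 1) => [|i]; last first.
    by rewrite -/n !(addrAC i n) !Bn.
  have tr i : tot (T i) = B (i - 1) i by rewrite -(T_row hT).
  apply: eq_rsum => i; rewrite tot_opr !tr addrK; congr (_ * _).
  by rewrite -(Xi_opp hB); congr B; lia.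
(* Sums over the rows are invariant under i -> i - 1, *)
have zz : rsum r (fun i => ip (zTS T S i) (zTS T S i))
  = rsum r (fun i => ip (zTS T S (i - 1)) (zTS T S (i - 1))).
  rewrite -(@rsum_shift r (-1)) // => i; have := ip_per 0 zper zper i.
  by rewrite !addr0.
(* and under the reflection i -> - i. *)
have yw : rsum r (fun i => ip (X i) (T i)) = rsum r (fun i => ip (Y i) (refl X i)).
  rewrite -(@rsum_opp r (fun i => ip (X i) (T i))) => [|i]; last first.
    by have := ip_per 0 Xper Tper i; rewrite !addr0.
  by apply: eq_rsum => i; rewrite -ip_opr.
pose F1 i := ip (zTS T S i) (dbl r A i).
pose F2 i := ip (dz (zTS T S) i) (zTS T S (i - 1)).
pose F3 i := ip (Y i) (dbl r A i) - 2 * ip (Y i) (Y i) - ip (Y i) (T i).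
pose F4 i := 2 * ip (X i) (C i - X i) - ip (X i) (refl X i) - ip (X i) (Jm 1 r.+1%:Z i).
pose F5 i := ip (zTS T S i) (zTS T S i).
pose F6 i := ip (zTS T S (i - 1)) (zTS T S (i - 1)).
pose G1 i := ip (X i) (X i) - ip (Y i) (Y i) + ip (X i) (Y i) - ip (Y i) (X i).
pose G2 i := ip (X i) (T i).
pose G3 i := ip (Y i) (refl X i).
have key : rsum r (fun i => F1 i - F2 i + F3 i - F4 i + (F5 i - F6 i))
  = rsum r (fun i => G1 i + (G2 i - G3 i)).
  apply: eq_rsum => i; rewrite /F1 /F2 /F3 /F4 /F5 /F6 /G1 /G2 /G3 /dz z_prev; apply: global_expand => //.
  - exact: (dbl_fin hA).
  - exact: Jm_fin.
  rewrite -z_prev; apply: funext => j.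
  rewrite [LHS](_ : _ = C i j + C i j) // [RHS](_ : _ = dbl r A i j + Jm 1 r.+1%:Z i j +
    (zTS T S i j - zTS T S (i - 1) j) + (zTS T S i j - zTS T S (i - 1) j)) //.
  rewrite /C A_TSE /dbl; move: (zTS T S i j) (zTS T S _ j) (A i j) (Jm _ _ _ _) => *; lia.
have e5 : rsum r (fun i => F1 i - F2 i + F3 i - F4 i + (F5 i - F6 i))
  = rsum r F1 - rsum r F2 + rsum r F3 - rsum r F4 + (rsum r F5 - rsum r F6).
  by rewrite /rsum -!sumrB -!big_split -!sumrB -!big_split.
have e6 : rsum r (fun i => G1 i + (G2 i - G3 i)) = rsum r G1 + (rsum r G2 - rsum r G3).
  by rewrite /rsum -!sumrB -!big_split.
rewrite (rsumD r G1) -e2'; move: key; rewrite e5 e6.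
rewrite -[rsum r F3]e3 -[rsum r F4]e4 [rsum r F5]zz [rsum r G2]yw.
move: e1; rewrite /ell_ABST -/C -/X -/F1 -/F2; have := e2.
move: (rsum r _) (rsum r F1) (rsum r F2) (rsum r F6) (rsum r G1) (rsum r G3) (xi_MX _ _ _).
move: ((ell_mat d r A)%:Z) ((ell_mat d r B)%:Z) ((ell_mat d r C)%:Z) ((ell d _)%:Z) => *; lia.
Qed.

Variable W : seq int.
Hypothesis uW : uniq W.
Hypothesis TW : forall i : nat, (i < r.+1)%N -> forall j, j \notin W ->
  T (i%:Z + 1) j = 0 /\ T (- i%:Z) (- j) = 0.

(** The exponent of v in the summand of n(X, Y) indexed by S, for the i-th
    factor. *)
Definition nuTS (i : int) : int :=
  2 * neps W (X i) (Y i) (opr (X (- i - 1))) (opr (S (- i)))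
  + \sum_(k <- W) S (- i) (- k) * (S (- i) (- k) - 1).

Lemma exponent_identity :
  2 * (ell_ABST r d A B S T - n_S r S - h_TS r T S)
  = 2 * xi_MX r C X + \sum_(0 <= i < r.+1) nuTS i%:Z.
Proof.
have := global_exponent; rewrite rsum_half => e.
pose loc (i : nat) := ip (X i%:Z) (X i%:Z) - ip (Y i%:Z) (Y i%:Z) + ip (X i%:Z) (Y i%:Z)
  - ip (Y i%:Z) (X i%:Z) + tot (Y i%:Z) * tot (T (i%:Z + 1))
  + (ip (X (- i%:Z - 1)) (X (- i%:Z - 1)) - ip (Y (- i%:Z - 1)) (Y (- i%:Z - 1))
  + ip (X (- i%:Z - 1)) (Y (- i%:Z - 1))
  - ip (Y (- i%:Z - 1)) (X (- i%:Z - 1)) + tot (Y (- i%:Z - 1)) * tot (T (- i%:Z - 1 + 1))).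
rewrite -/loc in e.
pose h (i : nat) := hW W (T (i%:Z + 1)) (S (i%:Z + 1)) (opr (S (- i%:Z))) (Y i%:Z).
have SW (i : nat) : (i < r.+1)%N -> forall j, j \notin W ->
  S (i%:Z + 1) j = 0 /\ S (- i%:Z) (- j) = 0.
  move=> ir j jW; have [t1 t2] := TW ir jW.
  have := S_ge0 hS (i%:Z + 1) j; have := S_le hS (i%:Z + 1) j; rewrite t1.
  have := S_ge0 hS (- i%:Z) (- j); have := S_le hS (- i%:Z) (- j); rewrite t2; lia.
have en : n_S r S = \sum_(0 <= i < r.+1) totW W (S (i%:Z + 1)).
  rewrite /n_S big_add1 /=; apply: eq_big_nat => i ir.
  rewrite (_ : i.+1%:Z = i%:Z + 1) /row_a; last by lia.
  by rewrite (fsW uW) // => j /(SW _ ir)[].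
have eh : h_TS r T S = \sum_(0 <= i < r.+1) h i.
  rewrite /h_TS !big_add1 -big_split /=; apply: eq_big_nat => i ir.
  rewrite (_ : i.+1%:Z = i%:Z + 1); last by lia.
  rewrite (_ : 1 - (i%:Z + 1) = - i%:Z); last by lia.
  rewrite (fsW uW) => [|j /(SW _ ir)[-> _]]; last by rewrite mul0r.
  rewrite (fsW uW) => [|j jW]; last first.
    by have [_ ->] := SW _ ir _ jW; have [_ ->] := TW ir jW; rewrite subrr mul0r.
  rewrite /h /hW; congr (_ + _); apply: eq_bigr => j _.
    by rewrite (fsWc uW) // => k /(TW ir)[].
  rewrite !(fsWc uW) //; first by move=> k /(SW _ ir)[].
    by move=> k /(SW _ ir)[].
  by move=> k /(TW ir)[].
have lc (i : nat) : (i < r.+1)%N ->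
    2 * totW W (S (i%:Z + 1)) + 2 * h i + nuTS i%:Z = loc i.
  move=> ir; pose t := T (i%:Z + 1); pose s := S (i%:Z + 1).
  pose u := opr (S (- i%:Z)); pose y := Y i%:Z.
  have s0 j : 0 <= s j := S_ge0 hS _ _.
  have tW j : j \notin W -> t j = 0 by move=> /(TW ir)[].
  have yW j : j \notin W -> y j = 0 by move=> /(TW ir)[].
  have sW j : j \notin W -> s j = 0 by move=> /(SW _ ir)[].
  have uW' j : j \notin W -> u j = 0 by move=> /(SW _ ir)[].
  have su : totW W s = totW W u.
    have := S_row hS (i%:Z + 1); rewrite (_ : 1 - (i%:Z + 1) = - i%:Z); last by lia.
    by rewrite /tot !(fsW uW).
  have xE : X i%:Z = t - s + u by [].
  have x'E : opr (X (- i%:Z - 1)) = s - u + y.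
    have := refl_XTS T S (i%:Z + 1); rewrite (_ : 1 - (i%:Z + 1) = - i%:Z); last by lia.
    by move=> <-; rewrite /refl neg_sub1.
  have y'E : opr (Y (- i%:Z - 1)) = t.
    by apply: funext => j; rewrite /Y /refl /opr opprK /t; congr T; lia.
  have oo p : opr (opr p) = p by apply: funext => j; rewrite /opr opprK.
  have fx' : finf (s - u + y) by rewrite -x'E; exact: finf_opr.
  have ft : finf t by exact: Tfin.
  have X'E : X (- i%:Z - 1) = opr (s - u + y) by rewrite -x'E oo.
  have Y'E : Y (- i%:Z - 1) = opr t by rewrite -y'E oo.
  rewrite /loc X'E Y'E (ip_opr fx' fx') (ip_opr ft ft) (ip_opr fx' ft) (ip_opr ft fx').
  rewrite (_ : T (- i%:Z - 1 + 1) = opr y); last first.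
    by rewrite subrK; apply: funext => j; rewrite /y /Y /refl /opr opprK.
  rewrite (tot_opr t) (tot_opr y) -/y -/t xE.
  have xW j : j \notin W -> (t - s + u) j = 0.
    by move=> jW; rewrite [LHS](_ : _ = t j - s j + u j) // tW // sW // uW'.
  have x'W j : j \notin W -> (s - u + y) j = 0.
    by move=> jW; rewrite [LHS](_ : _ = s j - u j + y j) // yW // sW // uW'.
  rewrite !(ipE uW) //.
  have -> : tot t = totW W t by rewrite /tot (fsW uW).
  have -> : tot y = totW W y by rewrite /tot (fsW uW).
  have := @local_identity W uW t s u y s0 su.
  rewrite /nuTS /h -/t -/s -/u -/y xE x'E.
  move=> ->; rewrite (mulrC (totW W t)).
  move: (ipW W _ _) (ipW W _ _) (ipW W _ _) (ipW W _ _) (ipW W _ _) (ipW W _ _).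
  by move: (ipW W _ _) (ipW W _ _) (totW W y * totW W t) => *; lia.
have eloc : \sum_(0 <= i < r.+1) loc i = 2 * n_S r S + 2 * h_TS r T S + \sum_(0 <= i < r.+1) nuTS i%:Z.
  rewrite en eh !mulr_sumr -!big_split; apply: eq_big_nat => i ir /=.
  by rewrite lc.
move: e; rewrite /loc in eloc; rewrite eloc.
move: (ell_ABST _ _ _ _ _ _) (n_S _ _) (h_TS _ _ _) (xi_MX _ _ _) (\sum_(_ <= _ < _) _) => *; lia.
Qed.
End Exponent.

(** * The bracket as a quotient of factorials *)

(** The product [2] [4] ... [2 b]. *)
Definition dfact (b : nat) : Qv := \prod_(1 <= k < b.+1) qint (2 * k%:Z).

Lemma dfactS b : dfact b.+1 = dfact b * qint (2 * b.+1%:Z).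
Proof. by rewrite /dfact big_nat_recr. Qed.

Lemma bracket_frac (F : fieldType) (P p q D E : F) : q != 0 ->
  P * (p / q) * (D * (E * q)) = P * (D * p * E).
Proof.
move=> q0; rewrite -mulrA; congr (_ * _); rewrite mulrA [p / q * D]mulrC -!mulrA.
by congr (D * (p * _)); rewrite mulrCA mulVf // mulr1.
Qed.

(** The diagonal factors of the bracket. *)
Lemma diag_bracket (b m : nat) (a : int) : a = 2 * b%:Z + 1 -> (m <= b)%N ->
  \prod_(0 <= k < m) (qint (a - 2 * k%:Z - 1) / qint (k%:Z + 1)) * (dfact (b - m) * qfact m%:Z)
  = dfact b.
Proof.
move=> ->; elim: m => [|m IH] mb; first by rewrite big_geq // subn0 qfact0 mul1r mulr1.
rewrite big_nat_recr //= qfactS -(IH (ltnW mb)) (_ : (b - m = (b - m.+1).+1)%N); last by lia.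
rewrite dfactS (_ : 2 * b%:Z + 1 - 2 * m%:Z - 1 = 2 * (b - m.+1).+1%:Z); last by lia.
rewrite (_ : m%:Z + 1 = m.+1%:Z); last by lia.
by rewrite bracket_frac // qint_neq0.
Qed.

Lemma diag_bracket0 (b m : nat) (a : int) : a = 2 * b%:Z + 1 -> (b < m)%N ->
  \prod_(0 <= k < m) (qint (a - 2 * k%:Z - 1) / qint (k%:Z + 1)) = 0.
Proof.
move=> -> bm; rewrite (big_cat_nat (n := b)) //=; last exact: ltnW.
rewrite [X in _ * X]big_ltn // (_ : 2 * b%:Z + 1 - 2 * b%:Z - 1 = 0); last by lia.
by rewrite qint0 !mul0r mulr0.
Qed.

Section Bracket.
Variables (r : nat) (W : seq int).
Hypotheses (uW : uniq W) (oW : forall j, (- j \in W) = (j \in W)).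
Let n : int := (period r)%:Z.
Let nE : n = 2 * r%:Z + 2. Proof. by rewrite /n /period; lia. Qed.

(** The positions of the i-th row that belong to the index set of [A]^!_c. *)
Definition ipl (i : nat) (j : int) : bool :=
  if i == 0%N then 1 <= j else if i == r.+1 then j <= r%:Z else true.

Lemma prod_Iplus (F : int * int -> Qv) :
  (forall i : nat, (i < r.+2)%N -> forall j, j \notin W -> F (i%:Z, j) = 1) ->
  \prod_(p \in Iplus r) F p = \prod_(0 <= i < r.+2) \prod_(j <- W | ipl i j) F (i%:Z, j).
Proof.
move=> F1; pose V := zseq 0 r.+2.
have IP (p : int * int) : p \in [seq (i, j) | i <- V, j <- W] ->
    (p \in Iplus r) = ipl `|p.1|%N p.2.
  move=> /allpairsP[[i j] /= [hi _ ->]] /=; move: hi; rewrite mem_zseq => hi.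
  rewrite /ipl; apply/idP/idP => [/set_mem|h].
    by rewrite /Iplus /=; do ?case: ifP => ?; lia.
  by apply/mem_set; move: h; rewrite /Iplus /=; do ?case: ifP => ?; lia.
rewrite (@fsbigE_cond _ _ _ _ _ [seq (i, j) | i <- V, j <- W]); last 2 first.
- by apply: allpairs_uniq => [||[? ?] [? ?] _ _ [-> ->] //]; rewrite ?zseq_uniq.
- move=> [i j] hp np; have hi : 0 <= i < r.+2%:Z by move: hp; rewrite /Iplus /=; lia.
  rewrite (_ : i = `|i|%N%:Z); last by lia.
  apply: F1; first by lia.
  apply/negP => jW; move/negP: np; apply; apply/allpairsP; exists (i, j); split => //=.
  by rewrite mem_zseq; lia.
transitivity (\prod_(p <- [seq (i, j) | i <- V, j <- W]) if ipl `|p.1|%N p.2 then F p else 1).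
  by rewrite big_mkcond; apply: eq_big_seq => p /IP ->.
rewrite big_allpairs_dep /V /zseq big_map -{1}[r.+2]subn0 -/(index_iota 0 r.+2); apply: eq_big_nat => i _.
by rewrite [RHS]big_mkcond /= add0r.
Qed.

Lemma prodWc (F : int -> Qv) (P : pred int) : (forall j, j \notin W -> F j = 1) ->
  \prod_(j \in [set j | P j]) F j = \prod_(j <- W | P j) F j.
Proof.
move=> F1; rewrite (@fsbigE_cond _ _ _ _ _ W) //; last by move=> j _; exact: F1.
by apply: eq_bigl => j; apply/idP/idP => [/set_mem|h] //; exact/mem_set.
Qed.

Lemma prod3 (F : int -> Qv) c : (forall j, j \notin W -> F j = 1) ->
  \prod_(j <- W) F j = (\prod_(j <- W | j < c) F j) * F c * \prod_(j <- W | c < j) F j.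
Proof.
move=> F1; rewrite (bigID (fun j => j < c)) /= -mulrA; congr (_ * _).
rewrite (bigID (fun j => j == c)) /=; congr (_ * _).
  rewrite (eq_bigl (fun j => j == c)) => [|j]; last by lia.
  case: (boolP (c \in W)) => cW; first by rewrite -big_filter filter_pred1_uniq // big_seq1.
  rewrite F1 // big_seq_cond big_pred0 // => j; case: eqP => [->|]; rewrite ?andbF //.
  by rewrite (negbTE cW).
by apply: eq_bigl => j; lia.
Qed.

Lemma prod_oppW (F : int -> Qv) : \prod_(j <- W) F (- j) = \prod_(j <- W) F j.
Proof.
rewrite -(big_map -%R xpredT F); apply: perm_big; apply: uniq_perm => //.
  by rewrite map_inj_uniq //; exact: oppr_inj.
move=> x; apply/mapP/idP => [[i iW ->]|xW]; first by rewrite oW.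
by exists (- x); rewrite ?opprK // oW.
Qed.

Variable X : mat.
Hypotheses (Xper : periodic r X).
Hypothesis XW : forall i : int, - r.+1%:Z <= i <= r.+1%:Z -> forall j, j \notin W -> X i j = 0.

Lemma Xmid j : X (- r.+1%:Z) (- j) = X r.+1%:Z (2 * r.+1%:Z - j).
Proof. by rewrite -(per_sh Xper 1 (- r.+1%:Z)) -/n nE; congr X; lia. Qed.

Let R (i : int) : Qv := \prod_(j <- W) qfact (X i j).

Lemma rowW (i : int) : - r.+1%:Z <= i <= r.+1%:Z ->
  \prod_(j \in [set: int]) qfact (X i j) = R i.
Proof. by move=> hi; rewrite (fsW uW) // => j /(XW hi) ->; rewrite qfact0. Qed.

Lemma row_fact_per (k i : int) : \prod_(j \in [set: int]) qfact (X (i + k * n) j)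
  = \prod_(j \in [set: int]) qfact (X i j).
Proof.
rewrite (reindex_fsbig (fun j => j + k * n) [set: int] [set: int]) //.
  by apply: eq_fsbigr => j _; rewrite (per_sh Xper).
split=> [j //|x y _ _|j _]; first by move/addIr.
by exists (j - k * n); rewrite ?subrK.
Qed.

Lemma mfact_split : mfact r X
  = (\prod_(1 <= i < r.+2) R i%:Z) * \prod_(0 <= i < r.+1) R (- i%:Z).
Proof.
rewrite /mfact (big_cat_nat (n := r.+2)) //=; last by rewrite /period; lia.
congr (_ * _); first by apply: eq_big_nat => i hi; apply: rowW; lia.
rewrite -{1}[r.+2]add0n big_addn (_ : ((period r).+1 - r.+2)%N = r.+1); last by rewrite /period; lia.
rewrite big_nat_rev; apply: eq_big_nat => i hi.
rewrite -(row_fact_per (-1)) (_ : _ + -1 * n = - i%:Z); last by rewrite nE; lia.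
by apply: rowW; lia.
Qed.

Lemma mfact_pairs : mfact r X = \prod_(0 <= i < r.+1) (R (i%:Z + 1) * R (- i%:Z)).
Proof.
rewrite mfact_split big_split /= big_add1; congr (_ * _); apply: eq_bigr => i _.
by congr R; lia.
Qed.

Lemma mfact_pairs' : mfact r X = \prod_(0 <= i < r.+1) (R i%:Z * R (- i%:Z - 1)).
Proof.
rewrite mfact_split big_split /= big_nat_recr //= [in RHS]big_nat_recl //=.
rewrite [X in _ * X = _]big_nat_recl //= [X in _ = _ * X]big_nat_recr //= big_add1 /=.
have -> : R (- r%:Z - 1) = R r.+1%:Z.
  rewrite -!rowW; [|lia|lia]; rewrite -(row_fact_per 1) mul1r nE.
  by apply: eq_fsbigr => j _; congr (qfact (X _ _)); lia.
have -> : \prod_(0 <= i < r) R (- i%:Z - 1) = \prod_(0 <= i < r) R (- i.+1%:Z).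
  by apply: eq_bigr => i _; congr R; lia.
by rewrite !oppr0 (AC (2*2) (3*1*(4*2))).
Qed.

(** Reflection sends the positions of [ipl] to the remaining positions modulo
    translation, except for the fixed positions (0, 0) and (r + 1, r + 1). *)
Lemma mfact_ipl : mfact r X
  = (\prod_(0 <= i < r.+2) \prod_(j <- W | ipl i j) (qfact (X i%:Z j) * qfact (X (- i%:Z) (- j))))
    * (qfact (X 0 0) * qfact (X r.+1%:Z r.+1%:Z)).
Proof.
have f1 i : - r.+1%:Z <= i <= r.+1%:Z -> forall j, j \notin W -> qfact (X i j) = 1.
  by move=> hi j /(XW hi) ->; rewrite qfact0.
rewrite mfact_split big_add1 /= big_nat_recr //= [X in _ * X = _]big_nat_recl //= oppr0.
rewrite [in RHS]big_nat_recl //= [in RHS]big_nat_recr //=.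
have e0 : \prod_(j <- W | ipl 0 j) (qfact (X 0 j) * qfact (X (- 0) (- j))) * qfact (X 0 0) = R 0.
  rewrite oppr0 big_split /= /R (@prod3 _ 0); last by apply: f1; lia.
  have -> : \prod_(j <- W | ipl 0 j) qfact (X 0 (- j)) = \prod_(j <- W | j < 0) qfact (X 0 j).
    rewrite big_mkcond [RHS]big_mkcond -[RHS]prod_oppW; apply: eq_bigr => j _.
    by rewrite /ipl /=; congr (if _ then _ else _); lia.
  have -> : \prod_(j <- W | ipl 0 j) qfact (X 0 j) = \prod_(j <- W | 0 < j) qfact (X 0 j).
    by apply: eq_bigl => j; rewrite /ipl /=; lia.
  by rewrite -[LHS]mulrA [LHS]mulrC.
have e1 : \prod_(j <- W | ipl r.+1 j) (qfact (X r.+1%:Z j) * qfact (X (- r.+1%:Z) (- j)))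
    * qfact (X r.+1%:Z r.+1%:Z) = R r.+1%:Z.
  rewrite big_split /= /R (@prod3 _ r.+1%:Z); last by apply: f1; lia.
  have -> : \prod_(j <- W | ipl r.+1 j) qfact (X (- r.+1%:Z) (- j))
    = \prod_(j <- W | r.+1%:Z < j) qfact (X r.+1%:Z j).
    rewrite -prodWc => [|j jW]; last by apply: f1; [lia|rewrite oW].
    rewrite -prodWc; last by apply: f1; lia.
    rewrite (reindex_fsbig (fun j => 2 * r.+1%:Z - j) [set j : int | r.+1%:Z < j]).
      by apply: eq_fsbigr => j _; rewrite Xmid; congr (qfact (X _ _)); lia.
    split=> [j /=|x y _ _|j /=]; rewrite /ipl /= ?eqxx; [lia|lia|move=> h].
    by exists (2 * r.+1%:Z - j) => /=; lia.
  have -> : \prod_(j <- W | ipl r.+1 j) qfact (X r.+1%:Z j) = \prod_(j <- W | j < r.+1%:Z) qfact (X r.+1%:Z j).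
    by apply: eq_bigl => j; rewrite /ipl /= eqxx; lia.
  by rewrite mulrAC.
have -> : \prod_(0 <= i < r) \prod_(j <- W | ipl i.+1 j) (qfact (X i.+1%:Z j) * qfact (X (- i.+1%:Z) (- j)))
  = (\prod_(0 <= i < r) R i.+1%:Z) * \prod_(0 <= i < r) R (- i.+1%:Z).
  rewrite -big_split; apply: eq_big_nat => i hi; rewrite /R -(prod_oppW (fun j => qfact (X (- _) j))).
  rewrite -big_split; apply: eq_bigl => j; rewrite /ipl /=; case: eqP => //; lia.
rewrite -e0 -e1; move: (\prod_(_ <- W | _) _) (\prod_(_ <- W | _) _) => a b.
by rewrite !mulrA (AC 6 (4*1*6*2*5*3)).
Qed.
End Bracket.

Lemma brf_frac (F : fieldType) (m k x x' nn : F) : x != 0 -> x' != 0 -> nn != 0 -> k != 0 ->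
  m / (x' * k) * (k / (x * nn)) * (x * x') * nn = m.
Proof.
move=> x0 x0' n0 k0; rewrite !invfM !mulrA.
have -> : m / x' / k * k / x / nn * x * x' * nn
  = m * (x'^-1 * x') * (k^-1 * k) * (x^-1 * x) * (nn^-1 * nn).
  by rewrite !mulrA (AC 9 (1*2*8*3*4*5*7*6*9)).
by rewrite !mulVf // !mulr1.
Qed.

Lemma odd_half (m : int) : (m = 1 %[mod 2])%Z -> 0 <= m -> exists b : nat, m = 2 * b%:Z + 1.
Proof.
move=> odd m0; have := divz_eq m 2; rewrite odd (_ : (1 %% 2)%Z = 1) // => e.
by exists `|(m %/ 2)%Z|%N; move: e; move: (m %/ 2)%Z => q; lia.
Qed.

Section BracketFormula.
Variables (r d : nat) (W : seq int).
Hypotheses (uW : uniq W) (oW : forall j, (- j \in W) = (j \in W)).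
Let n : int := (period r)%:Z.
Let nE : n = 2 * r%:Z + 2. Proof. by rewrite /n /period; lia. Qed.
Variables (M X : mat).
Hypotheses (hM : Xi r d M) (Xper : periodic r X) (X0 : forall i j, 0 <= X i j).
Let N : mat := fun i j => M i j - X i j - X (- i) (- j).
Hypothesis MW : forall i : int, - r.+1%:Z <= i <= r.+1%:Z -> forall j, j \notin W -> M i j = 0.
Hypothesis XW : forall i : int, - r.+1%:Z <= i <= r.+1%:Z -> forall j, j \notin W -> X i j = 0.

(** The off-diagonal factor of the bracket at the reflected position - p. *)
Definition brf (p : int * int) : Qv :=
  qbinom (M p.1 p.2) (X (- p.1) (- p.2)) * qbinom (M p.1 p.2 - X (- p.1) (- p.2)) (X p.1 p.2).

(** The diagonal factor of the bracket. *)
Definition brd (i : int) : Qv :=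
  \prod_(0 <= k < `|X i i|%N) (qint (M i i - 2 * k%:Z - 1) / qint (k%:Z + 1)).

Lemma M_mid : M (- r%:Z - 1) (- r%:Z - 1) = M r.+1%:Z r.+1%:Z.
Proof. by rewrite -(Xi_opp hM); congr M; lia. Qed.

Lemma X_mid : X (- r%:Z - 1) (- r%:Z - 1) = X r.+1%:Z r.+1%:Z.
Proof. by rewrite -(per_sh Xper 1) -/n nE; congr X; lia. Qed.

Lemma br_ipl : br_MX r M X
  = (\prod_(0 <= i < r.+2) \prod_(j <- W | ipl r i j) brf (i%:Z, j)) * (brd 0 * brd r.+1%:Z).
Proof.
rewrite /br_MX -(prod_Iplus uW) => [|i hi j jW]; last first.
  have m0 : M i%:Z j = 0 by apply: MW => //; lia.
  have x0 : X i%:Z j = 0 by apply: XW => //; lia.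
  have x1 : X (- i%:Z) (- j) = 0 by apply: XW; rewrite ?oW //; lia.
  by rewrite /brf /= m0 x0 x1 !qbinom0 mulr1.
congr (_ * _); last by rewrite !big_cons big_nil mulr1 /brd M_mid X_mid.
rewrite (reindex_fsbig (fun p : int * int => (- p.1, - p.2)) (Iplus r) (Iset r)).
  by apply: eq_fsbigr => p _ /=; rewrite (Xi_opp hM) !opprK.
split=> [[i j]|[i j] [i' j'] _ _ [] /oppr_inj -> /oppr_inj -> //|[i j]].
  by rewrite /Iplus /Iset /=; lia.
move=> hp; exists (- i, - j); rewrite /= ?opprK //.
by move: hp; rewrite /Iplus /Iset /=; lia.
Qed.

Lemma brf_fact i j : 0 <= N i j ->
  brf (i, j) * (qfact (X i j) * qfact (X (- i) (- j))) * qfact (N i j) = qfact (M i j).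
Proof.
move=> N0; have x0 := X0 i j; have x1 := X0 (- i) (- j).
rewrite /brf /= !qbinom_fact; [|by move: N0; rewrite /N; lia|by move: N0; rewrite /N; lia].
have -> : M i j - X (- i) (- j) - X i j = N i j by rewrite /N addrAC.
have f1 := qfact_neq0 (X i j); have f2 := qfact_neq0 (X (- i) (- j)).
have f3 := qfact_neq0 (N i j); have f4 := qfact_neq0 (M i j - X (- i) (- j)).
move: (qfact (M i j)) (qfact (M i j - _)) (qfact (X i j)) (qfact (X (- i) (- j))) (qfact (N i j)) f1 f2 f3 f4.
move=> m k x x' nn f1 f2 f3 f4; exact (brf_frac m f1 f2 f3 f4).
Qed.

Lemma prim0 (F : mat) : prim r F 0 0 = ((F 0 0 - 1) %/ 2)%Z.
Proof. by rewrite /prim !eqxx. Qed.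

Lemma prim1 (F : mat) : prim r F r.+1%:Z r.+1%:Z = ((F r.+1%:Z r.+1%:Z - 1) %/ 2)%Z.
Proof. by rewrite /prim !eqxx orbT. Qed.

Lemma mfact_cE (F : mat) :
  mfact_c r F = dfact `|((F 0 0 - 1) %/ 2)%Z| * dfact `|((F r.+1%:Z r.+1%:Z - 1) %/ 2)%Z|
    * \prod_(p \in Iplus r) qfact (F p.1 p.2).
Proof. by rewrite /mfact_c prim0 prim1. Qed.

Lemma brd_fact i : (M i i = 1 %[mod 2])%Z -> X (- i) (- i) = X i i -> 0 <= N i i ->
  brd i * (dfact `|((N i i - 1) %/ 2)%Z| * qfact (X i i)) = dfact `|((M i i - 1) %/ 2)%Z|.
Proof.
move=> odd Xs N0; have x0 := X0 i i; have m0 := Xi_ge0 hM i i.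
have [b Mb] := odd_half odd m0.
have Xb : X i i = `|X i i|%N%:Z by lia.
have Nb : N i i = 2 * (b - `|X i i|)%N%:Z + 1 by move: N0; rewrite /N Xs Mb; lia.
have h (c : nat) : `|((2 * c%:Z + 1 - 1) %/ 2)%Z|%N = c by rewrite addrK mulKz.
rewrite Nb h Mb h {2}Xb; apply: diag_bracket => //.
by move: N0; rewrite /N Xs Mb; lia.
Qed.

Lemma X_sym1 : X (- r.+1%:Z) (- r.+1%:Z) = X r.+1%:Z r.+1%:Z.
Proof. by rewrite -X_mid; congr X; lia. Qed.

(** The bracket as a quotient of factorials; here N = M - X_theta. *)
Lemma br_fact : (forall i j, 0 <= N i j) ->
  br_MX r M X * (mfact_c r N * mfact r X) = mfact_c r M.
Proof.
move=> N0; rewrite br_ipl !mfact_cE (mfact_ipl uW oW Xper XW).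
have NW i : - r.+1%:Z <= i <= r.+1%:Z -> forall j, j \notin W -> N i j = 0.
  move=> hi j jW; have m0 : M i j = 0 by apply: MW => //; lia.
  have x0 : X i j = 0 by apply: XW => //; lia.
  have x1 : X (- i) (- j) = 0 by apply: XW; rewrite ?oW //; lia.
  by rewrite /N m0 x0 x1.
rewrite !(prod_Iplus uW) => [|i hi j jW /=|i hi j jW /=]; last 2 first.
- by rewrite MW ?qfact0 //; lia.
- by rewrite NW ?qfact0 //; lia.
have e0 := @brd_fact 0 (Xi_odd0 hM) erefl (N0 _ _).
have e1 := @brd_fact r.+1%:Z (Xi_odd1 hM) X_sym1 (N0 _ _).
rewrite -e0 -e1.
have -> : \prod_(0 <= i < r.+2) \prod_(j <- W | ipl r i j) qfact (M (i%:Z, j).1 (i%:Z, j).2)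
  = (\prod_(0 <= i < r.+2) \prod_(j <- W | ipl r i j) brf (i%:Z, j))
   * (\prod_(0 <= i < r.+2) \prod_(j <- W | ipl r i j) (qfact (X i%:Z j) * qfact (X (- i%:Z) (- j))))
   * \prod_(0 <= i < r.+2) \prod_(j <- W | ipl r i j) qfact (N (i%:Z, j).1 (i%:Z, j).2).
  rewrite -!big_split; apply: eq_bigr => i _ /=; rewrite -!big_split; apply: eq_bigr => j _ /=.
  by rewrite brf_fact.
by rewrite !mulrA (AC 9 (2*4*8*3*5*9*1*7*6)).
Qed.

Lemma N_per k i j : N (i + k * n) (j + k * n) = N i j.
Proof.
rewrite /N (Xi_sh hM) (per_sh Xper); congr (_ - _).
by rewrite -(per_sh Xper (- k) (- i)) -/n; congr X; rewrite mulNr opprD.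
Qed.

Lemma N_opp i j : N (- i) (- j) = N i j.
Proof. by rewrite /N !opprK (Xi_opp hM) addrAC. Qed.

(** Reflection and translation move any position to one that occurs in the bracket. *)
Lemma N_position i j : N i j < 0 -> exists (i' : nat) j', [/\ N i'%:Z j' < 0, (i' < r.+2)%N
  & ipl r i' j' \/ ((i' = 0%N \/ i' = r.+1) /\ j' = i'%:Z)].
Proof.
move=> Nij; pose q := (i %/ n)%Z; pose i0 := (i %% n)%Z; pose j0 := j - q * n.
have ie : i = i0 + q * n by rewrite /i0 addrC; exact: divz_eq.
have n0 : n != 0 by rewrite nE; lia.
have i0b : 0 <= i0 < n by rewrite modz_ge0 //= ltz_pmod // nE; lia.
have N0 : N i0 j0 < 0 by rewrite -(N_per q) -ie subrK.
have step (a b : int) : 0 <= a <= r.+1%:Z -> N a b < 0 ->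
    exists (i' : nat) j', [/\ N i'%:Z j' < 0, (i' < r.+2)%N
      & ipl r i' j' \/ ((i' = 0%N \/ i' = r.+1) /\ j' = i'%:Z)].
  move=> ha Nab; case: (eqVneq a 0) => [a0|a0].
    subst a; case: (ltgtP b 0) => [b0|b0|b0].
    - exists 0%N, (- b); split=> //; first by rewrite -(N_opp 0 b) oppr0 in Nab.
      by left; rewrite /ipl /=; lia.
    - by exists 0%N, b; split=> //; left; rewrite /ipl /=; lia.
    - by exists 0%N, 0; split=> //; [rewrite b0 in Nab|right; split=> //; left].
  case: (eqVneq a r.+1%:Z) => [a1|a1].
    subst a; case: (ltgtP b r.+1%:Z) => [b0|b0|b0].
    - by exists r.+1, b; split=> //; left; rewrite /ipl eqxx /=; lia.
    - exists r.+1, (2 * r.+1%:Z - b); split=> //; last by left; rewrite /ipl eqxx /=; lia.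
      move: Nab; rewrite -N_opp -(N_per 1) nE (_ : - r.+1%:Z + _ = r.+1%:Z); last by lia.
      by rewrite (_ : - b + _ = 2 * r.+1%:Z - b) //; lia.
    - by exists r.+1, b; split=> //; right; split=> //; right.
  exists `|a|%N, b; rewrite (_ : `|a|%N%:Z = a); last by lia.
  split=> //; first by lia.
  by left; rewrite /ipl; do 2 (case: eqP => [?|_]; first lia).
case: (leP i0 r.+1%:Z) => c; first by apply: (step i0 j0) => //; lia.
apply: (step (- i0 + 1 * n) (- j0 + 1 * n)); first by rewrite nE in i0b *; lia.
by rewrite N_per N_opp.
Qed.

(** The bracket vanishes as soon as N = M - X_theta has a negative entry; for
    M = A_(X,Y) this is the matrix A - Y_theta. *)
Lemma br_zero i j : N i j < 0 -> br_MX r M X = 0.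
Proof.
move=> /N_position[i' [j' [Nij hi [hp|[hd hj]]]]]; rewrite br_ipl.
  have j'W : j' \in W.
    apply/negPn/negP => jW; move: Nij.
    have m0 : M i'%:Z j' = 0 by apply: MW => //; lia.
    have x0 : X i'%:Z j' = 0 by apply: XW => //; lia.
    have x1 : X (- i'%:Z) (- j') = 0 by apply: XW; rewrite ?oW //; lia.
    by rewrite /N m0 x0 x1.
  have b0 : brf (i'%:Z, j') = 0.
    have m0 := Xi_ge0 hM i'%:Z j'; have x0 := X0 i'%:Z j'.
    rewrite /brf /=; case: (leP (X (- i'%:Z) (- j')) (M i'%:Z j')) => c.
      by rewrite [X in _ * X]qbinom_small ?mulr0 //; move: Nij; rewrite /N; lia.
    by rewrite qbinom_small ?mul0r //; rewrite m0.
  have -> : \prod_(0 <= i0 < r.+2) \prod_(j0 <- W | ipl r i0 j0) brf (i0%:Z, j0) = 0.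
    rewrite (big_cat_nat (n := i')) //=; last exact: ltnW.
    rewrite [X in _ * X]big_ltn // (big_rem j') //= hp b0 !mul0r mulr0 //.
  by rewrite mul0r.
have Xs : X (- i'%:Z) (- i'%:Z) = X i'%:Z i'%:Z by case: hd => ->; [rewrite oppr0|exact: X_sym1].
have [b Mb] : exists b : nat, M i'%:Z i'%:Z = 2 * b%:Z + 1.
  by apply: odd_half; [case: hd => ->; [exact: (Xi_odd0 hM)|exact: (Xi_odd1 hM)]|exact: (Xi_ge0 hM)].
have bz : brd i'%:Z = 0.
  by apply: (diag_bracket0 Mb); move: Nij; rewrite hj /N Xs Mb; lia.
have -> : brd 0 * brd r.+1%:Z = 0.
  by case: hd bz => -> ->; rewrite ?mul0r ?mulr0.
by rewrite mulr0.
Qed.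
End BracketFormula.

(** * Products of sums, and finiteness *)

Section Families.
Variables (K : choiceType) (t0 : K) (U : nat -> set K).

(** Families of m elements of the sets U i, extended by t0. *)
Definition fam (m : nat) : set (nat -> K) :=
  [set g | (forall i, (i < m)%N -> U i (g i)) /\ (forall i, (m <= i)%N -> g i = t0)].

(** The family g with its m-th member replaced by t. *)
Definition updn (g : nat -> K) (m : nat) (t : K) : nat -> K :=
  fun i => if i == m then t else g i.

Lemma fam_bij m t : U m t ->
  set_bij (fam m) (fam m.+1 `&` [set g | g m = t]) (fun g => updn g m t).
Proof.
move=> ut; split.
- move=> g [g1 g2]; split; last by rewrite /= /updn eqxx.
  split=> i hi; rewrite /updn; case: eqP => [im|im]; [by rewrite im|by apply: g1; lia|by lia|].
  by apply: g2; lia.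
- move=> g g' /set_mem[_ g2] /set_mem[_ g2'] e; apply: funext => i.
  case: (eqVneq i m) => [->|im]; first by rewrite g2 // g2'.
  by have := congr1 (fun h => h i) e; rewrite /updn (negbTE im).
- move=> g [[g1 g2] gm]; exists (updn g m t0); last first.
    by apply: funext => i; rewrite /updn; case: eqP => [->|//]; rewrite -gm.
  split=> i hi; rewrite /updn; case: eqP => [im|im] //; first by lia.
    by apply: g1; lia.
  by apply: g2; lia.
Qed.

Hypothesis Ufin : forall i, finite_set (U i).

Lemma fam_fin m : finite_set (fam m).
Proof.
elim: m => [|m IH].
  apply: (@sub_finite_set _ _ [set (fun=> t0)]) => // g [_ g2].
  by apply: funext => i; exact: g2.
apply: (@sub_finite_set _ _ (\bigcup_(t in U m) ((fun g => updn g m t) @` fam m))).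
  move=> g hg; exists (g m); first by case: hg => g1 _; exact: g1.
  have ut : U m (g m) by case: hg => g1 _; exact: g1.
  by have [_ _ s] := fam_bij ut; apply: s; split.
by apply: bigcup_finite => // t _; exact: finite_image.
Qed.

Lemma prod_fsum (f : nat -> K -> Qv) m :
  \prod_(0 <= i < m) \sum_(u \in U i) f i u = \sum_(g \in fam m) \prod_(0 <= i < m) f i (g i).
Proof.
elim: m => [|m IH].
  have -> : fam 0 = [set (fun=> t0)].
    apply/seteqP; split=> [g [_ g2]|g ->]; last by split.
    by apply: funext => i; exact: g2.
  by rewrite fsbig_set1 !big_geq.
rewrite big_nat_recr //= IH.
rewrite (@fsum_partition_sub _ _ _ (fam m.+1) (U m) (fun g => g m)); last 2 first.
- exact: fam_fin.
- by move=> g [g1 _]; exact: g1.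
rewrite mulr_fsumr; apply: eq_fsbigr => t /set_mem ut.
rewrite [RHS](reindex_fsbig (fun g => updn g m t) (fam m)); last exact: (fam_bij ut).
rewrite mulr_fsuml; apply: eq_fsbigr => g _.
rewrite big_nat_recr //= {2}/updn eqxx; congr (_ * _); apply: eq_big_nat => i hi.
by rewrite /updn (_ : (i == m) = false) //; lia.
Qed.
End Families.

Lemma per_eq (r : nat) (a : int) (F G : mat) : periodic r F -> periodic r G ->
  (forall i j, a <= i < a + (period r)%:Z -> F i j = G i j) -> F = G.
Proof.
move=> pF pG e; apply: funext => i; apply: funext => j.
pose n := (period r)%:Z; pose q := ((i - a) %/ n)%Z.
have n0 : 0 < n by rewrite /n /period; lia.
have ie := divz_eq (i - a) n; have i1 := modz_ge0 (i - a) (lt0r_neq0 n0).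
have i2 := ltz_pmod (i - a) n0.
rewrite -(per_sh pF (- q) i j) -(per_sh pG (- q) i j) mulNr; apply: e.
by move: ie i1 i2; rewrite -/n -/q; move: ((i - a) %% n)%Z (q * n) => x y; lia.
Qed.

(** Periodic matrices bounded by a given matrix with finite rows. *)
Lemma finite_periodic (r : nat) (A : mat) : (forall i, finf (A i)) ->
  finite_set [set F : mat | periodic r F /\ forall i j, 0 <= F i j <= A i j].
Proof.
move=> Afin.
have [K hK] : exists K : nat, forall i j, 0 <= i < (period r)%:Z -> A i j <> 0 -> `|j| <= K%:Z.
  have : finite_set (\bigcup_(m in [set m : int | 0 <= m <= (period r)%:Z]) [set j | A m j <> 0]).
    by apply: bigcup_finite => [|m _]; [exact: finite_zrange|exact: Afin].
  move=> /finite_bounded[K hK]; exists K => m j hm h; apply: hK; exists m => //=; lia.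
pose V := [seq (i, j) | i <- zseq 0 (period r), j <- zseq (- K%:Z) (2 * K + 1)].
pose res (F : mat) : int * int -> int := fun p => if p \in V then F p.1 p.2 else 0.
have inV i j : ((i, j) \in V) = (i \in zseq 0 (period r)) && (j \in zseq (- K%:Z) (2 * K + 1)).
  apply/allpairsP/andP => [[[i' j'] [/= h1 h2 [-> ->]]] //|[h1 h2]].
  by exists (i, j).
pose BB := [set p : int * int -> int | (forall k, k \notin V -> p k = 0) /\
     (forall k, 0 <= p k <= (fun k => `|A k.1 k.2|) k)].
have fBB : finite_set BB by exact: finite_box.
pose n := (period r)%:Z.
pose ext (p : int * int -> int) : mat :=
  fun i j => p (i - (i %/ n)%Z * n, j - (i %/ n)%Z * n).
apply: (@sub_finite_set _ _ (ext @` BB)); last exact: finite_image.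
move=> F [pF bF]; exists (res F).
  split=> [k /negbTE|k]; rewrite /res; first by move=> ->.
  by case: ifP => _; [have := bF k.1 k.2|]; lia.
apply: funext => i; apply: funext => j; rewrite /ext /res.
have n0 : 0 < n by rewrite /n /period; lia.
have ie := divz_eq i n; have i1 := modz_ge0 i (lt0r_neq0 n0).
have i2 := ltz_pmod i n0.
have e := per_sh pF (- (i %/ n)%Z) i j; rewrite mulNr -/n in e.
case: ifP => h; rewrite /= ?e //; apply/esym; rewrite -e.
apply: contrapT => Fn; move: h; rewrite inV !mem_zseq.
have Am : A (i - (i %/ n)%Z * n) (j - (i %/ n)%Z * n) <> 0.
  by move=> A0; have := bF (i - (i %/ n)%Z * n) (j - (i %/ n)%Z * n); rewrite A0; move: Fn; move: (F _ _) => x; lia.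
have hi : 0 <= i - (i %/ n)%Z * n < (period r)%:Z.
  by rewrite -/n; move: ie i1 i2; move: (i %% n)%Z ((i %/ n)%Z * n) => x y; lia.
have := hK _ _ hi Am; move: hi; move: (i - _) (j - _) => x y; lia.
Qed.

(** * The fibre over X and Y *)

Section Fibre.
Variables (r d : nat).
Variables (A B : mat).
Hypotheses (hA : Xi r d A) (hB : Xi r d B).
Variable T : mat.
Hypothesis hT : Theta_BA r B A T.
Let n : int := (period r)%:Z.
Let nE : n = 2 * r%:Z + 2. Proof. by rewrite /n /period; lia. Qed.
Let Y := refl T.
Variable X : mat.
Hypotheses (Xper : periodic r X) (X0 : forall i j, 0 <= X i j).
Hypothesis rel : forall i j, X i j + X (- i - 1) (- j) = Y i j + Y (- i - 1) (- j).
Hypothesis Xtot : forall i, tot (X i) = B i (i + 1).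
Variable W : seq int.
Hypotheses (uW : uniq W) (oW : forall j, (- j \in W) = (j \in W)).
Hypothesis TW : forall i : int, - r.+1%:Z <= i <= r.+1%:Z -> forall j, j \notin W -> T i j = 0.

Lemma XYW (i : int) : - r.+1%:Z <= i <= r%:Z -> forall j, j \notin W ->
  X i j = 0 /\ Y i j = 0.
Proof.
move=> hi j jW; have t1 : T (i + 1) j = 0 by apply: TW => //; lia.
have t2 : T (- i) (- j) = 0 by apply: TW; rewrite ?oW //; lia.
have := rel i j; have := X0 i j; have := X0 (- i - 1) (- j).
rewrite /Y /refl /opr opprK (_ : - (- i - 1) = i + 1) ?t1 ?t2; last by lia.
by move: (X i j) (X _ _) => *; lia.
Qed.

(** The possible rows u = (s_(-i,-j))_j of the matrices S in the fibre over X. *)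
Definition Uset (i : nat) : set (int -> int) :=
  [set u | adm W (Y i%:Z) (opr (X (- i%:Z - 1))) u /\ forall k, u k <= X i%:Z k].

(** The zero row. *)
Definition zrow : int -> int := fun=> 0.

(** The number of periods by which row i differs from a row in - r, ..., r + 1. *)
Definition quo (i : int) : int := ((i + r%:Z) %/ n)%Z.

(** The matrix S with given rows g i = (s_(-i,-j))_j, for 0 <= i <= r.  The rows
    1, ..., r + 1 are determined by X, and the others by periodicity. *)
Definition Sfam (g : nat -> int -> int) : mat := fun i j =>
  let i0 := i - quo i * n in let j0 := j - quo i * n in
  if 0 < i0 then T i0 j0 + g (absz (i0 - 1)%R) j0 - X (i0 - 1) j0 else g `|i0|%N (- j0).

(** The rows of S with nonpositive index, read backwards. *)
Definition fam_of (S : mat) : nat -> int -> int :=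
  fun i => if (i < r.+1)%N then opr (S (- i%:Z)) else zrow.

Lemma n_gt0 : 0 < n. Proof. by rewrite nE; lia. Qed.

Lemma quo0 i : - r%:Z <= i <= r.+1%:Z -> quo i = 0.
Proof. by move=> h; rewrite /quo divz_small // nE; lia. Qed.

Lemma Sfam_per g : periodic r (Sfam g).
Proof.
move=> i j; rewrite /Sfam; have -> : quo (i + n) = quo i + 1.
  rewrite /quo (_ : i + n + r%:Z = 1 * n + (i + r%:Z)) ?divzMDl ?gt_eqF ?n_gt0 //; [exact: addrC|lia].
rewrite mulrDl mul1r (_ : i + n - (quo i * n + n) = i - quo i * n); last by lia.
by rewrite (_ : j + n - (quo i * n + n) = j - quo i * n) //; lia.
Qed.

Lemma Sfam_pos g (k : nat) j : (k < r.+1)%N ->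
  Sfam g (k%:Z + 1) j = T (k%:Z + 1) j + g k j - X k%:Z j.
Proof.
move=> hk; rewrite /Sfam quo0; last by lia.
by rewrite mul0r !subr0 addrK absz_nat (_ : 0 < k%:Z + 1) //; lia.
Qed.

Lemma Sfam_neg g (k : nat) j : (k < r.+1)%N -> Sfam g (- k%:Z) j = g k (- j).
Proof.
move=> hk; rewrite /Sfam quo0; last by lia.
by rewrite mul0r !subr0 abszN absz_nat (_ : 0 < - k%:Z = false) //; lia.
Qed.

Lemma window_ind (P : int -> Prop) :
  (forall i q, P i -> P (i + q * n)) ->
  (forall k : nat, (k < r.+1)%N -> P (k%:Z + 1)) ->
  (forall k : nat, (k < r.+1)%N -> P (- k%:Z)) -> forall i, P i.
Proof.
move=> Pq P1 P2 i; have ie := divz_eq (i + r%:Z) n.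
have i1 := modz_ge0 (i + r%:Z) (lt0r_neq0 n_gt0); have i2 := ltz_pmod (i + r%:Z) n_gt0.
move: ie i1 i2; move: ((i + r%:Z) %/ n)%Z ((i + r%:Z) %% n)%Z => q x ie i1 i2.
rewrite (_ : i = x - r%:Z + q * n); last by move: ie; move: (q * n) => y; lia.
apply: Pq; case: (ltP 0 (x - r%:Z)) => c.
  rewrite (_ : x - r%:Z = (absz (x - r%:Z - 1)%R)%:Z + 1); last by lia.
  by apply: P1; move: i2; rewrite nE; lia.
rewrite (_ : x - r%:Z = - (absz (x - r%:Z)%R)%:Z); last by lia.
by apply: P2; lia.
Qed.

Let Tper : periodic r T := T_per hT.
Let Tfin : forall i, finf (T i) := T_fin hA hT.

Lemma X_fin' i : finf (X i).
Proof.
apply: (@finf2 (Y i) (T (i + 1))) => [||j y0 t0]; first exact: (refl_fin hA hT).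
  exact: Tfin.
have := rel i j; have := X0 i j; have := X0 (- i - 1) (- j).
rewrite y0 /Y /refl /opr opprK (_ : - (- i - 1) = i + 1) ?t0; last by lia.
by move: (X i j) (X _ _) => *; lia.
Qed.

Lemma rel2 i j : X (- i - 1) j = T (- i) j + T (i + 1) (- j) - X i (- j).
Proof.
have := rel i (- j); rewrite /Y /refl /opr !opprK (_ : - (- i - 1) = i + 1); last by lia.
by move: (X _ _) (X _ _) (T _ _) (T _ _) => *; lia.
Qed.

Section OneFamily.
Variable g : nat -> int -> int.
Hypothesis hg : fam zrow Uset r.+1 g.

Lemma g_bounds (k : nat) j : (k < r.+1)%N ->
  [/\ 0 <= g k j, g k j <= T (- k%:Z) (- j), g k j <= X k%:Z j
    & 0 <= g k j + X (- k%:Z - 1) (- j) - T (- k%:Z) (- j)].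
Proof.
case: hg => g1 _ /g1[[_ h1] h2]; have [h3 h4] := h1 j; have h5 := h2 j.
by split=> //; case/andP: h3.
Qed.

Lemma Sfam_le i j : 0 <= Sfam g i j <= T i j.
Proof.
move: i j; apply: (@window_ind (fun i => forall j, 0 <= Sfam g i j <= T i j)).
- move=> i q h j.
  have -> : Sfam g (i + q * n) j = Sfam g i (j - q * n).
    by rewrite -[RHS](per_sh (@Sfam_per g) q) subrK.
  by have -> : T (i + q * n) j = T i (j - q * n) by rewrite -[RHS](per_sh Tper q) subrK.
- move=> k hk j; rewrite Sfam_pos //; have [b1 b2 b3 b4] := g_bounds j hk.
  move: b4; rewrite rel2 opprK; move: b1 b2 b3.
  by move: (T _ _) (T _ _) (X _ _) (g _ _) => *; lia.
move=> k hk j; rewrite Sfam_neg //; have [b1 b2 b3 b4] := g_bounds (- j) hk.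
by rewrite opprK in b2; rewrite b1.
Qed.

Lemma Sfam_fin i : finf (Sfam g i).
Proof.
by apply: (finf_sub (Tfin i)) => j tj; have := Sfam_le i j; rewrite tj; lia.
Qed.

Lemma Sfam_row i : tot (Sfam g i) = tot (opr (Sfam g (1 - i))).
Proof.
(* It suffices to consider one row of each pair (i, 1 - i). *)
have key (k : nat) : (k < r.+1)%N -> tot (Sfam g (k%:Z + 1)) = tot (opr (Sfam g (- k%:Z))).
  move=> hk; have eS : Sfam g (k%:Z + 1) = T (k%:Z + 1) + g k - X k%:Z.
    by apply: funext => j; rewrite Sfam_pos.
  have eg : opr (Sfam g (- k%:Z)) = g k.
    by apply: funext => j; rewrite /opr Sfam_neg // opprK.
  rewrite eS eg /tot.
  have fg : finf (g k) by rewrite -eg; apply: finf_opr; exact: Sfam_fin.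
  have [V [uV tV gV xV]] := finf_window (Tfin (k%:Z + 1)) fg (X_fin' k%:Z).
  have := Xtot k%:Z; have := T_row hT (k%:Z + 1); rewrite /row_a /tot addrK.
  rewrite !(fsW uV) // => [h1 h2|j jV]; last first.
    by rewrite [LHS](_ : _ = T (k%:Z + 1) j + g k j - X k%:Z j) // tV // gV // xV.
  transitivity (\sum_(j <- V) (T (k%:Z + 1) j + g k j - X k%:Z j)); first by [].
  by rewrite sumrB big_split /= h1 h2; move: (B _ _) (\sum_(_ <- _) _) => *; lia.
have tp F i' : periodic r F -> tot (F (i' + n)) = tot (F i').
  move=> pF; rewrite /tot (reindex_fsbig (fun j => j + n) [set: int] [set: int]).
    by apply: eq_fsbigr => j _; exact: pF.
  split=> [j //|x y _ _|j _]; first by move/addIr.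
  by exists (j - n); rewrite ?subrK.
have tpq F i' q : periodic r F -> tot (F (i' + q * n)) = tot (F i').
  move=> pF; rewrite /tot (reindex_fsbig (fun j => j + q * n) [set: int] [set: int]).
    by apply: eq_fsbigr => j _; exact: (per_sh pF).
  split=> [j //|x y _ _|j _]; first by move/addIr.
  by exists (j - q * n); rewrite ?subrK.
have pS := @Sfam_per g.
move: i; apply: window_ind => [i q|k hk|k hk].
- rewrite !tot_opr tpq // => ->; rewrite (_ : 1 - (i + q * n) = 1 - i + (- q) * n) ?tpq //.
  by rewrite mulNr; move: (q * n) => y; lia.
- by rewrite key // (_ : 1 - (k%:Z + 1) = - k%:Z) //; lia.
by rewrite -tot_opr -key // tot_opr opprK addrC.
Qed.

Lemma Sfam_Gamma : Gamma r T (Sfam g).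
Proof.
split; first split.
- by move=> i j; have /andP[] := Sfam_le i j.
- exact: Sfam_per.
- by move=> i j; have /andP[] := Sfam_le i j.
exact: Sfam_row.
Qed.

Lemma Sfam_X : XTS T (Sfam g) = X.
Proof.
apply: (@per_eq r (- r.+1%:Z)) => //; first exact: (X_per hT Sfam_Gamma).
move=> i j hi; rewrite /XTS; case: (leP 0 i) => c.
  rewrite (_ : i = `|i|%N%:Z); last by lia.
  rewrite Sfam_pos ?Sfam_neg ?opprK; [|rewrite -/n nE in hi; lia..].
  by move: (T _ _) (g _ _) (X _ _) => *; lia.
pose k := absz (- i - 1)%R; have ki : i = - k%:Z - 1 by rewrite /k; lia.
have hk : (k < r.+1)%N by rewrite /k; lia.
rewrite ki rel2 (_ : - k%:Z - 1 + 1 = - k%:Z); last by lia.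
rewrite (_ : - (- k%:Z - 1) = k%:Z + 1); last by lia.
rewrite Sfam_neg // Sfam_pos //.
by move: (T _ _) (T _ _) (g _ _) (X _ _) => *; lia.
Qed.

Lemma fam_of_Sfam : fam_of (Sfam g) = g.
Proof.
apply: funext => i; rewrite /fam_of; case: ltnP => hi.
  by apply: funext => j; rewrite /opr Sfam_neg // opprK.
by case: hg => _ g2; rewrite g2.
Qed.
End OneFamily.

Lemma fibre_bij : set_bij (fam zrow Uset r.+1)
  (Gamma r T `&` [set S | XTS T S = X]) Sfam.
Proof.
split.
- by move=> g hg; split; [exact: Sfam_Gamma|exact: Sfam_X].
- by move=> g g' /set_mem hg /set_mem hg' e; rewrite -(fam_of_Sfam hg) e fam_of_Sfam.
move=> S [hS SX]; have Sper : periodic r S := S_per hS.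
have Xe i j : X i j = T (i + 1) j - S (i + 1) j + S (- i) (- j) by rewrite -SX.
exists (fam_of S).
  split=> i hi; last by rewrite /fam_of ltnNge hi.
  rewrite /fam_of hi; split; first split.
  - move=> j jW; have t0 : T (- i%:Z) (- j) = 0 by apply: TW; rewrite ?oW //; lia.
    by rewrite /opr; have := S_ge0 hS (- i%:Z) (- j); have := S_le hS (- i%:Z) (- j); rewrite t0; lia.
  - move=> k; rewrite /opr; split; first by rewrite (S_ge0 hS) (S_le hS).
    rewrite Xe opprK subrK (_ : - (- i%:Z - 1) = i%:Z + 1) /Y /refl /opr; last by lia.
    by have := S_ge0 hS (i%:Z + 1) k; move: (S _ _) (S _ _) (T _ _) => *; lia.
  by move=> k; rewrite /opr Xe; have := S_le hS (i%:Z + 1) k; move: (S _ _) (S _ _) (T _ _) => *; lia.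
apply: (@per_eq r (- r%:Z)); [exact: Sfam_per|exact: Sper|move=> i j hi].
case: (ltP 0 i) => c.
  rewrite (_ : i = (absz (i - 1)%R)%:Z + 1); last by lia.
  have hk : (absz (i - 1)%R < r.+1)%N by move: hi; rewrite -/n nE; lia.
  rewrite Sfam_pos // /fam_of hk Xe /opr.
  by move: (T _ _) (S _ _) (S _ _) => *; lia.
rewrite (_ : i = - `|i|%N%:Z); last by lia.
have hk : (`|i| < r.+1)%N by lia.
by rewrite Sfam_neg // /fam_of hk /opr opprK.
Qed.

Lemma Uset_fin i : finite_set (Uset i).
Proof.
have fb : finite_set [set p : int -> int | (forall k, k \notin W -> p k = 0) /\
     (forall k, 0 <= p k <= (fun k => X i%:Z k) k)] by exact: finite_box.
by apply: sub_finite_set fb => u [[u1 u2] u3]; split=> // k; have [/andP[]] := u2 k => -> _ _; rewrite u3.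
Qed.
End Fibre.

(** * Comparison of the coefficients *)

Lemma prod_exprz_nat (x : Qv) (f : nat -> int) m : x != 0 ->
  \prod_(0 <= i < m) x ^ (f i) = x ^ (\sum_(0 <= i < m) f i).
Proof.
move=> x0; elim: m => [|m IH]; first by rewrite !big_geq // expr0z.
by rewrite !big_nat_recr //= IH expfzDr.
Qed.

Lemma fsprod_neq0 (K : choiceType) (P : set K) (F : K -> Qv) : (forall k, F k != 0) ->
  \prod_(k \in P) F k != 0.
Proof.
move=> F0; apply: (big_ind (fun x : Qv => x != 0)).
- exact: oner_neq0.
- exact: mulf_neq0.
move=> i _; exact: F0.
Qed.

Lemma nprod_neq0 (W : seq int) m (F : nat -> int -> int) :
  \prod_(0 <= i < m) \prod_(k <- W) qfact (F i k) != 0.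
Proof.
apply: (big_ind (fun x : Qv => x != 0)); [exact: oner_neq0|exact: mulf_neq0|].
move=> i _; exact: qfact_prod_neq0.
Qed.

Lemma dfact_neq0 b : dfact b != 0.
Proof.
elim: b => [|b IH]; first by rewrite /dfact big_geq ?oner_neq0.
rewrite dfactS (_ : 2 * b.+1%:Z = (2 * b.+1)%N%:Z); last by lia.
by apply: mulf_neq0; [exact: IH|exact: qint_neq0].
Qed.

Lemma mfact_c_neq0 r F : mfact_c r F != 0.
Proof.
rewrite mfact_cE; apply: mulf_neq0; last by apply: fsprod_neq0 => p; exact: qfact_neq0.
apply: mulf_neq0; exact: dfact_neq0.
Qed.

Lemma coef_frac (F : fieldType) (vx n vn MX QB SS XU YU br mC mN U : F) :
  MX != 0 -> mN != 0 -> U != 0 -> br * (mN * MX) = mC ->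
  vx * (n * vn * MX * QB / (SS * XU * YU)) * br
  = n * (vx * vn) * (mC * (QB * U) / (mN * (SS * U) * (XU * YU))).
Proof.
move=> M0 N0 U0 <-.
have -> : br * (mN * MX) * (QB * U) = (mN * U) * (br * MX * QB).
  by rewrite !mulrA (AC 5 (2*5*1*3*4)).
have -> : mN * (SS * U) * (XU * YU) = (mN * U) * (SS * XU * YU).
  by rewrite !mulrA (AC 5 (1*3*2*4*5)).
rewrite -(mulf_div (mN * U) (mN * U)) divff ?mulf_neq0 // mul1r !mulrA; move: (_^-1) => D.
by rewrite (AC 7 (2*1*3*7*4*5*6)).
Qed.

Section Coefficient.
Variables (r d : nat).
Hypothesis hd : (2 <= d)%N.
Variables (A B : mat).
Hypotheses (hA : Xi r d A) (hB : Xi r d B) (hBtri : tridiagonal B).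
Hypothesis hAB : row_c r A = col_c r B.
Variables T S : mat.
Hypotheses (hT : Theta_BA r B A T) (hS : Gamma r T S).
Let n : int := (period r)%:Z.
Let nE : n = 2 * r%:Z + 2. Proof. by rewrite /n /period; lia. Qed.
Let X := XTS T S.
Let Y := refl T.
Let C := A_TS A T S.
Variable W : seq int.
Hypotheses (uW : uniq W) (oW : forall j, (- j \in W) = (j \in W)).
Hypothesis AW : forall i : int, - r.+2%:Z <= i <= r.+2%:Z -> forall j, j \notin W -> A i j = 0.

Lemma TSW (i : int) : - r.+2%:Z <= i <= r.+2%:Z -> forall j, j \notin W -> T i j = 0 /\ S i j = 0.
Proof.
move=> hi j /(AW hi) a0; have := T_le hT i j; have := T_ge0 hT i j; have := T_ge0 hT (- i) (- j).
have := S_ge0 hS i j; have := S_le hS i j; rewrite a0.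
by move: (T _ _) (S i j) (T i j) => *; lia.
Qed.

Lemma TSW' (i : int) : - r.+2%:Z <= i <= r.+2%:Z -> forall j, j \notin W -> T i (- j) = 0 /\ S i (- j) = 0.
Proof. by move=> hi j jW; apply: TSW => //; rewrite oW. Qed.

Lemma XW (i : int) : - r.+1%:Z <= i <= r.+1%:Z -> forall j, j \notin W -> X i j = 0.
Proof.
move=> hi j jW; have [|t1 s1] := @TSW (i + 1) _ j jW; first by lia.
have [|t2 s2] := @TSW' (- i) _ j jW; first by lia.
by rewrite /X /XTS t1 s1 s2.
Qed.

Lemma CW (i : int) : - r.+1%:Z <= i <= r.+1%:Z -> forall j, j \notin W -> C i j = 0.
Proof.
move=> hi j jW; have a0 : A i j = 0 by apply: AW => //; lia.
have [|t1 s1] := @TSW (i + 1) _ j jW; first by lia.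
have [|t2 s2] := @TSW' (- i) _ j jW; first by lia.
have [|t3 s3] := @TSW i _ j jW; first by lia.
have [|t4 s4] := @TSW' (- (i - 1)) _ j jW; first by lia.
by rewrite /C A_TSE !zTSE subrK a0 t1 s1 s2 t2 t3 s3 t4 s4.
Qed.

(** The row - i of S, read backwards. *)
Definition urow (i : nat) : int -> int := opr (S (- i%:Z)).

(** The row i + 1 of S is the vector of row sums of the strictly upper triangular
    part of sigma. *)
Lemma offdiag_S (i : nat) k : offdiag (Y i%:Z) (opr (X (- i%:Z - 1))) (urow i) k = S (i%:Z + 1) k.
Proof.
rewrite /offdiag /urow /Y /refl /opr /X /XTS subrK (_ : - (- i%:Z - 1) = i%:Z + 1); last by lia.
by rewrite opprK; move: (S (- _) _) (T _ _) (S _ k) => *; lia.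
Qed.

Lemma n_S_rows : n_S r S = \sum_(0 <= i < r.+1) \sum_(k <- W) urow i k.
Proof.
rewrite /n_S big_add1 /=; apply: eq_big_nat => i hi.
rewrite -[RHS](fsW uW) => [|j jW]; last first.
  by have [|_ e] := @TSW' (- i%:Z) _ j jW; [lia|exact: e].
have := S_row hS i.+1%:Z; rewrite /tot -/(row_a S _) => ->.
by rewrite (_ : 1 - i.+1%:Z = - i%:Z) //; lia.
Qed.

Lemma dbr_rows : dbr_S r S = (\prod_(0 <= i < r.+1) \prod_(l <- W)
      qbinom (\sum_(k <- W | k < l) (offdiag (Y i%:Z) (opr (X (- i%:Z - 1))) (urow i) k - urow i k)) (urow i l))
   * \prod_(0 <= i < r.+1) \prod_(l <- W) qfact (urow i l).
Proof.
rewrite /dbr_S big_add1 -big_split /=; apply: eq_big_nat => i hi; rewrite -big_split /=.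
have dE l : dag S i.+1%:Z l = urow i l.
  by rewrite /dag /urow /opr (_ : 1 - i.+1%:Z = - i%:Z) //; lia.
rewrite (reindex_fsbig (fun l : int => l - 1) [set: int] [set: int]); last first.
  split=> [j //|x y _ _|j _]; first by move/addIr.
  by exists (j + 1); rewrite ?addrK.
have uz j : j \notin W -> urow i j = 0.
  by move=> jW; have [|_ e] := @TSW' (- i%:Z) _ j jW; [lia|exact: e].
rewrite (fsW uW) => [|j jW]; last by rewrite subrK dE uz // qbinom0 qfact0 mul1r.
apply: eq_bigr => l _; rewrite subrK dE; congr (qbinom _ _ * _).
have sE k : (S - dag S) i.+1%:Z k = offdiag (Y i%:Z) (opr (X (- i%:Z - 1))) (urow i) k - urow i k.
  by rewrite offdiag_S -dE (_ : i.+1%:Z = i%:Z + 1) //; lia.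
rewrite (fsWc uW) => [|k kW]; last first.
  by rewrite sE offdiag_S uz //; have [|_ ->] := @TSW (i%:Z + 1) _ k kW; first by lia.
by apply: eq_big => [k|k _]; [lia|exact: sE].
Qed.

Let Tper : periodic r T := T_per hT.
Let Sper : periodic r S := S_per hS.
Let Xper : periodic r X := X_per hT hS.

Lemma mfact_S : mfact r S
  = (\prod_(0 <= i < r.+1) \prod_(k <- W) qfact (offdiag (Y i%:Z) (opr (X (- i%:Z - 1))) (urow i) k))
    * \prod_(0 <= i < r.+1) \prod_(l <- W) qfact (urow i l).
Proof.
rewrite (mfact_pairs uW Sper) => [|i hi j jW]; last first.
  by have [|_ ->] := @TSW i _ j jW; first by lia.
rewrite big_split /=; congr (_ * _); apply: eq_bigr => i _.
  by apply: eq_bigr => k _; rewrite offdiag_S.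
by rewrite -(prod_oppW uW oW).
Qed.

Lemma mfact_TS : mfact r (T - S)
  = (\prod_(0 <= i < r.+1) \prod_(k <- W) qfact (X i%:Z k - urow i k))
    * \prod_(0 <= i < r.+1) \prod_(k <- W) qfact (Y i%:Z k - urow i k).
Proof.
have pTS : periodic r (T - S).
  move=> i j; change (T (i + n) (j + n) - S (i + n) (j + n) = T i j - S i j).
  by congr (_ - _); [exact: Tper|exact: Sper].
rewrite (mfact_pairs uW pTS) => [|i hi j jW]; last first.
  have [|t0 s0] := @TSW i _ j jW; first by lia.
  by rewrite [LHS](_ : _ = T i j - S i j) // t0 s0.
rewrite big_split /=; congr (_ * _); apply: eq_bigr => i _.
  by apply: eq_bigr => k _; rewrite /X /XTS /urow /opr addrK.
by rewrite -(prod_oppW uW oW).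
Qed.

Lemma mfact_X : mfact r X
  = (\prod_(0 <= i < r.+1) \prod_(k <- W) qfact (X i%:Z k))
    * \prod_(0 <= i < r.+1) \prod_(k <- W) qfact (opr (X (- i%:Z - 1)) k).
Proof.
rewrite (mfact_pairs' uW Xper XW) big_split /=; congr (_ * _); apply: eq_bigr => i _.
by rewrite -(prod_oppW uW oW).
Qed.

Lemma br_C : br_MX r C X * (mfact_c r (A - theta T) * mfact r X) = mfact_c r C.
Proof.
have hC := A_TS_Xi hA hB hT hS.
have NE : A - theta T = fun i j => C i j - X i j - X (- i) (- j).
  apply: funext => i; apply: funext => j.
  rewrite [LHS](_ : _ = A i j - (T i j + T (- i) (- j))) //.
  rewrite /C A_TSE !zTSE subrK /X /XTS !opprK.
  rewrite (_ : - (i - 1) = - i + 1); last by lia.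
  by move: (T (- i + 1) _) (S (- i + 1) _) (T (- i) _) (S (- i) _) (T (i + 1) _) (S (i + 1) _)
    (T i j) (S i j) => *; lia.
rewrite NE; apply: (br_fact uW oW hC Xper (X_ge0 hS) CW XW) => i j.
have := congr1 (fun F : mat => F i j) NE; rewrite /= => <-.
rewrite [X in _ <= X](_ : _ = A i j - (T i j + T (- i) (- j))) // subr_ge0.
exact: (T_le hT).
Qed.

(** Termwise comparison: the summand of n(X, Y) indexed by S yields the coefficient
    of the term (T, S). *)
Lemma coef_identity :
  v ^ (2 * xi_MX r C X)
  * (\prod_(0 <= i < r.+1) nvterm W (X i%:Z) (Y i%:Z) (opr (X (- i%:Z - 1))) (urow i))
  * br_MX r C X
  = (v ^+ 2 - 1) ^ n_S r S * v ^ (2 * (ell_ABST r d A B S T - n_S r S - h_TS r T S))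
    * dbr_AST r A S T.
Proof.
have TW' (i : nat) : (i < r.+1)%N -> forall j, j \notin W ->
    T (i%:Z + 1) j = 0 /\ T (- i%:Z) (- j) = 0.
  move=> hi j jW; split.
    by have [|-> _] := @TSW (i%:Z + 1) _ j jW; first by lia.
  by have [|-> _] := @TSW' (- i%:Z) _ j jW; first by lia.
rewrite (exponent_identity hd hA hB hBtri hAB hT hS uW TW') -/X -/C expfzDr ?v_neq0 //.
set NU := \sum_(0 <= i < r.+1) nuTS _ _ _ _.
rewrite /dbr_AST -/C dbr_rows mfact_S mfact_TS n_S_rows.
rewrite /nvterm prodf_div !big_split /=.
rewrite (prod_exprz_nat _ _ v_neq0) (prod_exprz_nat _ _ v2_neq1) -mfact_X.
change (\sum_(0 <= i < r.+1) (2 * neps W (X i%:Z) (Y i%:Z) (opr (X (- i%:Z - 1))) (urow i)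
   + \sum_(k <- W) urow i k * (urow i k - 1))) with NU.
apply: coef_frac; [|exact: mfact_c_neq0| |exact: br_C].
  rewrite mfact_X; apply: mulf_neq0; exact: nprod_neq0.
exact: nprod_neq0.
Qed.
End Coefficient.

(** * Comparison of the two sums *)

Lemma fsum_scale (K : choiceType) (P : set K) (V : lmodType Qv) (c : K -> Qv) (x : V) : finite_set P ->
  \sum_(k \in P) c k *: x = (\sum_(k \in P) c k) *: x.
Proof.
move=> fP; rewrite (fsbig_finite _ _ fP) [in RHS](fsbig_finite _ _ fP) /=.
by rewrite scaler_suml.
Qed.

Lemma refl2 (T : mat) : refl (refl T) = T.
Proof. by apply: funext => i; apply: funext => j; rewrite /refl /opr !opprK. Qed.

Lemma A_XYE A X Y i j : A_XY A X Y i j = A i j + X i j - Y i j - (X (i - 1) j - Y (i - 1) j).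
Proof. by []. Qed.

Section Final.
Variables (r d : nat).
Hypothesis hd : (2 <= d)%N.
Variables (A B : mat).
Hypotheses (hA : Xi r d A) (hB : Xi r d B) (hBtri : tridiagonal B).
Hypothesis hAB : row_c r A = col_c r B.
Variable alpha : int -> int.
Variables (V : lmodType Qv) (e : mat -> V).
Hypothesis halpha : forall i : int, alpha i = B i (i + 1).
Let n : int := (period r)%:Z.
Let nE : n = 2 * r%:Z + 2. Proof. by rewrite /n /period; lia. Qed.

Lemma A_per : periodic r A.
Proof. by move=> i j; have := Xi_sh hA 1 i j; rewrite !mul1r. Qed.

Lemma A_fin i : finf (A i). Proof. exact: (Xi_fin hA). Qed.

(** The indices of the second sum for which the bracket does not vanish. *)
Definition XYset : set (mat * mat) :=
  [set p | XY_index r d A alpha p /\ Theta_BA r B A (refl p.2)].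

(** The coefficient of the term (T, S) of the first sum. *)
Definition coef1 (T S : mat) : Qv :=
  (v ^+ 2 - 1) ^ n_S r S * v ^ (2 * (ell_ABST r d A B S T - n_S r S - h_TS r T S))
  * dbr_AST r A S T.

(** The coefficient of the term (X, Y) of the second sum. *)
Definition coef2 (p : mat * mat) : Qv :=
  v ^ (2 * xi_MX r (A_XY A p.1 p.2) p.1) * n_XY r p.1 p.2 * br_MX r (A_XY A p.1 p.2) p.1.

Lemma A_window (k : nat) : exists W : seq int, [/\ uniq W, forall j, (- j \in W) = (j \in W)
  & forall i : int, - k%:Z <= i <= k%:Z -> forall j, j \notin W -> A i j = 0].
Proof.
have [K hK] := Xi_band hA; pose m := (K + k)%N.
exists (zseq (- m%:Z) (2 * m + 1)); split=> [|j|i hi j]; first exact: zseq_uniq.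
  by rewrite !mem_zseq; lia.
by rewrite mem_zseq => jW; apply: contrapT => /hK; move: jW; rewrite /m; lia.
Qed.

Section OneT.
Variable T : mat.
Hypothesis hT : Theta_BA r B A T.
Let Y := refl T.

Lemma Gamma_fin : finite_set (Gamma r T).
Proof.
apply: sub_finite_set (@finite_periodic r _ (T_fin hA hT)) => S hS.
split; first exact: (S_per hS).
by move=> i j; rewrite (S_ge0 hS) (S_le hS).
Qed.

Lemma A_TS_XY S : A_TS A T S = A_XY A (XTS T S) Y.
Proof.
apply: funext => i; apply: funext => j; rewrite A_TSE A_XYE /zTS.
rewrite [(XTS T S i - refl T i) j](_ : _ = XTS T S i j - refl T i j) //.
rewrite [(XTS T S (i - 1) - refl T (i - 1)) j](_ : _ = XTS T S (i - 1) j - refl T (i - 1) j) //.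
rewrite -/Y; move: (XTS _ _ _ j) (XTS _ _ i j) (Y _ j) (Y i j) (A i j) => *; lia.
Qed.

Lemma tot_T i : tot (T i) = B (i - 1) i.
Proof. by rewrite -(T_row hT). Qed.

Lemma XTS_index S : Gamma r T S -> XYset (XTS T S, Y).
Proof.
move=> hS; split; last by rewrite /= refl2.
have Yper : periodic r Y := refl_per (T_per hT).
have Y0 i j : 0 <= Y i j by exact: (T_ge0 hT).
split.
- split; split=> //; first exact: (X_ge0 hS).
  exact: (X_per hT hS).
- move=> i j; rewrite /XTS /Y /refl /opr !opprK (_ : - (- i - 1) = i + 1); last by lia.
  by rewrite subrK; move: (S (i + 1) _) (S (- i) _) (T (i + 1) _) (T (- i) _) => *; lia.
- split=> i; split.
  + exact: (X_fin hA hT hS).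
  + have [W [uW tW sW s'W]] := finf_window (T_fin hA hT (i + 1)) (S_fin hA hT hS (i + 1))
      (finf_opr (S_fin hA hT hS (- i))).
    have -> : alpha i = tot (T (i + 1)) by rewrite halpha tot_T addrK.
    have := S_row hS (i + 1).
    rewrite (_ : 1 - (i + 1) = - i); last by lia.
    rewrite /tot !(fsW uW) // => [es|j jW]; last by rewrite /XTS tW // sW // -[S _ _]/(opr _ _) s'W.
    by rewrite big_split sumrB /= es subrK.
  + exact: (Y_fin hA hT).
  + rewrite halpha subrK -/(tot (Y i)) tot_opr tot_T; congr B; lia.
- split=> i j.
    change (0 <= A i j - Y i j + Y (i - 1) j); have := Y0 (i - 1) j; have := T_le hT i j; have := T_ge0 hT i j.
    by rewrite /Y /refl /opr; move: (T i j) (A i j) (T (- i) _) (T _ _) => *; lia.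
  change (A (i + n) (j + n) - Y (i + n) (j + n) + Y (i + n - 1) (j + n)
    = A i j - Y i j + Y (i - 1) j).
  have -> : A (i + n) (j + n) = A i j by exact: A_per.
  have -> : Y (i + n) (j + n) = Y i j by exact: Yper.
  by have -> : Y (i + n - 1) (j + n) = Y (i - 1) j by rewrite addrAC; exact: Yper.
by rewrite -A_TS_XY; exact: (A_TS_Xi hA hB hT hS).
Qed.

(** The coefficient of (X, Y) is the sum over the fibre of the coefficients of (T, S). *)
Lemma fibre_sum X : XYset (X, Y) ->
  coef2 (X, Y) = \sum_(S \in Gamma r T `&` [set S | XTS T S = X]) coef1 T S.
Proof.
move=> [[[[X0 Xper] _] rel [hX hY] _ hC] _].
have [W [uW oW AW]] := A_window r.+2.
have Xtot i : tot (X i) = B i (i + 1) by rewrite -halpha; case: (hX i).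
have Ytot i : tot (Y i) = B (- i - 1) (- i).
  by have := halpha (- i - 1); rewrite subrK => <-; case: (hY i).
have TW i : - r.+2%:Z <= i <= r.+2%:Z -> forall j, j \notin W -> T i j = 0.
  move=> hi j /(AW _ hi) a0; have := T_le hT i j; have := T_ge0 hT i j.
  by have := T_ge0 hT (- i) (- j); rewrite a0; move: (T (- i) _) (T i j) => *; lia.
have TW1 i : - r.+1%:Z <= i <= r.+1%:Z -> forall j, j \notin W -> T i j = 0.
  by move=> hi; apply: TW; lia.
have xyW := XYW X0 rel uW oW TW1.
have bij := fibre_bij hA hT Xper X0 rel Xtot uW oW TW1.
have nE' : n_XY r X Y = \sum_(g \in fam zrow (Uset T X W) r.+1)
    \prod_(0 <= i < r.+1) nvterm W (X i%:Z) (Y i%:Z) (opr (X (- i%:Z - 1))) (g i).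
  rewrite -(@prod_fsum _ zrow (Uset T X W) (@Uset_fin T X W)
    (fun i => nvterm W (X i%:Z) (Y i%:Z) (opr (X (- i%:Z - 1))))).
  apply: eq_big_nat => i hi; apply: (n_vecE uW).
  - exact: X0.
  - by move=> k kW; have [] := @xyW i%:Z _ k kW; first by lia.
  - by move=> k; exact: (T_ge0 hT).
  - by move=> k kW; have [] := @xyW i%:Z _ k kW; first by lia.
  - by move=> k; exact: X0.
  - by move=> k kW; have [] := @xyW (- i%:Z - 1) _ (- k) _; rewrite ?oW //; lia.
  have e1 := Xtot (- i%:Z - 1); have e2 := Ytot i%:Z.
  rewrite -tot_opr /tot (fsW uW) in e1; last first.
    by move=> k kW; have [] := @xyW (- i%:Z - 1) _ (- k) _; rewrite ?oW //; lia.
  rewrite /tot (fsW uW) in e2; last first.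
    by move=> k kW; have [] := @xyW i%:Z _ k kW; first by lia.
  by rewrite [LHS]e1 e2 subrK.
rewrite /coef2 /= nE' mulr_fsumr mulr_fsuml.
rewrite [RHS](reindex_fsbig (Sfam r T X) (fam zrow (Uset T X W) r.+1)); last exact: bij.
apply: eq_fsbigr => g /set_mem hg.
have hS : Gamma r T (Sfam r T X g) by exact: (Sfam_Gamma hA hT X0 rel Xtot uW hg).
have SX : XTS T (Sfam r T X g) = X by exact: (Sfam_X hA hT Xper X0 rel Xtot uW hg).
have sg := fam_of_Sfam uW hg.
have := coef_identity hd hA hB hBtri hAB hT hS uW oW AW.
rewrite A_TS_XY SX -/(coef1 _ _) => <-; congr (_ * _ * _).
apply: eq_big_nat => i hi; congr nvterm.
by have := congr1 (fun f => f i) sg; rewrite /fam_of /urow; case: ifP => // ; lia.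
Qed.

Lemma Gamma_sum :
  \sum_(S \in Gamma r T) coef1 T S *: e (A_TS A T S)
  = \sum_(X \in [set X | XYset (X, Y)]) coef2 (X, Y) *: e (A_XY A X Y).
Proof.
rewrite (@fsum_partition_sub _ _ _ _ [set X | XYset (X, Y)] (XTS T)); last 2 first.
- exact: Gamma_fin.
- exact: XTS_index.
apply: eq_fsbigr => X /set_mem hX; rewrite fibre_sum // -fsum_scale; last first.
  by apply: finite_setIl; exact: Gamma_fin.
by apply: eq_fsbigr => S /set_mem[_ SX]; rewrite A_TS_XY SX.
Qed.
End OneT.

Lemma XYset_fin : finite_set XYset.
Proof.
pose bd : mat := fun i j => A (i + 1) j + A i j.
have bfin i : finf (bd i).
  by apply: finfD; exact: A_fin.
apply: sub_finite_set (finite_setX (@finite_periodic r _ bfin) (@finite_periodic r _ A_fin)).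
move=> [X Y] [[[[X0 Xper] [Y0 Yper]] rel _ _ _] hT]; rewrite /= in hT.
have YA i j : Y i j <= A i j.
  have := T_le hT i j; rewrite /refl /opr !opprK; have := Y0 i j; have := Y0 (- i) (- j).
  by move: (Y _ _) (Y i j) => *; lia.
split; split=> //= i j; last by rewrite Y0 YA.
rewrite X0 /= /bd; have := rel i j; have := YA i j; have := YA (- i - 1) (- j).
rewrite -(Xi_opp hA (- i - 1)) opprK (_ : - (- i - 1) = i + 1); last by lia.
have := X0 (- i - 1) (- j).
by move: (X _ _) (X i j) (Y _ _) (Y i j) (A _ _) (A i j) => *; lia.
Qed.

Lemma coef2_zero p : XY_index r d A alpha p -> ~ Theta_BA r B A (refl p.2) -> coef2 p = 0.
Proof.
case: p => X Y [[[X0 Xper] [Y0 Yper]] rel [hX hY] hD hC] /= nT.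
have [i [j hij]] : exists i j, A i j < Y (- i) (- j) + Y i j.
  apply: contrapT => nh; apply: nT; split.
  - split=> [i j|]; first exact: Y0.
    exact: (refl_per Yper).
  - move=> i j; rewrite /theta /refl /opr !opprK leNgt; apply/negP => c.
    by apply: nh; exists i, j.
  move=> i; rewrite -[row_a _ i]/(tot _) tot_opr.
  have [_ yi] := hY (- i); rewrite /tot yi halpha opprK subrK //.
rewrite /coef2 /=; suff -> : br_MX r (A_XY A X Y) X = 0 by rewrite mulr0.
have Xfin k : finf (X k) by have [] := hX k.
have Mfin k : finf (A_XY A X Y k) by exact: (Xi_fin hC).
(* A window containing the supports of the rows that occur in the bracket. *)
have [K hK] : exists K : nat, forall k, - r.+1%:Z <= k <= r.+1%:Z -> forall l,
    X k l <> 0 \/ A_XY A X Y k l <> 0 -> `|l| <= K%:Z.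
  have : finite_set (\bigcup_(k in [set k : int | - r.+1%:Z <= k <= r.+1%:Z])
      ([set l | X k l <> 0] `|` [set l | A_XY A X Y k l <> 0])).
    by apply: bigcup_finite => [|k _]; [exact: finite_zrange|rewrite finite_setU; split; [exact: Xfin|exact: Mfin]].
  by move=> /finite_bounded[K hK]; exists K => k hk l h; apply: hK; exists k.
pose W := zseq (- K%:Z) (2 * K + 1).
have uW : uniq W by exact: zseq_uniq.
have oW l : (- l \in W) = (l \in W) by rewrite !mem_zseq; lia.
have XW k : - r.+1%:Z <= k <= r.+1%:Z -> forall l, l \notin W -> X k l = 0.
  move=> hk l; rewrite mem_zseq => lW; apply: contrapT => h.
  by have := hK k hk l (or_introl h); move: lW; lia.
have MW k : - r.+1%:Z <= k <= r.+1%:Z -> forall l, l \notin W -> A_XY A X Y k l = 0.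
  move=> hk l; rewrite mem_zseq => lW; apply: contrapT => h.
  by have := hK k hk l (or_intror h); move: lW; lia.
apply: (br_zero uW oW hC Xper X0 MW XW (i := i) (j := j)).
rewrite A_XYE; have := rel (i - 1) j; rewrite (_ : - (i - 1) - 1 = - i); last by lia.
move: hij; move: (X (i - 1) j) (X (- i) _) (X i j) (Y (i - 1) j) (Y (- i) _) (Y i j) (A i j) => *.
lia.
Qed.

Lemma index_sum :
  \sum_(p \in XY_index r d A alpha) coef2 p *: e (A_XY A p.1 p.2)
  = \sum_(T \in Theta_BA r B A) \sum_(X \in [set X | XYset (X, refl T)])
      coef2 (X, refl T) *: e (A_XY A X (refl T)).
Proof.
transitivity (\sum_(p \in XYset) coef2 p *: e (A_XY A p.1 p.2)).
  apply/esym/fsbig_widen => [p [] //|p [/= hp nT]].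
  rewrite /preimage /= coef2_zero ?scale0r // => hT.
  by apply: nT; split.
rewrite (@fsum_partition_sub _ _ _ _ (Theta_BA r B A) (fun p => refl p.2)); last 2 first.
- exact: XYset_fin.
- by move=> p [].
apply: eq_fsbigr => T /set_mem hT.
rewrite (reindex_fsbig (fun X => (X, refl T)) [set X | XYset (X, refl T)]) //.
split=> [X hX|X X' _ _ [] //|[X Y] [hX /= YT]]; first by split=> //=; rewrite refl2.
by exists X; rewrite /= -YT refl2.
Qed.
Lemma sums_equal :
  \sum_(T \in Theta_BA r B A) \sum_(S \in Gamma r T) coef1 T S *: e (A_TS A T S)
  = \sum_(p \in XY_index r d A alpha) coef2 p *: e (A_XY A p.1 p.2).
Proof.
rewrite index_sum; apply: eq_fsbigr => T /set_mem hT; exact: Gamma_sum.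
Qed.
End Final.

Theorem propositionA3 (r d : nat) (hd : (2 <= d)%N) (A B : mat)
    (hA : Xi r d A) (hB : Xi r d B) (hBtri : tridiagonal B)
    (hAB : row_c r A = col_c r B)
    (alpha : int -> int) (halpha : forall i : int, alpha i = B i (i + 1)) :
  \sum_(T \in Theta_BA r B A) \sum_(S \in Gamma r T)
    ((v ^+ 2 - 1) ^ n_S r S
     * v ^ (2 * (ell_ABST r d A B S T - n_S r S - h_TS r T S))
     * dbr_AST r A S T) *: e_ (A_TS A T S)
  = \sum_(p \in XY_index r d A alpha)
    (v ^ (2 * xi_MX r (A_XY A p.1 p.2) p.1)
     * n_XY r p.1 p.2
     * br_MX r (A_XY A p.1 p.2) p.1) *: e_ (A_XY A p.1 p.2).
Proof.
exact: (sums_equal hd hA hB hBtri hAB e_ halpha).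
Qed.
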